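(* Let $T>0$, let $\Gamma\subset\mathbb{S}_d^+$ be bounded, closed and convex, let $G(A)=\frac12\sup_{\gamma\in\Gamma}\mathrm{tr}(A\gamma)$ for $A\in\mathbb{S}_d$, and let $B$ be the $d$-dimensional $G$-Brownian motion with $G$-expectation $\mathbb{E}$. Let $\sigma:\mathbb{R}^d\to\mathbb{S}_d$ and $b:\mathbb{R}^d\to\mathbb{R}^d$ satisfy, for all $x,x'\in\mathbb{R}^d$: (i) $|\sigma(x)-\sigma(x')|\le L_\sigma|x-x'|$ and $|b(x)-b(x')|\le L_b|x-x'|$; (ii) $\lambda_\sigma I\le\sigma(x)\le\Lambda_\sigma I$ for constants $\Lambda_\sigma\ge\lambda_\sigma>0$; (iii) $\lambda_\Gamma^2I\le\gamma\le\Lambda_\Gamma^2I$ for all $\gamma\in\Gamma$, for constants $\Lambda_\Gamma\ge\lambda_\Gamma>0$. For $x\in\mathbb{R}^d$ let $X^x$ be the solution of $dX^x_t=\sigma(X^x_t)\,dB_t+b(X^x_t)\,dt$, $X^x_0=x$, on $[0,T]$. For $\varphi\in C_b(\mathbb{R}^d)$ set $u(T,x):=\mathbb{E}[\varphi(X^x_T)]$. Then for all $x,y\in\mathbb{R}^d$ $$|u(T,x)-u(T,y)|\le C\,\frac{\|\varphi\|_\infty}{\sqrt{(1-e^{-LT})/L}}\,|x-y|,$$ where $C=\dfrac{2\Lambda_\sigma^2}{\lambda_\sigma^3\lambda_\Gamma}$ and $L=2L_b+\Lambda_\Gamma^2L_\sigma^2$.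
   Context: $\mathbb{S}_d$ (resp. $\mathbb{S}_d^+$) is the set of real symmetric (resp. symmetric nonnegative definite) $d\times d$ matrices; $|\cdot|$ is the Euclidean norm on vectors and the Hilbert–Schmidt norm on matrices. $C_b(\mathbb{R}^d)$ is the set of bounded continuous real functions and $\|\varphi\|_\infty=\sup|\varphi|$. If $L=0$, $(1-e^{-LT})/L$ is read as $T$. $G$-expectation: $\Omega_T=C_0([0,T];\mathbb{R}^d)$ is the space of continuous paths starting at $0$, $B_t(\omega)=\omega(t)$. $L_{ip}(\Omega_T)$ is the set of $\xi=\varphi(B_{t_1},\dots,B_{t_n})$ with $n\in\mathbb{N}$, $t_i\in[0,T]$, $\varphi$ bounded Lipschitz on $(\mathbb{R}^d)^n$. For such $\xi$ with $0=t_0<t_1<\dots<t_n=T$, the conditional $G$-expectation is $\mathbb{E}_t[\xi]=u_k(t,\omega(t);\omega(t_1),\dots,\omega(t_{k-1}))$ for $t\in[t_{k-1},t_k)$, where $u_k(t,x;x_1,\dots,x_{k-1})$ is the (viscosity) solution of $\partial_tu_k+G(\partial_x^2u_k)=0$ on $[t_{k-1},t_k)\times\mathbb{R}^d$ with terminal condition $u_k(t_k,x;x_1,\dots,x_{k-1})=u_{k+1}(t_k,x;x_1,\dots,x_{k-1},x)$ for $k<n$ and $u_n(t_n,x;x_1,\dots,x_{n-1})=\varphi(x_1,\dots,x_{n-1},x)$. $\mathbb{E}=\mathbb{E}_0$; $L^p_G(\Omega_T)$ is the completion of $L_{ip}(\Omega_T)$ under $\mathbb{E}[|\xi|^p]^{1/p}$,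 to which $\mathbb{E}$ extends. There is a weakly compact set $\mathcal{P}$ of probability measures on $\Omega_T$ with $\mathbb{E}[\xi]=\sup_{P\in\mathcal{P}}E_P[\xi]$; the capacity is $c(A)=\sup_{P\in\mathcal{P}}P(A)$, and ''quasi-surely'' (q.s.) means outside a set of capacity zero. Step processes are $\eta_t=\xi_{t_k}\in L_{ip}(\Omega_{t_k})$ for $t\in(t_k,t_{k+1}]$; $M^p_G(0,T)$ is the completion of the step processes under $\mathbb{E}[\int_0^T|\eta_s|^pds]^{1/p}$. The Itô integral against $B$ is defined on step processes as usual and extended continuously to $M^2_G(0,T)$. The SDE is understood q.s., with solution having components in $M^2_G(0,T)$ and continuous paths. *)

(* Defs.v *)
From HB Require Import structures.
From mathcomp Require Import all_boot all_order all_algebra.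
From mathcomp Require Import all_classical all_reals all_analysis.

Set Implicit Arguments.
Unset Strict Implicit.
Unset Printing Implicit Defensive.

Import Order.TTheory GRing.Theory Num.Theory.
Import numFieldNormedType.Exports.

Local Open Scope classical_set_scope.
Local Open Scope ring_scope.

(* Euclidean norm on vectors, Hilbert-Schmidt norm on matrices.  (The norm
   [`|A|] of the library is the entrywise maximum.) *)
Definition enorm {R : realType} {m n : nat} (A : 'M[R]_(m, n)) : R :=
  Num.sqrt (\sum_i \sum_j A i j ^+ 2).

Definition symmetric_mx {R : realType} {d : nat} (A : 'M[R]_d) : Prop :=
  A^T = A.

Definition loewner_le {R : realType} {d : nat} (A B : 'M[R]_d) : Prop :=
  forall v : 'cV[R]_d, (v^T *m A *m v) 0 0 <= (v^T *m B *m v) 0 0.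

Definition lipschitz_with {R : realType} {m n p q : nat} (K : R)
    (f : 'M[R]_(m, n) -> 'M[R]_(p, q)) : Prop :=
  forall x y, enorm (f x - f y) <= K * enorm (x - y).

Definition bounded_real {R : realType} {U : Type} (f : U -> R) : Prop :=
  exists M : R, forall x, `|f x| <= M.

Definition bounded_lipschitz {R : realType} {m n : nat}
    (f : 'M[R]_(m, n) -> R) : Prop :=
  bounded_real f /\
  exists K : R, forall x y, `|f x - f y| <= K * enorm (x - y).

Definition sup_norm {R : realType} {U : Type} (f : U -> R) : R :=
  sup [set `|f x| | x in [set: U]].

Definition Gfun {R : realType} {d : nat} (Gamma : set 'M[R]_d)
    (A : 'M[R]_d) : R :=
  2^-1 * sup [set \tr (A *m g) | g in Gamma].

Definition basis_cv {R : realType} {d : nat} (i : 'I_d) : 'cV[R]_d :=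
  delta_mx i 0.

Definition time_deriv {R : realType} {d : nat} (f : R * 'cV[R]_d -> R)
    (p : R * 'cV[R]_d) : R :=
  'D_1 (fun t : R => f (t, p.2)) p.1.

Definition space_deriv {R : realType} {d : nat} (i : 'I_d)
    (f : R * 'cV[R]_d -> R) (p : R * 'cV[R]_d) : R :=
  'D_(basis_cv i) (fun x : 'cV[R]_d => f (p.1, x)) p.2.

Definition hessian {R : realType} {d : nat} (f : R * 'cV[R]_d -> R)
    (p : R * 'cV[R]_d) : 'M[R]_d :=
  \matrix_(i, j) space_deriv i (space_deriv j f) p.

Definition C12 {R : realType} {d : nat} (f : R * 'cV[R]_d -> R) : Prop :=
  [/\ continuous f,
      (forall p : R * 'cV[R]_d, derivable (fun t : R => f (t, p.2)) p.1 1) /\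
        continuous (time_deriv f),
      forall i, (forall p : R * 'cV[R]_d,
          derivable (fun x : 'cV[R]_d => f (p.1, x)) p.2 (basis_cv i)) /\
        continuous (space_deriv i f) &
      forall i j, (forall p : R * 'cV[R]_d,
          derivable (fun x : 'cV[R]_d => space_deriv j f (p.1, x)) p.2
            (basis_cv i)) /\
        continuous (space_deriv i (space_deriv j f))].

Definition local_max_on {R : realType} {U : topologicalType} (D : set U)
    (f : U -> R) (p : U) : Prop :=
  D p /\ \forall q \near within D (nbhs p), f q <= f p.

Definition strip {R : realType} {d : nat} (a b : R) : set (R * 'cV[R]_d) :=
  [set p | a <= p.1 < b].

Definition visc_subsolution {R : realType} {d : nat} (G : 'M[R]_d -> R)
    (a b : R) (u : R * 'cV[R]_d -> R) : Prop :=
  forall f p, C12 f -> local_max_on (strip a b) (u \- f) p ->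
    0 <= time_deriv f p + G (hessian f p).

Definition visc_supersolution {R : realType} {d : nat} (G : 'M[R]_d -> R)
    (a b : R) (u : R * 'cV[R]_d -> R) : Prop :=
  forall f p, C12 f -> local_max_on (strip a b) (f \- u) p ->
    time_deriv f p + G (hessian f p) <= 0.

(* d_t u + G(D^2 u) = 0 on [a, b) x R^d with u(b, .) = g; boundedness selects
   the uniqueness class. *)
Definition Gheat_solution {R : realType} {d : nat} (G : 'M[R]_d -> R)
    (a b : R) (g : 'cV[R]_d -> R) (u : R * 'cV[R]_d -> R) : Prop :=
  [/\ {within [set p : R * 'cV[R]_d | a <= p.1 <= b], continuous u},
      exists M : R, forall t x, a <= t <= b -> `|u (t, x)| <= M,
      visc_subsolution G a b u,
      visc_supersolution G a b u &
      forall x, u (b, x) = g x].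

(* The solution, which is unique on [a, b] x R^d; arbitrary elsewhere. *)
Definition Gheat {R : realType} {d : nat} (G : 'M[R]_d -> R) (a b : R)
    (g : 'cV[R]_d -> R) : R * 'cV[R]_d -> R :=
  xget (fun=> 0) [set u | Gheat_solution G a b g u].

(* C_0([0,T]; R^d).  A path is stored with its constant continuation outside
   [0,T], so that distinct elements differ on [0,T]. *)
Record wpath (R : realType) (d : nat) (T : R) := WPath {
  wpath_fun :> R -> 'cV[R]_d ;
  wpath_continuous : continuous wpath_fun ;
  wpath_start : wpath_fun 0 = 0 ;
  wpath_stop : forall t, wpath_fun t = wpath_fun (Num.max 0 (Num.min t T)) }.

Lemma wpath0_continuous (R : realType) (d : nat) :
  continuous (fun _ : R => 0 : 'cV[R]_d).
Proof. by move=> x; exact: cvg_cst. Qed.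

Definition wpath0 (R : realType) (d : nat) (T : R) : wpath d T :=
  @WPath R d T (fun=> 0) (@wpath0_continuous R d) erefl (fun=> erefl).

HB.instance Definition _ (R : realType) (d : nat) (T : R) :=
  gen_eqMixin (wpath d T).
HB.instance Definition _ (R : realType) (d : nat) (T : R) :=
  gen_choiceMixin (wpath d T).
HB.instance Definition _ (R : realType) (d : nat) (T : R) :=
  isPointed.Build (wpath d T) (@wpath0 R d T).

Definition wpath_unif (R : realType) (d : nat) (T : R) (w : wpath d T) :
  {uniform` `[0, T]%classic -> 'cV[R]_d} := w.

HB.instance Definition _ (R : realType) (d : nat) (T : R) :=
  Topological.copy (wpath d T) (initial_topology (@wpath_unif R d T)).
HB.instance Definition _ (R : realType) (d : nat) (T : R) :=
  Measurable.copy (wpath d T)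
    (g_sigma_algebraType (@open (wpath d T))).

(* The element of (R^d)^n listed in [s], as a matrix with n columns; [enorm]
   is then the Euclidean norm of (R^d)^n. *)
Definition columns {R : realType} {d : nat} (n : nat) (s : seq 'cV[R]_d) :
  'M[R]_(d, n) :=
  \matrix_(i, k) (nth 0 s k) i 0.

Definition cylinder {R : realType} {d : nat} {T : R} (s : seq R)
    (f : 'M[R]_(d, size s) -> R) (w : wpath d T) : R :=
  f (columns (size s) (map w s)).

(* L_ip(Omega_t), as functions on Omega_T. *)
Definition Lip {R : realType} {d : nat} {T : R} (t : R)
    (xi : wpath d T -> R) : Prop :=
  exists (s : seq R) (f : 'M[R]_(d, size s) -> R),
    [/\ forall r, r \in s -> 0 <= r <= t, bounded_lipschitz f &
        xi = cylinder f].

(* For s = [t_k; ...; t_n], past = [x_1; ...; x_{k-1}] and r = t_{k-1}, the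
   value u_k(r, x; x_1, ..., x_{k-1}). *)
Fixpoint backward_value {R : realType} {d : nat} (G : 'M[R]_d -> R)
    (f : seq 'cV[R]_d -> R) (r : R) (s : seq R) (past : seq 'cV[R]_d)
    (x : 'cV[R]_d) : R :=
  if s is t :: s' then
    Gheat G r t (fun y => backward_value G f t s' (rcons past y) y) (r, x)
  else f past.

(* Graph of xi |-> u_1(0, 0) over the representations of xi with
   0 < t_1 < ... < t_n = T. *)
Definition is_lip_expectation {R : realType} {d : nat} {T : R}
    (G : 'M[R]_d -> R) (xi : wpath d T -> R) (e : R) : Prop :=
  exists (s : seq R) (f : 'M[R]_(d, size s) -> R),
    [/\ path <%R 0 s, last 0 s = T, bounded_lipschitz f, xi = cylinder f &
        e = backward_value G (fun p => f (columns (size s) p)) 0 s [::] 0].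

(* Sound because the value does not depend on the representation. *)
Definition lip_expectation {R : realType} {d : nat} {T : R}
    (G : 'M[R]_d -> R) (xi : wpath d T -> R) : R :=
  xget 0 [set e | is_lip_expectation G xi e].

Definition upper_expectation {R : realType} {d : nat} {T : R}
    (PP : set (probability (wpath d T) R)) (f : wpath d T -> \bar R) : \bar R :=
  ereal_sup [set (\int[P]_w f w)%E | P in PP].

Definition bounded_continuous {R : realType} (U : topologicalType) : Type :=
  {f : U -> R | continuous f /\ bounded_real f}.

(* Compactness for weak convergence: the weak topology is the one induced by
   P |-> (f |-> E_P[f]) from the product topology, with f ranging over the
   bounded continuous functions. *)
Definition weakly_compact {R : realType} {d : nat} {T : R}
    (PP : set (probability (wpath d T) R)) : Prop :=
  compact ([set (fun f : @bounded_continuous R (wpath d T) =>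
      \int[P]_w (projT1 f w)) | P in PP] :
    set {ptws (@bounded_continuous R (wpath d T)) -> R}).

Definition represents {R : realType} {d : nat} {T : R} (G : 'M[R]_d -> R)
    (PP : set (probability (wpath d T) R)) : Prop :=
  weakly_compact PP /\
  forall xi : wpath d T -> R, Lip T xi ->
    (lip_expectation G xi)%:E = upper_expectation PP (fun w => (xi w)%:E).

Definition capacity {R : realType} {d : nat} {T : R}
    (PP : set (probability (wpath d T) R)) (A : set (wpath d T)) : \bar R :=
  ereal_sup [set P A | P in PP].

Definition quasi_surely {R : realType} {d : nat} {T : R}
    (PP : set (probability (wpath d T) R)) (Q : wpath d T -> Prop) : Prop :=
  exists N : set (wpath d T),
    [/\ measurable N, capacity PP N = 0%E & forall w, ~ N w -> Q w].

(* Convergence in L^p_G, on the realization of the completion by random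
   variables. *)
Definition cvg_LpG {R : realType} {d : nat} {T : R}
    (PP : set (probability (wpath d T) R)) (p : nat)
    (xin : nat -> wpath d T -> R) (xi : wpath d T -> R) : Prop :=
  measurable_fun [set: wpath d T] xi /\
  upper_expectation PP (fun w => (`|xi w - xin n w| ^+ p)%:E)
    @[n --> \oo] --> 0%E.

(* Continuous extension of the G-expectation from L_ip(Omega_T) to
   L^1_G(Omega_T). *)
Definition is_Gexpectation {R : realType} {d : nat} {T : R}
    (G : 'M[R]_d -> R) (PP : set (probability (wpath d T) R))
    (xi : wpath d T -> R) (e : R) : Prop :=
  exists xin : nat -> wpath d T -> R,
    [/\ forall n, Lip T (xin n), cvg_LpG PP 1 xin xi &
        lip_expectation G (xin n) @[n --> \oo] --> e].

Definition Gexpectation {R : realType} {d : nat} {T : R}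
    (G : 'M[R]_d -> R) (PP : set (probability (wpath d T) R))
    (xi : wpath d T -> R) : R :=
  xget 0 [set e | is_Gexpectation G PP xi e].

(* Only the indices k <= step_size matter. *)
Record step_process (R : realType) (d : nat) (T : R) := StepProcess {
  step_size : nat ;
  step_time : nat -> R ;
  step_coef : nat -> wpath d T -> R ;
  step_first : step_time 0 = 0 ;
  step_last : step_time step_size = T ;
  step_lt : forall k, (k < step_size)%N -> step_time k < step_time k.+1 ;
  step_lip : forall k, (k < step_size)%N -> Lip (step_time k) (step_coef k) }.

Definition step_eval {R : realType} {d : nat} {T : R} (h : step_process d T)
    (t : R) (w : wpath d T) : R :=
  \sum_(k < step_size h)
    step_coef h k w * \1_(`]step_time h k, step_time h k.+1]%classic) t.

Definition step_ito {R : realType} {d : nat} {T : R} (h : step_process d T)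
    (j : 'I_d) (t : R) (w : wpath d T) : R :=
  \sum_(k < step_size h)
    step_coef h k w * (w (Num.min (step_time h k.+1) t) j 0
                       - w (Num.min (step_time h k) t) j 0).

Definition cvg_MpG {R : realType} {d : nat} {T : R}
    (PP : set (probability (wpath d T) R)) (p : nat)
    (hn : nat -> step_process d T) (eta : R -> wpath d T -> R) : Prop :=
  measurable_fun (`[0, T]%classic `*` [set: wpath d T])
    (fun q : R * wpath d T => eta q.1 q.2) /\
  upper_expectation PP (fun w =>
      (\int[lebesgue_measure]_(s in `[0%R, T])
        (`|eta s w - step_eval (hn n) s w| ^+ p)%:E)%E)
    @[n --> \oo] --> 0%E.

Definition MpG {R : realType} {d : nat} {T : R}
    (PP : set (probability (wpath d T) R)) (p : nat)
    (eta : R -> wpath d T -> R) : Prop :=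
  exists hn : nat -> step_process d T, cvg_MpG PP p hn eta.

(* [I] is (a version of) the integral over [0,t] of [eta] in M^2_G(0,T)
   against the j-th coordinate of B, as the L^2_G limit of the integrals of
   step processes. *)
Definition is_ito {R : realType} {d : nat} {T : R}
    (PP : set (probability (wpath d T) R)) (j : 'I_d)
    (eta : R -> wpath d T -> R) (t : R) (I : wpath d T -> R) : Prop :=
  exists hn : nat -> step_process d T,
    cvg_MpG PP 2 hn eta /\ cvg_LpG PP 2 (fun n => step_ito (hn n) j t) I.

(* [X] solves  dX = sigma(X) dB + b(X) dt  on [0,T] with X_0 = x; [M i j] is
   the integral of sigma(X)_ij against B^j. *)
Definition SDE_solution {R : realType} {d : nat} {T : R}
    (PP : set (probability (wpath d T) R))
    (sigma : 'cV[R]_d -> 'M[R]_d) (b : 'cV[R]_d -> 'cV[R]_d) (x : 'cV[R]_d)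
    (X : R -> wpath d T -> 'cV[R]_d) : Prop :=
  [/\ forall i, MpG PP 2 (fun t w => X t w i 0),
      quasi_surely PP (fun w => {within `[0, T], continuous (X^~ w)}) &
      exists M : 'I_d -> 'I_d -> R -> wpath d T -> R,
        (forall i j t, 0 <= t <= T ->
           is_ito PP j (fun s w => sigma (X s w) i j) t (M i j t)) /\
        quasi_surely PP (fun w => forall t i, 0 <= t <= T ->
           X t w i 0 = x i 0 + \sum_j M i j t w
             + \int[lebesgue_measure]_(s in `[0, t]) b (X s w) i 0)].

Definition exp_quotient {R : realType} (L T : R) : R :=
  if L == 0 then T else (1 - expR (- (L * T))) / L.

(* Main.v *)
(* Run the Euler scheme of the equation with increments of B clamped at a level rho.
   Uniformly over the representing measures it is close to X_T in L^2, so u(T, x) is a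
   limit of iterated G-heat values V and U of functionals of the scheme started at x and y.

   One step satisfies a log-Harnack inequality: if U > 0 is a G-heat solution, then ln U,
   transported along a drift v, is a supersolution up to the cost |v|^2 / (2 lGamma^2).
   The drift is chosen to couple the step from x with the step from y.  Backward in time
   this gives, with F = lam * phi at maturity for V and exp F for U,
     V(x) <= ln U(y) + c_k |x - y|^2 + error,
   where p_k = 1 / c_k obeys an affine recursion whose limit is the weight
   (1 - exp (- L T)) / L.  Since ln U <= U - 1 and exp F <= 1 + F + (3 / 2) F^2 for small
   lam, optimizing lam yields the gradient bound.

   Uniqueness for the G-heat equation is proved by mollifying supersolutions (G is convex,
   so box averages remain supersolutions) and comparing with smooth functions; existence
   is proved by a controlled random walk and an ultrafilter limit. *)

Require Import Defs.
From HB Require Import structures.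
From mathcomp Require Import all_boot all_order all_algebra.
From mathcomp Require Import all_classical all_reals all_analysis.
From mathcomp Require Import measurable_realfun ring lra.

Set Implicit Arguments.
Unset Strict Implicit.
Unset Printing Implicit Defensive.

Import Order.TTheory GRing.Theory Num.Theory.
Import numFieldNormedType.Exports.

Local Open Scope classical_set_scope.
Local Open Scope ring_scope.

(** The measures in [PP] may be mutually singular, so a coupling by change of measure has no common
    reference measure. Probabilistic facts are therefore read off the G-heat equation: moments of
    increments come from polynomial supersolutions, and the change of measure becomes the transport
    term of the log-Harnack inequality. Clamping the increments makes functionals of the scheme
    bounded and Lipschitz, hence members of [Lip] with an explicit backward value; moment bounds
    make its effect of order [rho ^- 2].

    The constants are matched as follows. Put [q = |x - y| / (lsigma * lGamma * sqrt xi)] with [xi]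
    the weight, and let [M] bound [phi]. The claim [2 * M * q] is trivial for [1 <= q]. For [q < 1]
    the choice [lam * M = 2/3 * q] makes both terms [3/2 * (lam * M)^2] and [4/3 * q^2 / 2] equal to
    [2/3 * q^2], and their sum is exactly [lam * (2 * M * q)]. The factor [3/2] pays for expanding
    the exponential, [4/3] for the finite mesh. The result has [2 / (lsigma * lGamma)] in place of
    [C], and [(Usigma / lsigma)^2 >= 1] leads to the stated constant. *)

Lemma le_of_eq {disp} {P : porderType disp} (x y : P) : x = y -> (x <= y)%O.
Proof. by move=> ->. Qed.

Lemma ge0_integrable {R : realType} {d} {X : measurableType d} (mu : {measure set X -> \bar R})
    (D : set X) (f : X -> R) : measurable_fun D f -> (forall x, 0 <= f x) ->
  (\int[mu]_(x in D) (f x)%:E < +oo)%E -> mu.-integrable D (EFin \o f).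
Proof.
move=> mf f0 fy; apply/integrableP; split; first exact/measurable_EFinP.
by apply: le_lt_trans fy; apply: le_of_eq; apply: eq_integral => x _ /=; rewrite ger0_norm.
Qed.

Lemma itv_oc_indic {R : realType} (a b : R) :
  (fun r => (a < r <= b)%R%:R) = (\1_(`]a, b]%classic) : R -> R).
Proof.
apply/funext => r; rewrite indicE; congr (nat_of_bool _)%:R.
by apply/idP/idP => [h|/set_mem]; [apply/mem_set; rewrite /= in_itv|rewrite /= in_itv].
Qed.

Lemma sqr_le_norm {R : realDomainType} (x y : R) : `|x| <= y -> x ^+ 2 <= y ^+ 2.
Proof.
move=> xy; rewrite -real_normK ?num_real // ler_pXn2r ?nnegrE //.
exact: le_trans (normr_ge0 x) xy.
Qed.

Lemma sum_ord_const {R : nzRingType} n (x : R) : \sum_(i < n) x = n%:R * x.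
Proof. by rewrite sumr_const card_ord mulr_natl. Qed.

(** * Euclidean norms *)

Section l2.
Context {R : realType} {I : finType}.
Implicit Types f g : I -> R.

Definition l2 f : R := Num.sqrt (\sum_i f i ^+ 2).

Lemma l2_sum_ge0 f : 0 <= \sum_i f i ^+ 2.
Proof. by apply: sumr_ge0 => i _; exact: sqr_ge0. Qed.

Lemma l2_ge0 f : 0 <= l2 f. Proof. exact: sqrtr_ge0. Qed.

Lemma l2_sqr f : l2 f ^+ 2 = \sum_i f i ^+ 2.
Proof. by rewrite sqr_sqrtr // l2_sum_ge0. Qed.

Lemma l2_coord f i : `|f i| <= l2 f.
Proof.
rewrite -(ler_pXn2r (ltn0Sn 1)) ?nnegrE ?normr_ge0 ?l2_ge0 //.
rewrite l2_sqr real_normK ?num_real // (bigD1 i) //= lerDl.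
by apply: sumr_ge0 => j _; exact: sqr_ge0.
Qed.

Lemma l2_eq0 f : l2 f = 0 -> forall i, f i = 0.
Proof.
by move=> f0 i; apply/eqP; rewrite -normr_le0; apply: le_trans (l2_coord f i) _; rewrite f0.
Qed.

Lemma l2_cauchy_schwarz f g : \sum_i f i * g i <= l2 f * l2 g.
Proof.
have [f0|f0] := eqVneq (l2 f) 0.
  by rewrite f0 mul0r big1 // => i _; rewrite (l2_eq0 f0) mul0r.
have [g0|g0] := eqVneq (l2 g) 0.
  by rewrite g0 mulr0 big1 // => i _; rewrite (l2_eq0 g0) mulr0.
have pf : 0 < l2 f by rewrite lt_def f0 l2_ge0.
have pg : 0 < l2 g by rewrite lt_def g0 l2_ge0.
(* This weight makes the two halves of Young's inequality equal, so that their sum is exactly the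
   product of the norms. *)
pose c := l2 g / l2 f.
have c0 : 0 < c by rewrite divr_gt0.
apply: (@le_trans _ _ (\sum_i (2^-1 * (c * f i ^+ 2) + 2^-1 * (c^-1 * g i ^+ 2)))).
  apply: ler_sum => i _; rewrite -subr_ge0.
  have -> : 2^-1 * (c * f i ^+ 2) + 2^-1 * (c^-1 * g i ^+ 2) - f i * g i
      = 2^-1 * c * (f i - c^-1 * g i) ^+ 2.
    by field; rewrite gt_eqF.
  by rewrite mulr_ge0 ?sqr_ge0 // mulr_ge0 ?invr_ge0 ?ler0n // ltW.
rewrite big_split /= -!mulr_sumr -!l2_sqr.
by apply: le_of_eq; rewrite /c; field; rewrite f0 g0.
Qed.

Lemma l2_triangle f g : l2 (fun i => f i + g i) <= l2 f + l2 g.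
Proof.
rewrite -(ler_pXn2r (ltn0Sn 1)) ?nnegrE ?addr_ge0 ?l2_ge0 //.
rewrite sqrrD !l2_sqr.
have -> : \sum_i (f i + g i) ^+ 2
   = \sum_i f i ^+ 2 + (\sum_i f i * g i) *+ 2 + \sum_i g i ^+ 2.
  rewrite -sumrMnl -!big_split /=; apply: eq_bigr => i _; by rewrite sqrrD.
by rewrite lerD2r lerD2l lerMn2r /= l2_cauchy_schwarz.
Qed.

Lemma l2_le_sum f : l2 f <= \sum_i `|f i|.
Proof.
rewrite -(ler_pXn2r (ltn0Sn 1)) ?nnegrE ?l2_ge0 ?sumr_ge0 //.
rewrite l2_sqr expr2 mulr_sumr; apply: ler_sum => i _.
rewrite -real_normK ?num_real // expr2 ler_wpM2r // (bigD1 i) //= lerDl.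
by apply: sumr_ge0.
Qed.

End l2.

Section enorm.
Context {R : realType} {m n : nat}.
Implicit Types A B : 'M[R]_(m, n).

Lemma enormE A : enorm A = l2 (fun p : 'I_m * 'I_n => A p.1 p.2).
Proof. by rewrite /enorm /l2 pair_big. Qed.

Lemma enorm_ge0 A : 0 <= enorm A. Proof. by rewrite enormE l2_ge0. Qed.

Lemma enorm_sqr A : enorm A ^+ 2 = \sum_i \sum_j A i j ^+ 2.
Proof. by rewrite enormE l2_sqr pair_big. Qed.

Lemma enorm_coord A i j : `|A i j| <= enorm A.
Proof. by rewrite enormE (l2_coord (fun p : 'I_m * 'I_n => A p.1 p.2) (i, j)). Qed.

Lemma enormD A B : enorm (A + B) <= enorm A + enorm B.
Proof.
rewrite !enormE; apply: le_trans (l2_triangle _ _); apply: le_of_eq.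
by congr l2; apply/funext => p; rewrite mxE.
Qed.

Lemma enormZ c A : enorm (c *: A) = `|c| * enorm A.
Proof.
apply/eqP; rewrite -(eqrXn2 (ltn0Sn 1)) ?mulr_ge0 ?enorm_ge0 //.
rewrite exprMn !enorm_sqr mulr_sumr; apply/eqP; apply: eq_bigr => i _.
by rewrite mulr_sumr; apply: eq_bigr => j _; rewrite mxE exprMn real_normK ?num_real.
Qed.

Lemma enormN A : enorm (- A) = enorm A.
Proof. by rewrite -scaleN1r enormZ normrN1 mul1r. Qed.

Lemma enorm_distC A B : enorm (A - B) = enorm (B - A).
Proof. by rewrite -enormN opprB. Qed.

Lemma enorm0 : enorm (0 : 'M[R]_(m, n)) = 0.
Proof. by rewrite -(scale0r (0 : 'M[R]_(m, n))) enormZ normr0 mul0r. Qed.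

Lemma enorm_le_sum A : enorm A <= \sum_i \sum_j `|A i j|.
Proof. by rewrite enormE pair_big; exact: l2_le_sum. Qed.

Lemma enorm_eq0 A : enorm A = 0 -> A = 0.
Proof. by rewrite enormE => /l2_eq0 h; apply/matrixP => i j; rewrite mxE (h (i, j)). Qed.

Lemma mx_norm_coord A i j : `|A i j| <= `|A|.
Proof.
rewrite [leRHS]/Num.norm /= mx_normrE.
exact: (le_bigmax _ (fun ij : 'I_m * 'I_n => `|A ij.1 ij.2|) (i, j)).
Qed.

Lemma mx_norm_enorm A : `|A| <= enorm A.
Proof.
rewrite [leLHS]/Num.norm /= mx_normrE; apply: bigmax_le; first exact: enorm_ge0.
by move=> [i j] _; exact: enorm_coord.
Qed.

End enorm.

Lemma enorm_cV {R : realType} {d : nat} (v : 'cV[R]_d) :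
  enorm v ^+ 2 = \sum_i v i 0 ^+ 2.
Proof. by rewrite enorm_sqr; apply: eq_bigr => i _; rewrite big_ord1. Qed.

Lemma enorm_cV_le_sum {R : realType} {d : nat} (v : 'cV[R]_d) :
  enorm v <= \sum_i `|v i 0|.
Proof. by apply: le_trans (enorm_le_sum v) _; apply: ler_sum => i _; rewrite big_ord1. Qed.

Lemma enorm_le_norm {R : realType} {d : nat} (v : 'cV[R]_d) : enorm v <= d%:R * `|v|.
Proof.
apply: le_trans (enorm_cV_le_sum v) _.
apply: le_trans (ler_sum _ (fun i _ => mx_norm_coord v i 0)) _.
by rewrite sum_ord_const.
Qed.

Lemma cauchy_schwarz_cV {R : realType} {d : nat} (v w : 'cV[R]_d) :
  (v^T *m w) 0 0 <= enorm v * enorm w.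
Proof.
rewrite mxE !enormE.
have e (u : 'cV[R]_d) : l2 (fun p : 'I_d * 'I_1 => u p.1 p.2) = l2 (fun i => u i 0).
  rewrite /l2; congr Num.sqrt; rewrite -(pair_big xpredT xpredT (fun i j => u i j ^+ 2)) /=.
  by apply: eq_bigr => i _; rewrite big_ord1.
rewrite !e; apply: le_trans (l2_cauchy_schwarz _ _); apply: le_of_eq.
by apply: eq_bigr => i _; rewrite mxE.
Qed.

Lemma dotvv {R : realType} {d : nat} (v : 'cV[R]_d) : (v^T *m v) 0 0 = enorm v ^+ 2.
Proof. by rewrite mxE enorm_cV; apply: eq_bigr => i _; rewrite mxE expr2. Qed.

Lemma dotC {R : realType} {d : nat} (v w : 'cV[R]_d) :
  (v^T *m w) 0 0 = (w^T *m v) 0 0.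
Proof. by rewrite !mxE; apply: eq_bigr => i _; rewrite !mxE mulrC. Qed.

Lemma enorm_mulmx {R : realType} {m n : nat} (A : 'M[R]_(m, n)) (v : 'cV[R]_n) :
  enorm (A *m v) <= enorm A * enorm v.
Proof.
rewrite -(ler_pXn2r (ltn0Sn 1)) ?nnegrE ?mulr_ge0 ?enorm_ge0 //.
rewrite exprMn enorm_cV enorm_sqr mulr_suml; apply: ler_sum => i _.
have := cauchy_schwarz_cV (row i A)^T v; have := cauchy_schwarz_cV (- row i A)^T v.
rewrite !trmxK mulNmx mxE (_ : - row i A = (-1) *: row i A) ?scaleN1r //.
rewrite linearN /= enormN -row_mul mxE => h1 h2.
have -> : \sum_j A i j ^+ 2 = enorm (row i A)^T ^+ 2.
  by rewrite enorm_cV; apply: eq_bigr => j _; rewrite !mxE.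
rewrite -exprMn -real_normK ?num_real // ler_pXn2r ?nnegrE ?mulr_ge0 ?enorm_ge0 //.
by rewrite ler_norml h2 lerNl h1.
Qed.

(** * Quadratic forms and the function G *)

Definition quad {R : realType} {d : nat} (A : 'M[R]_d) (v : 'cV[R]_d) : R :=
  (v^T *m A *m v) 0 0.

Lemma quadE {R : realType} {d : nat} (A : 'M[R]_d) (v : 'cV[R]_d) :
  quad A v = \sum_i \sum_j v i 0 * A i j * v j 0.
Proof.
rewrite /quad mxE exchange_big; apply: eq_bigr => j _; rewrite mxE mulr_suml.
by apply: eq_bigr => i _; rewrite mxE.
Qed.

Lemma quadDZ {R : realType} {d : nat} (A : 'M[R]_d) (v w : 'cV[R]_d) c :
  quad A (v + c *: w) = quad A v
    + c * ((v^T *m A *m w) 0 0 + (w^T *m A *m v) 0 0) + c ^+ 2 * quad A w.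
Proof.
have e : (v + c *: w)^T = v^T + c *: w^T by rewrite linearD linearZ.
rewrite /quad e !mulmxDl !mulmxDr -!scalemxAl -!scalemxAr.
move: (v^T *m A *m v) (v^T *m A *m w) (w^T *m A *m v) (w^T *m A *m w) => p q r s.
by rewrite !mxE; ring.
Qed.

Lemma quad_scalar {R : realType} {d : nat} (c : R) (v : 'cV[R]_d) :
  quad c%:M v = c * enorm v ^+ 2.
Proof. by rewrite /quad mul_mx_scalar -scalemxAl mxE dotvv. Qed.

Lemma quad_outer {R : realType} {d : nat} (A : 'M[R]_d) (v : 'cV[R]_d) :
  \tr (A *m (v *m v^T)) = quad A v.
Proof.
by rewrite mulmxA mxtrace_mulC mulmxA /quad /mxtrace big_ord1.
Qed.

(** Cholesky factorization by induction on the dimension: a positive pivot [a] splits off one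
    rank-one term, and the Schur complement of the pivot is again positive definite. The vectors
    found here become the jump directions of random walks with covariance [A]. *)
Lemma posdef_decomp {R : realType} {d : nat} (A : 'M[R]_d) :
  A^T = A -> (forall v : 'cV[R]_d, v != 0 -> 0 < quad A v) ->
  exists l : 'I_d -> 'cV[R]_d, A = \sum_k l k *m (l k)^T.
Proof.
elim: d A => [|d IH] A symA pA.
  by exists (fun=> 0); apply/matrixP => -[].
pose B : 'M[R]_(1 + d) := A.
pose a := ulsubmx B 0 0; pose r := dlsubmx B; pose S := drsubmx B.
have symB : B^T = B by [].
have pB : forall v : 'cV[R]_(1 + d), v != 0 -> 0 < quad B v := pA.
have urE : ursubmx B = r^T by rewrite /r trmx_dlsub symB.
have ulE : ulsubmx B = a%:M by rewrite [LHS]mx11_scalar.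
have symS : S^T = S by rewrite /S trmx_drsub symB.
have BE : B = block_mx a%:M r^T r S by rewrite -ulE -urE submxK.
have qB (x : R) (w : 'cV[R]_d) : quad B (col_mx x%:M w) =
    a * x ^+ 2 + 2 * x * (r^T *m w) 0 0 + quad S w.
  have wr : w^T *m r = r^T *m w.
    by rewrite -[LHS]trmxK trmx_mul trmxK [RHS]mx11_scalar [in LHS](mx11_scalar (r^T *m w)) tr_scalar_mx.
  rewrite /quad BE tr_col_mx mul_row_block mul_row_col tr_scalar_mx.
  rewrite !mul_scalar_mx !mul_mx_scalar wr !mulmxDl -scalemxAl.
  move: (r^T *m w) (w^T *m S *m w) => p q; rewrite !mxE /= !mulr1n.
  by ring.
have a0 : 0 < a.
  have := pB (col_mx (1%:M) 0 : 'cV_(1 + d)).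
  rewrite qB mulmx0 /quad mulmx0 !mxE expr1n mulr1 mulr0 !addr0; apply.
  apply/eqP => /(congr1 (fun M : 'cV_(1 + d) => usubmx M 0 0)).
  by rewrite col_mxKu !mxE => /eqP; rewrite oner_eq0.
have [l lE] : exists l : 'I_d -> 'cV[R]_d,
    S - a^-1 *: (r *m r^T) = \sum_k l k *m (l k)^T.
  apply: IH; first by rewrite linearB /= linearZ /= trmx_mul trmxK symS.
  (* The first coordinate minimizes [qB] for fixed [w]; the minimum is the quadratic form of the
     Schur complement. *)
  move=> w w0; have := pB (col_mx (- (a^-1 * (r^T *m w) 0 0))%:M w : 'cV_(1 + d)).
  rewrite qB.
  have -> : quad (S - a^-1 *: (r *m r^T)) w = quad S w - a^-1 * (r^T *m w) 0 0 ^+ 2.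
    rewrite /quad mulmxBr mulmxBl mxE [in X in _ + X]mxE; congr (_ - _).
    rewrite -scalemxAr -scalemxAl mxE; congr (_ * _).
    have -> : w^T *m (r *m r^T) *m w = (w^T *m r) *m (r^T *m w) by rewrite !mulmxA.
    by rewrite [LHS]mxE big_ord1 expr2 dotC.
  move=> h; have := h _; rewrite (_ : (_ + _ + _ = quad S w - a^-1 * (r^T *m w) 0 0 ^+ 2)).
    apply; apply: contra w0 => /eqP e; apply/eqP.
    by move: (congr1 (fun M : 'cV_(1 + d) => dsubmx M) e); rewrite col_mxKd linear0.
  by field; rewrite gt_eqF.
pose l0 : 'cV[R]_(1 + d) := col_mx (Num.sqrt a)%:M ((Num.sqrt a)^-1 *: r).
exists (fun k => if unlift ord0 k is Some j then (col_mx 0 (l j) : 'cV_(1 + d)) else l0).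
rewrite big_ord_recl unlift_none.
under eq_bigr do rewrite liftK.
have e : \sum_k (col_mx 0 (l k) : 'cV_(1 + d)) *m (col_mx 0 (l k) : 'cV_(1 + d))^T =
    block_mx 0 0 0 (\sum_k l k *m (l k)^T) :> 'M[R]_(1 + d).
  apply: (big_rec2 (fun x y => x = block_mx 0 0 0 y)); first by rewrite block_mx0.
  move=> k x y _ ->; rewrite tr_col_mx mul_col_row trmx0 !mul0mx !mulmx0.
  by rewrite add_block_mx !addr0.
transitivity (l0 *m l0^T + block_mx 0 0 0 (\sum_k l k *m (l k)^T) : 'M[R]_(1 + d)); last first.
  by rewrite -e.
rewrite -[LHS]/B.
rewrite -lE /l0 tr_col_mx mul_col_row add_block_mx !addr0 {1}BE.
have sa : Num.sqrt a != 0 by rewrite sqrtr_eq0 -ltNge.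
have saa : Num.sqrt a * Num.sqrt a = a by rewrite -expr2 sqr_sqrtr // ltW.
set q := Num.sqrt a in sa saa *.
have e1 : (q%:M : 'M[R]_1) *m (q%:M)^T = a%:M by rewrite tr_scalar_mx -scalar_mxM saa.
have e2 : (q%:M : 'M[R]_1) *m (q^-1 *: r)^T = r^T.
  by rewrite linearZ /= mul_scalar_mx scalerA mulfV // scale1r.
have e3 : (q^-1 *: r) *m (q%:M : 'M[R]_1)^T = r.
  by rewrite tr_scalar_mx mul_mx_scalar scalerA mulfV // scale1r.
have e4 : (q^-1 *: r) *m (q^-1 *: r)^T + (S - a^-1 *: (r *m r^T)) = S.
  by rewrite linearZ /= -scalemxAl -scalemxAr scalerA -invfM saa addrC subrK.
by rewrite e1 e2 e3 e4.
Qed.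

Lemma basis_form {R : realType} {d : nat} (A : 'M[R]_d) (i j : 'I_d) :
  ((basis_cv i)^T *m A *m basis_cv j) 0 0 = A i j.
Proof. by rewrite /basis_cv trmx_delta -rowE -colE !mxE. Qed.

Lemma quad_basis {R : realType} {d : nat} (A : 'M[R]_d) (i : 'I_d) :
  quad A (basis_cv i) = A i i.
Proof. exact: basis_form. Qed.

Lemma enorm_basis {R : realType} {d : nat} (i : 'I_d) :
  enorm (basis_cv i : 'cV[R]_d) = 1.
Proof.
apply/eqP; rewrite -(eqrXn2 (ltn0Sn 1)) ?enorm_ge0 // -dotvv expr1n.
by rewrite -[X in X *m _]mulmx1 basis_form mxE eqxx.
Qed.

Lemma cV_basis_sum {R : realType} {d : nat} (v : 'cV[R]_d) :
  v = \sum_i v i 0 *: basis_cv i.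
Proof.
apply/matrixP => i j; rewrite ord1 summxE (bigD1 i) //= big1 => [|k ki].
  by rewrite !mxE !eqxx mulr1 addr0.
by rewrite !mxE eq_sym (negbTE ki) mulr0.
Qed.

(** Applied to [Gamma] throughout, and to a singleton containing [sigma z] in order to bound the
    entries of [sigma]. *)
Definition elliptic {R : realType} {d : nat} (Gamma : set 'M[R]_d) (lG UG : R) :=
  [/\ Gamma !=set0, 0 < lG & forall g, Gamma g ->
    [/\ g^T = g, forall v, lG ^+ 2 * enorm v ^+ 2 <= quad g v &
        forall v, quad g v <= UG ^+ 2 * enorm v ^+ 2]].

Section Gfun.
Context {R : realType} {d : nat} (Gamma : set 'M[R]_d) (lG UG : R) (ellG : elliptic Gamma lG UG).
Local Notation G := (Gfun Gamma).

Lemma elliptic_quad_ge0 g v : Gamma g -> 0 <= quad g v.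
Proof.
case: ellG => _ _ /[apply] -[_ h _]; apply: le_trans (h v).
by rewrite mulr_ge0 ?sqr_ge0.
Qed.

Lemma elliptic_diag g i : Gamma g -> g i i <= UG ^+ 2.
Proof.
case: ellG => _ _ /[apply] -[_ _ /(_ (basis_cv i))].
by rewrite quad_basis enorm_basis expr1n mulr1.
Qed.

(** Positivity on the sum and on the difference of two basis vectors bounds twice the off-diagonal
    entry by the sum of the two diagonal ones. *)
Lemma elliptic_entry g i j : Gamma g -> `|g i j| <= UG ^+ 2.
Proof.
move=> Gg; have [_ _ /(_ _ Gg)[sg _ _]] := ellG.
have q c : quad g (basis_cv i + c *: basis_cv j) = g i i + c * (2 * g i j) + c ^+ 2 * g j j.
  have gji : g j i = g i j by rewrite -[in LHS]sg mxE.
  by rewrite quadDZ !basis_form !quad_basis gji; ring.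
have h1 := elliptic_quad_ge0 (basis_cv i + 1 *: basis_cv j) Gg.
have h2 := elliptic_quad_ge0 (basis_cv i + (-1) *: basis_cv j) Gg.
have := elliptic_diag i Gg; have := elliptic_diag j Gg; move: h1 h2; rewrite !q => *.
by rewrite ler_norml; apply/andP; split; lra.
Qed.

Lemma elliptic_tr g (A : 'M[R]_d) : Gamma g ->
  `|\tr (A *m g)| <= UG ^+ 2 * \sum_i \sum_j `|A i j|.
Proof.
move=> Gg; rewrite /mxtrace mulr_sumr.
apply: le_trans (ler_norm_sum _ _ _) _; apply: ler_sum => i _.
rewrite mxE mulr_sumr; apply: le_trans (ler_norm_sum _ _ _) _; apply: ler_sum => j _.
by rewrite normrM mulrC ler_wpM2r // elliptic_entry.
Qed.

Lemma Gfun_has_sup A : has_sup [set \tr (A *m g) | g in Gamma].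
Proof.
have [[g0 Gg0] _ _] := ellG; split; first by exists (\tr (A *m g0)), g0.
exists (UG ^+ 2 * \sum_i \sum_j `|A i j|) => _ [g Gg <-].
by apply: le_trans (elliptic_tr A Gg); exact: ler_norm.
Qed.

Lemma Gfun_ge A g : Gamma g -> 2^-1 * \tr (A *m g) <= G A.
Proof.
move=> Gg; rewrite /Gfun ler_pM2l ?invr_gt0 //.
by apply: ub_le_sup; [case: (Gfun_has_sup A)|exists g].
Qed.

Lemma Gfun_le A c : (forall g, Gamma g -> 2^-1 * \tr (A *m g) <= c) -> G A <= c.
Proof.
move=> h; rewrite /Gfun ler_pdivrMl //; apply: ge_sup; first by case: (Gfun_has_sup A).
by move=> _ [g Gg <-]; rewrite -ler_pdivrMl ?h.
Qed.

Lemma Gfun_add A B : G (A + B) <= G A + G B.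
Proof.
apply: Gfun_le => g Gg; rewrite mulmxDl linearD /= mulrDr.
by apply: lerD; exact: Gfun_ge.
Qed.

Lemma Gfun_scalar_le c : 0 <= c -> G c%:M <= 2^-1 * c * (d%:R * UG ^+ 2).
Proof.
move=> c0; apply: Gfun_le => g Gg; rewrite mul_scalar_mx linearZ /= mulrA ler_wpM2l //.
  by rewrite mulr_ge0 ?invr_ge0.
rewrite /mxtrace; apply: (@le_trans _ _ (\sum_(i < d) UG ^+ 2)).
  by apply: ler_sum => i _; exact: elliptic_diag.
by rewrite sum_ord_const.
Qed.

(** Each [enorm (l k) ^+ 2] is one of the nonnegative summands of the trace of [g]. The bound does
    not depend on [g], which makes the jumps of all controlled walks small at the same time. *)
Lemma elliptic_decomp g : Gamma g -> exists2 l : 'I_d -> 'cV[R]_d,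
  g = \sum_k l k *m (l k)^T & forall k, enorm (l k) ^+ 2 <= d%:R * UG ^+ 2.
Proof.
move=> Gg; have [_ lG0 /(_ _ Gg)[sg lg _]] := ellG.
have [v v0|l gE] := posdef_decomp sg.
  apply: lt_le_trans (lg v); rewrite mulr_gt0 ?exprn_gt0 //.
  by rewrite lt_def enorm_ge0 andbT; apply: contra v0 => /eqP/enorm_eq0 ->.
exists l => // k.
have -> : enorm (l k) ^+ 2 = \tr (l k *m (l k)^T) by rewrite mxtrace_mulC /mxtrace big_ord1 dotvv.
apply: (@le_trans _ _ (\tr g)).
  rewrite [in leRHS]gE (bigD1 k) //= linearD /= lerDl linear_sum /=; apply: sumr_ge0 => i _.
  by rewrite mxtrace_mulC /mxtrace big_ord1 dotvv sqr_ge0.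
rewrite mulr_natl /mxtrace; apply: (@le_trans _ _ (\sum_(i < d) UG ^+ 2)).
  by apply: ler_sum => i _; exact: elliptic_diag.
by rewrite sumr_const card_ord.
Qed.

End Gfun.

Lemma tr_decomp {R : realType} {d : nat} (A g : 'M[R]_d) (l : 'I_d -> 'cV[R]_d) :
  g = \sum_k l k *m (l k)^T -> \tr (A *m g) = \sum_k quad A (l k).
Proof.
move=> ->; rewrite mulmx_sumr linear_sum; apply: eq_bigr => k _; exact: quad_outer.
Qed.
(** * Directional derivatives *)

Lemma nbhs_dist {R : realType} {V : normedModType R} (p : V) (P : set V) :
  nbhs p P <-> exists2 e : R, 0 < e & forall q, `|q - p| < e -> P q.
Proof.
rewrite -nbhs_nbhs_norm; split=> -[e /= e0 h]; exists e => //= q; rewrite /ball_ /= => qp.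
  by apply: h; rewrite /ball_ /= distrC.
by apply: h; rewrite distrC.
Qed.

Lemma continuous_dist {R : realType} {V W : normedModType R} (f : V -> W) (p : V) : {for p, continuous f} <->
  forall e : R, 0 < e -> exists2 h : R, 0 < h & forall q, `|q - p| < h -> `|f q - f p| <= e.
Proof.
split=> [cf e e0|h].
  have /cvgrPdist_le/(_ e e0)/nbhs_dist [h h0 H] := cf.
  by exists h => // q /H; rewrite distrC.
apply/cvgrPdist_le => e e0; have [k k0 H] := h e e0.
by apply/nbhs_dist; exists k => // q /H; rewrite distrC.
Qed.

Section directional.
Context {R : realType} {V : normedModType R}.
Implicit Types (f g F D : V -> R) (p q v w : V).

Lemma is_derive_dist f p v l : is_derive p v f l <->
  forall e : R, 0 < e -> exists2 h : R, 0 < h &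
    forall s : R, `|s| < h -> `|f (p + s *: v) - f p - s * l| <= e * `|s|.
Proof.
have key : (h^-1 *: ((f \o shift p) (h *: v) - f p) @[h --> (0:R)^'] --> l) <->
  forall e : R, 0 < e -> exists2 h : R, 0 < h &
    forall s : R, `|s| < h -> `|f (p + s *: v) - f p - s * l| <= e * `|s|.
  have aux (s : R) : s != 0 -> forall e, (`|l - s^-1 *: ((f \o shift p) (s *: v) - f p)| <= e) =
      (`|f (p + s *: v) - f p - s * l| <= e * `|s|).
    move=> s0 e; rewrite -(ler_pM2r (_ : 0 < `|s|)) ?normr_gt0 // -normrM distrC.
    rewrite mulrBl /= (addrC (s *: v)); congr (`|_| <= _).
    rewrite [_ *: _](_ : _ = s^-1 * (f (p + s *: v) - f p)) //.
    by rewrite mulrAC mulVf // mul1r (mulrC l).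
  split=> [/cvgrPdist_le h e e0|h].
    have /nbhs_dist [k k0 H] := h e e0; exists k => // s sk.
    have [->|s0] := eqVneq s 0; first by rewrite scale0r addr0 subrr mul0r subrr normr0 mulr0.
    by rewrite -aux //; apply: H; rewrite ?subr0.
  apply/cvgrPdist_le => e e0; have [k k0 H] := h e e0.
  by apply/nbhs_dist; exists k => // s; rewrite subr0 => /H hs s0; rewrite aux.
split=> [[df fl]|h].
  by apply/key; rewrite -fl; exact: df.
have /key kl := h.
by apply: DeriveDef; [apply/cvg_ex; exists l | rewrite /derive; apply/cvg_lim].
Qed.

(** Uniformity in the base point makes the derivative additive in the direction [v]: after the
    increment along the first direction, the base point of the second has moved. Continuous partial
    derivatives are strict, so they add up to derivatives in all directions. *)
Definition strict_deriv f v p (l : R) :=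
  forall e : R, 0 < e -> exists2 h : R, 0 < h & forall q (s : R), `|q - p| < h -> `|s| < h ->
    `|f (q + s *: v) - f q - s * l| <= e * `|s|.

Lemma strict_deriv_is_derive f v p l : strict_deriv f v p l -> is_derive p v f l.
Proof.
move=> sf; apply/is_derive_dist => e e0; have [h h0 H] := sf e e0.
by exists h => // s; apply: H; rewrite subrr normr0.
Qed.

End directional.

Lemma is_derive_line {R : realType} {V : normedModType R} (f : V -> R) v p s l :
  is_derive (p + s *: v) v f l -> is_derive s (1 : R) (fun r : R => f (p + r *: v)) l.
Proof.
move=> /is_derive_dist h; apply/is_derive_dist => e /h [k k0 H]; exists k => // r /H.
by rewrite (_ : s + r *: (1 : R) = s + r) ?scalerDl ?addrA // [r *: (1 : R)]mulr1.
Qed.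

Section strict.
Context {R : realType} {V : normedModType R}.
Implicit Types (f g F D : V -> R) (p q v w : V).

Lemma mean_value_line f D p v :
  (forall q, is_derive q v f (D q)) ->
  exists2 c : R, 0 <= c <= 1 & f (p + v) - f p = D (p + c *: v).
Proof.
move=> df.
have dg (s : R) : is_derive s 1 (fun r : R => f (p + r *: v)) (D (p + s *: v)).
  by apply: is_derive_line; exact: df.
have cg : {within `[(0 : R), 1], continuous (fun r : R => f (p + r *: v))}.
  by apply: derivable_within_continuous => s _; exact: ex_derive.
have [c c01 /=] := @MVT_segment _ _ (fun r => D (p + r *: v)) 0 1 ler01 (fun s _ => dg s) cg.
rewrite scale1r scale0r addr0 subr0 mulr1 => ->.
by exists c => //; move: c01; rewrite in_itv.
Qed.

Lemma is_derive_scale f v l p c : is_derive p v f l -> is_derive p (c *: v) f (c * l).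
Proof.
move=> /is_derive_dist h; apply/is_derive_dist => e e0.
have [k k0 H] := h (e / (`|c| + 1)) (divr_gt0 e0 (ltr_wpDl (normr_ge0 _) ltr01)).
exists (k / (`|c| + 1)) => [|s]; first by rewrite divr_gt0 // ltr_wpDl.
rewrite ltr_pdivlMr ?ltr_wpDl // => sk; rewrite scalerA mulrA.
have {}sk : `|s * c| < k.
  by rewrite normrM; apply: le_lt_trans sk; rewrite ler_wpM2l // lerDl.
apply: le_trans (H _ sk) _; rewrite -mulrA ler_pM2l // normrM mulrA mulrAC.
rewrite ler_piMl // mulrC ler_pdivrMr ?ltr_wpDl // mul1r lerDl //.
Qed.

Lemma strict_deriv_partial f D v p :
  (forall q, is_derive q v f (D q)) -> {for p, continuous D} -> strict_deriv f v p (D p).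
Proof.
move=> df /continuous_dist cD e e0; have [h h0 H] := cD e e0.
have w0 : 0 < `|v| + 1 by rewrite ltr_wpDl.
exists (Num.min (h / 2) (h / 2 / (`|v| + 1))).
  by rewrite lt_min !divr_gt0.
move=> q s; rewrite !lt_min => /andP[qh _] /andP[_]; rewrite ltr_pdivlMr // => sh.
have [c /andP[c0 c1] ->] := mean_value_line (D := fun q => s * D q) q (fun q => is_derive_scale s (df q)).
rewrite -mulrBr normrM mulrC ler_wpM2r // H //.
rewrite addrAC; apply: le_lt_trans (ler_normD _ _) _.
rewrite [ltRHS](splitr h) ltrD // scalerA normrZ normrM (ger0_norm c0).
apply: le_lt_trans sh; rewrite -mulrA; apply: (@le_trans _ _ (`|s| * `|v|)).
  by rewrite ler_piMl ?mulr_ge0.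
by rewrite ler_wpM2l // lerDl.
Qed.

Lemma strict_deriv0 f p : strict_deriv f 0 p 0.
Proof.
move=> e e0; exists 1 => // q s _ _.
by rewrite scaler0 addr0 subrr mulr0 subrr normr0 mulr_ge0 // ltW.
Qed.

Lemma strict_derivD f v w p l m :
  strict_deriv f v p l -> strict_deriv f w p m -> strict_deriv f (v + w) p (l + m).
Proof.
move=> sv sw e e0; have e20 : 0 < e / 2 by rewrite divr_gt0.
have [h h0 H] := sv _ e20; have [k k0 K] := sw _ e20.
have v0 : 0 < `|v| + 1 by rewrite ltr_wpDl.
pose r := Num.min h (Num.min (k / 2) (k / 2 / (`|v| + 1))).
exists r; first by rewrite !lt_min h0 !divr_gt0.
move=> q s; rewrite !lt_min => /and3P[qh qk _] /and3P[sh sk].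
rewrite ltr_pdivlMr // => sv'.
rewrite scalerDr addrA mulrDr.
rewrite (_ : f (q + s *: v + s *: w) - f q - (s * l + s * m) =
  (f (q + s *: v) - f q - s * l) + (f (q + s *: v + s *: w) - f (q + s *: v) - s * m)); last by ring.
apply: le_trans (ler_normD _ _) _; rewrite [e in leRHS](splitr e) mulrDl lerD ?H //.
apply: K; last by apply: lt_trans sk _; rewrite gtr_pMr // invf_lt1 // ltr1n.
rewrite addrAC; apply: le_lt_trans (ler_normD _ _) _.
rewrite [ltRHS](splitr k) ltrD // normrZ; apply: le_lt_trans sv'.
by rewrite ler_wpM2l // lerDl.
Qed.

Lemma strict_derivZ f v p l c : strict_deriv f v p l -> strict_deriv f (c *: v) p (c * l).
Proof.
move=> h e e0.
have c0 : 0 < `|c| + 1 by rewrite ltr_wpDl.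
have [k k0 H] := h (e / (`|c| + 1)) (divr_gt0 e0 c0).
exists (Num.min k (k / (`|c| + 1))) => [|q s]; first by rewrite lt_min k0 divr_gt0.
rewrite !lt_min => /andP[qk _] /andP[_].
rewrite ltr_pdivlMr // => sk; rewrite scalerA mulrA.
have {}sk : `|s * c| < k.
  by rewrite normrM; apply: le_lt_trans sk; rewrite ler_wpM2l // lerDl.
apply: le_trans (H _ _ qk sk) _; rewrite -mulrA ler_pM2l // normrM mulrA mulrAC.
by rewrite ler_piMl // mulrC ler_pdivrMr // mul1r lerDl.
Qed.

Lemma strict_deriv_sum (I : Type) (r : seq I) f (v : I -> V) (c : I -> R) p (l : I -> R) :
  (forall i, strict_deriv f (v i) p (l i)) ->
  strict_deriv f (\sum_(i <- r) c i *: v i) p (\sum_(i <- r) c i * l i).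
Proof.
move=> h; elim: r => [|i r IH]; first by rewrite !big_nil; exact: strict_deriv0.
by rewrite !big_cons; apply: strict_derivD => //; exact: strict_derivZ.
Qed.

Lemma is_derive_shift f v p z l :
  is_derive (p + z) v f l -> is_derive p v (fun q => f (q + z)) l.
Proof.
move=> /is_derive_dist h; apply/is_derive_dist => e /h [k k0 H]; exists k => // s /H.
by rewrite [p + z + _]addrAC.
Qed.

Lemma is_derive_postcomp (g : R -> R) f v p l m :
  is_derive (f p) 1 g m -> is_derive p v f l -> is_derive p v (fun q => g (f q)) (m * l).
Proof.
move=> dg df.
have h0 : is_derive (0 : R) (1 : R) (fun r : R => f (p + r *: v)) l.
  by apply: is_derive_line; rewrite scale0r addr0.
have h1 : is_derive ((fun r : R => f (p + r *: v)) 0) 1 g m by rewrite scale0r addr0.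
have /is_derive_dist h := is_derive1_comp h1 h0.
apply/is_derive_dist => e /h [k k0 H]; exists k => // s /H /=.
by rewrite add0r scale0r addr0 [s *: (1 : R)]mulr1.
Qed.

Lemma is_derive_const (c : R) p v : is_derive p v (fun=> c) 0.
Proof. exact: is_derive_cst. Qed.

Lemma is_derive_val f v p l l' : is_derive p v f l -> l = l' -> is_derive p v f l'.
Proof. by move=> ? <-. Qed.

Lemma is_derive_f f g v p l : is_derive p v f l -> (forall q, f q = g q) -> is_derive p v g l.
Proof. by move=> h /funext <-. Qed.

End strict.

Section continuity.
Context {R : realType} {V : normedModType R}.
Implicit Types (f g : V -> R).

Lemma continuous_add f g : continuous f -> continuous g -> continuous (fun q => f q + g q).
Proof. by move=> cf cg q; apply: cvgD; [exact: cf|exact: cg]. Qed.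

Lemma continuous_mul f g : continuous f -> continuous g -> continuous (fun q => f q * g q).
Proof. by move=> cf cg q; apply: cvgM; [exact: cf|exact: cg]. Qed.

Lemma continuous_scale c f : continuous f -> continuous (fun q => c * f q).
Proof. by apply: continuous_mul; exact: cst_continuous. Qed.

Lemma continuous_shift z f : continuous f -> continuous (fun q => f (q + z)).
Proof.
move=> cf q; apply: (@continuous_comp _ _ _ (fun q => q + z) f); last exact: cf.
by apply: cvgD; [exact: cvg_id|exact: cvg_cst].
Qed.

Lemma continuous_sum (I : Type) (r : seq I) (F : I -> V -> R) :
  (forall i, continuous (F i)) -> continuous (fun q => \sum_(i <- r) F i q).
Proof.
move=> cF; elim: r => [|i r IH].
  by under eq_fun do rewrite big_nil; exact: cst_continuous.
by under eq_fun do rewrite big_cons; exact: continuous_add.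
Qed.

End continuity.
Arguments continuous_scale {R V} c {f}.
Arguments continuous_shift {R V} z {f}.

(** * Functions of class C12 with named derivatives *)

Section C12.
Context {R : realType} {d : nat}.
Local Notation E := (R * 'cV[R]_d)%type.
Implicit Types (f g ft gt : E -> R) (fx gx : 'I_d -> E -> R) (fxx gxx : 'I_d -> 'I_d -> E -> R).

Definition dir_t : E := (1, 0).
Definition dir_x (i : 'I_d) : E := (0, basis_cv i).

(** [C12] with its derivatives named as functions on the product space, so that the rules for sums,
    products, logarithms and translations compute them. In [fxx i j] the derivative along [j] is
    taken first. *)
Definition hasC12 f ft fx fxx :=
  [/\ continuous f,
      (forall p, is_derive p dir_t f (ft p)) /\ continuous ft,
      (forall i p, is_derive p (dir_x i) f (fx i p)) /\ (forall i, continuous (fx i)) &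
      (forall i j p, is_derive p (dir_x i) (fx j) (fxx i j p)) /\
      (forall i j, continuous (fxx i j))].

Lemma is_derive_time f p l :
  is_derive p dir_t f l <-> is_derive p.1 (1 : R) (fun t : R => f (t, p.2)) l.
Proof.
have e (s : R) : p + s *: dir_t = (p.1 + s *: (1 : R), p.2).
  by case: p => a b; congr pair => /=; rewrite scaler0 addr0.
by rewrite !is_derive_dist; split=> h x /h [k k0 H]; exists k => // s /H;
  rewrite e; case: (p).
Qed.

Lemma is_derive_space f i p l :
  is_derive p (dir_x i) f l <->
  is_derive p.2 (basis_cv i) (fun x : 'cV[R]_d => f (p.1, x)) l.
Proof.
have e (s : R) : p + s *: dir_x i = (p.1, p.2 + s *: basis_cv i).
  by case: p => a b; congr pair => /=; rewrite scaler0 addr0.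
by rewrite !is_derive_dist; split=> h x /h [k k0 H]; exists k => // s /H;
  rewrite e; case: (p).
Qed.

Lemma hasC12_time_deriv f ft fx fxx : hasC12 f ft fx fxx -> time_deriv f = ft.
Proof.
by case=> _ [h _] _ _; apply/funext => p; have /is_derive_time[_] := h p.
Qed.

Lemma hasC12_space_deriv f ft fx fxx i : hasC12 f ft fx fxx -> space_deriv i f = fx i.
Proof.
by case=> _ _ [h _] _; apply/funext => p; have /is_derive_space[_] := h i p.
Qed.

Lemma hasC12_hessian f ft fx fxx p : hasC12 f ft fx fxx ->
  hessian f p = \matrix_(i, j) fxx i j p.
Proof.
move=> h; apply/matrixP => i j; rewrite !mxE (hasC12_space_deriv j h).
by case: h => _ _ _ [/(_ i j p)/is_derive_space[_ hd] _]; exact: hd.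
Qed.

Lemma hasC12_C12 f ft fx fxx : hasC12 f ft fx fxx -> C12 f.
Proof.
move=> h; split.
- by case: h.
- rewrite (hasC12_time_deriv h); case: h => _ [h1 h2] _ _; split=> // p.
  by have /is_derive_time[] := h1 p.
- move=> i; rewrite (hasC12_space_deriv i h); case: h => _ _ [h1 h2] _; split=> // p.
  by have /is_derive_space[] := h1 i p.
- move=> i j; rewrite (hasC12_space_deriv j h).
  case: h => _ _ _ [h1 h2]; split.
    by move=> p; have /is_derive_space[] := h1 i j p.
  rewrite (_ : space_deriv i (fx j) = fxx i j) //.
  by apply/funext => p; have /is_derive_space[] := h1 i j p.
Qed.

Lemma C12_hasC12 f : C12 f ->
  hasC12 f (time_deriv f) (space_deriv^~ f) (fun i j => space_deriv i (space_deriv j f)).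
Proof.
case=> cf [ft cft] fx fxx; split.
- exact: cf.
- split; last exact: cft.
  move=> p; apply/is_derive_time; split=> //; exact: ft.
- split=> i; last by case: (fx i).
  by move=> p; apply/is_derive_space; split; [case: (fx i) => h _; exact: h|].
- split=> i j; last by case: (fxx i j).
  by move=> p; apply/is_derive_space; split; [case: (fxx i j) => h _; exact: h|].
Qed.

Lemma hasC12_cst c : hasC12 (fun=> c) (fun=> 0) (fun _ _ => 0) (fun _ _ _ => 0).
Proof.
by split; [|split|split|split] => *; try exact: cst_continuous; exact: is_derive_const.
Qed.

Lemma hasC12_fst : hasC12 fst (fun=> 1) (fun _ _ => 0) (fun _ _ _ => 0).
Proof.
have h (k : R) : continuous (fun _ : E => k) := @cst_continuous _ _ k.
split; first by move=> p; exact: cvg_fst.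
- split; last exact: h.
  move=> p; apply/is_derive_dist => e e0; exists 1 => // s _.
  have -> : (p + s *: dir_t).1 = p.1 + s by rewrite /= [_ *: _]mulr1.
  by rewrite mulr1 [p.1 + s]addrC addrK subrr normr0 mulr_ge0 // ltW.
- split=> *; last exact: h.
  apply/is_derive_dist => e e0; exists 1 => // s _.
  by rewrite /= scaler0 addr0 mulr0 !subrr normr0 mulr_ge0 // ltW.
- by split=> *; [exact: is_derive_const|exact: h].
Qed.

Lemma hasC12_coord k : hasC12 (fun p => p.2 k 0) (fun=> 0) (fun i _ => (i == k)%:R)
  (fun _ _ _ => 0).
Proof.
have h (c : R) : continuous (fun _ : E => c) := @cst_continuous _ _ c.
split.
- move=> p; apply: (@continuous_comp _ _ _ snd (fun x : 'cV[R]_d => x k 0)).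
    exact: cvg_snd.
  exact: coord_continuous.
- split; last exact: h.
  move=> p; apply/is_derive_dist => e e0; exists 1 => // s _.
  by rewrite /= scaler0 addr0 mulr0 !subrr normr0 mulr_ge0 // ltW.
- split=> [i p|*]; last exact: h.
  apply/is_derive_dist => e e0; exists 1 => // s _.
  have -> : (p + s *: dir_x i).2 k 0 = p.2 k 0 + s * (i == k)%:R.
    by rewrite /= !mxE eqxx andbT eq_sym.
  by rewrite [p.2 k 0 + _]addrC addrK subrr normr0 mulr_ge0 // ltW.
- by split=> *; [exact: is_derive_const|exact: h].
Qed.

Lemma hasC12D f ft fx fxx g gt gx gxx : hasC12 f ft fx fxx -> hasC12 g gt gx gxx ->
  hasC12 (fun p => f p + g p) (fun p => ft p + gt p) (fun i p => fx i p + gx i p)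
    (fun i j p => fxx i j p + gxx i j p).
Proof.
case=> cf [f1 f2] [f3 f4] [f5 f6] [cg [g1 g2] [g3 g4] [g5 g6]].
split; [|split|split|split] => *; try exact: continuous_add; exact: is_deriveD.
Qed.

Lemma hasC12M f ft fx fxx g gt gx gxx : hasC12 f ft fx fxx -> hasC12 g gt gx gxx ->
  hasC12 (fun p => f p * g p) (fun p => f p * gt p + g p * ft p)
    (fun i p => f p * gx i p + g p * fx i p)
    (fun i j p => f p * gxx i j p + gx j p * fx i p + (g p * fxx i j p + fx j p * gx i p)).
Proof.
have h := @continuous_add R E; have m := @continuous_mul R E.
case=> cf [f1 f2] [f3 f4] [f5 f6] [cg [g1 g2] [g3 g4] [g5 g6]].
split; [exact: m|split|split|split] => *; first 1 [exact: is_deriveM].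
- by apply: h; exact: m.
- exact: is_deriveM.
- by apply: h; exact: m.
- by apply: is_deriveD; exact: is_deriveM.
- by apply: (h); apply: h; exact: m.
Qed.

Lemma hasC12Z c f ft fx fxx : hasC12 f ft fx fxx ->
  hasC12 (fun p => c * f p) (fun p => c * ft p) (fun i p => c * fx i p)
    (fun i j p => c * fxx i j p).
Proof.
case=> cf [f1 f2] [f3 f4] [f5 f6].
by split; [|split|split|split] => *; try exact: continuous_scale; exact: is_deriveZ.
Qed.

Lemma hasC12_ext f ft fx fxx g gt gx gxx : hasC12 f ft fx fxx ->
  f =1 g -> ft =1 gt -> (forall i, fx i =1 gx i) -> (forall i j, fxx i j =1 gxx i j) ->
  hasC12 g gt gx gxx.
Proof.
move=> h /funext <- /funext <- h1 h2.
have -> : gx = fx by apply/funext => i; apply/esym/funext/h1.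
suff -> : gxx = fxx by [].
by apply/funext => i; apply/funext => j; apply/esym/funext/h2.
Qed.

Lemma hasC12_sum (I : Type) (r : seq I) (F Ft : I -> E -> R) Fx Fxx :
  (forall k, hasC12 (F k) (Ft k) (Fx k) (Fxx k)) ->
  hasC12 (fun p => \sum_(k <- r) F k p) (fun p => \sum_(k <- r) Ft k p)
    (fun i p => \sum_(k <- r) Fx k i p) (fun i j p => \sum_(k <- r) Fxx k i j p).
Proof.
move=> h; elim: r => [|k r IH].
  by apply: (hasC12_ext (hasC12_cst 0)) => [p|p|i p|i j p]; rewrite big_nil.
by apply: (hasC12_ext (hasC12D (h k) IH)) => [p|p|i p|i j p]; rewrite big_cons.
Qed.

Lemma hasC12_shift (z : E) f ft fx fxx : hasC12 f ft fx fxx ->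
  hasC12 (fun p => f (p + z)) (fun p => ft (p + z)) (fun i p => fx i (p + z))
    (fun i j p => fxx i j (p + z)).
Proof.
case=> cf [f1 f2] [f3 f4] [f5 f6].
by split; [|split|split|split] => *; try exact: continuous_shift; exact: is_derive_shift.
Qed.

Lemma hasC12_ln f ft fx fxx : (forall p, 0 < f p) -> hasC12 f ft fx fxx ->
  hasC12 (fun p => ln (f p)) (fun p => (f p)^-1 * ft p) (fun i p => (f p)^-1 * fx i p)
    (fun i j p => (f p)^-1 * fxx i j p - ((f p)^-1 * fx i p) * ((f p)^-1 * fx j p)).
Proof.
move=> f0; have fn0 p : f p != 0 by rewrite gt_eqF.
have m := @continuous_mul R E.
case=> cf [f1 f2] [f3 f4] [f5 f6].
have civ : continuous (fun p => (f p)^-1).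
  by move=> p; apply: cvgV => //; exact: cf.
have dl v l p : is_derive p v f l -> is_derive p v (fun q => ln (f q)) ((f p)^-1 * l).
  by move=> df; apply: is_derive_postcomp => //; exact: is_derive1_ln.
split; [|split|split|split].
- move=> p; apply: (@continuous_comp _ _ _ f (@ln R)); first exact: cf.
  exact: continuous_ln.
- by move=> p; exact: dl.
- exact: m.
- by move=> i p; exact: dl.
- by move=> i; exact: m.
- move=> i j p.
  have hV : is_derive p (dir_x i) (fun q => (f q)^-1) (- (f p) ^- 2 * fx i p).
    apply: (@is_derive_postcomp _ _ (fun x : R => x^-1)).
    by have := is_deriveV (fn0 p) (is_derive_id (f p) 1); rewrite [_ *: 1]mulr1.
  have hM := is_deriveM hV (f5 i j p).
  apply: (is_derive_val hM).
  rewrite [X in X + _](_ : _ = (f p)^-1 * fxx i j p) //.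
  rewrite [X in _ + X](_ : _ = fx j p * (- (f p) ^- 2 * fx i p)) //.
  by rewrite expr2 invfM; ring.
- by move=> i j p; apply: cvgB; [exact: m|apply: (m); exact: m].
Qed.

Lemma norm_dir_t : `|dir_t| = 1.
Proof. by rewrite /dir_t prod_normE /= normr0 normr1 max_l ?ler01. Qed.

Lemma space_dir_sum (v : 'cV[R]_d) : (0, v) = \sum_i v i 0 *: dir_x i :> E.
Proof.
rewrite [in LHS](cV_basis_sum v); apply: (big_rec2 (fun y x => (0, y) = x :> E)) => //.
by move=> i y1 y2 _ <-; congr pair => /=; rewrite scaler0 add0r.
Qed.

Lemma hasC12_strict f ft fx fxx (tau : R) (v : 'cV[R]_d) p : hasC12 f ft fx fxx ->
  strict_deriv f (tau, v) p (tau * ft p + \sum_i v i 0 * fx i p).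
Proof.
case=> cf [f1 f2] [f3 f4] _.
have -> : (tau, v) = tau *: dir_t + \sum_i v i 0 *: dir_x i :> E.
  by rewrite -space_dir_sum; congr pair => /=; rewrite ?scaler0 ?addr0 ?add0r // [_ *: 1]mulr1.
apply: strict_derivD.
  by apply: strict_derivZ; apply: strict_deriv_partial => //; exact: f2.
by apply: strict_deriv_sum => i; apply: strict_deriv_partial => //; exact: f4.
Qed.

Lemma hasC12_strict2 f ft fx fxx (v : 'cV[R]_d) p j : hasC12 f ft fx fxx ->
  strict_deriv (fx j) (0, v) p (\sum_i v i 0 * fxx i j p).
Proof.
case=> cf _ _ [f5 f6]; rewrite space_dir_sum.
by apply: strict_deriv_sum => i; apply: strict_deriv_partial => //; exact: f6.
Qed.

End C12.
Section taylor.
Context {R : realType} {d : nat}.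
Local Notation E := (R * 'cV[R]_d)%type.
Implicit Types (f ft : E -> R) (fx : 'I_d -> E -> R) (fxx : 'I_d -> 'I_d -> E -> R).

Definition hess (fxx : 'I_d -> 'I_d -> E -> R) (p : E) : 'M[R]_d := \matrix_(i, j) fxx i j p.

Lemma quad_hess fxx p (v : 'cV[R]_d) :
  quad (hess fxx p) v = \sum_j v j 0 * \sum_i v i 0 * fxx i j p.
Proof.
rewrite quadE exchange_big; apply: eq_bigr => j _; rewrite mulr_sumr; apply: eq_bigr => i _.
by rewrite mxE; ring.
Qed.

Lemma is_derive_sum_scale (V : normedModType R) (I : Type) (r : seq I) (F : I -> V -> R)
    (c : I -> R) (l : I -> R) p v :
  (forall i, is_derive p v (F i) (l i)) ->
  is_derive p v (fun q => \sum_(i <- r) c i * F i q) (\sum_(i <- r) c i * l i).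
Proof.
move=> h; elim: r => [|i r IH].
  rewrite big_nil; apply: (is_derive_f (is_derive_const 0 p v)) => q.
  by rewrite big_nil.
rewrite big_cons.
apply: (is_derive_f (is_deriveD (is_deriveZ (c i) (h i)) IH)) => q.
by rewrite big_cons.
Qed.

Lemma hasC12_derive_line f ft fx fxx v p : hasC12 f ft fx fxx ->
  is_derive p (0, v) f (\sum_i v i 0 * fx i p).
Proof.
by move=> h; have := strict_deriv_is_derive (hasC12_strict 0 v p h); rewrite mul0r add0r.
Qed.

Lemma hasC12_derive_line2 f ft fx fxx (v : 'cV[R]_d) (p : E) : hasC12 f ft fx fxx ->
  is_derive p (0, v) (fun q => \sum_j v j 0 * fx j q) (quad (hess fxx p) v).
Proof.
move=> h; rewrite quad_hess; apply: is_derive_sum_scale => j.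
exact: strict_deriv_is_derive (hasC12_strict2 v p j h).
Qed.

(** The symmetric difference cancels first-order terms: one mean value theorem expresses it by [D1]
    at two opposite points, a second one by the Hessian at a single point between them. Only the
    oscillation of the Hessian along the segment enters. *)
Lemma taylor2 f ft fx fxx (p : E) (v : 'cV[R]_d) (Q eta : R) : hasC12 f ft fx fxx ->
  (forall s, `|s| <= 1 -> `|quad (hess fxx (p + s *: (0, v))) v - Q| <= eta) ->
  `|f (p + (0, v)) + f (p - (0, v)) - 2 * f p - Q| <= 2 * eta.
Proof.
move=> hf hQ; set w : E := (0, v).
pose D1 q := \sum_i v i 0 * fx i q.
have d1 q : is_derive q w f (D1 q) by exact: hasC12_derive_line hf.
have d2 q : is_derive q w D1 (quad (hess fxx q) v) by exact: hasC12_derive_line2 hf.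
pose g (s : R) := f (p + s *: w) + f (p + s *: (- w)) - Q * (s * s).
have dg (s : R) : is_derive s (1 : R) g (D1 (p + s *: w) + - D1 (p + s *: (- w)) - Q * (s * 1 + s * 1)).
  apply: is_deriveB.
    apply: is_deriveD; first exact: is_derive_line.
    apply: is_derive_line.
    by have := is_derive_scale (- 1) (d1 (p + s *: (- w))); rewrite scaleN1r mulN1r.
have [c /andP[c0 c1]] := mean_value_line 0 dg.
rewrite add0r [c *: (1 : R)]mulr1 add0r {1 2}/g !scale1r !scale0r !addr0 !mulr1 mulr0.
have [e /andP[e0 e1]] := mean_value_line (p + c *: (- w))
  (fun q => is_derive_scale (2 * c) (d2 q)).
have -> : p + c *: (- w) + (2 * c) *: w = p + c *: w.
  by rewrite -addrA scalerN -scaleNr -scalerDl; congr (_ + _ *: _); ring.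
have -> : p + c *: (- w) + e *: ((2 * c) *: w) = p + (e * (2 * c) - c) *: w.
  by rewrite -addrA scalerN -scaleNr scalerA -scalerDl; congr (_ + _ *: _); ring.
move=> E1 E2.
have -> : f (p + w) + f (p - w) - 2 * f p - Q = 2 * c *
    (quad (hess fxx (p + (e * (2 * c) - c) *: w)) v - Q).
  rewrite mulrBr -E1.
  have -> : f (p + w) + f (p - w) - 2 * f p - Q =
    f (p + w) + f (p - w) - Q - (f p + f p - Q * 0) by ring.
  by rewrite E2; ring.
rewrite normrM ger0_norm ?mulr_ge0 // -mulrA ler_pM2l //.
apply: (@le_trans _ _ (c * eta)).
  rewrite ler_wpM2l // hQ // ler_norml.
  have := ler_wpM2r c0 e1; have := mulr_ge0 e0 c0; move=> *; apply/andP; split; lra.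
rewrite ler_piMl //; apply: le_trans (hQ 0 _); rewrite ?normr0 //.
Qed.

End taylor.

(** * Comparison with smooth functions *)

Section compact_slab.
Context {R : realType} {d : nat}.
Local Notation E := (R * 'cV[R]_d)%type.

Definition slab (a b r : R) : set E := [set p : E | a <= p.1 <= b /\ forall i, `|p.2 i 0| <= r].

Lemma compact_box (r : R) : compact [set x : 'cV[R]_d | forall i, `|x i 0| <= r].
Proof.
have cT : continuous (fun v : 'rV[R]_d => v^T : 'cV[R]_d).
  move=> v; apply/continuous_dist => e e0; exists e => // w wv.
  rewrite -linearB /= [leLHS]/Num.norm /= mx_normrE; apply: bigmax_le => [|[i j] _ /=].
    exact: ltW.
  rewrite mxE; apply: le_trans (ltW wv).
  exact: mx_norm_coord.
have := @rV_compact R d (fun=> `[- r, r]%classic) (fun=> @segment_compact _ _ _).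
move=> /(continuous_compact (continuous_subspaceT cT)).
congr compact; apply/seteqP; split=> [_ [v h <-] i|x h].
  by rewrite mxE ler_norml; have := h i; rewrite /= in_itv.
exists x^T; last by rewrite trmxK.
by move=> i; rewrite mxE /= in_itv /= -ler_norml.
Qed.

Lemma compact_slab a b r : compact (slab a b r).
Proof.
rewrite (_ : slab a b r = `[a, b] `*` [set x : 'cV[R]_d | forall i, `|x i 0| <= r]).
  by apply: compact_setX; [exact: segment_compact|exact: compact_box].
by apply/seteqP; split=> -[t x] /=; rewrite /slab /= in_itv.
Qed.

End compact_slab.

Section comparison_smooth.
Context {R : realType} {d : nat} (Gamma : set 'M[R]_d) (lG UG : R) (ellG : elliptic Gamma lG UG).
Local Notation G := (Gfun Gamma).
Local Notation E := (R * 'cV[R]_d)%type.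
Implicit Types (u v f ft : E -> R) (fx : 'I_d -> E -> R) (fxx : 'I_d -> 'I_d -> E -> R).

(** The summand [d%:R * UG ^+ 2] balances [G] of the Hessian of the squared norm, and the extra [1]
    makes [k * penalty] a strict supersolution; strictness is what contradicts a touching point. *)
Definition Kpen : R := d%:R * UG ^+ 2 + 1.

Definition penalty (b : R) (p : E) : R := 1 + enorm p.2 ^+ 2 + Kpen * (b - p.1).

Lemma Kpen_ge0 : 0 <= Kpen.
Proof. by rewrite addr_ge0 // mulr_ge0 ?sqr_ge0. Qed.

Lemma penalty_ge b p : p.1 <= b -> 1 + enorm p.2 ^+ 2 <= penalty b p.
Proof. by move=> pb; rewrite lerDl mulr_ge0 ?Kpen_ge0 // subr_ge0. Qed.

Lemma hasC12_sqnorm : hasC12 (fun p : E => enorm p.2 ^+ 2) (fun=> 0)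
  (fun i p => 2 * p.2 i 0) (fun i j _ => 2 * (i == j)%:R).
Proof.
have h k := hasC12M (@hasC12_coord R d k) (hasC12_coord k).
apply: (hasC12_ext (hasC12_sum (index_enum 'I_d) h)) => [p|p|i p|i j p].
- by rewrite enorm_cV; apply: eq_bigr => k _; rewrite expr2.
- by rewrite big1 // => k _; rewrite mulr0 addr0.
- rewrite (bigD1 i) //= big1 => [|k ki]; first by rewrite eqxx mulr1; ring.
  by rewrite eq_sym (negbTE ki) mulr0 addr0.
- rewrite (bigD1 i) //= big1 => [|k ki]; first by rewrite eqxx (eq_sym j) !mulr1; ring.
  by rewrite (eq_sym i) (negbTE ki) /=; ring.
Qed.

Lemma hasC12_penalty b : hasC12 (penalty b) (fun=> - Kpen) (fun i p => 2 * p.2 i 0)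
  (fun i j _ => 2 * (i == j)%:R).
Proof.
have h := hasC12D (hasC12D (@hasC12_cst R d 1) hasC12_sqnorm)
  (hasC12Z Kpen (hasC12D (hasC12_cst b) (hasC12Z (- 1) (@hasC12_fst R d)))).
apply: (hasC12_ext h) => [p|p|i p|i j p]; rewrite /penalty; ring.
Qed.

Lemma hess_penalty fxx k p :
  hess (fun i j q => fxx i j q + k * (2 * (i == j)%:R)) p = hess fxx p + (k * 2)%:M.
Proof. by apply/matrixP => i j; rewrite !mxE mulrA mulr_natr. Qed.

Lemma penalized_max a b (w : E -> R) (k D : R) p0 : 0 < k ->
  {within [set p : E | a <= p.1 <= b], continuous w} ->
  (forall p : E, a <= p.1 <= b -> w p <= D - k * penalty b p) ->
  (forall x, w (b, x) <= 0) -> a <= p0.1 <= b -> 0 < w p0 ->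
  exists2 q : E, a <= q.1 < b & local_max_on (strip a b) w q.
Proof.
(* Beyond radius [r] the penalty exceeds [|D| / k], so that [w] is negative there. The term [1]
   gives [r <= r ^+ 2], and [enorm p0.2] puts [p0] into the slab. *)
move=> k0 cw wD wb p0ab lt0; pose r := 1 + `|D| / k + enorm p0.2.
have out p : a <= p.1 <= b -> ~ slab a b r p -> w p < 0.
  move=> pab np; apply: le_lt_trans (wD _ pab) _; rewrite subr_lt0.
  have [i ri] : exists i, r < `|p.2 i 0|.
    by apply: contra_notP np => h; split => // i; rewrite leNgt; apply/negP => ?; apply: h; exists i.
  have rp : r < enorm p.2 by apply: lt_le_trans ri (enorm_coord _ _ _).
  have r1 : 1 <= r by rewrite /r -addrA lerDl addr_ge0 ?enorm_ge0 // divr_ge0 // ltW.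
  have /penalty_ge pen : p.1 <= b by case/andP: pab.
  have rr : r <= r ^+ 2 by rewrite expr2 ler_peMr // (le_trans ler01).
  have rp2 : r ^+ 2 < enorm p.2 ^+ 2 by rewrite ltr_pXn2r ?nnegrE ?enorm_ge0 // (le_trans ler01).
  have e0 : `|D| / k < r by rewrite /r addrAC ltrDr ltr_pwDl ?enorm_ge0.
  apply: le_lt_trans (ler_norm D) _; move: e0; rewrite ltr_pdivrMr // => e0.
  by apply: lt_trans e0 _; rewrite mulrC ltr_pM2l //; lra.
have s0 : slab a b r p0.
  split => // i; apply: le_trans (enorm_coord _ _ _) _.
  by rewrite /r lerDr addr_ge0 // divr_ge0 // ltW.
have cws : {within slab a b r, continuous w}.
  by apply: (@continuous_subspaceW _ _ _ [set p : E | a <= p.1 <= b]); first by move=> p [].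
have [q qs qmax] := compact_EVT_max (ex_intro _ p0 s0) (@compact_slab _ _ a b r) cws.
have qab : a <= q.1 <= b by move: qs; rewrite inE => -[].
have q0 : 0 < w q by apply: lt_le_trans lt0 (qmax p0 _); rewrite inE.
have qb : q.1 < b.
  rewrite lt_neqAle; case/andP: qab => _ ->; rewrite andbT; apply/eqP => qb.
  by have := wb q.2; rewrite -qb -surjective_pairing leNgt q0.
have qab' : a <= q.1 < b by rewrite qb andbT; case/andP: qab.
exists q => //; split=> //.
rewrite near_withinE; apply: nearW => p /andP[pa pb]; have pab : a <= p.1 <= b by rewrite pa ltW.
have [ps|ps] := pselect (slab a b r p); first by apply: qmax; rewrite inE.
by apply: ltW; apply: lt_trans q0; exact: out.
Qed.

Let G_scalar k : 0 < k -> G (k * 2)%:M <= k * (d%:R * UG ^+ 2).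
Proof.
move=> k0; apply: le_trans (Gfun_scalar_le ellG _) _; first by rewrite mulr_ge0 // ltW.
by apply: le_of_eq; field.
Qed.

(** A positive value of [u - f - k * penalty] would produce a maximum before time [b], at which the
    strict supersolution [f + k * penalty] tests [u]. The terminal inequality leaves room
    [k * (1 + enorm x ^+ 2)], since smooth approximations of a supersolution match the data only on
    bounded sets. *)
Lemma comparison_super_penalized a b (u f ft : E -> R) fx fxx (k M C : R) : 0 < k ->
  {within [set p : E | a <= p.1 <= b], continuous u} ->
  (forall p : E, a <= p.1 <= b -> u p <= M) ->
  visc_subsolution G a b u ->
  hasC12 f ft fx fxx ->
  (forall p : E, a <= p.1 < b -> ft p + G (hess fxx p) <= 0) ->
  (forall p : E, a <= p.1 <= b -> C <= f p) ->
  (forall x, u (b, x) <= f (b, x) + k * (1 + enorm x ^+ 2)) ->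
  forall p : E, a <= p.1 <= b -> u p <= f p + k * penalty b p.
Proof.
move=> k0 cu uM su hf supf fC ufb p0 p0ab; rewrite leNgt; apply/negP => lt0.
have hF := hasC12D hf (hasC12Z k (hasC12_penalty b)).
set F := (fun p => f p + k * penalty b p) in hF.
have [|p pab|x||q qab lmax] := @penalized_max a b (u \- F) k (M - C) p0 k0 _ _ _ p0ab.
- move=> p; apply: cvgB; first exact: cu.
  by apply: (continuous_subspaceT (f := F)); case: hF.
- by rewrite /= /F; have := uM _ pab; have := fC _ pab; lra.
- by have := ufb x; rewrite /= /F /penalty subrr mulr0 addr0; lra.
- by rewrite /= subr_gt0.
have := su F q (hasC12_C12 hF) lmax.
rewrite (hasC12_time_deriv hF) (hasC12_hessian q hF).
rewrite -[X in G X]/(hess (fun i j q => fxx i j q + k * (2 * (i == j)%:R)) q) hess_penalty.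
rewrite leNgt => /negP; apply.
have := supf q qab; have := Gfun_add ellG (hess fxx q) (k * 2)%:M; have := G_scalar k0.
have -> : k * - Kpen = - k * (d%:R * UG ^+ 2) - k by rewrite /Kpen; ring.
lra.
Qed.

(** A subsolution for one matrix [g] suffices, because [G] dominates the linear operator with
    covariance [g]. Such subsolutions are built from random walks with fixed jump directions. *)
Lemma comparison_sub_penalized a b (v f ft : E -> R) fx fxx (g : 'M[R]_d) (k M C : R) :
  0 < k -> Gamma g ->
  {within [set p : E | a <= p.1 <= b], continuous v} ->
  (forall p : E, a <= p.1 <= b -> M <= v p) ->
  visc_supersolution G a b v ->
  hasC12 f ft fx fxx ->
  (forall p : E, a <= p.1 < b -> 0 <= ft p + 2^-1 * \tr (hess fxx p *m g)) ->
  (forall p : E, a <= p.1 <= b -> f p <= C) ->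
  (forall x, f (b, x) <= v (b, x)) ->
  forall p : E, a <= p.1 <= b -> f p <= v p + k * penalty b p.
Proof.
move=> k0 Gg cv vM sv hf subf fC fvb p0 p0ab; rewrite leNgt; apply/negP => lt0.
have hF := hasC12D hf (hasC12Z (- k) (hasC12_penalty b)).
set F := (fun p => f p + - k * penalty b p) in hF.
have [|p pab|x||q qab lmax] := @penalized_max a b (F \- v) k (C - M) p0 k0 _ _ _ p0ab.
- move=> p; apply: cvgB; last exact: cv.
  by apply: (continuous_subspaceT (f := F)); case: hF.
- by rewrite /= /F; have := vM _ pab; have := fC _ pab; lra.
- rewrite /= /F /penalty subrr mulr0 addr0; have := fvb x.
  have : 0 <= k * (1 + enorm x ^+ 2) by rewrite mulr_ge0 ?addr_ge0 ?sqr_ge0 // ltW.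
  lra.
- by rewrite /= /F; lra.
have := sv F q (hasC12_C12 hF) lmax.
rewrite (hasC12_time_deriv hF) (hasC12_hessian q hF).
rewrite -[X in G X]/(hess (fun i j q => fxx i j q + - k * (2 * (i == j)%:R)) q) hess_penalty.
rewrite leNgt => /negP; apply.
have := subf q qab; have := Gfun_ge ellG (hess fxx q + (- k * 2)%:M) Gg.
have := Gfun_ge ellG (k * 2)%:M Gg; have := G_scalar k0.
rewrite mulmxDl linearD /= !mul_scalar_mx !linearZ /=.
have -> : - k * - Kpen = k * (d%:R * UG ^+ 2) + k by rewrite /Kpen; ring.
lra.
Qed.

End comparison_smooth.
(** * Box averages *)

Lemma segment_uniform {R : realType} {W : normedModType R} (w0 : W) (P : W -> R -> Prop) :
  (forall r0, 0 <= r0 <= 1 -> exists2 h : R, 0 < h &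
     forall w r, `|w - w0| < h -> `|r - r0| < h -> P w r) ->
  exists2 h : R, 0 < h & forall w, `|w - w0| < h -> forall r, 0 <= r <= 1 -> P w r.
Proof.
move=> H.
have N : \forall w \near nbhs w0, `[(0 : R), 1]%classic `<=` P w.
  apply: ((compact_near_coveringP _).1 (@segment_compact _ _ _) W (nbhs w0) P _) => r0.
  rewrite /= in_itv /= => /H [h h0 Hh].
  exists ([set r | `|r - r0| < h], [set w | `|w - w0| < h]) => /=.
    by split; apply/nbhs_dist; exists h.
  by move=> [r w] /= [rh wh]; exact: Hh.
have /nbhs_dist[h h0 Hh] := N.
by exists h => // w /Hh /= K r r01; apply: K; rewrite /= in_itv.
Qed.

Section avg.
Context {R : realType} {V : normedModType R}.
Implicit Types (f g D : V -> R) (e p q v w : V) (es : seq V).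

(** Averages over a segment replace convolution with a kernel: the derivative along [e] is the
    difference of the end values, so each repetition of a direction gains one derivative, and
    inequalities between functions are preserved. *)
Definition avg e f p : R := \int[lebesgue_measure]_(r in `[(0 : R), 1]) f (p + r *: e).

Lemma continuous_line f p e : continuous f -> continuous (fun r : R => f (p + r *: e)).
Proof.
move=> cf r; apply: (@continuous_comp _ _ _ (fun r : R => p + r *: e) f); last exact: cf.
by apply: cvgD; [exact: cvg_cst|apply: cvgZ; [exact: cvg_id|exact: cvg_cst]].
Qed.

Lemma integrable_line (h : R -> R) : continuous h ->
  lebesgue_measure.-integrable `[(0 : R), 1] (EFin \o h).
Proof.
move=> ch; apply: continuous_compact_integrable; first exact: segment_compact.
exact: continuous_subspaceT.
Qed.

Lemma lebesgue_unit : fine (@lebesgue_measure R `[(0 : R), 1]%classic) = 1.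
Proof. by rewrite lebesgue_measure_itv /= lte_fin ltr01 oppr0 adde0. Qed.

Lemma le_avg e f g p : continuous f -> continuous g ->
  (forall r, 0 <= r <= 1 -> f (p + r *: e) <= g (p + r *: e)) -> avg e f p <= avg e g p.
Proof.
move=> cf cg h; apply: le_Rintegral => //.
- by apply: integrable_line; exact: continuous_line.
- by apply: integrable_line; exact: continuous_line.
Qed.

Lemma avg_cst e c p : avg e (fun=> c) p = c.
Proof. by rewrite /avg Rintegral_cst // lebesgue_unit mulr1. Qed.

Lemma avgD e f g p : continuous f -> continuous g ->
  avg e (fun q => f q + g q) p = avg e f p + avg e g p.
Proof.
move=> cf cg; rewrite /avg RintegralD //.
- by apply: integrable_line; exact: continuous_line.
- by apply: integrable_line; exact: continuous_line.
Qed.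

Lemma avgZ e c f p : continuous f -> avg e (fun q => c * f q) p = c * avg e f p.
Proof.
by move=> cf; rewrite /avg RintegralZl //; apply: integrable_line; exact: continuous_line.
Qed.

Lemma avg_shift e f z p : avg e (fun q => f (q + z)) p = avg e f (p + z).
Proof. by rewrite /avg; apply: eq_Rintegral => r _; rewrite addrAC. Qed.

Lemma avg_dist e f g p c : continuous f -> continuous g ->
  (forall r, 0 <= r <= 1 -> `|f (p + r *: e) - g (p + r *: e)| <= c) ->
  `|avg e f p - avg e g p| <= c.
Proof.
move=> cf cg h.
have cc (k : R) : continuous (fun _ : V => k) := @cst_continuous _ _ k.
have cD := @continuous_add R V.
have h1 : avg e f p <= avg e (fun q => g q + c) p.
  apply: le_avg => // [|r /h]; first exact: cD.
  by rewrite ler_norml => /andP[_]; rewrite lerBlDl.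
have h2 : avg e g p <= avg e (fun q => f q + c) p.
  apply: le_avg => // [|r /h]; first exact: cD.
  rewrite ler_norml => /andP[+ _]; lra.
move: h1 h2; rewrite !avgD // avg_cst => h1 h2.
by rewrite ler_norml; apply/andP; split; lra.
Qed.

Lemma continuous_avg e f : continuous f -> continuous (avg e f).
Proof.
move=> cf p; apply/continuous_dist => eps eps0.
have [r0 r01|h h0 H] := @segment_uniform _ _ p
    (fun q r => `|f (q + r *: e) - f (p + r *: e)| <= eps).
  have /continuous_dist/(_ (eps / 2))[|h h0 H] := cf (p + r0 *: e); first by rewrite divr_gt0.
  have e0 : 0 < `|e| + 1 by rewrite ltr_wpDl.
  exists (Num.min (h / 2) (h / 2 / (`|e| + 1))); first by rewrite lt_min !divr_gt0.
  move=> q r; rewrite !lt_min => /andP[qh _] /andP[_]; rewrite ltr_pdivlMr // => rh.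
  have rh' : `|r - r0| * `|e| < h / 2 by apply: le_lt_trans rh; rewrite ler_wpM2l // lerDl.
  have -> : f (q + r *: e) - f (p + r *: e) = (f (q + r *: e) - f (p + r0 *: e))
    - (f (p + r *: e) - f (p + r0 *: e)) by ring.
  rewrite (splitr eps).
  apply: le_trans (ler_normB _ _) _; apply: lerD; apply: H.
    rewrite opprD addrACA -scalerBl; apply: le_lt_trans (ler_normD _ _) _.
    by rewrite [ltRHS](splitr h) ltrD // normrZ.
  rewrite opprD addrACA subrr add0r -scalerBl normrZ; apply: lt_trans rh' _.
  by rewrite gtr_pMr // invf_lt1 // ltr1n.
exists h => // q qp; have := @avg_dist e (fun z => f (z + (q - p))) f p eps.
rewrite avg_shift (addrC p) subrK; apply => // [z|r r01]; first exact: continuous_shift.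
by rewrite (_ : p + r *: e + (q - p) = q + r *: e) ?H // addrC addrA subrK.
Qed.

(** Difference quotients converge uniformly along the segment, by strictness of the derivative and
    compactness; hence the derivative passes under the integral. *)
Lemma avg_derive_under e f D v : continuous D -> (forall q, is_derive q v f (D q)) ->
  continuous f -> forall p, is_derive p v (avg e f) (avg e D p).
Proof.
move=> cD df cf p; apply/is_derive_dist => eps eps0.
have [r0 r01|h h0 H] := @segment_uniform _ R 0 (fun s r =>
    `|f (p + r *: e + s *: v) - f (p + r *: e) - s * D (p + r *: e)| <= eps * `|s|).
  have eps2 : 0 < eps / 2 by rewrite divr_gt0.
  have [h h0 H] := strict_deriv_partial df (cD (p + r0 *: e)) eps2.
  have /continuous_dist/(_ _ eps2)[k k0 K] := cD (p + r0 *: e).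
  have e0 : 0 < `|e| + 1 by rewrite ltr_wpDl.
  exists (Num.min h (Num.min (h / (`|e| + 1)) (k / (`|e| + 1)))).
    by rewrite !lt_min h0 !divr_gt0.
  move=> s r; rewrite subr0 !lt_min => /and3P[sh _ _] /and3P[_ rh rk].
  have near x : `|r - r0| < x / (`|e| + 1) -> `|p + r *: e - (p + r0 *: e)| < x.
    rewrite ltr_pdivlMr // => rx.
    rewrite opprD addrACA subrr add0r -scalerBl normrZ; apply: le_lt_trans rx.
    by rewrite ler_wpM2l // lerDl.
  have := H _ _ (near _ rh) sh; have := K _ (near _ rk).
  set a := f _ - f _; set x := D _; set y := D _ => hxy hs.
  have -> : a - s * x = (a - s * y) - s * (x - y) by ring.
  apply: le_trans (ler_normB _ _) _; rewrite (splitr eps) mulrDl lerD // normrM mulrC.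
  by rewrite ler_wpM2r.
exists h => // s sh.
have cs := continuous_shift (s *: v) cf; have csD := continuous_scale s cD.
have cfD := continuous_add cf csD.
rewrite -avg_shift -addrA -opprD -avgZ // -avgD //.
apply: avg_dist => // r r01; rewrite opprD addrA; apply: H => //; by rewrite subr0.
Qed.

(** The window contains all [s + r] with [|s| < 1] and [-1 < r < 2], where [avg_derive_dir]
    differentiates. *)
Lemma antiderivative (h : R -> R) : continuous h ->
  exists H : R -> R, forall x : R, -3 < x < 4 -> is_derive x (1 : R) H (h x).
Proof.
move=> ch; exists (fun x => \int[lebesgue_measure]_(t in `[(-3 : R), x]) h t) => x /andP[x3 x4].
have ih : lebesgue_measure.-integrable `[(-3 : R), 4] (EFin \o h).
  apply: continuous_compact_integrable; first exact: segment_compact.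
  exact: continuous_subspaceT.
have [|dH eH] := @continuous_FTC1 R h (BLeft (-3)) x 4 x4 ih _ (ch x).
  by rewrite /= lte_fin.
split; first exact: dH.
by rewrite -derive1E; exact: eH.
Qed.

Lemma avg_derive_dir e f p : continuous f -> is_derive p e (avg e f) (f (p + e) - f p).
Proof.
move=> cf; pose h (r : R) := f (p + r *: e).
have ch : continuous h by exact: continuous_line.
have [H dH] := antiderivative ch.
have key s : `|s| < 1 -> avg e f (p + s *: e) = H (s + 1) - H s.
  rewrite ltr_norml => /andP[s1 s2].
  have dF (r : R) : -1 < r < 2 -> is_derive r (1 : R) (fun r => H (s + 1 * r)) (h (s + r)).
    move=> /andP[r1 r2].
    have hd : is_derive (s + r *: (1 : R)) (1 : R) H (h (s + r)).
      by rewrite [_ *: _]mulr1; apply: dH; apply/andP; split; lra.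
    apply: (is_derive_f (is_derive_line hd)) => q.
    by rewrite [_ *: _]mulr1 mul1r.
  have cs : {within `[(0 : R), 1], continuous (fun r => h (s + r))}.
    apply: continuous_subspaceT => r.
    by under eq_fun do rewrite addrC; exact: continuous_shift.
  have cF (r : R) : -1 < r < 2 -> {for r, continuous (fun r : R => H (s + 1 * r))}.
    by move=> /dF [df _]; apply/differentiable_continuous/derivable1_diffP.
  have := @continuous_FTC2 R (fun r => h (s + r)) (fun r => H (s + 1 * r)) 0 1 ltr01 cs _ _.
  rewrite mulr1 mulr0 addr0 => E.
  rewrite /avg /Rintegral.
  under eq_integral do rewrite -addrA -scalerDl -/(h _).
  rewrite E //.
  - split.
    + by move=> r; rewrite in_itv /= => /andP[r1 r2]; have [] := dF r; rewrite ?r1 //; lra.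
    + by apply: cvg_at_right_filter; apply: cF; lra.
    + by apply: cvg_at_left_filter; apply: cF; lra.
  - move=> r; rewrite in_itv /= => /andP[r1 r2].
    by rewrite derive1E; have [_ ->] : is_derive r (1 : R) (fun r => H (s + 1 * r)) (h (s + r)) by apply: dF; lra.
have d0 : is_derive (0 : R) (1 : R) (fun s => H (s + 1) - H s) (h 1 - h 0).
  have d1 : is_derive (0 : R) (1 : R) H (h 0) by apply: dH; lra.
  have d2 : is_derive (0 + 1 : R) (1 : R) H (h 1) by rewrite add0r; apply: dH; lra.
  by have := is_derive_shift d2 => {}d2; apply: is_deriveB.
move: d0 => /is_derive_dist d0; apply/is_derive_dist => eps /d0 [k k0 K].
exists (Num.min k 1) => [|s]; first by rewrite lt_min k0 ltr01.
rewrite lt_min => /andP[sk s1].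
have := K s sk; rewrite [s *: (1 : R)]mulr1 add0r -key //.
have e0 := key 0; rewrite scale0r addr0 normr0 add0r in e0.
by rewrite add0r -e0 // /h scale1r scale0r addr0.
Qed.

Definition avgs es f : V -> R := foldr avg f es.

Definition fdiff e f : V -> R := fun q => f (q + e) - f q.

Lemma continuous_fdiff e f : continuous f -> continuous (fdiff e f).
Proof.
by move=> cf q; apply: cvgB; [exact: continuous_shift|exact: cf].
Qed.

Lemma continuous_avgs es f : continuous f -> continuous (avgs es f).
Proof. by move=> cf; elim: es => //= e es; exact: continuous_avg. Qed.

Lemma avgs_shift es f z p : avgs es (fun q => f (q + z)) p = avgs es f (p + z).
Proof.
elim: es p => //= e es IH p; rewrite -avg_shift; congr avg; apply/funext => q.
exact: IH.
Qed.

Lemma avgsD es f g p : continuous f -> continuous g ->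
  avgs es (fun q => f q + g q) p = avgs es f p + avgs es g p.
Proof.
move=> cf cg; elim: es p => //= e es IH p.
by rewrite -avgD; [congr avg; apply/funext => q; exact: IH|exact: continuous_avgs..].
Qed.

Lemma avgsZ es c f p : continuous f -> avgs es (fun q => c * f q) p = c * avgs es f p.
Proof.
move=> cf; elim: es p => //= e es IH p.
by rewrite -avgZ; [congr avg; apply/funext => q; exact: IH|exact: continuous_avgs].
Qed.

Lemma avgs_cst es c p : avgs es (fun=> c) p = c.
Proof.
elim: es p => //= e es IH p; rewrite -[RHS](avg_cst e c p).
by congr avg; apply/funext => q; exact: IH.
Qed.

Lemma avgs_sum (I : Type) (r : seq I) es (F : I -> V -> R) p : (forall i, continuous (F i)) ->
  avgs es (fun q => \sum_(i <- r) F i q) p = \sum_(i <- r) avgs es (F i) p.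
Proof.
move=> cF; elim: r => [|i r IH].
  by under eq_fun do rewrite big_nil; rewrite avgs_cst big_nil.
under eq_fun do rewrite big_cons.
by rewrite avgsD ?IH ?big_cons //; exact: continuous_sum.
Qed.

Lemma avgs_fdiff e es f p : continuous f ->
  avgs es (fdiff e f) p = avgs es f (p + e) - avgs es f p.
Proof.
move=> cf; rewrite /fdiff.
have cs := continuous_shift e cf; have cn := continuous_scale (-1) cf.
rewrite -avgs_shift -mulN1r -avgsZ // -avgsD //.
by congr avgs; apply/funext => q; rewrite mulN1r.
Qed.

Lemma avgs_derive e es f : continuous f -> e \in es ->
  forall p, is_derive p e (avgs es f) (avgs (rem e es) (fdiff e f) p).
Proof.
move=> cf; elim: es => //= e' es IH; rewrite inE.
have [-> _ p|ne /= ein p] := eqVneq e' e.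
  by rewrite avgs_fdiff //; apply: avg_derive_dir; exact: continuous_avgs.
apply: avg_derive_under; last exact: continuous_avgs.
  by apply: continuous_avgs; exact: continuous_fdiff.
exact: IH.
Qed.

Definition spread es : R := \sum_(e <- es) `|e|.

Lemma le_avgs es f g p : continuous f -> continuous g ->
  (forall q, `|q - p| <= spread es -> f q <= g q) -> avgs es f p <= avgs es g p.
Proof.
move=> cf cg; elim: es p => [p h|e es IH p h] /=.
  by apply: h; rewrite subrr normr0 /spread big_nil.
apply: le_avg; [exact: continuous_avgs..|move=> r /andP[r0 r1]].
apply: IH => q hq; apply: h.
have -> : q - p = (q - (p + r *: e)) + r *: e by rewrite opprD addrA subrK.
apply: le_trans (ler_normD _ _) _; rewrite /spread big_cons addrC lerD //.
by rewrite normrZ ger0_norm // ler_piMl.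
Qed.

Lemma avgs_dist es f p c eta : continuous f ->
  (forall q, `|q - p| <= spread es -> `|f q - c| <= eta) -> `|avgs es f p - c| <= eta.
Proof.
move=> cf h; have cc (k : R) : continuous (fun _ : V => k) := @cst_continuous _ _ k.
have h1 : avgs es f p <= avgs es (fun=> c + eta) p.
  by apply: le_avgs => // q /h; rewrite ler_norml => /andP[_]; rewrite lerBlDl.
have h2 : avgs es (fun=> c - eta) p <= avgs es f p.
  by apply: le_avgs => // q /h; rewrite ler_norml => /andP[+ _]; lra.
move: h1 h2; rewrite !avgs_cst => h1 h2.
by rewrite ler_norml; apply/andP; split; lra.
Qed.

Lemma avgs_bound es f p M : continuous f -> (forall q, `|f q| <= M) -> `|avgs es f p| <= M.
Proof. by move=> cf fM; rewrite -[avgs es f p]subr0; apply: avgs_dist => // q _; rewrite subr0. Qed.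

End avg.
(** * Symmetric random walks *)

Section walk.
Context {R : realType} {d : nat} (l : 'I_d -> 'cV[R]_d) (c : R) (d_gt0 : (0 < d)%N).
Local Notation E := (R * 'cV[R]_d)%type.
Implicit Types (f g ft : E -> R) (fx : 'I_d -> E -> R) (fxx : 'I_d -> 'I_d -> E -> R) (p q : E).

Definition jump (k : 'I_d) : E := (0, c *: l k).

(** With [c ^+ 2 = d%:R * tau] one step has covariance [tau] times the matrix
    [\sum_k l k *m (l k)^T]; the number of directions cancels. *)
Definition walk f : E -> R := fun p =>
  (2 * d%:R)^-1 * \sum_k (f (p + jump k) + f (p - jump k)).

Let d2_gt0 : 0 < 2 * d%:R :> R. Proof. by rewrite mulr_gt0 // ltr0n. Qed.

Lemma le_walk f g p : (forall q, f q <= g q) -> walk f p <= walk g p.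
Proof.
move=> fg; apply: ler_wpM2l; first by rewrite invr_ge0 ltW.
apply: ler_sum => k _.
by apply: lerD; exact: fg.
Qed.

Lemma walkD f g p : walk (fun q => f q + g q) p = walk f p + walk g p.
Proof.
rewrite /walk -mulrDr -big_split /=; congr (_ * _); apply: eq_bigr => k _; ring.
Qed.

Lemma walkZ a f p : walk (fun q => a * f q) p = a * walk f p.
Proof.
by rewrite /walk [RHS]mulrCA; congr (_ * _); rewrite mulr_sumr; apply: eq_bigr => k _; rewrite mulrDr.
Qed.

Lemma walk_cst a p : walk (fun=> a) p = a.
Proof.
rewrite /walk.
have -> : \sum_(k < d) (a + a) = 2 * d%:R * a by rewrite sum_ord_const; ring.
by rewrite mulKf // gt_eqF.
Qed.

Lemma walk_dist f p a D :
  (forall k, `|f (p + jump k) - a| <= D /\ `|f (p - jump k) - a| <= D) -> `|walk f p - a| <= D.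
Proof.
move=> h.
have -> : walk f p - a = (2 * d%:R)^-1 *
    \sum_k ((f (p + jump k) - a) + (f (p - jump k) - a)).
  rewrite -[X in _ - X](walk_cst a p) /walk -mulrBr -sumrB; congr (_ * _).
  by apply: eq_bigr => k _; ring.
rewrite normrM ger0_norm; last by rewrite invr_ge0 ltW.
rewrite ler_pdivrMl //.
apply: le_trans (ler_norm_sum _ _ _) _.
have -> : 2 * d%:R * D = \sum_(k < d) (D + D).
  by rewrite sum_ord_const; ring.
apply: ler_sum => k _; apply: le_trans (ler_normD _ _) _.
by have [h1 h2] := h k; apply: lerD.
Qed.

Lemma hasC12_walk f ft fx fxx : hasC12 f ft fx fxx ->
  hasC12 (walk f) (walk ft) (fun i => walk (fx i)) (fun i j => walk (fxx i j)).
Proof.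
move=> hf; rewrite /walk; apply: (hasC12_ext (hasC12Z (2 * d%:R)^-1 (hasC12_sum (index_enum 'I_d)
  (fun k => hasC12D (hasC12_shift (jump k) hf) (hasC12_shift (- jump k) hf))))) => //.
Qed.

Lemma continuous_walk f : continuous f -> continuous (walk f).
Proof.
move=> cf; apply: continuous_scale; apply: continuous_sum => k.
by apply: continuous_add; exact: continuous_shift.
Qed.

Lemma avgs_walk es f p : continuous f -> avgs es (walk f) p = walk (avgs es f) p.
Proof.
move=> cf; have cs z := continuous_shift z cf.
have c2 k : continuous (fun q => f (q + jump k) + f (q - jump k)) by exact: continuous_add.
rewrite /walk avgsZ; [congr (_ * _)|exact: continuous_sum].
by rewrite avgs_sum //; apply: eq_bigr => k _; rewrite avgsD // !avgs_shift.
Qed.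

Lemma walk_sqdist x p :
  walk (fun q => enorm (q.2 - x) ^+ 2) p =
  enorm (p.2 - x) ^+ 2 + c ^+ 2 / d%:R * \sum_k enorm (l k) ^+ 2.
Proof.
have e k : enorm ((p + jump k).2 - x) ^+ 2 + enorm ((p - jump k).2 - x) ^+ 2 =
    2 * (enorm (p.2 - x) ^+ 2 + c ^+ 2 * enorm (l k) ^+ 2).
  rewrite /= !enorm_cV mulr_sumr -!big_split /= mulr_sumr; apply: eq_bigr => i _.
  by rewrite !mxE; ring.
rewrite /walk; under eq_bigr do rewrite e.
rewrite -mulr_sumr big_split /= sum_ord_const -mulr_sumr.
by field; rewrite pnatr_eq0 -lt0n.
Qed.

Lemma le_iter_walk m f g p : (forall q, f q <= g q) -> iter m walk f p <= iter m walk g p.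
Proof. by elim: m p => [|m IH] p fg //=; apply: le_walk => // q; exact: IH. Qed.

Lemma iter_walkD m f g p : iter m walk (fun q => f q + g q) p = iter m walk f p + iter m walk g p.
Proof.
elim: m p => [//|m IH] p /=; rewrite -walkD; congr walk; apply/funext => q; exact: IH.
Qed.

Lemma iter_walkZ m a f p : iter m walk (fun q => a * f q) p = a * iter m walk f p.
Proof.
elim: m p => [//|m IH] p /=; rewrite -[RHS](walkZ a); congr walk; apply/funext => q; exact: IH.
Qed.

Lemma iter_walk_cst m a p : iter m walk (fun=> a) p = a.
Proof.
elim: m p => [//|m IH] p /=; rewrite -[RHS](walk_cst a p); congr walk.
apply/funext => q; exact: IH.
Qed.

Lemma continuous_iter_walk m f : continuous f -> continuous (iter m walk f).
Proof. by move=> cf; elim: m => //= m; exact: continuous_walk. Qed.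

Lemma avgs_iter_walk es m f p : continuous f -> avgs es (iter m walk f) p = iter m walk (avgs es f) p.
Proof.
move=> cf; elim: m p => [//|m IH] p /=.
rewrite avgs_walk; last exact: continuous_iter_walk.
by congr walk; apply/funext => q; exact: IH.
Qed.

Lemma iter_walk_sqdist m x p :
  iter m walk (fun q => enorm (q.2 - x) ^+ 2) p =
  enorm (p.2 - x) ^+ 2 + m%:R * (c ^+ 2 / d%:R * \sum_k enorm (l k) ^+ 2).
Proof.
elim: m p => [|m IH] p /=; first by rewrite mul0r addr0.
rewrite (_ : iter m walk _ = fun q => enorm (q.2 - x) ^+ 2 + m%:R * (c ^+ 2 / d%:R * \sum_k enorm (l k) ^+ 2)).
  by rewrite walkD walk_cst // walk_sqdist // -addrA -natr1; congr (_ + _); ring.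
by apply/funext => q; exact: IH.
Qed.

Lemma iter_walk_telescope m f p :
  iter m walk f p = f p + \sum_(j < m) iter j walk (fun q => walk f q - f q) p.
Proof.
elim: m p => [|m IH] p; first by rewrite big_ord0 addr0.
rewrite big_ord_recr /= addrA -IH.
have -> : (fun q => walk f q - f q) = (fun q => walk f q + (-1) * f q).
  by apply/funext => q; rewrite mulN1r.
rewrite iter_walkD (iter_walkZ m (-1) f p) mulN1r addrC subrK.
by elim: m {IH} p => //= m IH p; congr walk; apply/funext => q; exact: IH.
Qed.

End walk.
(** * Mollification of viscosity supersolutions *)

Lemma le_eps_mul {R : realType} (x y z : R) :
  (forall k : R, 0 < k -> x <= y + k * z) -> x <= y.
Proof.
move=> h; apply/ler_addgt0Pr => e e0.
have z0 : 0 < `|z| + 1 by rewrite ltr_wpDl.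
apply: le_trans (h (e / (`|z| + 1)) (divr_gt0 e0 z0)) _.
rewrite lerD2l mulrAC ler_pdivrMr // ler_pM2l //.
by apply: le_trans (ler_norm _) _; rewrite lerDl.
Qed.

Lemma compact_uniform {R : realType} {V : normedModType R} (K : set V) (f : V -> R) e :
  compact K -> continuous f -> 0 < e ->
  exists2 h : R, 0 < h & forall p q, K p -> `|q - p| <= h -> `|f q - f p| <= e.
Proof.
move=> cK cf e0.
have : \forall h \near nbhs (0 : R), K `<=` [set p | forall q, `|q - p| < `|h| -> `|f q - f p| <= e].
  apply: ((compact_near_coveringP _).1 cK R (nbhs (0 : R))
    (fun h p => forall q, `|q - p| < `|h| -> `|f q - f p| <= e) _) => p Kp.
  have /continuous_dist/(_ (e / 2))[|h h0 H] := cf p; first by rewrite divr_gt0.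
  exists ([set q | `|q - p| < h / 2], [set k : R | `|k| < h / 2]) => /=.
    split; first by apply/nbhs_dist; exists (h / 2); rewrite ?divr_gt0.
    by apply/nbhs_dist; exists (h / 2); rewrite ?divr_gt0 // => k; rewrite subr0.
  move=> [x k] /= [xp kh] q qx.
  have -> : f q - f x = (f q - f p) - (f x - f p) by ring.
  rewrite (splitr e); apply: le_trans (ler_normB _ _) _; apply: lerD; apply: H.
    have -> : q - p = (q - x) + (x - p) by rewrite addrA subrK.
    apply: le_lt_trans (ler_normD _ _) _; rewrite [ltRHS](splitr h) ltrD //.
    exact: lt_trans qx kh.
  by apply: lt_trans xp _; rewrite gtr_pMr // invf_lt1 // ltr1n.
move=> /nbhs_dist[h h0 H]; exists (h / 4); first by rewrite divr_gt0.
move=> p q Kp qp; apply: (H (h / 2) _ p Kp q).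
  by rewrite subr0 ger0_norm ?divr_ge0 ?ltW // ltr_pdivrMr // mulr_natr mulr2n ltrDl.
rewrite ger0_norm; last by rewrite divr_ge0 ?ltW.
apply: le_lt_trans qp _; lra.
Qed.

Section spacemoll.
Context {R : realType} {d : nat}.
Local Notation E := (R * 'cV[R]_d)%type.
Implicit Types (f g v : E -> R) (fxx : 'I_d -> 'I_d -> E -> R) (es : seq E).

Definition space_dirs es := forall e, e \in es -> e.1 = 0.

(** A time slice kept as a function on the product space, so that [hasC12] and box averages apply to
    it unchanged. *)
Definition freeze (t : R) f : E -> R := fun p => f (t, p.2).

Lemma continuous_freeze t f : continuous f -> continuous (freeze t f).
Proof.
move=> cf p; apply/continuous_dist => e e0.
have /continuous_dist/(_ e e0)[h h0 H] := cf (t, p.2).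
exists h => // q qp; apply: H; apply: le_lt_trans qp.
by rewrite !prod_normE /= subrr normr0 ge_max !le_max normr_ge0 lexx orbT.
Qed.

Lemma avgs_freeze es f t (p : E) : space_dirs es ->
  avgs es f (t, p.2) = avgs es (freeze t f) p.
Proof.
elim: es p => [//|e es IH] p sp /=; rewrite /avg; apply: eq_Rintegral => r _.
have e0 : e.1 = 0 by apply: sp; rewrite inE eqxx.
rewrite -IH; last by move=> e' ein; apply: sp; rewrite inE ein orbT.
congr avgs; congr pair => /=; by rewrite e0 scaler0 addr0.
Qed.

Lemma freeze_fdiff e f t : e.1 = 0 -> freeze t (fdiff e f) = fdiff e (freeze t f).
Proof.
move=> e0; apply/funext => p; rewrite /freeze /fdiff /=; congr (f _ - _).
by congr pair => /=; rewrite e0 addr0.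
Qed.

Lemma lip_of_partials (H : E -> R) (D : 'I_d -> E -> R) (B : R) p (w : 'cV[R]_d) :
  (forall k q, is_derive q (dir_x k) H (D k q)) -> (forall k, continuous (D k)) ->
  (forall k q, `|D k q| <= B) -> `|H (p + (0, w)) - H p| <= B * \sum_k `|w k 0|.
Proof.
move=> dH cD bD.
have dw q : is_derive q (0, w) H (\sum_k w k 0 * D k q).
  apply: strict_deriv_is_derive; rewrite space_dir_sum.
  by apply: strict_deriv_sum => i; apply: strict_deriv_partial => //; exact: cD.
have [c _ ->] := mean_value_line p dw.
apply: le_trans (ler_norm_sum _ _ _) _; rewrite mulr_sumr; apply: ler_sum => k _.
by rewrite normrM mulrC ler_wpM2r.
Qed.

Definition LipH (B : R) fxx := forall i j p (w : 'cV[R]_d),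
  `|fxx i j (p + (0, w)) - fxx i j p| <= B * \sum_k `|w k 0|.

Section dirs.
Context (eps : R) (eps_gt0 : 0 < eps).

Definition xdir (i : 'I_d) : E := eps *: dir_x i.
(** Three copies of each direction: two derivatives form the Hessian, the third makes it Lipschitz
    in space. *)
Definition xdirs : seq E := flatten [seq nseq 3 (xdir i) | i <- enum 'I_d].
Definition tdir : E := eps *: dir_t.
Definition txdirs := tdir :: xdirs.

Lemma xdir_space i : (xdir i).1 = 0. Proof. by rewrite /xdir /= scaler0. Qed.

Lemma xdirs_space : space_dirs xdirs.
Proof.
move=> e /flattenP[s /mapP[i _ ->]]; rewrite mem_nseq /= => /eqP ->; exact: xdir_space.
Qed.

Lemma rem_space e es : space_dirs es -> space_dirs (rem e es).
Proof. by move=> h e' /mem_rem; exact: h. Qed.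

Lemma count_xdirs i : (3 <= count_mem (xdir i) xdirs)%N.
Proof.
rewrite /xdirs; have : i \in enum 'I_d by rewrite mem_enum.
elim: (enum 'I_d) => //= j s IH; rewrite inE => /orP[/eqP <-|/IH h].
  by rewrite eqxx.
by apply: leq_trans h _; rewrite !addnA leq_addl.
Qed.

Lemma count_rem_ge (e e' : E) es n : (n.+1 <= count_mem e es -> n <= count_mem e (rem e' es))%N.
Proof. by move=> h; rewrite count_rem leq_subRL ?(leq_trans _ h) //; case: (_ && _) => /=; rewrite ?add0n ?add1n // ltnW. Qed.

Definition dx i es f : E -> R := fun p => eps^-1 * avgs (rem (xdir i) es) (fdiff (xdir i) f) p.

Lemma continuous_scaleavgs c es f : continuous f -> continuous (fun p => c * avgs es f p).
Proof. by move=> cf; apply: continuous_scale; exact: continuous_avgs. Qed.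

Lemma avgs_dx i es f p : continuous f -> xdir i \in es ->
  is_derive p (dir_x i) (avgs es f) (dx i es f p).
Proof.
move=> cf ie; have := is_derive_scale eps^-1 (avgs_derive cf ie p).
by rewrite /xdir scalerA mulVf ?gt_eqF // scale1r.
Qed.

Lemma scaleavgs_dx c i es f p : continuous f -> xdir i \in es ->
  is_derive p (dir_x i) (fun q => c * avgs es f q) (c * dx i es f p).
Proof. by move=> cf ie; apply: is_deriveZ; exact: avgs_dx. Qed.

Definition dxx i j es f : E -> R := fun p => eps^-1 * (eps^-1 *
  avgs (rem (xdir i) (rem (xdir j) es)) (fdiff (xdir i) (fdiff (xdir j) f)) p).

Definition dxxx k i j es f : E -> R := fun p => eps^-1 * (eps^-1 * (eps^-1 *
  avgs (rem (xdir k) (rem (xdir i) (rem (xdir j) es)))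
    (fdiff (xdir k) (fdiff (xdir i) (fdiff (xdir j) f))) p)).

Lemma fdiff_bound e f M : (forall p, `|f p| <= M) -> forall p, `|fdiff e f p| <= 2 * M.
Proof.
move=> h p; apply: le_trans (ler_normB _ _) _; have := h p; have := h (p + e); lra.
Qed.

Lemma hasC12_avgs es f ft : continuous f -> (forall i, 3 <= count_mem (xdir i) es)%N ->
  (forall p, is_derive p dir_t (avgs es f) (ft p)) -> continuous ft ->
  hasC12 (avgs es f) ft (fun i => dx i es f) (fun i j => dxx i j es f).
Proof.
move=> cf ce dt cft.
have in1 i : xdir i \in es.
  by rewrite -has_pred1 has_count; apply: leq_trans (ce i).
have in2 i j : xdir i \in rem (xdir j) es.
  by rewrite -has_pred1 has_count; apply: leq_trans (count_rem_ge _ (ce i)).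
have cd := @continuous_fdiff R E.
split; [exact: continuous_avgs|by split|split|split].
- by move=> i p; exact: avgs_dx.
- by move=> i; apply: continuous_scaleavgs; exact: cd.
- move=> i j p; apply: scaleavgs_dx => //; exact: cd.
- move=> i j; apply: continuous_scale.
  by apply: continuous_scaleavgs; do 2! apply: (cd).
Qed.

Lemma LipH_avgs es f M : continuous f -> (forall i, 3 <= count_mem (xdir i) es)%N ->
  (forall p, `|f p| <= M) ->
  LipH (eps^-1 * (eps^-1 * (eps^-1 * (2 * (2 * (2 * M)))))) (fun i j => dxx i j es f).
Proof.
move=> cf ce fM i j p w.
have cd := @continuous_fdiff R E.
have ei : 0 <= eps^-1 by rewrite invr_ge0 ltW.
apply: (@lip_of_partials _ (fun k => dxxx k i j es f)).
- move=> k q; apply: is_deriveZ; apply: scaleavgs_dx; first by do 2! apply: (cd).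
  rewrite -has_pred1 has_count; apply: leq_trans (count_rem_ge _ (count_rem_ge _ (ce k))) => //.
- move=> k; do 2! apply: continuous_scale.
  by apply: continuous_scaleavgs; do 3! apply: (cd).
- move=> k q; rewrite /dxxx !normrM !(ger0_norm ei) !ler_wpM2l //.
  apply: avgs_bound; first by do 3! apply: (cd).
  by do 3! apply: fdiff_bound.
Qed.

Lemma dxx_bound es f M : continuous f -> (forall p, `|f p| <= M) ->
  forall i j p, `|dxx i j es f p| <= eps^-1 * (eps^-1 * (2 * (2 * M))).
Proof.
move=> cf fM i j p.
have cd := @continuous_fdiff R E.
have ei : 0 <= eps^-1 by rewrite invr_ge0 ltW.
rewrite /dxx !normrM !(ger0_norm ei) !ler_wpM2l //.
apply: avgs_bound; first by do 2! apply: (cd).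
by do 2! apply: fdiff_bound.
Qed.

Lemma dxx_freeze es f t i j (p : E) : space_dirs es ->
  dxx i j es f (t, p.2) = dxx i j es (freeze t f) p.
Proof.
move=> sp; rewrite /dxx (avgs_freeze _ t p); last by do 2! apply: rem_space.
by rewrite !freeze_fdiff ?xdir_space.
Qed.

Lemma spread_xdirs : spread xdirs <= 3 * d%:R * eps.
Proof.
rewrite /spread /xdirs big_flatten /= big_map big_enum /=.
have -> : 3 * d%:R * eps = \sum_(i < d) (eps *+ 3).
  by rewrite sumr_const card_ord -mulrnA -[RHS]mulr_natl natrM.
apply: ler_sum => i _.
have h : `|xdir i| <= eps.
  rewrite normrZ gtr0_norm //; apply: ler_piMr; first exact: ltW.
  rewrite /dir_x prod_normE /= normr0.
  by rewrite ge_max ler01 /=; apply: le_trans (mx_norm_enorm _) _; rewrite enorm_basis.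
by rewrite !big_cons big_nil addr0 -mulr_natr; lra.
Qed.

End dirs.
End spacemoll.
Section control.
Context {R : realType} {d : nat} (Gamma : set 'M[R]_d) (lG UG : R) (ellG : elliptic Gamma lG UG)
  (d_gt0 : (0 < d)%N).
Local Notation G := (Gfun Gamma).
Local Notation E := (R * 'cV[R]_d)%type.

(** * Random walks below a viscosity supersolution *)

Section walk_expansion.
Implicit Types (f v ft psi : E -> R) (fx : 'I_d -> E -> R) (fxx gxx : 'I_d -> 'I_d -> E -> R).

Lemma quad_bound (A : 'M[R]_d) (w : 'cV[R]_d) D :
  (forall i j, `|A i j| <= D) -> `|quad A w| <= D * (\sum_i `|w i 0|) ^+ 2.
Proof.
move=> h; rewrite quadE expr2 mulr_suml mulr_sumr.
apply: le_trans (ler_norm_sum _ _ _) _; apply: ler_sum => i _.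
rewrite mulrA mulr_sumr.
apply: le_trans (ler_norm_sum _ _ _) _; apply: ler_sum => j _.
by rewrite !normrM ler_wpM2r // mulrC ler_wpM2r.
Qed.

Lemma sum_norm_le_enorm (w : 'cV[R]_d) : \sum_k `|w k 0| <= d%:R * enorm w.
Proof.
have -> : d%:R * enorm w = \sum_(k < d) enorm w by rewrite sum_ord_const.
by apply: ler_sum => k _; exact: enorm_coord.
Qed.

Context (g : 'M[R]_d) (l : 'I_d -> 'cV[R]_d) (S : R) (Gg : Gamma g) (gE : g = \sum_k l k *m (l k)^T)
  (lS : forall k, \sum_i `|l k i 0| <= S).

Definition Lop fxx (p : E) : R := 2^-1 * \tr (hess fxx p *m g).

Lemma S_ge0 : 0 <= S.
Proof. by apply: le_trans (lS (Ordinal d_gt0)); exact: sumr_ge0. Qed.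

Lemma Lop_dist fxx gxx p q D : (forall i j, `|fxx i j p - gxx i j q| <= D) ->
  `|Lop fxx p - Lop gxx q| <= 2^-1 * UG ^+ 2 * (d%:R ^+ 2 * D).
Proof.
move=> h; rewrite /Lop -mulrBr -linearB -mulmxBl normrM ger0_norm ?invr_ge0 // -mulrA.
rewrite ler_pM2l ?invr_gt0 //; apply: le_trans (elliptic_tr ellG _ Gg) _.
rewrite ler_wpM2l ?sqr_ge0 //.
apply: (@le_trans _ _ (\sum_(i < d) \sum_(j < d) D)).
  by apply: ler_sum => i _; apply: ler_sum => j _; rewrite !mxE.
by rewrite !sumr_const card_ord -mulrnA -[X in X <= _]mulr_natl natrM expr2.
Qed.

Lemma Lop_bound fxx p D : (forall i j, `|fxx i j p| <= D) ->
  `|Lop fxx p| <= 2^-1 * UG ^+ 2 * (d%:R ^+ 2 * D).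
Proof.
move=> h; have := @Lop_dist fxx (fun _ _ _ => 0) p p D.
rewrite {2}/Lop (_ : hess (fun _ _ _ => 0) p = 0); last by apply/matrixP => i j; rewrite !mxE.
by rewrite mul0mx mxtrace0 mulr0 subr0; apply => i j; rewrite subr0.
Qed.

Lemma quadB (A B : 'M[R]_d) w : quad (A - B) w = quad A w - quad B w.
Proof.
rewrite !quadE -sumrB; apply: eq_bigr => i _; rewrite -sumrB; apply: eq_bigr => j _.
by rewrite !mxE; ring.
Qed.

Lemma quadZ (A : 'M[R]_d) c w : quad A (c *: w) = c ^+ 2 * quad A w.
Proof.
rewrite !quadE mulr_sumr; apply: eq_bigr => i _; rewrite mulr_sumr; apply: eq_bigr => j _.
by rewrite !mxE; ring.
Qed.

(** [taylor2] is used for each pair of opposite jumps, and [tr_decomp] adds the quadratic forms up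
    to the trace against [g]. Along a jump the Hessian varies by at most [B * (c * S)], whence the
    third power. *)
Lemma walk_expand f ft fx fxx B c p : 0 <= c -> 0 <= B ->
  hasC12 f ft fx fxx -> LipH B fxx ->
  `|walk l c f p - f p - c ^+ 2 / d%:R * Lop fxx p| <= B * (c * S) ^+ 3.
Proof.
move=> c0 B0 hf lip.
have S0 := S_ge0; have d2 : 0 < 2 * d%:R :> R by rewrite mulr_gt0 // ltr0n.
have dn0 : d%:R != 0 :> R by rewrite pnatr_eq0 -lt0n.
have -> : walk l c f p - f p - c ^+ 2 / d%:R * Lop fxx p = (2 * d%:R)^-1 *
   \sum_k (f (p + jump l c k) + f (p - jump l c k) - 2 * f p - quad (hess fxx p) (c *: l k)).
  have -> : \sum_k (f (p + jump l c k) + f (p - jump l c k) - 2 * f p - quad (hess fxx p) (c *: l k))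
    = \sum_k (f (p + jump l c k) + f (p - jump l c k)) - d%:R * (2 * f p)
        - c ^+ 2 * \tr (hess fxx p *m g).
    rewrite !sumrB; congr (_ - _ - _).
      by rewrite sum_ord_const.
    rewrite (tr_decomp _ gE) mulr_sumr; apply: eq_bigr => k _; exact: quadZ.
  rewrite /walk /Lop; field; exact: dn0.
rewrite normrM ger0_norm; last by rewrite invr_ge0 ltW.
rewrite ler_pdivrMl //; apply: le_trans (ler_norm_sum _ _ _) _.
have -> : 2 * d%:R * (B * (c * S) ^+ 3) = \sum_(k < d) (2 * (B * (c * S) ^+ 3)).
  by rewrite sum_ord_const; ring.
apply: ler_sum => k _; apply: (taylor2 hf) => s s1.
have sk : \sum_i `|(c *: l k) i 0| <= c * S.
  apply: (@le_trans _ _ (c * \sum_i `|l k i 0|)); last by rewrite ler_wpM2l.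
  by rewrite mulr_sumr; apply: ler_sum => i _; rewrite mxE normrM ger0_norm.
rewrite -quadB (_ : B * (c * S) ^+ 3 = B * (c * S) * (c * S) ^+ 2); last by ring.
have cS : 0 <= c * S by rewrite mulr_ge0.
apply: (@le_trans _ _ (B * (c * S) * (\sum_i `|(c *: l k) i 0|) ^+ 2)).
  apply: quad_bound => i j; rewrite !mxE.
  have -> : s *: (0, c *: l k) = (0, s *: (c *: l k)) :> E by congr pair; rewrite /= scaler0.
  apply: le_trans (lip i j p _) _; rewrite ler_wpM2l //; apply: le_trans sk.
  by apply: ler_sum => m _; rewrite [in leLHS]mxE normrM ler_piMl.
rewrite ler_wpM2l ?mulr_ge0 // ler_pXn2r ?nnegrE //; exact: sumr_ge0.
Qed.

(** The constants survive a step of the walk unchanged ([nice_walk]), so the error of one step does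
    not grow under iteration. *)
Definition nice (B C : R) psi := exists fx fxx,
  [/\ hasC12 psi (fun=> 0) fx fxx, LipH B fxx, forall i j p, `|fxx i j p| <= B,
      forall p t, psi (t, p.2) = psi p & forall p, psi p <= C].

Lemma walk_addr c f p z : walk l c f (p + z) = walk l c (fun q => f (q + z)) p.
Proof.
by rewrite /walk; congr (_ * _); apply: eq_bigr => k _; rewrite ![p + _ + z]addrAC.
Qed.

Lemma nice_walk B C c psi : nice B C psi -> nice B C (walk l c psi).
Proof.
case=> fx [fxx [h1 h2 h3 h4 h5]].
exists (fun i => walk l c (fx i)), (fun i j => walk l c (fxx i j)); split.
- by apply: (hasC12_ext (hasC12_walk l c h1)) => // p; rewrite walk_cst.
- move=> i j p w; rewrite walk_addr.
  have -> : walk l c (fun q => fxx i j (q + (0, w))) p - walk l c (fxx i j) p =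
      walk l c (fun q => fxx i j (q + (0, w)) - fxx i j q) p - 0.
    rewrite subr0 -[X in _ - X]mul1r -mulNr -walkZ -walkD; congr walk.
    by apply/funext => q; rewrite mulN1r.
  by apply: walk_dist => // k; rewrite !subr0; split; exact: h2.
- by move=> i j p; rewrite -[walk _ _ _ _]subr0; apply: walk_dist => // k; rewrite !subr0.
- move=> p t; rewrite /walk; congr (_ * _); apply: eq_bigr => k _.
  by rewrite -(h4 (p + jump l c k) (t + 0)) -(h4 (p - jump l c k) (t - 0)).
- by move=> p; rewrite -(walk_cst l c d_gt0 C p); exact: le_walk.
Qed.

Lemma nice_sub B C k psi : 0 <= k -> nice B C psi -> nice B C (fun p => psi p - k).
Proof.
move=> k0 [fx [fxx [h1 h2 h3 h4 h5]]]; exists fx, fxx; split => //.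
- by apply: (hasC12_ext (hasC12D h1 (hasC12_cst (- k)))) => [p|p|i p|i j p]; rewrite ?addr0.
- by move=> p t; rewrite h4.
- by move=> p; have := h5 p; lra.
Qed.

Definition pos (x : R) : R := (x + `|x|) / 2.

Lemma pos_ge0 x : 0 <= x -> pos x = x.
Proof. by move=> x0; rewrite /pos ger0_norm //; field. Qed.

Lemma pos_le0 x : x <= 0 -> pos x = 0.
Proof. by move=> x0; rewrite /pos ler0_norm // subrr mul0r. Qed.

(** A correction that vanishes from [t0] on and is still of class C12: squaring the positive part
    makes its time derivative continuous. *)
Lemma hasC12_sqpos t0 : @hasC12 R d (fun p => pos (t0 - p.1) ^+ 2)
  (fun p => - 2 * pos (t0 - p.1)) (fun _ _ => 0) (fun _ _ _ => 0).
Proof.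
have cp : continuous (fun p : E => pos (t0 - p.1)).
  move=> p; rewrite /pos; apply: cvgM; last exact: cvg_cst.
  have h : (fun p : E => t0 - p.1) @ p --> t0 - p.1.
    by apply: cvgB; [exact: cvg_cst|exact: cvg_fst].
  by apply: cvgD => //; exact: cvg_norm.
split; [|split|split|split].
- exact: (continuous_mul cp cp).
- move=> p; apply/is_derive_dist => e e0; exists e => // s se.
  have -> : (p + s *: dir_t).1 = p.1 + s by rewrite /= [_ *: _]mulr1.
  apply: (@le_trans _ _ (`|s| * `|s|)); last by rewrite ler_wpM2r // ltW.
  rewrite -normrM ger0_norm -?expr2 ?sqr_ge0 // opprD addrA.
  move: (t0 - p.1) => x; rewrite ler_norml.
  have [x0|x0] := leP 0 x; have [y0|y0] := leP 0 (x - s).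
  + by rewrite !pos_ge0 //; apply/andP; split; nra.
  + by rewrite (pos_ge0 x0) (pos_le0 (ltW y0)); apply/andP; split; nra.
  + by rewrite (pos_ge0 y0) (pos_le0 (ltW x0)); apply/andP; split; nra.
  + by rewrite (pos_le0 (ltW y0)) (pos_le0 (ltW x0)); apply/andP; split; nra.
- exact: continuous_scale.
- move=> i p; apply/is_derive_dist => e e0; exists 1 => // s _.
  by rewrite /= scaler0 addr0 mulr0 !subrr normr0 mulr_ge0 // ltW.
- by move=> i; exact: cst_continuous.
- by move=> i j p; exact: is_derive_const.
- by move=> i j; exact: cst_continuous.
Qed.

Lemma local_max_on_sub (U : topologicalType) (D1 D2 : set U) (f : U -> R) p :
  (\forall q \near p, D2 q -> D1 q) -> D1 `<=` D2 ->
  local_max_on D1 f p -> local_max_on D2 f p.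
Proof.
move=> near12 sub12 [Dp fp]; split; first exact: sub12.
have h : nbhs p [set q | (D2 q -> D1 q) /\ (D1 q -> f q <= f p)] by exact: filterI near12 fp.
change (nbhs p [set q | D2 q -> f q <= f p]).
by apply: filterS h => q [h1 h2] D2q; apply: h2; exact: h1.
Qed.

Lemma near_lt_fst (p : E) b : p.1 < b -> \forall q \near p, q.1 < b.
Proof.
move=> pb; apply/nbhs_dist; exists (b - p.1); first by rewrite subr_gt0.
move=> q; rewrite prod_normE /= gt_max => /andP[+ _]; rewrite ltr_norml => /andP[_].
by rewrite ltrBlDr subrK.
Qed.

Lemma local_max_on_right a b b' f p : b' <= b ->
  local_max_on (strip a b') f p -> local_max_on (strip a b) f p.
Proof.
move=> bb' mp; have [/andP[_ pb] _] := mp; apply: local_max_on_sub mp.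
  by apply: filterS (near_lt_fst pb) => q qb /andP[aq _]; rewrite /strip /= aq.
by move=> q /andP[aq qb]; rewrite /strip /= aq (lt_le_trans qb bb').
Qed.

Lemma visc_super_right a b b' v : b' <= b ->
  visc_supersolution G a b v -> visc_supersolution G a b' v.
Proof. by move=> bb' sv f p cf mp; apply: sv => //; exact: local_max_on_right mp. Qed.

Section one_step.
Context (a b : R) (v : E -> R) (M : R) (cv : continuous v) (vM : forall p, `|v p| <= M)
  (sv : visc_supersolution G a b v).

Definition K0 : R := d%:R * S ^+ 3 + 2^-1 * UG ^+ 2 * (d%:R ^+ 2 * S).

Lemma K0_ge0 : 0 <= K0.
Proof.
have S0 := S_ge0; apply: addr_ge0; first by rewrite mulr_ge0 // exprn_ge0.
by apply: mulr_ge0; rewrite mulr_ge0 ?invr_ge0 ?sqr_ge0 ?exprn_ge0.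
Qed.

(** The smooth function [F] equals [psi] at [t1] and moves backward at the rate [Lam - e], reaching
    the walk minus [tau * e] at [t0]; it is compared with [v] by [comparison_sub_penalized]. Of the
    margin [e], the part [e1] pays for replacing the difference quotient [Lam] by [Lop], and [c1]
    for the change of [Lop] along the step. *)
Lemma one_step B C psi t0 tau x : 0 <= B -> nice B C psi -> a <= t0 -> 0 < tau ->
  t0 + tau <= b -> (forall y, psi (t0 + tau, y) <= v (t0 + tau, y)) ->
  walk l (Num.sqrt (d%:R * tau)) psi (t0, x) - tau * (B * Num.sqrt (d%:R * tau) * K0) <= v (t0, x).
Proof.
move=> B0 np at0 tau0 tb psiv; set c := Num.sqrt _; set t1 := t0 + tau in tb psiv *.
have S0 := S_ge0; have d0 : 0 < d%:R :> R by rewrite ltr0n.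
have dt : 0 <= d%:R * tau by rewrite mulr_ge0 // ltW.
have c0 : 0 <= c by exact: sqrtr_ge0.
have c2 : c ^+ 2 = d%:R * tau by rewrite sqr_sqrtr.
have cd : c ^+ 2 / d%:R = tau by rewrite c2 mulrAC mulfV ?mul1r // gt_eqF.
have U0 : 0 <= 2^-1 * UG ^+ 2 by rewrite mulr_ge0 ?invr_ge0 ?sqr_ge0.
have [fx [fxx [h1 h2 h3 h4 h5]]] := np.
pose A := walk l c.
pose e1 := B * (c * S) ^+ 3 / tau.
pose c1 := 2^-1 * UG ^+ 2 * (d%:R ^+ 2 * (B * (c * S))).
have c10 : 0 <= c1 by rewrite mulr_ge0 // mulr_ge0 ?exprn_ge0 // !mulr_ge0.
have e10 : 0 <= e1 by apply: divr_ge0; [rewrite mulr_ge0 // exprn_ge0 // mulr_ge0|exact: ltW].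
pose e := e1 + c1.
have eE : e = B * c * K0.
  rewrite /e /e1 /c1 /K0.
  have -> : B * (c * S) ^+ 3 / tau = B * c * S ^+ 3 * (c ^+ 2 / tau) by ring.
  by rewrite c2 mulfK ?gt_eqF //; ring.
pose Lam p := tau^-1 * (A psi p - psi p).
have hLam : hasC12 Lam (fun=> 0) (fun i p => tau^-1 * (A (fx i) p + - 1 * fx i p))
    (fun i j p => tau^-1 * (A (fxx i j) p + - 1 * fxx i j p)).
  apply: (hasC12_ext (hasC12Z tau^-1 (hasC12D (hasC12_walk l c h1) (hasC12Z (- 1) h1)))) => // p.
    by rewrite /Lam mulN1r.
  by rewrite walk_cst // mulr0 addr0 mulr0.
(* Comparison runs over the whole of [[a, t1]], since a maximum relative to times after [t0] need
   not be one on the strip from [a]. Before [t0] the factor [(t1 - p.1) / tau] exceeds 1, and this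
   [N] compensates the excess exactly. *)
pose N := c1 / (2 * tau).
pose F p := psi p + (t1 - p.1) * (Lam p - e) - N * pos (t0 - p.1) ^+ 2.
pose Fxx i j p := fxx i j p + (t1 - p.1) * (tau^-1 * (A (fxx i j) p - fxx i j p)).
have hF : hasC12 F (fun p => - (Lam p - e) + 2 * N * pos (t0 - p.1))
    (fun i p => fx i p + (t1 - p.1) * (tau^-1 * (A (fx i) p + - 1 * fx i p))) Fxx.
  have hth := hasC12D (@hasC12_cst R d t1) (hasC12Z (- 1) (@hasC12_fst R d)).
  have hLe := hasC12D hLam (hasC12_cst (- e)).
  apply: (hasC12_ext (hasC12D (hasC12D h1 (hasC12M hth hLe)) (hasC12Z (- N) (hasC12_sqpos t0))))
    => [p|p|i p|i j p]; rewrite /F /Fxx; ring.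
have LLam p : `|Lam p - Lop fxx p| <= e1.
  have -> : Lam p - Lop fxx p = tau^-1 * (A psi p - psi p - tau * Lop fxx p).
    by rewrite /Lam; field; rewrite gt_eqF.
  rewrite normrM gtr0_norm ?invr_gt0 // mulrC ler_pM2r ?invr_gt0 //.
  by have := walk_expand p c0 B0 h1 h2; rewrite cd.
have ALop p : `|Lop (fun i j => A (fxx i j)) p - Lop fxx p| <= c1.
  apply: Lop_dist => i j; apply: walk_dist => // k.
  have jk (s : R) : `|s| <= 1 -> `|fxx i j (p + s *: jump l c k) - fxx i j p| <= B * (c * S).
    move=> s1; have -> : s *: jump l c k = (0, s *: (c *: l k)) :> E by congr pair; rewrite /= scaler0.
    apply: le_trans (h2 i j p _) _; rewrite ler_wpM2l //.
    apply: (@le_trans _ _ (c * \sum_i `|l k i 0|)); last by rewrite ler_wpM2l.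
    rewrite mulr_sumr; apply: ler_sum => m _; rewrite !mxE !normrM mulrA ler_wpM2r //.
    by rewrite (ger0_norm c0) ler_piMl.
  split; first by have := jk 1; rewrite scale1r; apply; rewrite normr1.
  by have := jk (- 1); rewrite scaleN1r; apply; rewrite normrN1.
have FL p : 2^-1 * \tr (hess Fxx p *m g) =
    Lop fxx p + (t1 - p.1) / tau * (Lop (fun i j => A (fxx i j)) p - Lop fxx p).
  rewrite /Lop.
  have -> : hess Fxx p = hess fxx p + ((t1 - p.1) / tau) *:
      (hess (fun i j => A (fxx i j)) p - hess fxx p).
    by apply/matrixP => i j; rewrite !mxE /Fxx mulrA.
  by rewrite mulmxDl linearD /= -scalemxAl linearZ /= mulmxBl linearB /=; ring.
have subF p : a <= p.1 < t1 ->
    0 <= - (Lam p - e) + 2 * N * pos (t0 - p.1) + 2^-1 * \tr (hess Fxx p *m g).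
  move=> /andP[ap pt1]; rewrite FL.
  have := LLam p; have := ALop p; rewrite !ler_norml => /andP[u1 u2] /andP[u3 u4].
  set k := (t1 - p.1) / tau; set del := Lop _ p - Lop fxx p in u1 u2 *.
  have k0 : 0 <= k by apply: divr_ge0; [rewrite subr_ge0; exact: ltW|exact: ltW].
  suff : k * c1 <= c1 + 2 * N * pos (t0 - p.1).
    have : - (k * c1) <= k * del by rewrite -mulrN ler_wpM2l.
    by rewrite /e; lra.
  have [tp|tp] := leP t0 p.1.
    rewrite pos_le0 ?subr_le0 // mulr0 addr0 ler_piMl // /k ler_pdivrMr // mul1r.
    by rewrite /t1; lra.
  rewrite pos_ge0; last by rewrite subr_ge0 ltW.
  rewrite /N /k /t1; apply: le_of_eq.
  by field; rewrite gt_eqF.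
have LopB p : Lop fxx p <= 2^-1 * UG ^+ 2 * (d%:R ^+ 2 * B).
  by apply: le_trans (ler_norm _) _; exact: Lop_bound.
have FC p : a <= p.1 <= t1 -> F p <= C + (t1 - a) * (2^-1 * UG ^+ 2 * (d%:R ^+ 2 * B)).
  move=> /andP[ap pt1]; rewrite /F.
  have : 0 <= N * pos (t0 - p.1) ^+ 2.
    by rewrite mulr_ge0 ?sqr_ge0 // divr_ge0 // mulr_ge0 // ltW.
  have q0 : 0 <= 2^-1 * UG ^+ 2 * (d%:R ^+ 2 * B) by rewrite mulr_ge0 // mulr_ge0 // exprn_ge0.
  have : (t1 - p.1) * (Lam p - e) <= (t1 - a) * (2^-1 * UG ^+ 2 * (d%:R ^+ 2 * B)).
    apply: (@le_trans _ _ ((t1 - p.1) * (2^-1 * UG ^+ 2 * (d%:R ^+ 2 * B)))).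
      rewrite ler_wpM2l ?subr_ge0 //; have := LLam p; rewrite ler_norml => /andP[_].
      by have := LopB p; rewrite /e; lra.
    by rewrite ler_wpM2r // lerB.
  by have := h5 p; lra.
have at1 : a <= t1 by rewrite /t1; lra.
have cvt : {within [set p : E | a <= p.1 <= t1], continuous v} by exact: continuous_subspaceT.
have key k : 0 < k -> F (t0, x) <= v (t0, x) + k * penalty UG t1 (t0, x).
  move=> k0.
  apply: (comparison_sub_penalized ellG k0 Gg cvt _ (visc_super_right tb sv) hF subF FC).
  - by move=> p _; have := vM p; rewrite ler_norml => /andP[+ _]; exact.
  - move=> y; rewrite /F /= subrr mul0r addr0 pos_le0 ?expr0n /= ?mulr0 ?subr0 //.
    by rewrite /t1; lra.
  - by rewrite /= at0 /t1; lra.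
have := le_eps_mul key; rewrite /F /= subrr pos_ge0 // expr0n /= mulr0 subr0.
have -> : t1 - t0 = tau by rewrite /t1; ring.
have -> : tau * (Lam (t0, x) - e) = A psi (t0, x) - psi (t0, x) - tau * e.
  by rewrite /Lam; field; rewrite gt_eqF.
by rewrite -eE -/A; lra.
Qed.

(** The accumulated error is a constant, which the walk leaves unchanged and [nice_sub] carries
    through the induction. *)
Lemma many_steps B C psi m t0 tau x : 0 <= B -> nice B C psi -> a <= t0 -> 0 < tau ->
  t0 + m%:R * tau <= b -> (forall y, psi (t0 + m%:R * tau, y) <= v (t0 + m%:R * tau, y)) ->
  iter m (walk l (Num.sqrt (d%:R * tau))) psi (t0, x)
    - m%:R * tau * (B * Num.sqrt (d%:R * tau) * K0) <= v (t0, x).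
Proof.
move=> B0 np at0 tau0; set c := Num.sqrt _; set e := B * c * K0.
have e0 : 0 <= e by rewrite /e mulr_ge0 ?K0_ge0 // mulr_ge0 // sqrtr_ge0.
elim: m t0 x at0 => [|m IH] t0 x at0 tb h.
  by move: (h x); rewrite !mul0r subr0 addr0.
have nm : nice B C (iter m (walk l c) psi) by elim: m {IH tb h} => //= m IH; exact: nice_walk.
have tE : t0 + m.+1%:R * tau = t0 + tau + m%:R * tau by rewrite -natr1; ring.
have st y : iter m (walk l c) psi (t0 + tau, y) - m%:R * tau * e <= v (t0 + tau, y).
  by apply: IH; rewrite -?tE //; lra.
have t1b : t0 + tau <= b.
  by apply: le_trans tb; rewrite tE lerDl mulr_ge0 // ltW.
have k0 : 0 <= m%:R * tau * e by rewrite mulr_ge0 // mulr_ge0 // ltW.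
have := one_step x B0 (nice_sub k0 nm) at0 tau0 t1b st.
rewrite -/c -/e.
have -> : walk l c (fun p => iter m (walk l c) psi p - m%:R * tau * e) (t0, x) =
   walk l c (iter m (walk l c) psi) (t0, x) - m%:R * tau * e.
  by rewrite walkD walk_cst.
by rewrite /= -natr1 => h'; apply: le_trans h'; apply: le_of_eq; ring.
Qed.

End one_step.

Definition Tr : R := \sum_k enorm (l k) ^+ 2.

Lemma Tr_ge0 : 0 <= Tr. Proof. by apply: sumr_ge0 => k _; exact: sqr_ge0. Qed.

(** Before each of the [m] steps the walk is at mean squared distance at most [s * Tr] from [p]. The
    change of [Lop Fxx] is linear in the distance [x], and [x <= sqrt s + x ^+ 2 / sqrt s] reduces
    it to this second moment; hence an error of order [s * sqrt s], uniformly in [m]. *)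
Lemma iter_walk_lower F Fx Fxx B s m p (c := Num.sqrt (d%:R * (s / m%:R)))
    (K1 := 2^-1 * UG ^+ 2 * (d%:R ^+ 2 * (B * d%:R))) : 0 <= B -> 0 < s -> (0 < m)%N ->
  hasC12 F (fun=> 0) Fx Fxx -> LipH B Fxx -> (forall i j p t, Fxx i j (t, p.2) = Fxx i j p) ->
  F p + s * Lop Fxx p - K1 * (1 + Tr) * (s * Num.sqrt s) - s * (d%:R * c * B * S ^+ 3)
    <= iter m (walk l c) F p.
Proof.
move=> B0 s0 m0 hF lipF tF.
have mr0 : 0 < m%:R :> R by rewrite ltr0n.
have dr0 : 0 < d%:R :> R by rewrite ltr0n.
pose tau := s / m%:R; have tau0 : 0 < tau by rewrite divr_gt0.
have mtau : m%:R * tau = s by rewrite /tau mulrCA mulfV ?mulr1 // gt_eqF.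
have c0 : 0 <= c by exact: sqrtr_ge0.
have c2 : c ^+ 2 = d%:R * tau by rewrite sqr_sqrtr // mulr_ge0 // ltW.
have cd : c ^+ 2 / d%:R = tau by rewrite c2 mulrAC mulfV ?mul1r // gt_eqF.
have K10 : 0 <= K1.
  apply: mulr_ge0; first by rewrite mulr_ge0 ?invr_ge0 ?sqr_ge0.
  by apply: mulr_ge0; [exact: sqr_ge0|rewrite mulr_ge0 // ler0n].
have q0 : 0 < Num.sqrt s by rewrite sqrtr_gt0.
have qq : Num.sqrt s * Num.sqrt s = s by rewrite -expr2 sqr_sqrtr // ltW.
pose cst := tau * (Lop Fxx p - K1 * Num.sqrt s) - B * (c * S) ^+ 3.
pose k := tau * K1 / Num.sqrt s.
have k0 : 0 <= k by apply: divr_ge0 (ltW q0); rewrite mulr_ge0 // ltW.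
have step q : cst + - k * enorm (q.2 - p.2) ^+ 2 <= walk l c F q - F q.
  have := walk_expand q c0 B0 hF lipF.
  rewrite cd ler_norml => /andP[h _].
  have : `|Lop Fxx q - Lop Fxx p| <= K1 * enorm (q.2 - p.2).
    have -> : K1 * enorm (q.2 - p.2) =
        2^-1 * UG ^+ 2 * (d%:R ^+ 2 * (B * (d%:R * enorm (q.2 - p.2)))) by rewrite /K1; ring.
    apply: Lop_dist => i j.
    have -> : Fxx i j q = Fxx i j (p + (0, q.2 - p.2)).
      by rewrite -(tF i j q (p + (0, q.2 - p.2)).1); congr (Fxx i j); congr pair; rewrite /= addrC subrK.
    apply: le_trans (lipF i j p _) _; rewrite ler_wpM2l //; exact: sum_norm_le_enorm.
  rewrite ler_norml => /andP[h2 _].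
  set x := enorm (q.2 - p.2) in h2 *.
  have x0 : 0 <= x by exact: enorm_ge0.
  have hx : x <= Num.sqrt s + x ^+ 2 / Num.sqrt s.
    rewrite -(ler_pM2r q0) mulrDl divfK ?gt_eqF //.
    have := sqr_ge0 (x - Num.sqrt s); have := mulr_ge0 x0 (ltW q0).
    by move: (Num.sqrt s) => y; nra.
  have hK : K1 * x <= K1 * (Num.sqrt s + x ^+ 2 / Num.sqrt s) by rewrite ler_wpM2l.
  have : tau * (Lop Fxx p - K1 * (Num.sqrt s + x ^+ 2 / Num.sqrt s)) <= tau * Lop Fxx q.
    by rewrite ler_pM2l //; lra.
  have -> : - k * x ^+ 2 = - tau * (K1 * (x ^+ 2 / Num.sqrt s)) by rewrite /k; ring.
  rewrite /cst; lra.
have stepj (j : 'I_m) : cst - k * (s * Tr) <= iter j (walk l c) (fun q => walk l c F q - F q) p.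
  apply: le_trans (le_iter_walk l c d_gt0 j p step).
  rewrite iter_walkD iter_walk_cst // (iter_walkZ l c j (- k)) iter_walk_sqdist // subrr enorm0 expr0n /= add0r.
  rewrite mulNr lerD2l lerN2 ler_wpM2l // cd -/Tr mulrA ler_wpM2r ?Tr_ge0 //.
  by rewrite -mtau ler_pM2r // ler_nat ltnW.
rewrite iter_walk_telescope.
have : \sum_(j < m) (cst - k * (s * Tr)) <=
    \sum_(j < m) iter j (walk l c) (fun q => walk l c F q - F q) p.
  by apply: ler_sum => j _; exact: stepj.
rewrite sum_ord_const => h.
have e1 : m%:R * cst = s * (Lop Fxx p - K1 * Num.sqrt s) - s * (d%:R * c * B * S ^+ 3).
  rewrite /cst mulrBr mulrA mtau; congr (_ - _).
  have -> : m%:R * (B * (c * S) ^+ 3) = m%:R * c ^+ 2 * (c * B * S ^+ 3) by ring.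
  by rewrite c2 -mtau; ring.
have e2 : m%:R * (k * (s * Tr)) = K1 * Tr * (s * Num.sqrt s).
  rewrite /k.
  have -> : m%:R * (tau * K1 / Num.sqrt s * (s * Tr)) = m%:R * tau * K1 * Tr * (s / Num.sqrt s) by ring.
  rewrite mtau; have -> : s / Num.sqrt s = Num.sqrt s by rewrite -{1}qq mulfK ?gt_eqF.
  by ring.
move: h; rewrite mulrBr e1 e2; lra.
Qed.

Section frozen.
Context (a b : R) (v : E -> R) (M eps : R) (cv : continuous v) (vM : forall p, `|v p| <= M)
  (sv : visc_supersolution G a b v) (eps_gt0 : 0 < eps).
Local Notation X := (@xdirs R d eps).

Lemma M_ge0 : 0 <= M. Proof. exact: le_trans (normr_ge0 _) (vM 0). Qed.

Lemma avgs_time_indep es f t p : space_dirs es -> (forall q s, f (s, q.2) = f q) ->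
  avgs es f (t, p.2) = avgs es f p.
Proof.
move=> sp tf; rewrite (avgs_freeze _ t p) //; congr avgs; apply/funext => q; exact: tf.
Qed.

Lemma time_indep_derive f p : (forall q s, f (s, q.2) = f q) -> is_derive p dir_t f 0.
Proof.
move=> tf; apply/is_derive_dist => e e0; exists 1 => // s _.
have -> : f (p + s *: dir_t) = f p.
  rewrite [p + s *: dir_t]surjective_pairing (_ : (p + s *: dir_t).2 = p.2) ?tf //.
  by rewrite /= scaler0 addr0.
by rewrite subrr mulr0 subr0 normr0 mulr_ge0 // ltW.
Qed.

Lemma hasC12_frozen e t : 0 < e -> hasC12 (avgs (@xdirs R d e) (freeze t v)) (fun=> 0)
   (fun i => dx e i (xdirs e) (freeze t v)) (fun i j => dxx e i j (xdirs e) (freeze t v)).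
Proof.
move=> e0; apply: (hasC12_avgs e0).
- exact: continuous_freeze.
- exact: count_xdirs.
- move=> p; apply: time_indep_derive => q s; apply: avgs_time_indep => //.
  exact: xdirs_space.
- exact: cst_continuous.
Qed.

(** A mollification is close to the slice only on bounded sets. Subtracting
    [k * (1 + enorm p.2 ^+ 2)] puts it below everywhere: within radius [r] by uniform continuity,
    outside because the quadratic exceeds [2 * M]. *)
Lemma approx_from_below t k : 0 < k -> exists B C psi,
  [/\ 0 <= B, nice B C psi, forall p, psi p <= freeze t v p &
      forall p, freeze t v p - 2 * k * (1 + enorm p.2 ^+ 2) <= psi p].
Proof.
move=> k0; have M0 := M_ge0; set g0 := freeze t v.
have cg : continuous g0 by exact: continuous_freeze.
have gM p : `|g0 p| <= M by exact: vM.
pose r := 1 + 2 * M / k.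
have [h h0 H] := compact_uniform (@compact_slab R d 0 0 r) cg k0.
have d0 : 0 < 3 * d%:R :> R by rewrite mulr_gt0 // ltr0n.
pose e := h / (3 * d%:R); have e0 : 0 < e by rewrite divr_gt0.
pose A := avgs (@xdirs R d e) g0.
have tA p s : A (s, p.2) = A p by apply: avgs_time_indep => //; exact: xdirs_space.
have close p : `|A p - g0 p| <= k * (1 + enorm p.2 ^+ 2).
  have [ps|ps] := pselect (slab 0 0 r (0, p.2)).
    apply: (@le_trans _ _ k); last by rewrite ler_peMr ?(ltW k0) // lerDl sqr_ge0.
    have -> : g0 p = g0 (0, p.2) by []. rewrite -(tA p 0).
    apply: avgs_dist => // q qp; apply: H => //; apply: le_trans qp _.
    by apply: le_trans (spread_xdirs e0) _; rewrite /e mulrCA mulfV ?mulr1 // gt_eqF.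
  have [i ri] : exists i, r < `|p.2 i 0|.
    apply: contra_notP ps => hh; split; first by rewrite /= lexx.
    by move=> i; rewrite leNgt; apply/negP => ?; apply: hh; exists i.
  have rp : r < enorm p.2 by apply: lt_le_trans ri (enorm_coord _ _ _).
  apply: (@le_trans _ _ (2 * M)).
    apply: le_trans (ler_normB _ _) _; have := gM p; have := avgs_bound (xdirs e) p cg gM.
    by rewrite -/(A p); lra.
  have kr : k * r = k + 2 * M by rewrite /r; field; rewrite gt_eqF.
  have r1 : 1 <= r by rewrite /r lerDl divr_ge0 ?mulr_ge0 // ltW.
  have rr : r <= enorm p.2 ^+ 2.
    apply: (@le_trans _ _ (r ^+ 2)); first by rewrite expr2 ler_peMr // (le_trans ler01).
    by rewrite ler_pXn2r ?nnegrE ?enorm_ge0 ?ltW // (lt_le_trans ltr01).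
  have := ler_wpM2l (ltW k0) rr; rewrite kr; lra.
pose psi p := A p - k * (1 + enorm p.2 ^+ 2).
have hA := hasC12_frozen t e0.
have ei : 0 <= e^-1 by rewrite invr_ge0 ltW.
pose B1 := e^-1 * (e^-1 * (e^-1 * (2 * (2 * (2 * M))))).
pose B2 := e^-1 * (e^-1 * (2 * (2 * M))) + 2 * k.
have B10 : 0 <= B1 by rewrite /B1 !mulr_ge0.
have B20 : 0 <= B2 by rewrite /B2 addr_ge0 ?mulr_ge0 // ltW.
exists (B1 + B2), M, psi; split.
- exact: addr_ge0.
- exists (fun i p => dx e i (xdirs e) g0 p - k * (2 * p.2 i 0)),
    (fun i j p => dxx e i j (xdirs e) g0 p - k * (2 * (i == j)%:R)); split.
  + by apply: (hasC12_ext (hasC12D hA (hasC12Z (- k) (hasC12D (@hasC12_cst R d 1) hasC12_sqnorm))))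
      => [p|p|i p|i j p]; rewrite /psi /A; ring.
  + move=> i j p w; rewrite (_ : _ - _ = dxx e i j (xdirs e) g0 (p + (0, w)) - dxx e i j (xdirs e) g0 p).
      apply: le_trans (LipH_avgs e0 cg (@count_xdirs R d e) gM i j p w) _.
      by rewrite ler_wpM2r ?sumr_ge0 // lerDl.
    by ring.
  + move=> i j p; apply: le_trans (ler_normB _ _) _.
    have := dxx_bound e0 (xdirs e) cg gM i j p.
    have : `|k * (2 * (i == j)%:R)| <= 2 * k.
      rewrite normrM (gtr0_norm k0) mulrC ler_pM2r // ger0_norm ?mulr_ge0 //.
      by case: (i == j); rewrite ?mulr1 ?mulr0.
    by rewrite /B2; lra.
  + by move=> p s; rewrite /psi tA.
  + move=> p; rewrite /psi; have := avgs_bound (xdirs e) p cg gM.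
    rewrite ler_norml => /andP[_]; rewrite -/A.
    have : 0 <= k * (1 + enorm p.2 ^+ 2) by rewrite mulr_ge0 ?(ltW k0) // addr_ge0 ?sqr_ge0.
    by rewrite -/(A p); lra.
- by move=> p; rewrite /psi; have := close p; rewrite ler_norml => /andP[_]; rewrite -/g0; lra.
- by move=> p; rewrite /psi; have := close p; rewrite ler_norml => /andP[+ _]; lra.
Qed.

Definition K1c : R := 2^-1 * UG ^+ 2 *
  (d%:R ^+ 2 * (eps^-1 * (eps^-1 * (eps^-1 * (2 * (2 * (2 * M))))) * d%:R)).

(** That [v] at time [t] dominates the mean of [v] at time [t + s] over the walk is, up to errors, a
    linear inequality, in contrast to the definition by test functions. It passes to averages, which
    commute with the walk, and the walk of the averaged function can be expanded by
    [iter_walk_lower]. *)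
Lemma mollified_step t s x : a <= t -> 0 < s -> t + s <= b ->
  avgs X v (t + s, x) + s * Lop (fun i j => dxx eps i j X v) (t + s, x)
    - K1c * (1 + Tr) * (s * Num.sqrt s) <= avgs X v (t, x).
Proof.
move=> at0 s0 tsb; have M0 := M_ge0.
pose p : E := (t, x).
set g0 := freeze (t + s) v.
have cg : continuous g0 by exact: continuous_freeze.
have gM q : `|g0 q| <= M by exact: vM.
pose F := avgs X g0.
pose B := eps^-1 * (eps^-1 * (eps^-1 * (2 * (2 * (2 * M))))).
have B0 : 0 <= B by rewrite /B !mulr_ge0 ?invr_ge0 ?(ltW eps_gt0).
have FE : avgs X v (t + s, x) = F p.
  by rewrite -[x]/(p.2) (avgs_freeze _ (t + s) p) //; exact: xdirs_space.
have FL : Lop (fun i j => dxx eps i j X v) (t + s, x) = Lop (fun i j => dxx eps i j X g0) p.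
  rewrite /Lop; congr (_ * \tr (_ *m _)); apply/matrixP => i j; rewrite !mxE.
  by rewrite -[x]/(p.2) dxx_freeze //; exact: xdirs_space.
rewrite FE FL.
apply/ler_addgt0Pr => eta eta0.
pose P (q : E) := 2 * (1 + enorm q.2 ^+ 2 + s * Tr).
have cP : continuous P.
  have := hasC12D (hasC12D (@hasC12_cst R d 1) hasC12_sqnorm) (hasC12_cst (s * Tr)).
  by move=> /(hasC12Z 2) [].
pose Pn := avgs X P p.
pose k := eta / 2 / (`|Pn| + 1).
have k0 : 0 < k by rewrite !divr_gt0 // ltr_wpDl.
have kP : k * Pn <= eta / 2.
  rewrite /k mulrAC ler_pdivrMr ?ltr_wpDl // ler_wpM2l ?divr_ge0 ?(ltW eta0) //.
  by apply: le_trans (ler_norm _) _; rewrite lerDl.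
have [B' [C [psi [B'0 npsi psig gpsi]]]] := approx_from_below (t + s) k0.
pose Kx := B' * K0 + d%:R * B * S ^+ 3.
have S0 : 0 <= S := S_ge0.
have Kx0 : 0 <= Kx.
  apply: addr_ge0; last by apply: mulr_ge0; [apply: mulr_ge0 => //; exact: ler0n|exact: exprn_ge0].
  by apply: mulr_ge0 => //; exact: K0_ge0.
(* The number of steps is chosen last: [B'] depends on the accuracy [k] and may be huge, but the
   error carries the factor [c], which vanishes as the step shrinks. *)
have [m m0 mc] : exists2 m, (0 < m)%N & s * (Num.sqrt (d%:R * (s / m%:R)) * Kx) <= eta / 2.
  pose z := eta / 2 / (s * (Kx + 1)).
  have z0 : 0 < z by rewrite !divr_gt0 // mulr_gt0 // ltr_wpDl.
  pose y := d%:R * s / z ^+ 2.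
  have y0 : 0 <= y by rewrite divr_ge0 ?sqr_ge0 // mulr_ge0 // ltW.
  exists (Num.bound y).+1 => //.
  have yb : y < (Num.bound y).+1%:R.
    by apply: lt_trans (archi_boundP y0) _; rewrite ltr_nat.
  have n0 : 0 < (Num.bound y).+1%:R :> R by rewrite ltr0n.
  have : Num.sqrt (d%:R * (s / (Num.bound y).+1%:R)) <= z.
    rewrite -(ger0_norm (ltW z0)) -sqrtr_sqr ler_sqrt ?sqr_ge0 // mulrA ler_pdivrMr //.
    by rewrite -ler_pdivrMl ?exprn_gt0 // mulrC ltW.
  move: (Num.sqrt _) => c cz.
  apply: (@le_trans _ _ (s * (z * (Kx + 1)))).
    rewrite ler_pM2l //; apply: (@le_trans _ _ (z * Kx)); first by rewrite ler_wpM2r.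
    by rewrite ler_wpM2l ?(ltW z0) // lerDl.
  rewrite /z; apply: le_of_eq; field.
  by rewrite !gt_eqF // ltr_wpDl.
set c := Num.sqrt _ in mc.
have mr0 : 0 < m%:R :> R by rewrite ltr0n.
have mtau : m%:R * (s / m%:R) = s by rewrite mulrCA mulfV ?mulr1 // gt_eqF.
have tau0 : 0 < s / m%:R by rewrite divr_gt0.
have low q : iter m (walk l c) g0 q + (- k * P q + - (s * (B' * c * K0))) <= freeze t v q.
  have st := @many_steps a b v M cv vM sv B' C psi m t (s / m%:R) q.2 B'0 npsi at0 tau0.
  rewrite mtau in st; have {}st := st tsb (fun y => psig (t + s, y)).
  have tpsi : iter m (walk l c) psi (t, q.2) = iter m (walk l c) psi q.
    have [? [? [_ _ _ h _]]] : nice B' C (iter m (walk l c) psi).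
      by elim: (m) => //= n IH; exact: nice_walk.
    exact: h.
  rewrite tpsi in st; apply: le_trans st.
  rewrite addrA lerD2r.
  apply: le_trans (le_iter_walk l c d_gt0 m q gpsi).
  rewrite -/g0.
  have -> : (fun q => g0 q - 2 * k * (1 + enorm q.2 ^+ 2)) =
      (fun q => g0 q + (- (2 * k) + - (2 * k) * enorm (q.2 - 0) ^+ 2)).
    by apply/funext => y; rewrite subr0; ring.
  rewrite iter_walkD lerD2l iter_walkD iter_walk_cst // (iter_walkZ l c m (- (2 * k))) iter_walk_sqdist // subr0.
  have c2 : c ^+ 2 = d%:R * (s / m%:R).
    by rewrite sqr_sqrtr //; apply: mulr_ge0; [exact: ler0n|exact: ltW].
  rewrite c2 -/Tr.
  rewrite (_ : m%:R * _ = s * Tr); first by rewrite /P; lra.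
  by field; rewrite !gt_eqF // ltr0n.
have cft : continuous (freeze t v) by exact: continuous_freeze.
have cI : continuous (iter m (walk l c) g0) by exact: continuous_iter_walk.
have ckP := continuous_scale (- k) cP; have cD := @continuous_add R E.
have cc (z : R) : continuous (fun _ : E => z) := @cst_continuous _ _ z.
have h := le_avgs (es := X) (p := p) (cD _ _ cI (cD _ _ ckP (cc (- (s * (B' * c * K0)))))) cft
  (fun q _ => low q).
rewrite -(avgs_freeze v t p (@xdirs_space R d eps)) -[(t, p.2)]/(t, x) in h.
rewrite avgsD // in h; last exact: cD.
rewrite avgsD // avgsZ // avgs_cst avgs_iter_walk // in h.
have hl := iter_walk_lower p B0 s0 m0 (hasC12_frozen (t + s) eps_gt0)
  (LipH_avgs eps_gt0 cg (@count_xdirs R d eps) gM).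
have tF i j (q : E) t' : dxx eps i j X g0 (t', q.2) = dxx eps i j X g0 q.
  by rewrite dxx_freeze //; exact: xdirs_space.
have := hl tF; rewrite -/c -/B -/F => {}hl.
move: h hl mc; rewrite -/Pn -/F /Kx /K1c -/B mulNr => h hl mc.
have eK : s * (c * (B' * K0 + d%:R * B * S ^+ 3)) =
  s * (B' * c * K0) + s * (d%:R * c * B * S ^+ 3) by ring.
move: mc; rewrite eK => mc.
lra.
Qed.

Local Notation TX := (@txdirs R d eps).
Local Notation W := (avgs TX v).

Lemma tdir_xdir i : (tdir eps == xdir eps i :> E) = false.
Proof.
apply/negP => /eqP /(congr1 fst) /= /eqP.
by rewrite scaler0 [_ *: _]mulr1 gt_eqF.
Qed.

Lemma count_txdirs i : (3 <= count_mem (xdir eps i) TX)%N.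
Proof. by rewrite /= (eq_sym (tdir eps)) eq_sym tdir_xdir add0n count_xdirs. Qed.

Definition mollt : E -> R := fun p => eps^-1 * avgs X (fdiff (tdir eps) v) p.

Lemma hasC12_mollified : hasC12 W mollt (fun i => dx eps i TX v) (fun i j => dxx eps i j TX v).
Proof.
apply: (hasC12_avgs eps_gt0) => //.
- exact: count_txdirs.
- move=> p; have := is_derive_scale eps^-1 (avgs_derive cv (mem_head (tdir eps) X) p).
  by rewrite /= eqxx scalerA mulVf ?gt_eqF // scale1r.
- by apply: continuous_scaleavgs; exact: continuous_fdiff.
Qed.

Lemma continuous_dxx i j es : continuous (dxx eps i j es v).
Proof.
apply: continuous_scale.
by apply: continuous_scaleavgs; do 2! apply: (continuous_fdiff).
Qed.

Lemma LopE fxx p : Lop fxx p = \sum_i \sum_j 2^-1 * g j i * fxx i j p.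
Proof.
rewrite /Lop /mxtrace mulr_sumr; apply: eq_bigr => i _.
by rewrite !mxE mulr_sumr; apply: eq_bigr => j _; rewrite mxE; ring.
Qed.

Lemma continuous_Lop fxx : (forall i j, continuous (fxx i j)) -> continuous (Lop fxx).
Proof.
move=> cf; rewrite (_ : Lop fxx = fun p => \sum_i \sum_j 2^-1 * g j i * fxx i j p).
  by do 2! apply: continuous_sum => ?; exact: continuous_scale.
by apply/funext => p; exact: LopE.
Qed.

Lemma avg_Lop p : avg (tdir eps) (Lop (fun i j => dxx eps i j X v)) p =
  Lop (fun i j => dxx eps i j TX v) p.
Proof.
rewrite (_ : Lop (fun i j => dxx eps i j X v) =
  fun p => \sum_i \sum_j 2^-1 * g j i * dxx eps i j X v p); last first.
  by apply/funext => q; exact: LopE.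
have cm i j : continuous (fun q => 2^-1 * g j i * dxx eps i j X v q).
  by apply: continuous_scale; exact: continuous_dxx.
rewrite LopE -[LHS]/(avgs [:: tdir eps] _ p) avgs_sum; last by move=> i; exact: continuous_sum.
apply: eq_bigr => i _; rewrite avgs_sum //.
apply: eq_bigr => j _; rewrite avgsZ /=; last exact: continuous_dxx.
congr (_ * _).
have cff : continuous (fdiff (xdir eps i) (fdiff (xdir eps j) v)).
  by do 2! apply: (continuous_fdiff).
rewrite /dxx /txdirs /= tdir_xdir /= tdir_xdir /=.
rewrite avgZ; last exact: continuous_scaleavgs.
by rewrite avgZ; last exact: continuous_avgs.
Qed.

(** A further average, along time, creates the missing time derivative; all times [t + r * eps] it
    involves are in the range of [mollified_step]. *)
Lemma mollified_time_step t s x : a <= t -> 0 < s -> t + eps + s <= b ->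
  W (t + s, x) + s * Lop (fun i j => dxx eps i j TX v) (t + s, x)
    - K1c * (1 + Tr) * (s * Num.sqrt s) <= W (t, x).
Proof.
move=> at0 s0 tsb.
have cA : continuous (avgs X v) by exact: continuous_avgs.
have cL : continuous (Lop (fun i j => dxx eps i j X v)).
  by apply: continuous_Lop => i j; exact: continuous_dxx.
have cs := @continuous_shift R E (s, 0).
have cc (z : R) : continuous (fun _ : E => z) := @cst_continuous _ _ z.
have cD := @continuous_add R E; have cZ := @continuous_scale R E.
pose K := K1c * (1 + Tr) * (s * Num.sqrt s).
have := @le_avg _ _ (tdir eps) (fun q : E => avgs X v (q + ((s, 0) : E)) +
   (s * Lop (fun i j => dxx eps i j X v) (q + ((s, 0) : E)) + - K)) (avgs X v) (t, x).
have cf : continuous (fun q : E => avgs X v (q + ((s, 0) : E)) +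
   (s * Lop (fun i j => dxx eps i j X v) (q + ((s, 0) : E)) + - K)).
  by apply: (cD); [exact: cs|apply: (cD) => //; apply: (cZ); exact: cs].
move=> /(_ cf cA) h; have {}h := h _.
have {}h : avg (tdir eps) (fun q : E => avgs X v (q + ((s, 0) : E)) +
   (s * Lop (fun i j => dxx eps i j X v) (q + ((s, 0) : E)) + - K)) (t, x) <= W (t, x).
  apply: h => r /andP[r0 r1].
  have -> : (t, x) + r *: tdir eps = (t + r * eps, x) :> E.
    by congr pair; rewrite /= ?scaler0 ?addr0 // [eps *: _]mulr1.
  have -> : (t + r * eps, x) + (s, 0) = (t + r * eps + s, x) :> E by congr pair; rewrite /= addr0.
  have re : 0 <= r * eps <= eps by rewrite mulr_ge0 ?(ltW eps_gt0) // ler_piMl // ltW.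
  by rewrite addrA; apply: mollified_step => //; lra.
move: h; rewrite avgD; [|exact: cs|by apply: (cD) => //; apply: (cZ); exact: cs].
rewrite avgD //; last by apply: (cZ); exact: cs.
rewrite avgZ; last exact: cs.
rewrite !avg_shift avg_cst avg_Lop.
have -> : (t, x) + (s, 0) = (t + s, x) :> E by congr pair; rewrite /= addr0.
by rewrite addrA.
Qed.

Lemma time_step_ineq (s del w0 w1 l0 l1 m k : R) : 0 < s -> - (del * s) <= w1 - w0 - s * m ->
  - del <= l1 - l0 -> k <= s * del -> w1 + s * l1 - k <= w0 -> m + l0 <= 3 * del.
Proof.
move=> s0 d1 d2 ks st; rewrite -(ler_pM2l s0).
have : s * (- del) <= s * (l1 - l0) by rewrite ler_pM2l.
by lra.
Qed.

(** Dividing [mollified_time_step] by [s] leaves an error of order [sqrt s]. The average in time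
    looks ahead by [eps], hence the distance kept from [b]. *)
Lemma mollified_linear p : a <= p.1 -> p.1 + eps < b ->
  mollt p + Lop (fun i j => dxx eps i j TX v) p <= 0.
Proof.
move=> ap pb; rewrite leNgt; apply/negP => pos0.
set LW := Lop _ in pos0 *.
have [del del0 delE] : exists2 del : R, 0 < del & mollt p + LW p = 4 * del.
  by exists ((mollt p + LW p) / 4); [rewrite divr_gt0|rewrite mulrC mulfVK].
have [_ [dW _] _ _] := hasC12_mollified.
have /is_derive_dist/(_ _ del0)[h1 h10 H1] := dW p.
have cLW : continuous LW by apply: continuous_Lop => i j; exact: continuous_dxx.
have /continuous_dist/(_ _ del0)[h2 h20 H2] := cLW p.
pose K := `|K1c * (1 + Tr)| + 1.
have K0 : 0 < K by rewrite ltr_wpDl.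
have [s [s0 sh1 sh2 sb sk]] : exists s : R, [/\ 0 < s, s <= h1 / 2, s <= h2 / 2,
    s <= b - (p.1 + eps) & s <= (del / K) ^+ 2].
  exists (Num.min (Num.min (h1 / 2) (h2 / 2)) (Num.min (b - (p.1 + eps)) ((del / K) ^+ 2))).
  split; rewrite ?ge_min ?lexx ?orbT //.
  by rewrite !lt_min !divr_gt0 // subr_gt0 pb exprn_gt0 // divr_gt0.
have tsb : p.1 + eps + s <= b by lra.
have := mollified_time_step p.2 ap s0 tsb.
have -> : (p.1, p.2) = p by case: (p).
have -> : (p.1 + s, p.2) = p + s *: dir_t.
  rewrite [RHS]surjective_pairing; congr pair; rewrite /= ?scaler0 ?addr0 // [_ *: _]mulr1.
  by [].
have n1 : `|s| < h1 by rewrite gtr0_norm //; apply: le_lt_trans sh1 _; rewrite ltr_pdivrMr // ltr_pMr // ltr1n.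
have := H1 s n1; rewrite (gtr0_norm s0) ler_norml => /andP[d1 _].
have n2 : `|p + s *: dir_t - p| < h2.
  rewrite addrC addKr normrZ gtr0_norm // norm_dir_t mulr1; apply: le_lt_trans sh2 _.
  by rewrite ltr_pdivrMr // ltr_pMr // ltr1n.
have := H2 _ n2; rewrite ler_norml => /andP[d2 _].
have qs : Num.sqrt s <= del / K.
  by rewrite -(ger0_norm (ltW (divr_gt0 del0 K0))) -sqrtr_sqr ler_sqrt ?sqr_ge0.
have kk : K1c * (1 + Tr) * Num.sqrt s <= del.
  apply: (@le_trans _ _ (K * Num.sqrt s)).
    by rewrite ler_wpM2r ?sqrtr_ge0 // /K; apply: le_trans (ler_norm _) _; rewrite lerDl.
  by rewrite mulrC -ler_pdivlMr.
have ks : K1c * (1 + Tr) * (s * Num.sqrt s) <= s * del.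
  by rewrite [s * Num.sqrt s]mulrC mulrA mulrC ler_pM2l.
move/(time_step_ineq s0 d1 d2 ks); rewrite delE ler_pM2r // leNgt ltr_nat.
by [].
Qed.

End frozen.
End walk_expansion.

(** The same average [avgs (txdirs eps) v] satisfies the linear inequality for each [g] in [Gamma],
    and the supremum over [g] restores [G]. It is here that [G] has to be a supremum of linear
    operators. *)
Theorem mollified_supersolution a b (v : E -> R) M eps : continuous v ->
  (forall p, `|v p| <= M) -> visc_supersolution G a b v -> 0 < eps ->
  exists Wt Wx Wxx, hasC12 (avgs (txdirs eps) v) Wt Wx Wxx /\
    forall p : E, a <= p.1 -> p.1 + eps < b -> Wt p + G (hess Wxx p) <= 0.
Proof.
move=> cv vM sv eps0.
exists (mollt v eps), (fun i => dx eps i (txdirs eps) v), (fun i j => dxx eps i j (txdirs eps) v).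
split; first exact: hasC12_mollified.
move=> p ap pb; rewrite addrC -lerBrDr sub0r; apply: (Gfun_le ellG) => g Gg.
have [l gE _] := elliptic_decomp ellG Gg.
have lS k : \sum_i `|l k i 0| <= \sum_k \sum_i `|l k i 0|.
  rewrite [leRHS](bigD1 k) //= lerDl; apply: sumr_ge0 => j _; exact: sumr_ge0.
have := mollified_linear Gg gE lS cv vM sv eps0 ap pb.
by rewrite /Lop; lra.
Qed.

(** * Comparison and uniqueness *)

Lemma within_dist {V : normedModType R} (D : set V) (f : V -> R) :
  {within D, continuous f} -> forall p e, D p -> 0 < e ->
  exists2 h : R, 0 < h & forall q, D q -> `|q - p| < h -> `|f q - f p| <= e.
Proof.
move=> /subspace_continuousP cf p e Dp e0; have /cvgrPdist_le/(_ e e0) := cf p Dp.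
rewrite near_withinE => /nbhs_dist[h h0 H]; exists h => // q Dq qp.
by rewrite distrC; apply: H.
Qed.

Section clamp.
Context (a b : R) (ab : a <= b).

(** Box averages look outside the strip; holding the time at the end points makes a function
    continuous and bounded everywhere without altering it on the strip. *)
Definition clamp (p : E) : E := (Num.max a (Num.min p.1 b), p.2).

Lemma clamp_in p : a <= (clamp p).1 <= b.
Proof. by rewrite /clamp /= le_max lexx /= ge_max ab ge_min lexx orbT. Qed.

Lemma clamp_id p : a <= p.1 <= b -> clamp p = p.
Proof. by case: p => t x /= /andP[at0 tb]; rewrite /clamp /= (min_l tb) (max_r at0). Qed.

Lemma clamp_lip p q : `|clamp q - clamp p| <= `|q - p|.
Proof.
rewrite !prod_normE /= ge_max !le_max lexx orbT andbT; apply/orP; left.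
have := ler_norm (q.1 - p.1); have := ler_norm (- (q.1 - p.1)); rewrite normrN ler_norml.
move: ab p.1 q.1 `|_| => ab' s t z h1 h2.
case: (leP t b) => ?; case: (leP s b) => ?; [case: (leP a t) => ?; case: (leP a s) => ?|
  case: (leP a t) => ?; case: (leP a b) => ?|case: (leP a b) => ?; case: (leP a s) => ?|
  case: (leP a b) => ?]; apply/andP; split; lra.
Qed.

Lemma continuous_clamp (u : E -> R) : {within [set p : E | a <= p.1 <= b], continuous u} ->
  continuous (u \o clamp).
Proof.
move=> cu p; apply/continuous_dist => e e0.
have [h h0 H] := within_dist cu (clamp_in p) e0; exists h => // q qp.
by apply: H; [exact: clamp_in|exact: le_lt_trans (clamp_lip p q) qp].
Qed.

Lemma visc_supersolution_clamp G v : visc_supersolution G a b v ->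
  visc_supersolution G a b (v \o clamp).
Proof.
move=> sv f p fC [Dp fp]; apply: sv => //; split=> //.
have cE q : strip a b q -> clamp q = q.
  by move=> /andP[aq qb]; apply: clamp_id; rewrite aq ltW.
move: fp; rewrite !near_withinE; apply: filterS => q h /[dup] Dq /h.
by rewrite /= !cE.
Qed.

End clamp.

Section comparison.
Implicit Types (u v F : E -> R).

(** Smooth supersolutions near [F] are available only up to [b - eps], where they are compared with
    [u] after adding [3 * k]: one [k] each for the changes of [u] and of [F] between [b - eps] and
    [b], and one for the distance of [f] to [F]. Outside the slab of radius [r] the quadratic room
    of [comparison_super_penalized] exceeds [M - C]. *)
Lemma comparison_approx a b u F (M C : R) : a <= b ->
  {within [set p : E | a <= p.1 <= b], continuous u} ->
  (forall p : E, a <= p.1 <= b -> u p <= M) ->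
  visc_subsolution G a b u ->
  continuous F ->
  (forall r e, 0 < e -> exists2 h : R, 0 < h & forall eps, 0 < eps <= h ->
    exists f ft fx fxx, [/\ hasC12 f ft fx fxx,
      forall p : E, a <= p.1 -> p.1 + eps < b -> ft p + G (hess fxx p) <= 0,
      forall p : E, a <= p.1 <= b -> C <= f p &
      forall p, slab a b r p -> `|f p - F p| <= e]) ->
  (forall x, u (b, x) <= F (b, x)) ->
  forall p : E, a <= p.1 <= b -> u p <= F p.
Proof.
move=> ab cu uM su cF H uF p /andP[ap pb].
have [pb'|pb'] := eqVneq p.1 b.
  by rewrite (_ : p = (b, p.2)) ?uF // [LHS]surjective_pairing pb'.
have {}pb' : p.1 < b by rewrite lt_neqAle pb'.
apply: (@le_eps_mul _ _ _ (4 + penalty UG b p)) => k k0.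
pose r := 1 + `|M - C| / k + enorm p.2.
have r1 : 1 <= r by rewrite /r -addrA lerDl addr_ge0 ?enorm_ge0 // divr_ge0 // ltW.
have [h1 h10 H1] := H r k k0.
have [h2 h20 H2] := compact_uniform (@compact_slab R d a b r) (continuous_clamp ab cu) k0.
have [h3 h30 H3] := compact_uniform (@compact_slab R d a b r) cF k0.
pose eps := Num.min (Num.min h1 h2) (Num.min h3 ((b - p.1) / 2)).
have eps0 : 0 < eps by rewrite !lt_min h10 h20 h30 divr_gt0 // subr_gt0.
have e1 : eps <= h1 by rewrite /eps !ge_min lexx.
have e2 : eps <= h2 by rewrite /eps !ge_min lexx !orbT.
have e3 : eps <= h3 by rewrite /eps !ge_min lexx !orbT.
have e4 : eps <= (b - p.1) / 2 by rewrite /eps !ge_min lexx !orbT.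
move: eps eps0 e1 e2 e3 e4 => eps eps0 e1 e2 e3 e4.
have pbe : p.1 <= b - eps by lra.
have abe : a <= b - eps by exact: le_trans pbe.
have beb : b - eps <= b by rewrite gerBl ltW.
have := H1 eps; rewrite eps0 e1 => /(_ isT)[f [ft [fx [fxx [hf sf Cf fF]]]]].
have sub0 q : a <= q.1 <= b - eps -> a <= q.1 <= b.
  by move=> /andP[-> /le_trans]; apply.
have ch : hasC12 (fun q => f q + 3 * k) (fun q => ft q + 0) (fun i q => fx i q + 0)
  (fun i j q => fxx i j q + 0) by apply: hasC12D hf _; exact: hasC12_cst.
have pslab : slab a b r p.
  split; first by rewrite ap.
  move=> i; apply: le_trans (enorm_coord _ i 0) _; rewrite /r lerDr.
  by rewrite addr_ge0 // divr_ge0 // ltW.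
have fpF : f p <= F p + k.
  by have := fF _ pslab; rewrite ler_norml => /andP[_]; rewrite lerBlDr addrC.
suff : u p <= f p + 3 * k + k * penalty UG (b - eps) p.
  have : k * penalty UG (b - eps) p <= k * penalty UG b p.
    by rewrite ler_pM2l // /penalty lerD2l ler_wpM2l ?Kpen_ge0 // lerD2r.
  move=> h4 h5; apply: le_trans h5 _; move: h4 fpF.
  by move: (penalty _ _ _) (penalty _ _ _) (f p) (F p) => *; lra.
apply: (@comparison_super_penalized R d Gamma lG UG ellG a (b - eps) u _ _ _ _ k M C k0 _ _ _ ch) => //.
- by apply: (continuous_subspaceW _ cu) => q; exact: sub0.
- by move=> q /sub0; exact: uM.
- move=> g q gC [Dq gq]; apply: (su g q gC); apply: local_max_on_right beb _; split => //.
- move=> q /andP[aq qb]; rewrite addr0 (_ : hess _ q = hess fxx q); last first.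
    by apply/matrixP => i j; rewrite !mxE addr0.
  by apply: sf => //; lra.
- by move=> q /sub0/Cf h; apply: le_trans h _; rewrite lerDl mulr_ge0 // ltW.
move=> x; have kx : 0 <= k * (1 + enorm x ^+ 2) by apply: mulr_ge0 (ltW k0) (addr_ge0 ler01 (sqr_ge0 _)).
have [xr|] := pselect (forall i, `|x i 0| <= r).
  have s1 : slab a b r (b, x) by split=> //=; rewrite ab lexx.
  have s2 : slab a b r (b - eps, x) by split=> //=; rewrite abe beb.
  have nn : `|((b - eps, x) : E) - (b, x)| = eps.
    rewrite prod_normE /= subrr normr0 addrAC subrr add0r normrN max_l ?normr_ge0 //.
    by rewrite gtr0_norm.
  have := H2 _ (b - eps, x) s1; rewrite nn => /(_ e2); rewrite /= !clamp_id ?ab ?lexx ?abe ?beb //.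
  rewrite ler_norml => /andP[_ u1].
  have := H3 _ (b - eps, x) s1; rewrite nn => /(_ e3); rewrite ler_norml => /andP[u2 _].
  have := fF _ s2; rewrite ler_norml => /andP[u3 _]; have u4 := uF x.
  by move: u1 u2 u3 u4 kx; move: (u _) (u _) (F _) (F _) (f _) (k * _) => *; lra.
move=> /existsNP[i /negP]; rewrite -ltNge => xi.
have rx : r < enorm x by apply: lt_le_trans xi (enorm_coord _ _ _).
have rx2 : r <= enorm x ^+ 2.
  apply: le_trans (ltW rx) _; rewrite expr2 ler_peMr ?enorm_ge0 //.
  by apply: le_trans r1 (ltW rx).
have Mk : M - C <= k * (1 + enorm x ^+ 2).
  apply: le_trans (_ : k * r <= _); last first.
    by rewrite ler_pM2l //; apply: le_trans rx2 _; rewrite lerDr.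
  apply: le_trans (ler_norm _) _; rewrite mulrC -ler_pdivrMr // /r.
  by rewrite addrAC lerDr addr_ge0 ?enorm_ge0.
have ubx : u (b - eps, x) <= M by apply: uM; rewrite /= abe beb.
have Cfx : C <= f (b - eps, x) by apply: Cf; rewrite /= abe beb.
by move: ubx Cfx Mk kx; move: (u _) (f _) (k * _) => *; lra.
by rewrite ap.
Qed.

Lemma mollified_close a b v r e : continuous v -> 0 < e ->
  exists2 h : R, 0 < h & forall eps, 0 < eps <= h ->
    forall p, slab a b r p -> `|avgs (txdirs eps) v p - v p| <= e.
Proof.
move=> cv e0; have [h h0 H] := compact_uniform (@compact_slab R d a b r) cv e0.
have D0 : 0 < 3 * d%:R + 1 :> R by rewrite ltr_wpDl // mulr_ge0.
exists (h / (3 * d%:R + 1)); first by rewrite divr_gt0.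
move=> eps /andP[eps0]; rewrite ler_pdivlMr // => eh p sp.
apply: avgs_dist => // q qp; apply: H => //; apply: le_trans qp _; apply: le_trans eh.
rewrite /txdirs /spread big_cons; have := @spread_xdirs R d eps eps0; rewrite /spread.
have -> : `|tdir eps : E| = eps.
  by rewrite /tdir normrZ norm_dir_t mulr1 gtr0_norm.
by move: (\sum_(_ <- _) _) => *; lra.
Qed.

Lemma avgs_ge es v c p : continuous v -> (forall q, c <= v q) -> c <= avgs es v p.
Proof.
move=> cv h; rewrite -[leLHS](avgs_cst es c p); apply: le_avgs => //; exact: cst_continuous.
Qed.

(** The smooth term [q] carries constants as well as the barriers that yield moments; since [G] is
    subadditive, adding it to a mollified supersolution gives a supersolution again. *)
Theorem comparison a b u v q qt qx qxx (Mu Mv C : R) : a <= b ->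
  {within [set p : E | a <= p.1 <= b], continuous u} ->
  (forall p : E, a <= p.1 <= b -> u p <= Mu) -> visc_subsolution G a b u ->
  {within [set p : E | a <= p.1 <= b], continuous v} ->
  (forall p : E, a <= p.1 <= b -> `|v p| <= Mv) -> visc_supersolution G a b v ->
  hasC12 q qt qx qxx -> (forall p : E, a <= p.1 < b -> qt p + G (hess qxx p) <= 0) ->
  (forall p : E, a <= p.1 <= b -> C <= q p) ->
  (forall x, u (b, x) <= v (b, x) + q (b, x)) ->
  forall p : E, a <= p.1 <= b -> u p <= v p + q p.
Proof.
move=> ab cu uM su cv vM sv hq sq qC uv.
pose w := v \o clamp a b; have cw : continuous w by exact: continuous_clamp.
have wM p : `|w p| <= Mv by apply: vM; exact: clamp_in.
have sw := visc_supersolution_clamp sv.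
have cq : continuous q by case: hq.
suff H (p : E) : a <= p.1 <= b -> u p <= w p + q p.
  by move=> p pab; have := H p pab; rewrite /w /= clamp_id.
move: p; apply: (@comparison_approx a b u (fun p => w p + q p) Mu (- Mv + C)) => //.
- exact: (continuous_add cw cq).
- move=> r e e0; have [h h0 H] := mollified_close a b r cw e0.
  exists h => // eps /[dup] /andP[eps0 _] /H He.
  have [Wt [Wx [Wxx [hW sW]]]] := mollified_supersolution cw wM sw eps0.
  have hWq := hasC12D hW hq.
  do 4 eexists; split; first exact: hWq.
  + move=> z az zb; have -> : hess (fun i j p0 => Wxx i j p0 + qxx i j p0) z =
        hess Wxx z + hess qxx z by apply/matrixP => i j; rewrite !mxE.
    have := Gfun_add ellG (hess Wxx z) (hess qxx z).
    have := sW z az zb; have : a <= z.1 < b by rewrite az; lra.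
    by move/sq; move: (G _) (G _) (G _) => *; lra.
  + move=> z /qC Cq; apply: lerD => //; apply: avgs_ge => // z'.
    by have := wM z'; rewrite ler_norml => /andP[].
  + move=> z /He; have -> : avgs (txdirs eps) w z + q z - (w z + q z) =
      avgs (txdirs eps) w z - w z by ring.
    by [].
by move=> x; rewrite /w /= clamp_id ?ab ?lexx.
Qed.

(** Transport along the drift [y], equal to the identity at the terminal time [b]. Composition with
    it adds the derivative along [y] to the time derivative and only relocates the Hessian. *)
Definition shear (b : R) (y : 'cV[R]_d) (p : E) : E := p + (0, (p.1 - b) *: y).

Lemma shear_time b y (p : E) (s : R) :
  shear b y (p + s *: dir_t) = shear b y p + s *: ((1, y) : E).
Proof.
rewrite /shear; congr pair; first by rewrite /= !addr0.
by rewrite /= scaler0 addr0 [s *: 1]mulr1 addrAC scalerDl addrA addrAC.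
Qed.

Lemma shear_space b y (p : E) (v : 'cV[R]_d) :
  shear b y (p + ((0, v) : E)) = shear b y p + ((0, v) : E).
Proof. by rewrite /shear; congr pair; rewrite /= ?addr0 // addrAC. Qed.

Lemma continuous_shear b y (f : E -> R) : continuous f -> continuous (fun p : E => f (shear b y p)).
Proof.
move=> cf p; apply: (@continuous_comp _ _ _ (shear b y) f); last exact: cf.
apply: cvgD; first exact: cvg_id.
apply/continuous_dist => e e0; have y0 : 0 < `|y| + 1 by rewrite ltr_wpDl.
exists (e / (`|y| + 1)); first by rewrite divr_gt0.
move=> q; rewrite ltr_pdivlMr // => qp.
have -> : ((0, (q.1 - b) *: y) - (0, (p.1 - b) *: y) : E) = (0, (q.1 - p.1) *: y).
  by congr pair; rewrite /= ?subr0 // -scalerBl opprB addrA subrK.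
rewrite prod_normE /= normr0 max_r ?normr_ge0 // normrZ; apply: ltW; apply: le_lt_trans qp.
apply: ler_pM => //; last by rewrite lerDl.
by rewrite prod_normE /= le_max lexx.
Qed.

Lemma hasC12_shear b y f ft fx fxx : hasC12 f ft fx fxx ->
  hasC12 (fun p => f (shear b y p))
    (fun p => ft (shear b y p) + \sum_i y i 0 * fx i (shear b y p))
    (fun i p => fx i (shear b y p)) (fun i j p => fxx i j (shear b y p)).
Proof.
move=> hf; have [cf [dt ct] h1 h2] := hf.
have sp (g : E -> R) i l p : is_derive (shear b y p) (dir_x i) g l ->
    is_derive p (dir_x i) (fun p => g (shear b y p)) l.
  move=> /is_derive_dist h; apply/is_derive_dist => e e0; have [k k0 H] := h e e0.
  exists k => // s sk; have dE : s *: dir_x i = (0, s *: basis_cv i) :> E.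
    by congr pair; rewrite /= scaler0.
  by rewrite dE shear_space -dE; exact: H.
split; first exact: continuous_shear.
- split; last first.
    apply: continuous_add; first exact: (continuous_shear ct).
    by apply: continuous_sum => i; apply: continuous_scale; exact: (continuous_shear (h1.2 i)).
  move=> p; have := hasC12_strict 1 y (shear b y p) hf.
  move=> /strict_deriv_is_derive/is_derive_dist; rewrite mul1r => h.
  apply/is_derive_dist => e e0; have [k k0 H] := h e e0.
  by exists k => // s sk; rewrite shear_time; exact: H.
- split=> [i p|i]; [apply: sp; exact: h1.1|exact: continuous_shear (h1.2 i)].
- split=> [i j p|i j]; [apply: sp; exact: h2.1|exact: continuous_shear (h2.2 i j)].
Qed.

Lemma ln_dist (c x y : R) : 0 < c -> c <= x -> c <= y -> `|ln x - ln y| <= `|x - y| / c.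
Proof.
move=> c0 cx cy.
wlog xy : x y cx cy / y <= x.
  by move=> H; have [|/ltW] := leP y x; [|rewrite distrC (distrC x)]; exact: H.
have y0 : 0 < y by exact: lt_le_trans cy.
have x0 : 0 < x by exact: lt_le_trans cx.
rewrite !ger0_norm ?subr_ge0 ?ler_ln // -ln_div ?posrE //.
have h : ln (x / y) <= x / y - 1.
  by rewrite lerBrDl -[leRHS]lnK ?posrE ?divr_gt0 // expR_ge1Dx.
apply: le_trans h _; have -> : x / y - 1 = (x - y) / y by rewrite mulrBl divff ?gt_eqF.
by rewrite ler_wpM2l ?subr_ge0 // lef_pV2 ?posrE.
Qed.

Lemma quad_log_hess (g : 'M[R]_d) (fx : 'I_d -> R) (fxx : 'I_d -> 'I_d -> R) (c : R) :
  \tr ((\matrix_(i, j) (c * fxx i j - (c * fx i) * (c * fx j))) *m g) =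
  c * \tr ((\matrix_(i, j) fxx i j) *m g) - quad g (\col_i (c * fx i)).
Proof.
rewrite quadE /mxtrace mulr_sumr; under eq_bigr do rewrite mxE.
under [X in _ = X - _]eq_bigr do rewrite mxE mulr_sumr.
rewrite [X in _ = _ - X]exchange_big /= -sumrB; apply: eq_bigr => i _.
by rewrite -sumrB; apply: eq_bigr => j _; rewrite !mxE; ring.
Qed.

(* If [w] is a positive supersolution then so is [ln w] transported along a
   drift [y], up to the price [|y|^2 / (2 lG^2)] per unit of time: the concavity
   of [ln] produces the term [- quad g z / 2], [z = Dw / w], which absorbs
   [y . z]. *)
Theorem log_comparison a b u v (y : 'cV[R]_d) (c Mu Mv : R) : a <= b -> 0 < c ->
  {within [set p : E | a <= p.1 <= b], continuous u} ->
  (forall p : E, a <= p.1 <= b -> u p <= Mu) -> visc_subsolution G a b u ->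
  {within [set p : E | a <= p.1 <= b], continuous v} ->
  (forall p : E, a <= p.1 <= b -> c <= v p <= Mv) -> visc_supersolution G a b v ->
  (forall x, u (b, x) <= ln (v (b, x))) ->
  forall p : E, a <= p.1 <= b ->
    u p <= ln (v (shear b y p)) + (b - p.1) * (enorm y ^+ 2 / (2 * lG ^+ 2)).
Proof.
move=> ab c0 cu uM su cv vM sv uv.
have [_ lG0 _] := ellG.
set kap := enorm y ^+ 2 / _.
have kap0 : 0 <= kap by rewrite divr_ge0 ?sqr_ge0 // mulr_ge0 // sqr_ge0.
pose w := v \o clamp a b; have cw : continuous w by exact: continuous_clamp.
have wc p : c <= w p by have /andP[] := vM _ (clamp_in ab p).
have wM p : `|w p| <= Mv.
  by rewrite ger0_norm ?(le_trans (ltW c0)) //; have /andP[] := vM _ (clamp_in ab p).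
have sw := visc_supersolution_clamp sv.
pose F (p : E) := ln (w (shear b y p)) + (b - p.1) * kap.
suff H (p : E) : a <= p.1 <= b -> u p <= F p.
  move=> p pab; have := H p pab; rewrite /F /w /= clamp_id //.
  by rewrite /shear /= addr0.
have hq : hasC12 (fun p : E => (b - p.1) * kap) (fun=> - kap) (fun _ _ => 0) (fun _ _ _ => 0).
  have h := hasC12D (@hasC12_cst R d (b * kap)) (hasC12Z (- kap) (@hasC12_fst R d)).
  by apply: (hasC12_ext h) => [p'|p'|i p'|i j p'] /=; ring.
move: p; apply: (@comparison_approx a b u F Mu (ln c)) => //.
- apply: continuous_add; last by case: hq.
  apply: (continuous_shear (f := fun p => ln (w p))) => {}z.
  apply: (@continuous_comp _ _ _ w (@ln R)); first exact: cw.
  by apply: continuous_ln; apply: lt_le_trans (wc z).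
(* The shear moves points by at most [(b - a) * enorm y], and [ln] has Lipschitz constant [c^-1]
   above [c]; this explains the radius and the tolerance [c * e]. *)
- move=> r e e0; have [h h0 H] := mollified_close a b (r + (b - a) * enorm y) cw
    (mulr_gt0 c0 e0).
  exists h => // eps /[dup] /andP[eps0 _] /H He.
  have [Wt [Wx [Wxx [hW sW]]]] := mollified_supersolution cw wM sw eps0.
  set W := avgs _ w in He hW.
  have Wc p : c <= W p by exact: avgs_ge.
  have W0 p : 0 < W p by exact: lt_le_trans (Wc p).
  have hl := hasC12_shear b y (hasC12_ln W0 hW).
  have hf := hasC12D hl hq.
  do 4 eexists; split; first exact: hf.
  + move=> p ap pb; set z := shear b y p.
    have z1 : z.1 = p.1 by rewrite /z /= addr0.
    set ft := _ + _ - kap; rewrite addrC -lerBrDr sub0r; apply: (Gfun_le ellG) => g Gg.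
    have -> : hess (fun i j p0 => (W (shear b y p0))^-1 * Wxx i j (shear b y p0) -
        (W (shear b y p0))^-1 * Wx i (shear b y p0) *
        ((W (shear b y p0))^-1 * Wx j (shear b y p0)) + 0) p =
        \matrix_(i, j) ((W z)^-1 * Wxx i j z - ((W z)^-1 * Wx i z) * ((W z)^-1 * Wx j z)).
      by apply/matrixP => i j; rewrite !mxE addr0.
    rewrite (quad_log_hess g (Wx^~ z) (fun i j => Wxx i j z)).
    set zz := \col_i _.
    have [_ _ /(_ _ Gg)[_ /(_ zz) gz _]] := ellG.
    have yz : \sum_i y i 0 * ((W z)^-1 * Wx i z) <= kap + 2^-1 * (lG ^+ 2 * enorm zz ^+ 2).
      have -> : \sum_i y i 0 * ((W z)^-1 * Wx i z) = (y^T *m zz) 0 0.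
        by rewrite mxE; apply: eq_bigr => i _; rewrite !mxE.
      apply: le_trans (cauchy_schwarz_cV _ _) _; rewrite /kap.
      have -> : enorm y * enorm zz = (enorm y / lG) * (lG * enorm zz).
        by rewrite mulrA mulfVK // gt_eqF.
      have -> : enorm y ^+ 2 / (2 * lG ^+ 2) = 2^-1 * (enorm y / lG) ^+ 2.
        by rewrite expr_div_n; field; rewrite gt_eqF.
      rewrite -exprMn; have := sqr_ge0 (enorm y / lG - lG * enorm zz).
      by move: (enorm y / lG) (lG * _) => A B; rewrite sqrrB; lra.
    have sWz : (W z)^-1 * (Wt z + 2^-1 * \tr (hess Wxx z *m g)) <= 0.
      rewrite pmulr_rle0 ?invr_gt0 //; apply: le_trans (sW z _ _); rewrite ?z1 //.
      by rewrite lerD2l; exact: (Gfun_ge ellG).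
    rewrite /ft -/z; move: yz gz sWz; rewrite /hess.
    set t1 := \tr _; set q1 := quad _ _; set l1 := lG ^+ 2 * _.
    move: (\sum_(i < d) y i 0 * ((W z)^-1 * Wx i z)) => S.
    by move: t1 q1 l1 (W z)^-1 (Wt z) => *; lra.
  + move=> p /andP[ap pb]; rewrite -[leLHS]addr0; apply: lerD.
      by rewrite ler_ln ?posrE.
    by rewrite mulr_ge0 // subr_ge0.
  + move=> p [/andP[ap pb] pr]; rewrite /F opprD addrACA subrr addr0.
    have {}He := He (shear b y p) _.
    apply: le_trans (ln_dist c0 (Wc _) (wc _)) _; rewrite ler_pdivrMr // mulrC.
    apply: He; split; first by rewrite /= addr0 ap.
    move=> i; rewrite !mxE; apply: le_trans (ler_normD _ _) _; apply: lerD => //.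
    rewrite normrM; apply: ler_pM => //; last exact: enorm_coord.
    by rewrite distrC ger0_norm ?subr_ge0 // lerB.
move=> x; rewrite /F /w /= subrr mul0r addr0.
have -> : shear b y (b, x) = (b, x) by rewrite /shear /= subrr scale0r; congr pair; rewrite addr0.
by rewrite clamp_id ?ab ?lexx.
Qed.

End comparison.

(** * Existence of the solution *)

(** One ultrafilter serves all points of space-time, so that a pointwise limit exists without
    extracting subsequences. *)
Lemma ultra_limit (U : set_system nat) (f : nat -> R) M : UltraFilter U ->
  (forall n, `|f n| <= M) ->
  exists l, forall e, 0 < e -> U [set n | `|f n - l| <= e].
Proof.
move=> UU fM.
have [l [_ cl]] : `[- M, M] `&` cluster (f @ U) !=set0.
  apply: (@segment_compact R (- M) M (f @ U)).
  suff -> : (f @ U) `[- M, M]%classic = U setT by exact: filterT.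
  congr (U _); apply/seteqP; split=> // n _; rewrite /= in_itv /= -ler_norml; exact: fM.
exists l => e e0.
have [//|Uc] := in_ultra_setVsetC [set n | `|f n - l| <= e] UU.
have [||y [/= ye]] := cl [set y | ~ `|y - l| <= e] [set y | `|y - l| < e].
- exact: Uc.
- by apply/nbhs_dist; exists e.
- by move=> /ltW.
Qed.

Lemma le_add_sqr_div (z al : R) : 0 < al -> z <= al + z ^+ 2 / al.
Proof.
move=> al0; rewrite -lerBlDl ler_pdivlMr //; have := sqr_ge0 (z - al); have := sqr_ge0 z.
have := sqr_ge0 al; rewrite sqrrB; nra.
Qed.

Section scheme.
Implicit Types (f g h u : E -> R) (l : 'I_d -> 'cV[R]_d) (p q : E).

Definition controls : set ('I_d -> 'cV[R]_d) :=
  [set l | Gamma (\sum_k l k *m (l k)^T) /\ forall k, enorm (l k) ^+ 2 <= d%:R * UG ^+ 2].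

Lemma controls_of (g : 'M[R]_d) : Gamma g -> exists2 l, controls l & g = \sum_k l k *m (l k)^T.
Proof. by move=> Gg; have [l gE ln] := elliptic_decomp ellG Gg; exists l => //; split; rewrite -?gE. Qed.

Lemma controls_nonempty : controls !=set0.
Proof. by have [[g /controls_of[l cl _]] _ _] := ellG; exists l. Qed.

Context (de : R) (de0 : 0 < de).
Local Notation c := (Num.sqrt (d%:R * de)).

(** Dynamic programming step of a controller who chooses the covariance in [Gamma] through a factor
    [l]. *)
Definition Qop f p : R := sup [set walk l c f p | l in controls].

Lemma c_sqr : c ^+ 2 = d%:R * de.
Proof. by rewrite sqr_sqrtr // mulr_ge0 // ltW. Qed.

Section Qop.
Context (f : E -> R) (M : R) (fM : forall p, `|f p| <= M).

Lemma walk_bound l p : `|walk l c f p| <= M.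
Proof.
rewrite -[walk l c f p]subr0; apply: walk_dist => // k.
by rewrite !subr0; split; exact: fM.
Qed.

Lemma Qop_has_sup p : has_sup [set walk l c f p | l in controls].
Proof.
have [l0 cl0] := controls_nonempty.
split; first by exists (walk l0 c f p), l0.
by exists M => _ [l _ <-]; apply: le_trans (ler_norm _) (walk_bound _ _).
Qed.

Lemma Qop_ge l p : controls l -> walk l c f p <= Qop f p.
Proof. by move=> cl; apply: ub_le_sup; [case: (Qop_has_sup p)|exists l]. Qed.

Lemma Qop_le p z : (forall l, controls l -> walk l c f p <= z) -> Qop f p <= z.
Proof. by move=> h; apply: ge_sup; [case: (Qop_has_sup p)|move=> _ [l /h ? <-]]. Qed.

Lemma Qop_bound p : `|Qop f p| <= M.
Proof.
rewrite ler_norml; apply/andP; split.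
  have [l cl] := controls_nonempty; apply: le_trans (Qop_ge p cl).
  by have := walk_bound l p; rewrite ler_norml => /andP[].
by apply: Qop_le => l _; apply: le_trans (ler_norm _) (walk_bound _ _).
Qed.

Lemma Qop_lip K : (forall p q, f p <= f q + K * enorm (p.2 - q.2)) ->
  forall p q, Qop f p <= Qop f q + K * enorm (p.2 - q.2).
Proof.
move=> fK p q; apply: Qop_le => l cl.
apply: le_trans (_ : walk l c f q + K * enorm (p.2 - q.2) <= _); last first.
  by rewrite lerD2r; exact: Qop_ge.
rewrite -(walk_cst l c d_gt0 (K * _) q) -walkD /walk ler_wpM2l ?invr_ge0 ?mulr_ge0 //.
apply: ler_sum => k _; apply: lerD.
  by apply: le_trans (fK _ (q + jump l c k)) _; rewrite /= opprD addrACA subrr addr0.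
by apply: le_trans (fK _ (q - jump l c k)) _; rewrite /= opprD addrACA subrr addr0.
Qed.

Lemma walk_sq_le l (k : R) p (x : 'cV[R]_d) : controls l -> 0 <= k ->
  walk l c (fun q => k * enorm (q.2 - x) ^+ 2) p <=
  k * enorm (p.2 - x) ^+ 2 + k * (de * (d%:R * (d%:R * UG ^+ 2))).
Proof.
move=> [_ ln] k0; rewrite walkZ walk_sqdist // -mulrDr ler_wpM2l // lerD2l c_sqr.
rewrite [d%:R * de]mulrC mulfK ?pnatr_eq0 -?lt0n // ler_pM2l //.
apply: (@le_trans _ _ (\sum_(k < d) d%:R * UG ^+ 2)); first exact: ler_sum.
by rewrite sum_ord_const.
Qed.

Lemma Qop_quad_le (k z : R) (x : 'cV[R]_d) : 0 <= k ->
  (forall q, f q <= z + k * enorm (q.2 - x) ^+ 2) -> forall p,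
  Qop f p <= z + k * (de * (d%:R * (d%:R * UG ^+ 2))) + k * enorm (p.2 - x) ^+ 2.
Proof.
move=> k0 h p; apply: Qop_le => l cl; apply: le_trans (le_walk l c d_gt0 p h) _.
rewrite walkD walk_cst //; have := walk_sq_le p x cl k0; lra.
Qed.

Lemma Qop_quad_ge (k z : R) (x : 'cV[R]_d) : 0 <= k ->
  (forall q, z - k * enorm (q.2 - x) ^+ 2 <= f q) -> forall p,
  z - k * (de * (d%:R * (d%:R * UG ^+ 2))) - k * enorm (p.2 - x) ^+ 2 <= Qop f p.
Proof.
move=> k0 h p; have [l cl] := controls_nonempty; apply: le_trans (Qop_ge p cl).
apply: le_trans (le_walk l c d_gt0 p h).
have -> : (fun q => z - k * enorm (q.2 - x) ^+ 2) =
    (fun q => z + (-1) * (k * enorm (q.2 - x) ^+ 2)).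
  by apply/funext => q; rewrite mulN1r.
rewrite walkD walk_cst // walkZ; have := walk_sq_le p x cl k0; lra.
Qed.

End Qop.

Section iterate.
Context (f : E -> R) (M K : R) (fM : forall p, `|f p| <= M) (K0 : 0 <= K)
  (fK : forall p q, f p <= f q + K * enorm (p.2 - q.2)).

Lemma iter_bound m p : `|iter m Qop f p| <= M.
Proof. by elim: m p => //= m IH p; exact: Qop_bound. Qed.

Lemma iter_lip m p q : iter m Qop f p <= iter m Qop f q + K * enorm (p.2 - q.2).
Proof. by elim: m p q => //= m IH p q; apply: Qop_lip IH p q; exact: iter_bound. Qed.

(** Paraboloids with vertex over [p] lie above and below [f], and each step lifts or lowers them by
    at most a fixed multiple of [de]. The parameter [al] stays free; optimizing it would give a
    modulus of the order of the square root of time. *)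
Lemma iter_time m al p : 0 < al ->
  `|iter m Qop f p - f p| <= K * (al + d%:R * (d%:R * UG ^+ 2) * (m%:R * de) / al).
Proof.
move=> al0; set C := d%:R * (d%:R * UG ^+ 2).
have k0 : 0 <= K / al by rewrite divr_ge0 // ltW.
have sq (z : R) : K * z <= K * al + K / al * z ^+ 2.
  apply: le_trans (ler_wpM2l K0 (le_add_sqr_div z al0)) _.
  by rewrite mulrDr lerD2l; apply: le_of_eq; ring.
have up q : iter m Qop f q <= (f p + K * al) + m%:R * (K / al * (de * C))
    + K / al * enorm (q.2 - p.2) ^+ 2.
  elim: m q => [|m IH] q.
    by rewrite mul0r addr0 /=; have := fK q p; have := sq (enorm (q.2 - p.2)); lra.
  rewrite iterS; apply: le_trans (Qop_quad_le (@iter_bound m) k0 IH q) _.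
  by rewrite -natr1 mulrDl mul1r addrA.
have lo q : (f p - K * al) - m%:R * (K / al * (de * C))
    - K / al * enorm (q.2 - p.2) ^+ 2 <= iter m Qop f q.
  elim: m q {up} => [|m IH] q.
    rewrite mul0r subr0 /=; have := fK p q; have := sq (enorm (q.2 - p.2)).
    by rewrite enorm_distC; lra.
  rewrite iterS; apply: le_trans (Qop_quad_ge (@iter_bound m) k0 IH q).
  by rewrite -natr1 mulrDl mul1r opprD addrA.
have := up p; have := lo p; rewrite subrr enorm0 expr0n /= mulr0 addr0 subr0.
have -> : m%:R * (K / al * (de * C)) = K * (C * (m%:R * de) / al) by ring.
rewrite mulrDr ler_norml; move: (iter m _ _ _) (f p) (K * al) (K * _) => *; lra.
Qed.

Lemma iter_time_indep m p q : p.2 = q.2 -> iter m Qop f p = iter m Qop f q.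
Proof.
move=> pq; apply/le_anti; have := iter_lip m p q; have := iter_lip m q p.
by rewrite pq subrr enorm0 mulr0 !addr0 => -> ->.
Qed.

End iterate.

Lemma le_walk_points l f h p :
  (forall k, f (p + jump l c k) <= h (p + jump l c k)) ->
  (forall k, f (p - jump l c k) <= h (p - jump l c k)) -> walk l c f p <= walk l c h p.
Proof.
by move=> h1 h2; rewrite /walk ler_wpM2l ?invr_ge0 ?mulr_ge0 //; apply: ler_sum => k _; exact: lerD.
Qed.

Lemma jump_norm l k : controls l -> `|jump l c k| <= c * Num.sqrt (d%:R * UG ^+ 2).
Proof.
move=> [_ ln]; rewrite prod_normE /= normr0 max_r // normrZ ger0_norm ?sqrtr_ge0 //.
rewrite ler_wpM2l ?sqrtr_ge0 //; apply: le_trans (mx_norm_enorm _) _.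
by rewrite -(ger0_norm (enorm_ge0 (l k))) -sqrtr_sqr ler_wsqrtr.
Qed.

End scheme.

(** Consistency of the scheme with the equation. It is uniform over the controls because all jumps
    obey the common bound [c * S]. *)
Lemma walk_C12 f ft fx fxx (p0 : E) eta : hasC12 f ft fx fxx -> 0 < eta ->
  exists2 rho : R, 0 < rho & forall p de l, 0 < de -> de < rho -> `|p - p0| < rho ->
  controls l ->
  `|walk l (Num.sqrt (d%:R * de)) f (p + de *: dir_t) - f p
    - de * (ft p0 + 2^-1 * \tr (hess fxx p0 *m (\sum_k l k *m (l k)^T)))| <= de * eta.
Proof.
move=> hf eta0; have [cf [dft cft] _ [_ cfxx]] := hf.
pose S := Num.sqrt (d%:R * UG ^+ 2); have S0 : 0 <= S by exact: sqrtr_ge0.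
have dn0 : d%:R != 0 :> R by rewrite pnatr_eq0 -lt0n.
have dp : 0 < d%:R :> R by rewrite ltr0n.
pose B := eta / 2 / (d%:R ^+ 3 * S ^+ 2 + 1).
have DS : 0 < d%:R ^+ 3 * S ^+ 2 + 1 :> R by rewrite ltr_wpDl // mulr_ge0 ?sqr_ge0 // exprn_ge0.
have B0 : 0 < B by rewrite !divr_gt0.
have [h h0 H] : exists2 h : R, 0 < h & forall q, `|q - p0| < h ->
    `|ft q - ft p0| <= eta / 2 /\ forall i j, `|fxx i j q - fxx i j p0| <= B.
  have : \forall q \near p0, `|ft q - ft p0| <= eta / 2 /\
      forall i j, `|fxx i j q - fxx i j p0| <= B.
    apply: filterI.
      have /continuous_dist/(_ (eta / 2))[|h h0 H] := cft p0; first by rewrite divr_gt0.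
      by apply/nbhs_dist; exists h.
    apply: (@filter_forall _ _ (fun i q => forall j, `|fxx i j q - fxx i j p0| <= B) (nbhs p0) (nbhs_filter p0)) => i.
    apply: (@filter_forall _ _ (fun j q => `|fxx i j q - fxx i j p0| <= B) (nbhs p0) (nbhs_filter p0)) => j.
    by have /continuous_dist/(_ B B0)[h h0 H] := cfxx i j p0; apply/nbhs_dist; exists h.
  by move=> /nbhs_dist.
have DS1 : 0 < d%:R * S ^+ 2 + 1 :> R by rewrite ltr_wpDl // mulr_ge0 ?sqr_ge0.
exists (Num.min (h / 3) ((h / 3) ^+ 2 / (d%:R * S ^+ 2 + 1))).
  by rewrite lt_min !divr_gt0 // exprn_gt0 // divr_gt0.
move=> p de l de0; rewrite !lt_min => /andP[deh deh2] /andP[ph _] cl.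
set c := Num.sqrt _.
have cS : c * S < h / 3.
  have c0 : 0 <= c by exact: sqrtr_ge0.
  have h3 : 0 <= h / 3 by rewrite divr_ge0 // ltW.
  rewrite ltNge; apply/negP => hc.
  have : (h / 3) ^+ 2 <= (c * S) ^+ 2 by rewrite ler_pXn2r ?nnegrE // mulr_ge0.
  rewrite [(c * S) ^+ 2]exprMn /c sqr_sqrtr ?mulr_ge0 ?(ltW de0) //; move: deh2; rewrite ltr_pdivlMr // => h1 h2.
  have := lt_le_trans h1 h2; rewrite mulrDr mulr1 -mulrA mulrCA.
  by rewrite ltNge lerDl (ltW de0).
have tn : `|de *: (dir_t : E)| < h / 3.
  by rewrite normrZ norm_dir_t mulr1 gtr0_norm.
have tE : `|f (p + de *: dir_t) - f p - de * ft p0| <= de * (eta / 2).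
  have [s /andP[s0 s1] ->] := @mean_value_line _ _ f (fun q => de * ft q) p (de *: dir_t)
    (fun q => is_derive_scale de (dft q)).
  rewrite -mulrBr normrM gtr0_norm // ler_pM2l //; apply: (H _ _).1.
  rewrite addrAC; apply: le_lt_trans (ler_normD _ _) _.
  have : `|s *: (de *: (dir_t : E))| <= `|de *: (dir_t : E)|.
    by rewrite [leLHS]normrZ ger0_norm // ler_piMl.
  by move: tn ph; move: `|_| `|_| `|_| => *; lra.
set q := p + de *: dir_t in tE *.
have xE k : `|f (q + jump l c k) + f (q - jump l c k) - 2 * f q
    - quad (hess fxx p0) (c *: l k)| <= 2 * (de * (eta / 2)).
  apply: (taylor2 hf) => s s1; rewrite -quadB.
  apply: (@le_trans _ _ (B * (\sum_i `|(c *: l k) i 0|) ^+ 2)).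
    apply: quad_bound => i j; rewrite !mxE; apply: (H _ _).2.
    have -> : q + s *: (0, c *: l k) - p0 = (p - p0) + (de *: dir_t + s *: jump l c k) :> E.
      by rewrite /q -(addrA p) addrAC.
    apply: le_lt_trans (ler_normD _ _) _.
    have n1 := ler_normD (de *: (dir_t : E)) (s *: jump l c k).
    have n2 : `|s *: jump l c k| <= c * S.
      rewrite normrZ; apply: le_trans (jump_norm de k cl).
      by rewrite ler_piMl.
    by move: n1 n2 cS tn ph; move: `|_| `|_| `|_| `|_| => *; lra.
  have sl : \sum_i `|(c *: l k) i 0| <= d%:R * (c * S).
    apply: (@le_trans _ _ (\sum_(i < d) c * S)); last first.
      by rewrite sum_ord_const.
    apply: ler_sum => i _; rewrite mxE normrM ger0_norm ?sqrtr_ge0 // ler_wpM2l ?sqrtr_ge0 //.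
    apply: le_trans (enorm_coord _ _ _) _; have [_ ln] := cl.
    by rewrite -(ger0_norm (enorm_ge0 (l k))) -sqrtr_sqr ler_wsqrtr.
  apply: (@le_trans _ _ (B * (d%:R * (c * S)) ^+ 2)).
    rewrite ler_pM2l // ler_pXn2r ?nnegrE //; first exact: sumr_ge0.
    by rewrite !mulr_ge0 ?sqrtr_ge0.
  have -> : B * (d%:R * (c * S)) ^+ 2 = de * (B * (d%:R ^+ 3 * S ^+ 2)).
    rewrite !exprMn /c sqr_sqrtr ?mulr_ge0 ?(ltW de0) //; ring.
  rewrite ler_pM2l // /B -mulrA ler_piMr ?(ltW (divr_gt0 eta0 _)) // mulrC.
  by rewrite ler_pdivrMr // mul1r lerDl.
have -> : walk l c f q - f p - de * (ft p0 + 2^-1 * \tr (hess fxx p0 *m \sum_k l k *m (l k)^T))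
  = (f q - f p - de * ft p0) + (2 * d%:R)^-1 * \sum_k (f (q + jump l c k) + f (q - jump l c k)
     - 2 * f q - quad (hess fxx p0) (c *: l k)).
  rewrite (tr_decomp _ erefl) !sumrB sumr_const card_ord -[(2 * f q) *+ d]mulr_natl.
  have -> : \sum_k quad (hess fxx p0) (c *: l k) = (d%:R * de) * \sum_k quad (hess fxx p0) (l k).
    rewrite mulr_sumr; apply: eq_bigr => k _; rewrite quadZ /c sqr_sqrtr // mulr_ge0 // ltW //.
  rewrite /walk; field; exact: dn0.
apply: le_trans (ler_normD _ _) _; rewrite [in leRHS](splitr eta) mulrDr lerD //.
rewrite normrM ger0_norm ?invr_ge0 ?mulr_ge0 // ler_pdivrMl ?mulr_gt0 //.
apply: le_trans (ler_norm_sum _ _ _) _.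
apply: le_trans (ler_sum _ (fun k _ => xE k)) _.
by rewrite sumr_const card_ord -[leLHS]mulr_natr mulrAC.
Qed.

Lemma norm_le_sqdist (p q : E) : `|q - p| ^+ 2 <= (q.1 - p.1) ^+ 2 + enorm (q.2 - p.2) ^+ 2.
Proof.
rewrite prod_normE /=; case: (leP `|q.1 - p.1| `|q.2 - p.2|) => _; last first.
  by rewrite real_normK ?num_real // lerDl sqr_ge0.
apply: (@le_trans _ _ (enorm (q.2 - p.2) ^+ 2)); last by rewrite lerDr sqr_ge0.
by rewrite ler_pXn2r ?nnegrE ?enorm_ge0 // mx_norm_enorm.
Qed.

(** The approximations [w n] may jump in time, so a maximum near [p0] need not be attained. A
    maximum up to [mu n] suffices, as [mu n] can be taken small compared with the time step. The
    quadratic term in [psi] makes the maximum at [p0] strict and forces the near-maximizers into any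
    given ball. *)
Lemma touch (U : set_system nat) (UF : ProperFilter U) (w : nat -> E -> R) (u f : E -> R) a b p0
    (mu : nat -> R) (k : R) :
  (forall n, 0 < mu n) -> 0 < k ->
  (forall e, 0 < e -> U [set n | forall p, slab a b (enorm p0.2 + 1) p -> `|w n p - u p| <= e]) ->
  local_max_on (strip a b) (u \- f) p0 ->
  let psi q := f q + k * ((q.1 - p0.1) ^+ 2 + enorm (q.2 - p0.2) ^+ 2) in
  exists2 r : R, 0 < r & forall rho, 0 < rho -> U [set n | exists p, [/\ a <= p.1, `|p - p0| < rho &
    forall q, a <= q.1 -> `|q - p0| <= r -> w n q - psi q <= w n p - psi p + mu n]].
Proof.
move=> mu0 k0 wu [/andP[ap0 p0b]]; rewrite near_withinE => /nbhs_dist[h h0 H] psi.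
pose r := Num.min (h / 2) (Num.min ((b - p0.1) / 2) 1).
have r0 : 0 < r by rewrite !lt_min !divr_gt0 ?subr_gt0 // ltr01.
have rh : r < h by rewrite /r gt_min ltr_pdivrMr // ltr_pMr // ltr1n.
have rb : r < b - p0.1.
  apply: (@le_lt_trans _ _ ((b - p0.1) / 2)); first by rewrite /r !ge_min lexx !orbT.
  by rewrite ltr_pdivrMr // ltr_pMr ?subr_gt0 // ltr1n.
have r1 : r <= 1 by rewrite /r !ge_min lexx !orbT.
exists r => // rho rho0; pose rr := Num.min rho r; have rr0 : 0 < rr by rewrite lt_min rho0.
have [e e0 ee] : exists2 e : R, 0 < e & k * rr ^+ 2 = 8 * e.
  exists (k * rr ^+ 2 / 8); last by field.
  by rewrite divr_gt0 // mulr_gt0 // exprn_gt0.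
apply: filterS (wu e e0) => n wn.
pose K q := a <= q.1 /\ `|q - p0| <= r.
have Kb q : K q -> q.1 < b.
  move=> [_ qr]; have : `|q.1 - p0.1| <= r by apply: le_trans qr; rewrite prod_normE le_max lexx.
  rewrite ler_norml => /andP[_]; lra.
have Kslab q : K q -> slab a b (enorm p0.2 + 1) q.
  move=> /[dup] /Kb/ltW qb [aq qr]; split; first by rewrite aq.
  move=> i; have -> : q.2 i 0 = p0.2 i 0 + (q.2 - p0.2) i 0 by rewrite !mxE; ring.
  apply: le_trans (ler_normD _ _) _; apply: lerD; first exact: enorm_coord.
  apply: le_trans (mx_norm_coord _ _ _) _; apply: le_trans r1; apply: le_trans qr.
  by rewrite prod_normE le_max lexx orbT.
have Kle q : K q -> w n q - psi q <= u p0 - f p0 + e - k * `|q - p0| ^+ 2.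
  move=> Kq; have := wn _ (Kslab _ Kq); rewrite ler_norml => /andP[_ wq].
  have := H q (le_lt_trans Kq.2 rh) _; rewrite /strip /= (Kb _ Kq) andbT Kq.1 => /(_ isT).
  have := ler_wpM2l (ltW k0) (norm_le_sqdist p0 q); rewrite /psi.
  by move: wq; move: (w n q) (u q) (f q) (u p0) (f p0) (k * _) (k * _) => *; lra.
have Kp0 : K p0 by split=> //; rewrite subrr normr0 ltW.
have p0ge : u p0 - f p0 - e <= w n p0 - psi p0.
  have := wn _ (Kslab _ Kp0); rewrite ler_norml => /andP[wq _].
  rewrite /psi !subrr enorm0 expr0n /= addr0 mulr0 addr0.
  by move: wq; move: (w n p0) (u p0) (f p0) => *; lra.
have hs : has_sup [set w n q - psi q | q in K].
  split; first by exists (w n p0 - psi p0), p0.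
  exists (u p0 - f p0 + e) => _ [q Kq <-]; apply: le_trans (Kle q Kq) _.
  by rewrite gerBl mulr_ge0 ?sqr_ge0 // ltW.
have m0 : 0 < Num.min (mu n) e by rewrite lt_min mu0.
have [_ [p Kp <-] pe] := sup_adherent m0 hs.
have ub q : K q -> w n q - psi q <= w n p - psi p + Num.min (mu n) e.
  move=> Kq; apply: le_trans (_ : sup [set w n q - psi q | q in K] <= _).
    by apply: ub_le_sup; [case: hs|exists q].
  by rewrite -lerBlDr ltW.
exists p; split; first by case: Kp.
  rewrite ltNge; apply/negP => rp.
  have rrp : rr <= `|p - p0| by apply: le_trans rp; rewrite /rr ge_min lexx.
  have : rr ^+ 2 <= `|p - p0| ^+ 2 by rewrite ler_pXn2r ?nnegrE ?(ltW rr0).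
  rewrite -(ler_pM2l k0) => rk.
  have := ub _ Kp0; have := Kle _ Kp; have me : Num.min (mu n) e <= e by rewrite ge_min lexx orbT.
  move: rk p0ge me e0; rewrite ee; move: (w n p0 - _) (w n p - _) (u p0 - _) (k * _) (Num.min _ _).
  by clear; move=> *; lra.
move=> q aq qr; apply: le_trans (ub q _) _ => //.
by rewrite lerD2l ge_min lexx.
Qed.

Lemma hasC12_sqdist (p0 : E) :
  hasC12 (fun q : E => (q.1 - p0.1) ^+ 2 + enorm (q.2 - p0.2) ^+ 2)
    (fun q => 2 * (q.1 - p0.1)) (fun i q => 2 * (q.2 - p0.2) i 0)
    (fun i j _ => 2 * (i == j)%:R).
Proof.
have h1 := hasC12D (@hasC12_fst R d) (hasC12_cst (- p0.1)).
have h := hasC12D (hasC12M h1 h1) (hasC12_shift ((0, - p0.2) : E) (@hasC12_sqnorm R d)).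
by apply: (hasC12_ext h) => [p|p|i p|i j p] /=; ring.
Qed.

Lemma small_jump (h : R) : 0 < h -> exists2 e : R, 0 < e & forall de, 0 < de <= e ->
  `|de *: (dir_t : E)| <= h /\ forall l k, controls l ->
    `|jump l (Num.sqrt (d%:R * de)) k| <= h.
Proof.
move=> h0; pose S := d%:R * (d%:R * UG ^+ 2); have S0 : 0 <= S by rewrite mulr_ge0 // mulr_ge0 ?sqr_ge0.
have S1 : 0 < S + 1 by rewrite ltr_wpDl.
exists (Num.min h (h ^+ 2 / (S + 1))); first by rewrite lt_min h0 divr_gt0 // exprn_gt0.
move=> de /andP[de0]; rewrite le_min => /andP[deh]; rewrite ler_pdivlMr // => deS; split.
  by rewrite normrZ norm_dir_t mulr1 gtr0_norm.
move=> l k cl; apply: le_trans (jump_norm _ k cl) _.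
rewrite -sqrtrM ?mulr_ge0 ?(ltW de0) // -(ger0_norm (ltW h0)) -sqrtr_sqr ler_wsqrtr //.
apply: le_trans deS; rewrite mulrDr mulr1 (_ : d%:R * de * _ = de * S) ?lerDl ?ltW //.
by rewrite /S; ring.
Qed.

Section existence.
Context (a b : R) (g : 'cV[R]_d -> R) (M K : R) (ab : a <= b) (gM : forall x, `|g x| <= M)
  (K0 : 0 <= K) (gK : forall x y, `|g x - g y| <= K * enorm (x - y)).

Let g0 (p : E) : R := g p.2.
Let de n : R := n.+1%:R^-1.
Let steps n (p : E) : nat := Num.truncn ((b - p.1) / de n).
Let wn n (p : E) : R := iter (steps n p) (Qop (de n)) g0 p.
Local Notation C := (d%:R * (d%:R * UG ^+ 2) : R).

Let de0 n : 0 < de n. Proof. by rewrite invr_gt0. Qed.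

Let g0M p : `|g0 p| <= M. Proof. exact: gM. Qed.

Let g0K p q : g0 p <= g0 q + K * enorm (p.2 - q.2).
Proof. by have := gK p.2 q.2; rewrite ler_norml => /andP[_]; rewrite /g0; lra. Qed.

Let wn_bound n p : `|wn n p| <= M.
Proof. exact: (iter_bound _ g0M). Qed.

Let C0 : 0 <= C.
Proof. exact: (mulr_ge0 (ler0n _ _) (mulr_ge0 (ler0n _ _) (sqr_ge0 _))). Qed.

(** Equicontinuity up to the mesh: with the smaller number of remaining steps for both points, the
    two values differ by a shift in space, and [iter_time] accounts for the additional steps. *)
Let wn_mod n p q al : 0 < al -> p.1 <= b -> q.1 <= b ->
  `|wn n p - wn n q| <= K * enorm (p.2 - q.2) + K * (al + C * (`|p.1 - q.1| + de n) / al).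
Proof.
move=> al0; wlog pq : p q / (steps n p <= steps n q)%N.
  move=> H pb qb; have [pq|/ltnW qp] := leqP (steps n p) (steps n q); first exact: H.
  by rewrite distrC enorm_distC (distrC p.1); exact: H.
move=> pb qb; set Q := Qop (de n).
have sp := truncn_itv (divr_ge0 (_ : 0 <= b - p.1) (ltW (de0 n))).
have {sp} /andP[_ sp] := sp ltac:(by rewrite subr_ge0).
have sq := truncn_itv (divr_ge0 (_ : 0 <= b - q.1) (ltW (de0 n))).
have {sq} /andP[sq _] := sq ltac:(by rewrite subr_ge0).
rewrite -/(steps n p) ltr_pdivrMr // in sp; rewrite -/(steps n q) ler_pdivlMr // in sq.
have ib m := @iter_bound (de n) g0 M g0M m.
have il m := @iter_lip (de n) g0 M K g0M g0K m.
have tm := @iter_time (de n) (de0 n) (iter (steps n p) Q g0) M K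
   (ib _) K0 (il _) (steps n q - steps n p) al q al0.
rewrite -iterD subnK // in tm.
have h1 : `|wn n p - iter (steps n p) Q g0 q| <= K * enorm (p.2 - q.2).
  have := il (steps n p) p q; have := il (steps n p) q p.
  rewrite (enorm_distC q.2) ler_norml /wn -/Q; move: (iter _ _ _ _) (iter _ _ _ _) (K * _) => *; lra.
have -> : wn n p - wn n q = (wn n p - iter (steps n p) Q g0 q) -
    (wn n q - iter (steps n p) Q g0 q) by ring.
apply: le_trans (ler_normB _ _) _; apply: lerD => //.
apply: le_trans tm _; rewrite ler_wpM2l // lerD2l ler_pM2r ?invr_gt0 // ler_wpM2l ?C0 //.
rewrite natrB // mulrBl; have := ler_norm (p.1 - q.1); move: sp sq; rewrite -natr1 mulrDl mul1r.
by lra.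
Qed.

Let mod_small e : 0 < e -> exists2 h : R, 0 < h & forall p q n, p.1 <= b -> q.1 <= b ->
  `|q - p| <= h -> de n <= h -> `|wn n q - wn n p| <= e.
Proof.
move=> e0; have K1 : 0 < K + 1 by rewrite ltr_wpDl.
pose al := e / 3 / (K + 1); have al0 : 0 < al by rewrite !divr_gt0.
have D1 : 0 < d%:R + 1 :> R by rewrite ltr_wpDl.
have C1 : 0 < C + 1 by rewrite ltr_wpDl ?C0.
have Kal : K * al <= e / 3.
  rewrite /al mulrCA ler_piMr ?ler_pdivrMr ?mul1r ?lerDl //; exact: ltW (divr_gt0 e0 _).
exists (Num.min (al / (d%:R + 1)) (al * al / (2 * (C + 1)))).
  by rewrite lt_min; apply/andP; split; apply: divr_gt0 => //; apply: mulr_gt0.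
move=> p q n pb qb; rewrite !le_min => /andP[qp1 qp2] /andP[_ dn].
apply: le_trans (wn_mod n al0 qb pb) _.
have h1 : K * enorm (q.2 - p.2) <= e / 3.
  apply: le_trans Kal; rewrite ler_wpM2l //; apply: le_trans (enorm_le_norm _) _.
  apply: (@le_trans _ _ ((d%:R + 1) * `|q - p|)).
    by apply: ler_pM => //; [rewrite lerDl|rewrite prod_normE le_max lexx orbT].
  by rewrite mulrC -ler_pdivlMr.
have h2 : C * (`|q.1 - p.1| + de n) / al <= al.
  rewrite ler_pdivrMr //; have : `|q.1 - p.1| + de n <= al * al / (C + 1).
    have -> : al * al / (C + 1) = al * al / (2 * (C + 1)) + al * al / (2 * (C + 1)).
      by field; rewrite gt_eqF.
    by apply: lerD => //; apply: le_trans qp2; rewrite prod_normE le_max lexx.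
  rewrite ler_pdivlMr // => h; apply: le_trans h; rewrite mulrC ler_wpM2l ?lerDl //.
  by rewrite addr_ge0 // ltW.
have : K * (al + C * (`|q.1 - p.1| + de n) / al) <= K * (al + al) by rewrite ler_wpM2l ?lerD2l.
by move: h1 Kal; rewrite [K * (al + al)]mulrDr; lra.
Qed.

Section limit.
Context (U : set_system nat) (u : E -> R) (UU : UltraFilter U) (inftyU : \oo `<=` U)
  (Uu : forall p e, 0 < e -> U [set n | `|wn n p - u p| <= e]).

Let de_small e : 0 < e -> U [set n | de n <= e].
Proof.
move=> e0; apply: inftyU; exists (Num.truncn e^-1) => // n /= nN.
rewrite /de invf_ple ?posrE // ltW //; apply: lt_le_trans (truncnS_gt _) _.
by rewrite ler_nat ltnS.
Qed.

Let u_small e : 0 < e -> exists2 h : R, 0 < h & forall p q, p.1 <= b -> q.1 <= b ->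
  `|q - p| <= h -> `|u q - u p| <= e.
Proof.
move=> e0; have e3 : 0 < e / 3 by rewrite divr_gt0.
have [h h0 H] := mod_small e3; exists h => // p q pb qb qp.
have [n [[n1 n2] n3]] := filter_ex (filterI (filterI (Uu p e3) (Uu q e3)) (de_small h0)).
have := H p q n pb qb qp n3; move: n1 n2; rewrite /= !ler_norml.
by move: (wn _ _) (wn _ _) (u _) (u _) => *; lra.
Qed.

Let u_bound p : `|u p| <= M.
Proof.
apply/ler_addgt0Pr => e e0; have [n /= n1] := filter_ex (Uu p e0).
have := wn_bound n p; move: n1; rewrite !ler_norml; move: (wn _ _) (u _) => *; lra.
Qed.

Let u_unif r e : 0 < e -> U [set n | forall p, slab a b r p -> `|wn n p - u p| <= e].
Proof.
move=> e0; have e3 : 0 < e / 3 by rewrite divr_gt0.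
have [h1 h10 H1] := mod_small e3; have [h2 h20 H2] := u_small e3.
have /near_covering_withinP/(_ nat U (fun n p => `|wn n p - u p| <= e) _) :=
  (compact_near_coveringP _).1 (@compact_slab R d a b r).
apply => p [/andP[_ pb] _].
exists ([set q | `|q - p| < Num.min h1 h2], [set n | `|wn n p - u p| <= e / 3 /\ de n <= h1]).
  split; last by apply: filterI; [exact: Uu|exact: de_small].
  by apply/nbhs_dist; exists (Num.min h1 h2); rewrite ?lt_min ?h10.
move=> [q n] /= [+ [n1 n2]] [/andP[_ qb] _]; rewrite lt_min => /andP[/ltW q1 /ltW q2].
have := H1 p q n pb qb q1 n2; have := H2 p q pb qb q2; move: n1; rewrite !ler_norml.
by move: (wn _ _) (wn _ _) (u _) (u _) => *; lra.
Qed.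

Let steps_shift n (p : E) y : p.1 + de n <= b ->
  steps n p = (steps n (p.1 + de n, y)).+1.
Proof.
move=> pb; rewrite /steps /=; apply: truncn_def.
have h : 0 <= (b - (p.1 + de n)) / de n by rewrite divr_ge0 ?subr_ge0 // ltW.
have := truncn_itv h; have -> : (b - (p.1 + de n)) / de n = (b - p.1) / de n - 1.
  by rewrite opprD addrA mulrBl divff ?gt_eqF.
by rewrite lerBrDr ltrBlDr !natr1.
Qed.

Let wn_step n l p : p.1 + de n <= b -> controls l ->
  walk l (Num.sqrt (d%:R * de n)) (wn n) (p + de n *: dir_t) =
  walk l (Num.sqrt (d%:R * de n))
    (iter (steps n (p + de n *: dir_t)) (Qop (de n)) g0) p.
Proof.
move=> pb cl; rewrite /walk; congr (_ * _); apply: eq_bigr => k _.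
have E1 (v : 'cV[R]_d) : p.1 + de n *: 1 + 0 = p.1 + de n by rewrite addr0 [_ *: _]mulr1.
have ii m := @iter_time_indep (de n) g0 M K g0M g0K m.
congr (_ + _); rewrite /wn /steps /= ?subr0 ?addr0; apply: ii.
  by rewrite /= scaler0 addr0.
by rewrite /= scaler0 addr0.
Qed.

Let wn_ge n l p : p.1 + de n <= b -> controls l ->
  walk l (Num.sqrt (d%:R * de n)) (wn n) (p + de n *: dir_t) <= wn n p.
Proof.
move=> pb cl; rewrite wn_step // [leRHS]/wn.
rewrite (steps_shift (p + de n *: dir_t).2 pb) iterS.
rewrite (_ : (p.1 + de n, (p + de n *: dir_t).2) = p + de n *: dir_t); last first.
  by rewrite [RHS]surjective_pairing /= [_ *: 1]mulr1.
by apply: Qop_ge; [move=> q; exact: (iter_bound _ g0M)|exact: cl].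
Qed.

Let wn_le n p z : p.1 + de n <= b ->
  (forall l, controls l ->
     walk l (Num.sqrt (d%:R * de n)) (wn n) (p + de n *: dir_t) <= z) -> wn n p <= z.
Proof.
move=> pb h; rewrite [leLHS]/wn.
rewrite (steps_shift (p + de n *: dir_t).2 pb) iterS.
rewrite (_ : (p.1 + de n, (p + de n *: dir_t).2) = p + de n *: dir_t); last first.
  by rewrite [RHS]surjective_pairing /= [_ *: 1]mulr1.
apply: Qop_le => [q|l cl]; first exact: (iter_bound _ g0M).
by rewrite -wn_step //; exact: h.
Qed.

(** Stated for general [w] and [v] because the supersolution property uses it with signs reversed.
    Of the [3 * eta], one pays for the consistency error, one for the near-maximality and one for
    the quadratic term added to [f]. *)
Let touch_walk (w : nat -> E -> R) v f ft fx fxx p0 eta :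
  (forall r e, 0 < e -> U [set n | forall p, slab a b r p -> `|w n p - v p| <= e]) ->
  hasC12 f ft fx fxx -> local_max_on (strip a b) (v \- f) p0 -> 0 < eta ->
  exists n p, p.1 + de n <= b /\ forall l, controls l ->
    walk l (Num.sqrt (d%:R * de n)) (w n) (p + de n *: dir_t) <=
    w n p + de n * (ft p0 + 2^-1 * \tr (hess fxx p0 *m \sum_k l k *m (l k)^T) + 3 * eta).
Proof.
move=> wv hf lm eta0; have [/andP[ap0 p0b] _] := lm.
have [k k0 kU] : exists2 k : R, 0 < k & k * (d%:R * UG ^+ 2) <= eta.
  have D0 : 0 < d%:R * UG ^+ 2 + 1 by rewrite ltr_wpDl // mulr_ge0 // sqr_ge0.
  exists (eta / (d%:R * UG ^+ 2 + 1)); first by rewrite divr_gt0.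
  by rewrite mulrAC ler_pdivrMr // ler_pM2l // lerDl.
have hpsi := hasC12D hf (hasC12Z k (hasC12_sqdist p0)).
have [rho rho0 Hw] := walk_C12 p0 hpsi eta0.
have mu0 n : 0 < de n * eta by rewrite mulr_gt0.
have [r r0 H] := touch ultra_proper mu0 k0 (wv _) lm.
have bp0 : 0 < (b - p0.1) / 2 by rewrite divr_gt0 // subr_gt0.
have r3 : 0 < r / 3 by rewrite divr_gt0.
have [e2 e20 H2] := small_jump r3.
pose rr := Num.min rho (Num.min (r / 3) ((b - p0.1) / 2)).
have rr0 : 0 < rr by rewrite !lt_min rho0 r3 bp0.
have ee0 : 0 < Num.min (rho / 2) (Num.min e2 ((b - p0.1) / 2)) by rewrite !lt_min e20 bp0 divr_gt0.
have [n [[p [ap pp0 Hp]] den]] := filter_ex (filterI (H rr rr0) (de_small ee0)).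
move: pp0; rewrite !lt_min => /and3P[prho pr pb].
move: den; rewrite /= !le_min => /and3P[drho de2 db].
exists n, p; split.
  have : `|p.1 - p0.1| < (b - p0.1) / 2 by apply: le_lt_trans pb; rewrite prod_normE le_max lexx.
  by rewrite ltr_norml => /andP[_]; move: db; lra.
move=> l cl; set c := Num.sqrt _; set q := p + _.
have [dn jn] := H2 (de n) ltac:(by rewrite de0 de2).
set psi := (fun q : E => f q + k * _) in hpsi Hp Hw.
set s := w n p - psi p + de n * eta in Hp.
have aq : a <= q.1 by rewrite /q /= [_ *: 1]mulr1; apply: le_trans ap _; rewrite lerDl ltW.
have qn j : `|j| <= r / 3 -> `|q + j - p0| <= r.
  move=> jr; rewrite (_ : q + j - p0 = (p - p0) + (de n *: dir_t + j)); last first.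
    by rewrite /q -(addrA p) addrAC.
  apply: le_trans (ler_normD _ _) _; have := ler_normD (de n *: (dir_t : E)) j.
  by move: jr dn pr; move: `|_| `|_| `|_| `|_| => *; lra.
have step j : j.1 = 0 -> `|j| <= r / 3 -> w n (q + j) <= psi (q + j) + s.
  move=> j1 jr; have aqj : a <= (q + j).1 by rewrite [(q + j).1]/= j1 addr0.
  by have := Hp _ aqj (qn _ jr); rewrite lerBlDl.
have le1 : walk l c (w n) q <= walk l c psi q + s.
  rewrite -[s in leRHS](walk_cst l c d_gt0 s q) -walkD; apply: (le_walk_points) => k'.
    by apply: step => //; exact: jn.
  by apply: step; rewrite ?normrN /= ?oppr0 //; exact: jn.
have := Hw p (de n) l (de0 n) _ prho cl; rewrite -/c -/q.
have drho' : de n < rho by apply: le_lt_trans drho _; rewrite ltr_pdivrMr // ltr_pMr // ltr1n.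
move=> /(_ drho'); set X := ft p0 + _ + _; rewrite ler_norml => /andP[_ le2].
have trX : X <= ft p0 + 2^-1 * \tr (hess fxx p0 *m \sum_k l k *m (l k)^T) + eta.
  rewrite /X subrr !mulr0 addr0 -addrA lerD2l.
  rewrite (_ : hess _ p0 = hess fxx p0 + (2 * k)%:M); last first.
    by apply/matrixP => i j; rewrite !mxE mulrCA mulrA mulr_natr.
  rewrite mulmxDl linearD /= mulrDr lerD2l; apply: le_trans kU.
  have k20 : 0 <= 2 * k by rewrite mulr_ge0 // ltW.
  apply: le_trans (Gfun_ge ellG _ cl.1) _; apply: le_trans (Gfun_scalar_le ellG k20) _.
  by rewrite mulKf ?pnatr_eq0.
move: trX => /(ler_wpM2l (ltW (de0 n))); move: le1 le2; rewrite -/(psi p) /s.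
move: (psi p) (walk l c psi q) (walk l c (w n) q) (ft p0 + 2^-1 * _) X => w1 w2 w3 w4 w5.
by rewrite !mulrDr (mulrCA (de n) 3); move: (de n * eta) (de n * w4) (de n * w5) => *; lra.
Qed.

Let solution_sub : visc_subsolution G a b u.
Proof.
move=> f p0 fC lm; have hf := C12_hasC12 fC.
apply: (@le_eps_mul _ 0 _ 3) => eta eta0.
have [n [p [pb H]]] := touch_walk u_unif hf lm eta0.
suff : wn n p <= wn n p + de n * (time_deriv f p0 + G (hessian f p0) + 3 * eta).
  by rewrite lerDl pmulr_rge0 // (mulrC eta).
apply: (wn_le pb) => l cl; apply: le_trans (H l cl) _.
rewrite lerD2l ler_pM2l // lerD2r lerD2l; exact: (Gfun_ge ellG _ cl.1).
Qed.

Let solution_super : visc_supersolution G a b u.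
Proof.
move=> f p0 fC lm; have hf := hasC12Z (- 1) (C12_hasC12 fC).
rewrite addrC -lerBrDr sub0r; apply: (Gfun_le ellG) => gam /(controls_of)[l cl ->].
rewrite -subr_ge0; apply: (@le_eps_mul _ 0 _ 3) => eta eta0.
have wv r e : 0 < e -> U [set n | forall p, slab a b r p -> `|(- 1) * wn n p - (- 1) * u p| <= e].
  move=> e0; apply: filterS (u_unif r e0) => n h p /h.
  by rewrite -mulrBr normrM normrN1 mul1r.
have lm' : local_max_on (strip a b) ((fun q => (- 1) * u q) \- (fun q => (- 1) * f q)) p0.
  case: lm => D lm; split=> //; apply: filterS lm => q; rewrite /= !mulN1r !opprK.
  by rewrite addrC (addrC (- u p0)).
have [n [p [pb H]]] := touch_walk wv hf lm' eta0.
have := H l cl; rewrite walkZ => h1; have := wn_ge pb cl => h2.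
have {h1 h2} : 0 <= de n * ((- 1) * time_deriv f p0 + 2^-1 * \tr (hess
    (fun i j q => (- 1) * space_deriv i (space_deriv j f) q) p0 *m \sum_k l k *m (l k)^T) + 3 * eta).
  by move: h1 h2; move: (walk _ _ _ _) (wn n p) (de n * _) => *; lra.
rewrite pmulr_rge0 // (_ : hess _ p0 = (- 1) *: hessian f p0); last first.
  by apply/matrixP => i j; rewrite !mxE.
rewrite -scalemxAl linearZ /= !mulN1r mulrN (mulrC eta).
by move: (time_deriv _ _) (\tr _) => *; lra.
Qed.

Lemma limit_solution : Gheat_solution G a b g u.
Proof.
split.
- apply/subspace_continuousP => p /= /andP[_ pb]; apply/cvgrPdist_le => e e0.
  have [h h0 H] := u_small e0; rewrite near_withinE; apply/nbhs_dist; exists h => // q qp /= /andP[_ qb].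
  by rewrite distrC; apply: H => //; exact: ltW.
- by exists M => t x _.
- exact: solution_sub.
- exact: solution_super.
move=> x; apply/eqP; rewrite -subr_eq0 -normr_le0; apply/ler_addgt0Pr => e e0; rewrite add0r.
have [n /=] := filter_ex (Uu (b, x) e0).
rewrite /wn /steps /= subrr mul0r truncn0 /= /g0 /= distrC; exact.
Qed.

End limit.

Theorem Gheat_solution_exists : exists u, Gheat_solution G a b g u.
Proof.
have [U [UU sU]] := ultraFilterLemma (_ : ProperFilter \oo).
have /choice[u Hu] : forall p, exists l, forall e, 0 < e -> U [set n | `|wn n p - l| <= e].
  by move=> p; apply: (@ultra_limit U (fun n => wn n p) M) => n.
by exists u; exact: (limit_solution UU sU Hu).
Qed.

End existence.

(** * The nonlinear semigroup *)

Section semigroup.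
Implicit Types (f g : 'cV[R]_d -> R) (u v : E -> R) (r s t : R) (x y z : 'cV[R]_d).

Lemma lipschitz_ge0 g (K : R) : (forall x y, `|g x - g y| <= K * enorm (x - y)) ->
  exists2 K' : R, 0 <= K' & forall x y, `|g x - g y| <= K' * enorm (x - y).
Proof.
move=> h; exists `|K| => // x y; apply: le_trans (h x y) _.
by rewrite ler_wpM2r ?enorm_ge0 // ler_norm.
Qed.

Lemma bounded_solution_bound a b g u : Gheat_solution G a b g u ->
  exists M, forall p : E, a <= p.1 <= b -> `|u p| <= M.
Proof. by case=> _ [M uM] _ _ _; exists M => -[t x] /=; exact: uM. Qed.

Lemma solution_le_super a b f g u v q qt qx qxx (C : R) : a <= b ->
  Gheat_solution G a b f u -> Gheat_solution G a b g v -> hasC12 q qt qx qxx ->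
  (forall p : E, a <= p.1 < b -> qt p + G (hess qxx p) <= 0) ->
  (forall p : E, a <= p.1 <= b -> C <= q p) -> (forall x, f x <= g x + q (b, x)) ->
  forall p : E, a <= p.1 <= b -> u p <= v p + q p.
Proof.
move=> ab su sv hq sq qC fg.
have [Mu uM] := bounded_solution_bound su; have [Mv vM] := bounded_solution_bound sv.
case: su => cu _ subu _ ub; case: sv => cv _ _ supv vb.
apply: (comparison (Mu := Mu) (C := C) ab cu _ subu cv vM supv hq sq) => //.
- by move=> p /uM; apply: le_trans; exact: ler_norm.
by move=> x; rewrite ub vb.
Qed.

Let hess0 (p : E) : hess (fun _ _ _ => 0) p = 0%:M :> 'M[R]_d.
Proof. by apply/matrixP => i j; rewrite !mxE mul0rn. Qed.

Let G0_le p : 0 + G (hess (fun _ _ _ => 0) p) <= 0.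
Proof.
rewrite add0r hess0; apply: le_trans (Gfun_scalar_le ellG (lexx 0)) _.
by rewrite mulr0 mul0r.
Qed.

Lemma solution_comparison a b f g u v (c : R) : a <= b ->
  Gheat_solution G a b f u -> Gheat_solution G a b g v -> (forall x, f x <= g x + c) ->
  forall p : E, a <= p.1 <= b -> u p <= v p + c.
Proof. by move=> ab su sv fg; apply: (solution_le_super (C := c) ab su sv (hasC12_cst c)). Qed.

Lemma solution_unique a b g u v : a <= b ->
  Gheat_solution G a b g u -> Gheat_solution G a b g v ->
  forall p : E, a <= p.1 <= b -> u p = v p.
Proof.
move=> ab su sv p pab; apply/le_anti/andP; split.
  by rewrite -[v p]addr0; apply: (solution_comparison ab su sv) => // x; rewrite addr0.
by rewrite -[u p]addr0; apply: (solution_comparison ab sv su) => // x; rewrite addr0.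
Qed.

Lemma Gheat_sol a b g : a <= b -> bounded_lipschitz g -> Gheat_solution G a b g (Gheat G a b g).
Proof.
move=> ab [[M gM] [K /lipschitz_ge0[K' K0 gK]]]; rewrite /Gheat.
have := xgetPex (fun=> 0) (Gheat_solution_exists a b gM K0 gK); exact.
Qed.

Definition Sop r t g : 'cV[R]_d -> R := fun x => Gheat G r t g (r, x).

Lemma Sop_solution a b g u x : a <= b -> bounded_lipschitz g -> Gheat_solution G a b g u ->
  Sop a b g x = u (a, x).
Proof.
by move=> ab bg su; apply: (solution_unique ab (Gheat_sol ab bg) su); rewrite /= lexx.
Qed.

Lemma Sop_le r t f g c x : r <= t -> bounded_lipschitz f -> bounded_lipschitz g ->
  (forall y, f y <= g y + c) -> Sop r t f x <= Sop r t g x + c.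
Proof.
move=> rt bf bg fg.
by apply: (solution_comparison rt (Gheat_sol rt bf) (Gheat_sol rt bg) fg); rewrite /= lexx.
Qed.

Lemma Sop_le_quad r t f g q qt qx qxx (C : R) x : r <= t ->
  bounded_lipschitz f -> bounded_lipschitz g -> hasC12 q qt qx qxx ->
  (forall p : E, r <= p.1 < t -> qt p + G (hess qxx p) <= 0) ->
  (forall p : E, r <= p.1 <= t -> C <= q p) ->
  (forall y, f y <= g y + q (t, y)) -> Sop r t f x <= Sop r t g x + q (r, x).
Proof.
move=> rt bf bg hq sq qC fg.
by apply: (solution_le_super rt (Gheat_sol rt bf) (Gheat_sol rt bg) hq sq qC fg); rewrite /= lexx.
Qed.

Lemma bounded_lipschitz_cst (c : R) : bounded_lipschitz (fun _ : 'cV[R]_d => c).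
Proof.
by split; [exists `|c| => //|exists 0 => x y; rewrite subrr normr0 mul0r].
Qed.

Lemma solution_cst a b c u : a <= b -> Gheat_solution G a b (fun=> c) u ->
  forall p : E, a <= p.1 <= b -> u p = c.
Proof.
move=> ab su p pab; have [M uM] := bounded_solution_bound su; case: su => cu _ subu supu ub.
have [[g Gg] _ _] := ellG.
apply/le_anti/andP; split; apply: (@le_eps_mul _ _ _ (penalty UG b p)) => k k0.
  apply: (comparison_super_penalized (C := c) (M := M) ellG k0 cu _ subu (hasC12_cst c)) => //.
  - by move=> q /uM; apply: le_trans; exact: ler_norm.
  - by move=> y; rewrite ub lerDl mulr_ge0 ?(ltW k0) // addr_ge0 ?sqr_ge0.
apply: (comparison_sub_penalized (C := c) (M := - M) ellG k0 Gg cu _ supu (hasC12_cst c)) => //.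
- by move=> q /uM; rewrite ler_norml => /andP[].
- by move=> q _; rewrite add0r hess0 (_ : 0%:M = 0) ?mul0mx ?linear0 ?mulr0 // raddf0.
- by move=> y; rewrite ub.
Qed.

Lemma Sop_cst r t c x : r <= t -> Sop r t (fun=> c) x = c.
Proof.
move=> rt; apply: (solution_cst rt (Gheat_sol rt (bounded_lipschitz_cst c))).
by rewrite /= lexx.
Qed.

Lemma Sop_bound r t g M x : r <= t -> bounded_lipschitz g -> (forall y, `|g y| <= M) ->
  `|Sop r t g x| <= M.
Proof.
move=> rt bg gM; rewrite ler_norml; apply/andP; split.
  rewrite -(Sop_cst (- M) x rt) -[leRHS]addr0.
  apply: Sop_le => //; first exact: bounded_lipschitz_cst.
  by move=> y; have := gM y; rewrite ler_norml addr0 => /andP[].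
rewrite -(Sop_cst M x rt) -[leRHS]addr0.
apply: Sop_le => //; first exact: bounded_lipschitz_cst.
by move=> y; have := gM y; rewrite ler_norml addr0 => /andP[].
Qed.

Lemma bounded_lipschitz_shift g z : bounded_lipschitz g -> bounded_lipschitz (fun y => g (y + z)).
Proof.
case=> [[M gM] [K gK]]; split; first by exists M.
by exists K => x y; have := gK (x + z) (y + z); rewrite opprD addrACA subrr addr0.
Qed.

Lemma hessian_shift (z : 'cV[R]_d) (f : E -> R) : C12 f ->
  C12 (fun p => f (p.1, p.2 + z)) /\ forall p,
  time_deriv (fun p => f (p.1, p.2 + z)) p = time_deriv f (p.1, p.2 + z) /\
  hessian (fun p => f (p.1, p.2 + z)) p = hessian f (p.1, p.2 + z).
Proof.
move=> /C12_hasC12 hf; have := hasC12_shift ((0, z) : E) hf.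
have E1 (p : E) : p + ((0, z) : E) = (p.1, p.2 + z) by congr pair; rewrite /= addr0.
rewrite (_ : (fun p : E => f (p + ((0, z) : E))) = fun p => f (p.1, p.2 + z)); last first.
  by apply/funext => p; rewrite E1.
move=> h; split; first exact: hasC12_C12 h.
by move=> p; rewrite (hasC12_time_deriv h) (hasC12_hessian p h) E1.
Qed.

Lemma local_max_on_shift a b (h : E -> R) z (p : E) :
  local_max_on (strip a b) (fun q : E => h (q.1, q.2 + z)) p ->
  local_max_on (strip a b) h (p.1, p.2 + z).
Proof.
move=> [Dp]; rewrite near_withinE => /nbhs_dist[e e0 H]; split => //.
rewrite near_withinE; apply/nbhs_dist; exists e => // q qp Dq.
have := H (q.1, q.2 - z) _ Dq; rewrite /= subrK -surjective_pairing; apply.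
apply: le_lt_trans qp; rewrite !prod_normE /= opprD (addrC (- p.2)) addrA.
by rewrite -(addrA q.2) -opprD (addrC z) opprD addrA.
Qed.

Lemma solution_shift a b g u z : Gheat_solution G a b g u ->
  Gheat_solution G a b (fun y => g (y + z)) (fun p => u (p.1, p.2 + z)).
Proof.
case=> cu [M uM] subu supu ub.
have key (m : R -> R -> R) (f : E -> R) (p : E) :
    local_max_on (strip a b) (fun q : E => m (u (q.1, q.2 + z)) (f q)) p ->
    local_max_on (strip a b) (fun q : E => m (u q) (f (q.1, q.2 - z))) (p.1, p.2 + z).
  move=> lm; apply: local_max_on_shift; move: lm; congr (local_max_on _ _ _); apply/funext => q /=.
  by rewrite addrK -surjective_pairing.
split.
- apply/subspace_continuousP => p Dp; apply/cvgrPdist_le => e e0.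
  have Dz : [set p : E | a <= p.1 <= b] (p.1, p.2 + z) by [].
  have [h h0 H] := within_dist cu Dz e0.
  rewrite near_withinE; apply/nbhs_dist; exists h => // q qp Dq; rewrite distrC.
  by apply: H => //; apply: le_lt_trans qp; rewrite !prod_normE /= opprD addrACA subrr addr0.
- by exists M => t x /uM.
- move=> f p fC lm; have [fC' H] := hessian_shift (- z) fC.
  have := subu _ _ fC' (key (fun s t => s - t) f p lm); have [-> ->] := H (p.1, p.2 + z).
  by rewrite /= addrK -surjective_pairing.
- move=> f p fC lm; have [fC' H] := hessian_shift (- z) fC.
  have := supu _ _ fC' (key (fun s t => t - s) f p lm); have [-> ->] := H (p.1, p.2 + z).
  by rewrite /= addrK -surjective_pairing.
by move=> x; rewrite ub.
Qed.

Lemma Sop_shift r t g x z : r <= t -> bounded_lipschitz g ->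
  Sop r t (fun y => g (y + z)) x = Sop r t g (x + z).
Proof.
move=> rt bg; rewrite (Sop_solution _ rt _ (solution_shift z (Gheat_sol rt bg))) //.
exact: bounded_lipschitz_shift.
Qed.

(** By translation invariance the values at two points are values at one point for the data and for
    a translate of it, and comparison bounds their difference. *)
Lemma Sop_lip r t g K : r <= t -> bounded_lipschitz g ->
  (forall x y, `|g x - g y| <= K * enorm (x - y)) ->
  forall x y, `|Sop r t g x - Sop r t g y| <= K * enorm (x - y).
Proof.
move=> rt bg gK.
have h x y : Sop r t g x <= Sop r t g y + K * enorm (x - y).
  rewrite -{1}(subrK y x) [x - y + y]addrC -Sop_shift //.
  apply: Sop_le => // [|z]; first exact: bounded_lipschitz_shift.
  have := gK (z + (x - y)) z; rewrite ler_norml => /andP[_]; rewrite lerBlDl.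
  by rewrite (_ : z + (x - y) - z = x - y) // addrAC subrr add0r.
move=> x y; have := h x y; have := h y x; rewrite (enorm_distC y) ler_norml.
by move: (Sop _ _ _ _) (Sop _ _ _ _) (K * _) => *; lra.
Qed.

Lemma bounded_lipschitz_Sop r t g : r <= t -> bounded_lipschitz g -> bounded_lipschitz (Sop r t g).
Proof.
move=> rt bg; case: (bg) => [[M gM] [K gK]]; split; first by exists M => x; exact: Sop_bound.
by exists K; exact: Sop_lip.
Qed.

(* A solution on [s, t] and a solution on [r, s] with matching data glue into
   a solution on [r, t]: at time [s] a test function for the glued function is
   in particular a test function for the solution on [s, t]. *)
Lemma solution_glue r s t g u v : r <= s -> s <= t ->
  Gheat_solution G s t g v -> Gheat_solution G r s (fun x => v (s, x)) u ->
  Gheat_solution G r t g (fun p => if p.1 < s then u p else v p).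
Proof.
move=> rs st [cv [Mv vM] subv supv vt] [cu [Mu uM] subu supu us].
set w := (fun p : E => _).
have wu (p : E) : p.1 <= s -> w p = u p.
  rewrite /w le_eqVlt => /orP[/eqP ps|->] //.
  by rewrite ps ltxx [p]surjective_pairing ps us.
have wv (p : E) : s <= p.1 -> w p = v p by rewrite /w ltNge => ->.
have lmv (p : E) (k : E -> R) (sg : R) : s <= p.1 ->
    local_max_on (strip r t) (fun q => sg * w q + k q) p ->
    local_max_on (strip s t) (fun q => sg * v q + k q) p.
  move=> sp [/andP[rp pt] lm]; split; first by rewrite /strip /= sp.
  move: lm; rewrite !near_withinE; apply: filterS => q h /andP[sq qt].
  by have := h; rewrite /strip /= qt (le_trans rs sq) => /(_ isT); rewrite !wv.
have lmu (p : E) (k : E -> R) (sg : R) : p.1 < s ->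
    local_max_on (strip r t) (fun q => sg * w q + k q) p ->
    local_max_on (strip r s) (fun q => sg * u q + k q) p.
  move=> ps [/andP[rp pt] lm]; split; first by rewrite /strip /= rp.
  move: lm; rewrite !near_withinE; apply: filterS => q h /andP[rq qs].
  have := h; rewrite /strip /= rq (lt_le_trans qs st) => /(_ isT).
  by rewrite !wu // ltW.
have p1 (k w' : E -> R) : (w' \- k) = fun q => 1 * w' q + - k q.
  by apply/funext => q; rewrite /= mul1r.
split.
- have -> : [set p : E | r <= p.1 <= t] =
      [set p : E | r <= p.1 <= s] `|` [set p : E | s <= p.1 <= t].
    apply/seteqP; split => p /=; last first.
      by move=> [/andP[-> /le_trans -> //]|/andP[sp ->]]; rewrite (le_trans rs sp).
    move=> /andP[rp pt]; have [ps|/ltW sp] := leP p.1 s; [left|right]; apply/andP; split => //.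
  have cl (a b : R) : closed [set p : E | a <= p.1 <= b].
    rewrite (_ : [set _ | _] = fst @^-1` `[a, b]); last first.
      by apply/seteqP; split => p /=; rewrite in_itv.
    by apply: preimage_closed; [move=> p _; exact: cvg_fst|exact: interval_closed].
  apply: withinU_continuous => //.
    apply: (subspace_eq_continuous _ cu) => p; rewrite inE /= => /andP[_ ps].
    exact: (esym (wu p ps)).
  apply: (subspace_eq_continuous _ cv) => p; rewrite inE /= => /andP[sp _].
  exact: (esym (wv p sp)).
- exists (`|Mu| + `|Mv|) => a x /andP[ra at0]; rewrite /w /=; case: ltP => sa.
    apply: le_trans (uM _ _ _) _; first by rewrite ra ltW.
    by apply: le_trans (ler_norm _) _; rewrite lerDl.
  apply: le_trans (vM _ _ _) _; first by rewrite sa.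
  by apply: le_trans (ler_norm _) _; rewrite lerDr.
- move=> f p fC; rewrite p1 => lm; have [ps|sp] := ltP p.1 s.
    by apply: subu => //; rewrite p1; exact: lmu.
  by apply: subv => //; rewrite p1; exact: lmv.
- have n1 (k w' : E -> R) : (k \- w') = fun q => (-1) * w' q + k q.
    by apply/funext => q; rewrite /= mulN1r addrC.
  move=> f p fC; rewrite n1 => lm; have [ps|sp] := ltP p.1 s.
    by apply: supu => //; rewrite n1; exact: lmu.
  by apply: supv => //; rewrite n1; exact: lmv.
by move=> x; rewrite wv.
Qed.

Lemma Sop_semigroup r s t g x : r <= s -> s <= t -> bounded_lipschitz g ->
  Sop r s (Sop s t g) x = Sop r t g x.
Proof.
move=> rs st bg; have bS := bounded_lipschitz_Sop st bg.
have sv := Gheat_sol st bg; have su := Gheat_sol rs bS.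
rewrite (Sop_solution x (le_trans rs st) bg (solution_glue rs st sv su)) /=.
case: ltP => // sr; have -> : s = r by apply/le_anti; rewrite rs sr.
have bS' := bounded_lipschitz_Sop (le_trans rs st) bg.
by case: (Gheat_sol (lexx r) bS') => _ _ _ _; apply.
Qed.

(** The starting point on the left is the one that the shear of [log_comparison] brings to [x] at
    time [r]. *)
Lemma Sop_log r t f F (c : R) x y : r <= t -> bounded_lipschitz f -> bounded_lipschitz F -> 0 < c ->
  (forall z, c <= F z) -> (forall z, f z <= ln (F z)) ->
  Sop r t f (x + (t - r) *: y) <= ln (Sop r t F x) + (t - r) * (enorm y ^+ 2 / (2 * lG ^+ 2)).
Proof.
move=> rt bf bF c0 cF fF.
have su := Gheat_sol rt bf; have sv := Gheat_sol rt bF.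
have [Mu uM] := bounded_solution_bound su; have [Mv vM] := bounded_solution_bound sv.
have cv' (p : E) : r <= p.1 <= t -> c <= Gheat G r t F p.
  move=> prt; have := Gheat_sol rt (bounded_lipschitz_cst c) => sc.
  have := @solution_comparison _ _ _ _ _ _ 0 rt sc sv _ p prt.
  by rewrite addr0 (solution_cst rt sc prt); apply => z; rewrite addr0.
case: (su) => cu _ subu _ ub; case: (sv) => cv _ _ supv vb.
have vM' (p : E) : r <= p.1 <= t -> c <= Gheat G r t F p <= Mv.
  by move=> h; rewrite cv' //; apply: le_trans (ler_norm _) (vM _ h).
have uM' (p : E) prt := le_trans (ler_norm _) (uM p prt).
have := log_comparison y rt c0 cu uM' subu cv vM' supv.
move=> /(_ _ (r, x + (t - r) *: y)); rewrite /Sop /= /shear /=.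
have -> : (r, x + (t - r) *: y) + (0, (r - t) *: y) = (r, x) :> E.
  congr pair; rewrite /= ?addr0 // -addrA -scalerDl (_ : t - r + (r - t) = 0) ?scale0r ?addr0 //.
  by ring.
by apply; [move=> z; rewrite ub vb|rewrite lexx].
Qed.

End semigroup.

(** * Iterated one-step values of cylinder functionals *)

Section functionals.
Implicit Types (D s : seq R) (w : R -> 'cV[R]_d) (r t : R) (x y : 'cV[R]_d).

Definition upd w t y : R -> 'cV[R]_d := fun r => if r == t then y else w r.

Definition wdist D w w' : R := \sum_(t <- D) enorm (w t - w' t).

(** Functionals of arbitrary functions of time, not only of paths: changing a single value by [upd]
    leaves the continuous paths, and enlarging the finite set [D] requires no renumbering of
    arguments. *)
Definition cylf D (Phi : (R -> 'cV[R]_d) -> R) :=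
  bounded_real Phi /\ exists2 K : R, 0 <= K & forall w w', `|Phi w - Phi w'| <= K * wdist D w w'.

Lemma wdist_eq0 D w w' : {in D, w =1 w'} -> wdist D w w' = 0.
Proof. by move=> h; rewrite /wdist big_seq big1 // => t /h ->; rewrite subrr enorm0. Qed.

Lemma wdist_upd D w w' t y y' :
  wdist D (upd w t y) (upd w' t y') <= wdist D w w' + (size D)%:R * enorm (y - y').
Proof.
rewrite /wdist; elim: D => [|r D IH]; first by rewrite !big_nil mul0r addr0.
rewrite !big_cons /= -natr1 mulrDl mul1r.
have h : enorm (upd w t y r - upd w' t y' r) <= enorm (w r - w' r) + enorm (y - y').
  by rewrite /upd; case: eqP => _; [rewrite lerDr|rewrite lerDl]; exact: enorm_ge0.
by move: IH h; move: (\sum_(_ <- _) _) (\sum_(_ <- _) _) => *; lra.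
Qed.

Lemma wdist_sub D s w w' : {subset D <= s} -> wdist D w w' <= (size D)%:R * wdist s w w'.
Proof.
move=> Ds; rewrite /wdist -sum1_size natr_sum mulr_suml big_seq [leRHS]big_seq.
apply: ler_sum => t /Ds ts; rewrite mul1r.
rewrite (perm_big _ (perm_to_rem ts)) big_cons /= lerDl.
by apply: sumr_ge0 => r _; exact: enorm_ge0.
Qed.

Lemma cylf_agree D Phi w w' : cylf D Phi -> {in D, w =1 w'} -> Phi w = Phi w'.
Proof.
move=> [_ [K K0 h]] /wdist_eq0 ww; have := h w w'; rewrite ww mulr0 normr_le0 subr_eq0.
by move/eqP.
Qed.

Lemma cylf_sub D s Phi : {subset D <= s} -> cylf D Phi -> cylf s Phi.
Proof.
move=> Ds [bP [K K0 h]]; split => //; exists (K * (size D)%:R); first by rewrite mulr_ge0.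
move=> w w'; apply: le_trans (h w w') _; rewrite -mulrA ler_wpM2l //; exact: wdist_sub.
Qed.

Definition assign s (A : 'M[R]_(d, size s)) : R -> 'cV[R]_d := fun t =>
  \col_i (if insub (index t s) is Some k then A i k else 0).

Lemma assign_columns s w : {in s, assign (columns (size s) (map w s)) =1 w}.
Proof.
move=> t ts; apply/colP => i; rewrite !mxE insubT ?index_mem // => h.
by rewrite mxE (nth_map 0) ?index_mem // nth_index.
Qed.

Lemma assign_dist s (A B : 'M[R]_(d, size s)) t :
  enorm (assign A t - assign B t) <= d%:R * enorm (A - B).
Proof.
apply: le_trans (enorm_cV_le_sum _) _.
apply: le_trans (_ : \sum_(i < d) enorm (A - B) <= _); last first.
  by rewrite sum_ord_const.
apply: ler_sum => i _; rewrite !mxE; case: insubP => [k _ _|_].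
  by have := enorm_coord (A - B) i k; rewrite !mxE.
by rewrite subrr normr0 enorm_ge0.
Qed.

Lemma cylf_matrix D s Phi : {subset D <= s} -> cylf D Phi ->
  bounded_lipschitz (fun A : 'M[R]_(d, size s) => Phi (assign A)).
Proof.
move=> Ds [[M PM] [K K0 h]]; split; first by exists M => A; exact: PM.
exists (K * ((size D)%:R * d%:R)) => A B; apply: le_trans (h _ _) _.
rewrite -mulrA ler_wpM2l // /wdist -mulrA.
apply: le_trans (_ : \sum_(t <- D) d%:R * enorm (A - B) <= _).
  by apply: ler_sum => t _; exact: assign_dist.
by rewrite big_const_seq count_predT iter_addr_0 -[leLHS]mulr_natl.
Qed.

Lemma cylinder_cylf (T : R) D s Phi : {subset D <= s} -> cylf D Phi ->
  (fun w : wpath d T => Phi w) =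
  cylinder (fun A : 'M[R]_(d, size s) => Phi (assign A)).
Proof.
move=> Ds cP; apply/funext => w; rewrite /cylinder; apply: (cylf_agree cP) => t /Ds ts.
by rewrite assign_columns.
Qed.

Lemma cylf_cylinder s (f : 'M[R]_(d, size s) -> R) : bounded_lipschitz f ->
  cylf s (fun w => f (columns (size s) (map w s))).
Proof.
move=> [[M fM] [K fK]]; split; first by exists M => w; exact: fM.
exists (`|K| * (d * size s)%:R); first by rewrite mulr_ge0.
move=> w w'; apply: le_trans (fK _ _) _.
apply: (@le_trans _ _ (`|K| * enorm (columns (size s) (map w s) - columns (size s) (map w' s)))).
  by rewrite ler_wpM2r ?enorm_ge0 // ler_norm.
rewrite -mulrA ler_wpM2l //; apply: le_trans (enorm_le_sum _) _.
apply: (@le_trans _ _ (\sum_(i < d) \sum_(k < size s) wdist s w w')); last first.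
  rewrite !sumr_const !card_ord -mulrnA mulnC -[leLHS]mulr_natl; by [].
apply: ler_sum => i _; apply: ler_sum => k _; rewrite !mxE !(nth_map 0) //.
have sk : s`_k \in s by rewrite mem_nth.
rewrite /wdist (perm_big _ (perm_to_rem sk)) big_cons /=.
apply: le_trans (_ : enorm (w s`_k - w' s`_k) <= _).
  by have := enorm_coord (w s`_k - w' s`_k) i 0; rewrite !mxE.
by rewrite lerDl; apply: sumr_ge0 => r _; exact: enorm_ge0.
Qed.

(** Representations of the expectation use positive times only; since paths start at 0, the value at
    time 0 can be inserted. *)
Lemma cylf_upd0 D Phi : cylf D Phi -> cylf [seq t <- D | t != 0] (fun w => Phi (upd w 0 0)).
Proof.
move=> [[M PM] [K K0 h]]; split; first by exists M => w; exact: PM.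
exists K => // w w'; apply: le_trans (h _ _) _; rewrite ler_wpM2l // /wdist big_filter.
rewrite [leRHS]big_mkcond /=; apply: ler_sum => t _; rewrite /upd.
by case: eqP => _ //=; rewrite subrr enorm0.
Qed.

Lemma LipP (T t : R) (xi : wpath d T -> R) : Lip t xi <-> exists D Phi,
  [/\ forall r, r \in D -> 0 <= r <= t, cylf D Phi & xi = (fun w : wpath d T => Phi w)].
Proof.
split=> [[s [f [st bf ->]]]|[D [Phi [Dt cP ->]]]].
  by exists s, (fun w => f (columns (size s) (map w s))); split => //; exact: cylf_cylinder.
exists D, (fun A : 'M[R]_(d, size D) => Phi (assign A)); split => //.
  exact: (cylf_matrix _ cP).
exact: (cylinder_cylf T _ cP).
Qed.

Lemma gap s t : t \notin s -> exists2 h : R, 0 < h & {in s, forall r, h <= `|r - t|}.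
Proof.
elim: s => [|a s IH]; first by exists 1.
rewrite inE negb_or => /andP[ta /IH[h h0 H]]; exists (Num.min h `|a - t|).
  by rewrite lt_min h0 normr_gt0 subr_eq0 eq_sym.
by move=> r; rewrite inE => /orP[/eqP ->|/H]; rewrite ge_min ?lexx ?orbT // => ->.
Qed.

(** Since values at finitely many positive times are arbitrary, cylinder functionals that agree on
    paths agree on all functions vanishing at 0 or depending on positive times only. The path is
    corrected by one hat function per time, narrow enough to vanish at 0 and at the times already
    treated. *)
Lemma path_through (T : R) s w : 0 < T -> (forall t, t \in s -> 0 < t <= T) ->
  exists p : wpath d T, {in s, p =1 w}.
Proof.
move=> T0; elim: s => [|t s IH] st; first by exists (wpath0 d T).
have [|p pw] := IH; first by move=> r rs; apply: st; rewrite inE rs orbT.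
have [ts|ts] := boolP (t \in s).
  by exists p => r; rewrite inE => /orP[/eqP ->|]; exact: pw.
have /andP[t0 tT] := st t (mem_head _ _).
have [|h h0 H] := @gap (0 :: s) t; first by rewrite inE negb_or gt_eqF.
pose hat (r : R) : R := Num.max 0 (1 - `|r - t| / h).
have hat0 r : h <= `|r - t| -> hat r = 0.
  by move=> hr; rewrite /hat max_l // subr_le0 ler_pdivlMr // mul1r.
have chat : continuous hat.
  move=> r; apply: (@continuous_max _ _ (fun=> 0) (fun r => 1 - `|r - t| / h)).
    exact: cvg_cst.
  apply: cvgB; first exact: cvg_cst.
  apply: cvgM; last exact: cvg_cst.
  by apply: cvg_norm; apply: cvgB; [exact: cvg_id|exact: cvg_cst].
pose cl (r : R) := Num.max 0 (Num.min r T).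
have ccl : continuous cl.
  move=> r; apply: (@continuous_max _ _ (fun=> 0) (fun r => Num.min r T)).
    exact: cvg_cst.
  by apply: continuous_min; [exact: cvg_id|exact: cvg_cst].
have clid r : 0 <= r <= T -> cl r = r.
  by move=> /andP[r0 rT]; rewrite /cl (min_l rT) max_r.
have clcl r : cl (cl r) = cl r.
  by apply: clid; rewrite /cl le_max lexx /= ge_max (ltW T0) ge_min lexx orbT.
pose q (r : R) : 'cV[R]_d := p r + hat (cl r) *: (w t - p t).
have cq : continuous q.
  move=> r; apply: cvgD; first exact: wpath_continuous.
  apply: cvgZ; last exact: cvg_cst.
  by apply: continuous_comp; [exact: ccl|exact: chat].
have q0 : q 0 = 0.
  rewrite /q wpath_start clid ?lexx ?(ltW T0) // hat0 ?scale0r ?addr0 //.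
  by apply: H; rewrite inE eqxx.
have qs r : q r = q (Num.max 0 (Num.min r T)).
  by rewrite /q -/(cl r) clcl (wpath_stop p r).
exists (WPath cq q0 qs) => r; rewrite inE => /orP[/eqP ->|rs] /=.
  rewrite /q clid ?(ltW t0) // /hat subrr normr0 mul0r subr0 max_r ?ler01 // scale1r.
  by rewrite addrCA subrr addr0.
have /andP[r0 rT] : 0 < r <= T by apply: st; rewrite inE rs orbT.
rewrite /q clid ?(ltW r0) // hat0 ?scale0r ?addr0 ?pw //.
by apply: H; rewrite inE rs orbT.
Qed.

End functionals.

(** * Independence of the backward value from the representation *)

Section BV.
Implicit Types (D s : seq R) (w : R -> 'cV[R]_d) (r t : R) (x y : 'cV[R]_d).
Implicit Types (Phi : (R -> 'cV[R]_d) -> R).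

(** Backward recursion in which the past is stored in [w] itself instead of a list; this makes
    values along different partitions comparable. *)
Fixpoint BV Phi r s w x : R :=
  if s is t :: s' then Sop r t (fun y => BV Phi t s' (upd w t y) y) x else Phi w.

Section bounds.
Context (D : seq R) (Phi : (R -> 'cV[R]_d) -> R) (M K : R) (PM : forall w, `|Phi w| <= M)
  (K0 : 0 <= K) (PK : forall w w', `|Phi w - Phi w'| <= K * wdist D w w').

Lemma BV_estimate s r : path <%R r s ->
  (forall w x, `|BV Phi r s w x| <= M) /\
  forall w w' x x', `|BV Phi r s w x - BV Phi r s w' x'| <=
    K * wdist D w w' + K * ((size s * size D)%:R * enorm (x - x')).
Proof.
elim: s r => [|t s IH] r /=; first by move=> _; split=> // w w' x x'; rewrite mul0n mul0r mulr0 addr0.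
move=> /andP[/ltW rt /IH[bM bK]].
pose h w y := BV Phi t s (upd w t y) y.
have hK w w' y y' : `|h w y - h w' y'| <=
    K * wdist D w w' + K * ((size s).+1 * size D)%:R * enorm (y - y').
  apply: le_trans (bK _ _ _ _) _; have := ler_wpM2l K0 (wdist_upd D w w' t y y').
  by rewrite mulSn natrD !mulrDr !mulrDl !mulrA; lra.
have hKw w y y' : `|h w y - h w y'| <= K * ((size s).+1 * size D)%:R * enorm (y - y').
  by have := hK w w y y'; rewrite wdist_eq0 // mulr0 add0r.
have hbl w : bounded_lipschitz (h w).
  by split; [exists M => y; exact: bM|exists (K * ((size s).+1 * size D)%:R)].
split=> [w x|w w' x x']; first by apply: (Sop_bound x rt (hbl w)) => y; exact: bM.
have le1 v v' : Sop r t (h v) x' <= Sop r t (h v') x' + K * wdist D v v'.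
  apply: Sop_le => // y; have := hK v v' y y; rewrite subrr enorm0 mulr0 addr0.
  by rewrite ler_norml => /andP[_]; lra.
have wC : wdist D w' w = wdist D w w' by apply: eq_bigr => q _; rewrite enorm_distC.
have := le1 w w'; have := le1 w' w; rewrite wC.
have := @Sop_lip r t (h w) _ rt (hbl w) (hKw w) x x'.
rewrite -/(h w) -/(h w') -mulrA !ler_norml; move: (Sop _ _ _ _) (Sop _ _ _ _) (Sop _ _ _ _).
by move: (K * _) (K * _) => *; lra.
Qed.

End bounds.

Lemma BV_bounded_lipschitz D Phi r t s w : cylf D Phi -> path <%R t s ->
  bounded_lipschitz (fun y => BV Phi t s (upd w r y) y).
Proof.
move=> [[M PM] [K K0 PK]] ps; have [bM bK] := BV_estimate PM K0 PK ps.
split; first by exists M => y; exact: bM.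
exists (K * (size D)%:R + K * (size s * size D)%:R) => y y'.
apply: le_trans (bK _ _ _ _) _; rewrite mulrDl -!mulrA lerD2r ler_wpM2l //.
by apply: le_trans (wdist_upd D w w r y y') _; rewrite wdist_eq0 // add0r.
Qed.

Lemma BV_agree D Phi r s w w' x : cylf D Phi -> path <%R r s -> {in D, w =1 w'} ->
  BV Phi r s w x = BV Phi r s w' x.
Proof.
move=> [[M PM] [K K0 PK]] ps ww; have [_ bK] := BV_estimate PM K0 PK ps.
have := bK w w' x x; rewrite wdist_eq0 // subrr enorm0 !mulr0 addr0 normr_le0 subr_eq0.
by move/eqP.
Qed.

(** The semigroup property merges the two steps around a time on which [Phi] does not depend. *)
Lemma BV_skip D Phi r t t' s w x : cylf D Phi -> t \notin D -> path <%R r [:: t, t' & s] ->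
  BV Phi r [:: t, t' & s] w x = BV Phi r (t' :: s) w x.
Proof.
move=> cP tD /= /and3P[rt tt' ps].
rewrite -(Sop_semigroup x (ltW rt) (ltW tt')); last exact: BV_bounded_lipschitz cP ps.
congr (Sop _ _ _ _); apply/funext => y; congr (Sop _ _ _ _); apply/funext => z.
apply: (BV_agree _ cP ps) => q qD; rewrite /upd; case: eqP => // _.
by case: eqP => // qt; rewrite -qt qD in tD.
Qed.

Lemma BV_filter D Phi (C : seq R) r s w x : cylf D Phi -> {subset D <= C} -> last r s \in C ->
  path <%R r s -> BV Phi r s w x = BV Phi r [seq t <- s | t \in C] w x.
Proof.
move=> cP DC; elim: s r w x => [//|t s IH] r w x lC /[dup] ps' /= /andP[rt ps].
have lC' : last t s \in C by [].
case: ifP => tC.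
  by rewrite /=; congr (Sop _ _ _ _); apply/funext => y; exact: IH.
case: s IH lC lC' ps ps' => [|t' s] IH lC lC' ps ps'; first by rewrite /= tC in lC'.
have tD : t \notin D by apply/negP => /DC; rewrite tC.
rewrite -[LHS]/(BV Phi r [:: t, t' & s] w x) (BV_skip _ _ cP tD ps').
by apply: IH => //; move: ps => /= /andP[tt' ->]; rewrite (lt_trans rt tt').
Qed.

Lemma BV_indep D Phi r s w x : cylf D Phi -> path <%R r s -> {in s, forall t, t \notin D} ->
  BV Phi r s w x = Phi w.
Proof.
move=> cP; elim: s r w x => [//|t s IH] r w x /= /andP[rt ps] sD.
rewrite (_ : (fun _ => _) = fun=> Phi w) ?Sop_cst ?(ltW rt) //.
apply/funext => y; rewrite IH //; last by move=> q qs; apply: sD; rewrite inE qs orbT.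
apply: (cylf_agree cP) => q qD; rewrite /upd; case: eqP => // qt.
by have := sD t (mem_head _ _); rewrite -qt qD.
Qed.

Lemma backward_value_BV s (f : 'M[R]_(d, size s) -> R) s0 s' r w x : s = s0 ++ s' -> uniq s ->
  backward_value G (fun p => f (columns (size s) p)) r s' (map w s0) x =
  BV (fun w => f (columns (size s) (map w s))) r s' w x.
Proof.
elim: s' s0 r w x => [|t s' IH] s0 r w x sE us; first by rewrite /= {3}sE cats0.
rewrite /= /Sop; congr (Gheat _ _ _ _ _); apply/funext => y.
have sE' : s = rcons s0 t ++ s' by rewrite cat_rcons.
rewrite -(IH (rcons s0 t)) //; congr backward_value; rewrite map_rcons /upd eqxx; congr rcons.
apply/eq_in_map => q qs; case: eqP => // qt.
by move: us; rewrite sE cat_uniq => /and3P[_ /hasPn/(_ t (mem_head _ _))]; rewrite -qt qs.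
Qed.

Lemma path_lt_uniq r s : path <%R r s -> uniq s /\ {in s, forall t, r < t}.
Proof.
move=> ps; split; first by apply: (sorted_uniq lt_trans ltxx); exact: path_sorted ps.
by apply/allP; exact: order_path_min lt_trans ps.
Qed.

Lemma path_lt_last r s : path <%R r s -> {in s, forall t, t <= last r s}.
Proof.
elim: s r => [//|a s IH] r /= /andP[ra ps] t; rewrite inE => /orP[/eqP ->|]; last exact: IH.
case: s {IH} ps => [//|c s ps]; have [_ h] := path_lt_uniq ps.
by rewrite ltW // h //= mem_last.
Qed.

(** Both partitions are compared with their common refinement [L], from which [BV_filter] removes
    the times that do not matter for [Phi]. *)
Lemma BV_unique D1 D2 Phi s1 s2 w x : cylf D1 Phi -> cylf D2 Phi ->
  {subset D1 <= s1} -> {subset D2 <= s2} -> path <%R 0 s1 -> path <%R 0 s2 ->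
  s1 != [::] -> last 0 s1 = last 0 s2 -> BV Phi 0 s1 w x = BV Phi 0 s2 w x.
Proof.
move=> c1 c2 D1s D2s p1 p2 s10 l12.
have s20 : s2 != [::].
  apply: contra_neq s10 => s20; rewrite s20 /= in l12.
  case: s1 p1 l12 {D1s c1} => // a s p1 l; have [_ pos] := path_lt_uniq p1.
  by have := pos (last a s) (mem_last a s); rewrite (_ : last a s = 0) ?ltxx.
have lm s : s != [::] -> last 0 s \in s by case: s => // a s _; rewrite /= mem_last.
pose L := sort <=%R (undup (s1 ++ s2)).
have mL t : (t \in L) = (t \in s1) || (t \in s2) by rewrite mem_sort mem_undup mem_cat.
have sL : sorted <%R L by rewrite sort_lt_sorted undup_uniq.
have [u1 pos1] := path_lt_uniq p1; have [u2 pos2] := path_lt_uniq p2.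
have pL : path <%R 0 L.
  rewrite path_sortedE; last exact: lt_trans.
  by rewrite sL andbT; apply/allP => t; rewrite mL => /orP[/pos1|/pos2].
have fE s : path <%R 0 s -> {subset s <= L} -> [seq t <- L | t \in s] = s.
  move=> ps sL'; apply: lt_sorted_eq.
  - by apply: sorted_filter sL; exact: lt_trans.
  - exact: path_sorted ps.
  - by move=> t; rewrite mem_filter andb_idr //; exact: sL'.
have L0 : L != [::] by apply: contraTneq (lm _ s10) => L0; have := mL (last 0 s1); rewrite L0 => /esym/norP[].
have lL : last 0 L = last 0 s1.
  apply/le_anti/andP; split.
    have := lm _ L0; rewrite mL => /orP[/(path_lt_last p1)//|/(path_lt_last p2)].
    by rewrite l12.
  by apply: path_lt_last => //; rewrite mL lm.
rewrite -(fE s1) // -?(BV_filter _ _ c1) ?lL ?lm //; last by move=> t; rewrite mL => ->.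
by rewrite -{1}(fE s2) // -?(BV_filter _ _ c2) ?lL ?l12 ?lm // => t; rewrite mL => ->; rewrite orbT.
Qed.

(** [lip_expectation] picks some representation by [xget], so every admissible one has to give the
    same value. Two of them agree a priori on paths only; [path_through] extends this to all [w]. *)
Theorem lip_expectation_BV (T : R) D Phi s : 0 < T -> cylf D Phi -> {subset D <= s} ->
  path <%R 0 s -> last 0 s = T ->
  lip_expectation G (fun w : wpath d T => Phi w) = BV Phi 0 s (fun=> 0) 0.
Proof.
move=> T0 cP Ds ps ls; set xi := (fun w : wpath d T => Phi w).
have s0 : s != [::] by case: s ls {Ds ps} T0 => //= <-; rewrite ltxx.
have val e : is_lip_expectation G xi e -> e = BV Phi 0 s (fun=> 0) 0.
  move=> [s' [f [ps' ls' bf xiE ->]]].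
  have [us' pos'] := path_lt_uniq ps'; have [us pos] := path_lt_uniq ps.
  rewrite (@backward_value_BV s' f [::] s' 0 (fun=> 0) 0) //.
  have cf := cylf_cylinder bf.
  have fE : (fun w => f (columns (size s') (map w s'))) = Phi.
    apply/funext => w; have [|p pw] := @path_through T (s' ++ s) w T0.
      move=> t; rewrite mem_cat => /orP[] ts; [rewrite pos' //|rewrite pos //] => /=.
        by rewrite -ls'; exact: path_lt_last ps' t ts.
      by rewrite -ls; exact: path_lt_last ps t ts.
    rewrite (cylf_agree cP (w := w) (w' := p)); last first.
      by move=> t /Ds ts; rewrite pw // mem_cat ts orbT.
    rewrite -[RHS]/(xi p) xiE /cylinder; congr (f (columns _ _)).
    by apply/eq_in_map => t ts; rewrite pw // mem_cat ts.
  have s'0 : s' != [::].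
    by apply: contraTneq T0 => s'E; rewrite -ls' s'E /= ltxx.
  by rewrite fE in cf *; apply: (BV_unique _ _ cf cP) => //; rewrite ls ls'.
have ex : exists e, is_lip_expectation G xi e.
  pose f := (fun A : 'M[R]_(d, size s) => Phi (assign A)).
  exists (backward_value G (fun p => f (columns (size s) p)) 0 s [::] 0), s, f.
  split => //; [exact: (cylf_matrix Ds cP)|exact: (cylinder_cylf T Ds cP)].
by apply: val; exact: (xgetPex 0 ex).
Qed.

(* [Phi w] only depends on the values of [w] up to time [t]; if its one-step value at time
   [s] is nonpositive whatever the past, so is its expectation. *)
Theorem lip_expectation_one_step (T s t : R) D Phi : 0 <= s -> s < t -> t <= T ->
  {in D, forall r, 0 <= r <= s} -> cylf (t :: D) Phi ->
  (forall w, w 0 = 0 -> Sop s t (fun y => Phi (upd w t y)) (w s) <= 0) ->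
  lip_expectation G (fun w : wpath d T => Phi w) <= 0.
Proof.
move=> s0 st tT Ds cP le0.
have T0 : 0 < T by apply: le_lt_trans s0 (lt_le_trans st tT).
have t0 : 0 < t by exact: le_lt_trans st.
pose Psi w := Phi (upd w 0 0); have cPsi := cylf_upd0 cP; rewrite -/Psi in cPsi.
pose s1 := sort <=%R (undup [seq r <- s :: D | r != 0]).
(* A partition has to end at [T]. After [t] the functional no longer depends on the path, so one
   more step suffices. *)
pose s3 := if t == T then [::] else [:: T].
have m1 r : (r \in s1) = (r != 0) && (r \in s :: D) by rewrite mem_sort mem_undup mem_filter.
have m1s r : r \in s1 -> 0 < r <= s.
  rewrite m1 inE => /andP[r0 /orP[/eqP rs|/Ds /andP[r0' ->]]].
    by rewrite rs lexx andbT lt_neqAle eq_sym -{1}rs r0.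
  by rewrite andbT lt_neqAle eq_sym r0.
have ss1 : sorted <%R s1 by rewrite sort_lt_sorted undup_uniq.
have p1 : path <%R 0 s1.
  rewrite path_sortedE; last exact: lt_trans.
  by rewrite ss1 andbT; apply/allP => r /m1s /andP[].
have l1 : last 0 s1 = s.
  have [s00|s00] := eqVneq s 0.
    by case E1 : s1 => [//|a s']; have := m1s a; rewrite E1 mem_head s00 => /(_ isT)/andP[/lt_geF ->].
  have ss : s \in s1 by rewrite m1 s00 mem_head.
  apply/le_anti; rewrite (path_lt_last p1 ss) andbT.
  have : last 0 s1 \in s1 by case: (s1) ss => // a s' _; rewrite /= mem_last.
  by move/m1s => /andP[].
have p3 : path <%R t s3.
  by rewrite /s3; case: eqP => //= tT'; rewrite andbT lt_neqAle tT andbT; apply/eqP.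
have pL : path <%R 0 (s1 ++ t :: s3) by rewrite cat_path p1 l1 /= st.
have lL : last 0 (s1 ++ t :: s3) = T by rewrite last_cat /= /s3; case: eqP.
have sub : {subset [seq r <- t :: D | r != 0] <= s1 ++ t :: s3}.
  move=> r; rewrite mem_filter inE mem_cat inE m1 inE => /andP[-> /orP[->|->]].
    by rewrite orbT.
  by rewrite orbT.
have -> : (fun w : wpath d T => Phi w) = (fun w : wpath d T => Psi w).
  apply/funext => w; congr Phi; apply/funext => r; rewrite /upd; case: eqP => // ->.
  exact: wpath_start.
rewrite (lip_expectation_BV T0 cPsi sub pL lL).
have claim s' r w x : path <%R r s' -> last r s' = s -> 0 <= r -> w 0 = 0 -> w r = x ->
    BV Psi r (s' ++ t :: s3) w x <= 0.
  elim: s' r w x => [|q s' IH] r w x /=.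
    move=> _ -> _ w0 <-.
    rewrite (_ : (fun _ => _) = fun y => Phi (upd w t y)); first exact: le0.
    apply/funext => y; rewrite (BV_indep _ _ cPsi p3).
      rewrite /Psi; congr Phi; apply/funext => r'; rewrite /upd.
      by case: eqP => // ->; rewrite (lt_eqF t0) w0.
    rewrite /s3; case: eqP => // tT' r'; rewrite inE => /eqP ->.
    rewrite mem_filter inE negb_and negbK negb_or; apply/orP; right; apply/andP; split.
      by apply/eqP => Tt; rewrite Tt in tT'.
    apply/negP => /Ds /andP[_ Ts]; have := le_lt_trans Ts (lt_le_trans st tT).
    by rewrite ltxx.
  move=> /andP[rq ps'] ls' r0 w0 wr.
  have q0 : 0 < q by exact: le_lt_trans rq.
  rewrite -[leRHS]addr0 -[X in _ <= X + _](Sop_cst 0 x (ltW rq)).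
  apply: (Sop_le x (ltW rq)).
  - apply: (BV_bounded_lipschitz _ _ cPsi); rewrite cat_path ps' ls' /= st.
    exact: p3.
  - exact: bounded_lipschitz_cst.
  - move=> y; rewrite addr0; apply: IH => //; first exact: ltW.
      by rewrite /upd (lt_eqF q0).
    by rewrite /upd eqxx.
by apply: claim.
Qed.

End BV.

End control.
Local Notation measT := (measurable_fun setT).
Local Notation intT P f := (P.-integrable setT (EFin \o f)).

(** * Integrals over [0, T] x Omega *)

Section double_integral.
Context {R : realType} {d0 : measure_display} {Om : measurableType d0} (P : probability Om R)
  (T : R).
Implicit Types (f g : R -> Om -> R).

Definition jointly_measurable f :=
  measurable_fun (`[0%R, T]%classic `*` [set: Om]) (fun q : R * Om => f q.1 q.2).

Definition dintegral f : \bar R :=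
  (\int[P]_w \int[lebesgue_measure]_(r in `[0%R, T]) (f r w)%:E)%E.

Let DT : set (R * Om) := `[0%R, T]%classic `*` [set: Om].

Let mDT : measurable DT.
Proof. exact: measurableX. Qed.

(** Extension by zero to all of [R * Om], where the theorems of Fubini and Tonelli apply. *)
Let patched f := (fun q : R * Om => (f q.1 q.2)%:E) \_ DT.

Let patched_measurable f : jointly_measurable f -> measT (patched f).
Proof.
move=> mf; have mT : measurable [set: R * Om] := measurableT.
apply: (measurable_restrict (fun q : R * Om => (f q.1 q.2)%:E) mDT mT).1.
by rewrite setTI; exact/measurable_EFinP.
Qed.

Let patched_ge0 f : (forall r w, 0 <= r <= T -> 0 <= f r w) -> forall q, (0 <= patched f q)%E.
Proof.
move=> f0 q; rewrite /patched patchE; case: ifPn => // /set_mem[/=].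
by rewrite in_itv /= => qT _; rewrite lee_fin f0.
Qed.

Let patchedE f r w : patched f (r, w) = ((fun r => (f r w)%:E) \_ `[0%R, T]%classic) r.
Proof.
rewrite /patched !patchE; case: (boolP (r \in _)) => [rT|/negP rT]; last first.
  by case: ifPn => // /set_mem[/= /mem_set].
by rewrite mem_set //; split => //; exact: set_mem.
Qed.

Lemma jointly_measurable_time f t : jointly_measurable f -> 0 <= t <= T ->
  measT (f t).
Proof.
move=> mf tT; apply/measurable_EFinP.
have := measurableT_comp (patched_measurable mf) (pair1_measurable t).
by apply: eq_measurable_fun => w _ /=; rewrite patchedE patchE mem_set //= in_itv.
Qed.

Lemma jointly_measurable_path f w : jointly_measurable f ->
  measurable_fun `[0%R, T]%classic (fun r => f r w).
Proof.
move=> mf; apply/measurable_EFinP.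
have := measurableT_comp (patched_measurable mf) (pair2_measurable w).
move=> /(measurable_funS measurableT (@subsetT _ `[0%R, T]%classic)).
by apply: eq_measurable_fun => r rT /=; rewrite patchedE patchE rT.
Qed.

Lemma measurable_time_integral f : jointly_measurable f ->
  (forall r w, 0 <= r <= T -> 0 <= f r w) ->
  measT (fun w => (\int[lebesgue_measure]_(r in `[0%R, T]) (f r w)%:E)%E).
Proof.
move=> mf f0.
have := @measurable_fun_fubini_tonelli_G _ _ _ _ R lebesgue_measure _
  (patched_measurable mf) (patched_ge0 f0).
apply: eq_measurable_fun => w _; rewrite /fubini_G [RHS]integral_mkcond.
by apply: eq_integral => r _; rewrite patchedE.
Qed.

Lemma dintegral_swap f : jointly_measurable f -> (forall r w, 0 <= r <= T -> 0 <= f r w) ->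
  dintegral f = (\int[lebesgue_measure]_(r in `[0%R, T]) \int[P]_w (f r w)%:E)%E.
Proof.
move=> mf f0.
have := @fubini_tonelli _ _ _ _ R lebesgue_measure P _
  (patched_measurable mf) (patched_ge0 f0).
rewrite /dintegral => E; symmetry; rewrite integral_mkcond; etransitivity; last first.
  transitivity (\int[P]_w \int[lebesgue_measure]_r patched f (r, w))%E; first exact: E.
  by apply: eq_integral => w _; rewrite [RHS]integral_mkcond; apply: eq_integral => r _;
     rewrite patchedE.
apply: eq_integral => r _; rewrite patchE; case: ifPn => rT.
  by apply: eq_integral => w _; rewrite patchedE patchE rT.
rewrite -[LHS](integral0 P setT).
by apply: eq_integral => w _; rewrite patchedE patchE (negPf rT).
Qed.

Lemma measurable_expectation f : jointly_measurable f -> (forall r w, 0 <= r <= T -> 0 <= f r w) ->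
  measurable_fun `[0%R, T]%classic (fun r => \int[P]_w (f r w)%:E)%E.
Proof.
move=> mf f0.
have := @measurable_fun_fubini_tonelli_F _ _ _ _ R P _
  (patched_measurable mf) (patched_ge0 f0).
move=> /(measurable_funS measurableT (@subsetT _ `[0%R, T]%classic)).
apply: eq_measurable_fun => r rT; rewrite /fubini_F.
by apply: eq_integral => w _; rewrite patchedE patchE rT.
Qed.

Let path_ge0 f w : (forall r w, 0 <= r <= T -> 0 <= f r w) ->
  forall r, `[0%R, T]%classic r -> (0 <= (f r w)%:E)%E.
Proof. by move=> f0 r; rewrite /= in_itv /= => rT; rewrite lee_fin f0. Qed.

Let integral_path_ge0 f : (forall r w, 0 <= r <= T -> 0 <= f r w) -> forall w, [set: Om] w ->
  (0 <= \int[lebesgue_measure]_(r in `[0%R, T]) (f r w)%:E)%E.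
Proof. by move=> f0 w _; apply: integral_ge0 => r; exact: path_ge0. Qed.

Let measurable_path f w : jointly_measurable f ->
  measurable_fun `[0%R, T]%classic (fun r => (f r w)%:E).
Proof. by move=> mf; apply/measurable_EFinP; exact: jointly_measurable_path. Qed.

Lemma dintegral_le f g : jointly_measurable f -> jointly_measurable g ->
  (forall r w, 0 <= r <= T -> 0 <= f r w <= g r w) -> (dintegral f <= dintegral g)%E.
Proof.
move=> mf mg fg.
have f0 r w : 0 <= r <= T -> 0 <= f r w by move=> /fg -/(_ w)/andP[].
have g0 r w : 0 <= r <= T -> 0 <= g r w.
  by move=> /fg -/(_ w)/andP[h1 h2]; exact: le_trans h2.
apply: ge0_le_integral => //; [exact: integral_path_ge0|exact: measurable_time_integral..|].
move=> w _; apply: ge0_le_integral => //; [exact: path_ge0|exact: measurable_path..|].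
by move=> r /=; rewrite in_itv /= => rT; rewrite lee_fin; case/andP: (fg r w rT).
Qed.

Lemma dintegralD f g : jointly_measurable f -> jointly_measurable g ->
  (forall r w, 0 <= r <= T -> 0 <= f r w) -> (forall r w, 0 <= r <= T -> 0 <= g r w) ->
  dintegral (fun r w => f r w + g r w) = (dintegral f + dintegral g)%E.
Proof.
move=> mf mg f0 g0; rewrite /dintegral -ge0_integralD //.
- by apply: eq_integral => w _; rewrite -ge0_integralD //; try exact: path_ge0; exact: measurable_path.
- exact: integral_path_ge0.
- exact: measurable_time_integral.
- exact: integral_path_ge0.
- exact: measurable_time_integral.
Qed.

Lemma dintegralZ (c : R) f : jointly_measurable f -> 0 <= c ->
  (forall r w, 0 <= r <= T -> 0 <= f r w) ->
  dintegral (fun r w => c * f r w) = (c%:E * dintegral f)%E.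
Proof.
move=> mf c0 f0; rewrite /dintegral -ge0_integralZl ?lee_fin //.
- apply: eq_integral => w _; rewrite -ge0_integralZl ?lee_fin //; first exact: measurable_path.
  exact: path_ge0.
- exact: measurable_time_integral.
- exact: integral_path_ge0.
Qed.

Lemma dintegral0 f : (forall r w, f r w = 0) -> dintegral f = 0%E.
Proof.
by move=> f0; apply: integral0_eq => w _; apply: integral0_eq => r _; rewrite f0.
Qed.

Lemma jointly_measurable_indic (a b : R) :
  jointly_measurable (fun r _ => (a < r <= b)%R%:R).
Proof.
have m : measT (fun r : R => (a < r <= b)%R%:R : R).
  by rewrite itv_oc_indic; exact: measurable_indic.
have := measurableT_comp m (@measurable_fst _ _ R Om).
exact: (measurable_funS measurableT (@subsetT _ DT)).
Qed.

Lemma jointly_measurable_const (g : Om -> R) : measT g ->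
  jointly_measurable (fun _ w => g w).
Proof.
move=> mg; have := measurableT_comp mg (@measurable_snd _ _ R Om).
exact: (measurable_funS measurableT (@subsetT _ DT)).
Qed.

Lemma jointly_measurable_sum (I : Type) (r : seq I) (f : I -> R -> Om -> R) :
  (forall i, jointly_measurable (f i)) ->
  jointly_measurable (fun t w => \sum_(i <- r) f i t w).
Proof. by move=> mf; apply: measurable_sum => i; exact: mf. Qed.

Lemma dintegral_sqrD (f g : R -> Om -> R) : jointly_measurable f -> jointly_measurable g ->
  (dintegral (fun r w => (f r w + g r w) ^+ 2)%R <=
   2%:E * dintegral (fun r w => f r w ^+ 2)%R +
   2%:E * dintegral (fun r w => g r w ^+ 2)%R)%E.
Proof.
move=> mf mg.
have mf2 : jointly_measurable (fun r w => f r w ^+ 2) := measurable_funX 2 mf.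
have mg2 : jointly_measurable (fun r w => g r w ^+ 2) := measurable_funX 2 mg.
have mfg : jointly_measurable (fun r w => (f r w + g r w) ^+ 2) := measurable_funX 2 (measurable_funD mf mg).
have f0 r w : 0 <= r <= T -> 0 <= f r w ^+ 2 by move=> _; exact: sqr_ge0.
have g0 r w : 0 <= r <= T -> 0 <= g r w ^+ 2 by move=> _; exact: sqr_ge0.
have mf2' : jointly_measurable (fun r w => 2 * f r w ^+ 2).
  by apply: measurable_funM => //; exact: mf2.
have mg2' : jointly_measurable (fun r w => 2 * g r w ^+ 2).
  by apply: measurable_funM => //; exact: mg2.
rewrite -!dintegralZ // -dintegralD //.
- apply: dintegral_le => //.
    by apply: measurable_funD; [exact: mf2'|exact: mg2'].
  move=> r w _; rewrite sqr_ge0 /=; have := sqr_ge0 (f r w - g r w); rewrite !sqrrD sqrrN; nra.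
- by move=> r w _; rewrite mulr_ge0 // sqr_ge0.
- by move=> r w _; rewrite mulr_ge0 // sqr_ge0.
Qed.

Lemma dintegral_sum_le (I : Type) (s : seq I) (f : I -> R -> Om -> R) (c : I -> R) :
  (forall i, jointly_measurable (f i)) -> (forall i r w, 0 <= r <= T -> 0 <= f i r w) ->
  (forall i, (dintegral (f i) <= (c i)%:E)%E) ->
  (dintegral (fun r w => \sum_(i <- s) f i r w)%R <= (\sum_(i <- s) c i)%:E)%E.
Proof.
move=> mf f0 fc; elim: s => [|i s IH].
  by rewrite big_nil dintegral0 // => r w; rewrite big_nil.
have -> : (fun r (w : Om) => \sum_(k <- i :: s) f k r w) =
    fun r w => f i r w + \sum_(k <- s) f k r w.
  by apply/funext => r; apply/funext => w; rewrite big_cons.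
rewrite big_cons dintegralD //; last by move=> r w rT; apply: sumr_ge0 => k _; exact: f0.
- by rewrite EFinD; apply: leeD.
- exact: jointly_measurable_sum.
- exact: f0.
Qed.

End double_integral.

Section prob_integral.
Context {R : realType} {d0 : measure_display} {Om : measurableType d0} (P : probability Om R).
Implicit Types (f g : Om -> R).

Lemma prob_integral_le f g : measT f -> measT g ->
  (forall w, 0 <= f w <= g w) -> (\int[P]_w (f w)%:E <= \int[P]_w (g w)%:E)%E.
Proof.
move=> mf mg fg; apply: ge0_le_integral => //.
- by move=> w _; rewrite lee_fin; case/andP: (fg w).
- exact/measurable_EFinP.
- exact/measurable_EFinP.
- by move=> w _; rewrite lee_fin; case/andP: (fg w).
Qed.

Lemma prob_integralD f g : measT f -> measT g ->
  (forall w, 0 <= f w) -> (forall w, 0 <= g w) ->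
  (\int[P]_w (f w + g w)%:E = \int[P]_w (f w)%:E + \int[P]_w (g w)%:E)%E.
Proof.
move=> mf mg f0 g0; rewrite -ge0_integralD //; [|exact/measurable_EFinP| |exact/measurable_EFinP];
  by move=> w _; rewrite lee_fin.
Qed.

Lemma prob_integralZ (c : R) f : measT f -> 0 <= c -> (forall w, 0 <= f w) ->
  (\int[P]_w (c * f w)%:E = c%:E * \int[P]_w (f w)%:E)%E.
Proof.
move=> mf c0 f0; rewrite -ge0_integralZl ?lee_fin //; first exact/measurable_EFinP.
by move=> w _; rewrite lee_fin.
Qed.

Lemma prob_integral_cst (c : R) : (\int[P]_(w in [set: Om]) c%:E = c%:E)%E.
Proof. by rewrite integral_cst // [X in (_ * X)%E](probability_setT P) mule1. Qed.

Lemma sum_prob_integral (I : finType) (f : I -> Om -> R) :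
  (forall i, measT (f i)) -> (forall i w, 0 <= f i w) ->
  (\int[P]_w (\sum_i f i w)%:E = \sum_i \int[P]_w (f i w)%:E)%E.
Proof.
move=> mf f0; rewrite -ge0_integral_sum //.
- by apply: eq_integral => w _; rewrite sumEFin.
- by move=> i; apply/measurable_EFinP.
- by move=> i w _; rewrite lee_fin.
Qed.

Lemma prob_integral_sqrD f g : measT f -> measT g ->
  (\int[P]_w ((f w + g w) ^+ 2)%:E <=
   2%:E * \int[P]_w (f w ^+ 2)%:E + 2%:E * \int[P]_w (g w ^+ 2)%:E)%E.
Proof.
move=> mf mg.
have mf2 := measurable_funX 2 mf; have mg2 := measurable_funX 2 mg.
have mfg := measurable_funX 2 (measurable_funD mf mg).
rewrite -!prob_integralZ //; first last; try by move=> w; exact: sqr_ge0.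
rewrite -prob_integralD //; first last; try by move=> w; rewrite mulr_ge0 // sqr_ge0.
- by apply: measurable_funM.
- by apply: measurable_funM.
apply: prob_integral_le => //; first by apply: measurable_funD; apply: measurable_funM.
by move=> w; rewrite sqr_ge0 /=; have := sqr_ge0 (f w - g w); rewrite !sqrrD sqrrN; nra.
Qed.

End prob_integral.

Lemma double_le {R : realType} (x y : \bar R) : (x <= y)%E -> (2%:E * x <= 2%:E * y)%E.
Proof. by move=> xy; apply: lee_wpmul2l. Qed.

(** * Measurability of continuous functions of random vectors *)

Section measurable_composition.
Context {R : realType} {d0 : measure_display} {S : measurableType d0} {d : nat}.

(* The open set {f > y} is the union of the rational cubes it contains. *)
Lemma measurable_comp_cV (D : set S) (X : S -> 'cV[R]_d) (f : 'cV[R]_d -> R) :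
  continuous f -> (forall i, measurable_fun D (fun w => X w i 0)) ->
  measurable_fun D (fun w => f (X w)).
Proof.
move=> cf mX mD; apply: (measurability _ (RGenOInfty.measurableE R)) => //.
move=> _ [_ [y ->] <-].
pose cube (c : {ffun 'I_d -> rat}) (q : rat) :=
  [set z : 'cV[R]_d | forall i, `|z i 0 - ratr (c i)| < ratr q].
have -> : D `&` (fun w => f (X w)) @^-1` `]y, +oo[%classic =
    \bigcup_(cq : {ffun 'I_d -> rat} * rat)
      (D `&` [set w | cube cq.1 cq.2 (X w) /\ cube cq.1 cq.2 `<=` [set z | y < f z]]).
  apply/seteqP; split=> w /=; last first.
    by move=> [cq _ [Dw [cw sub]]]; split => //; rewrite in_itv /= andbT; exact: sub.
  rewrite in_itv /= andbT => -[Dw yf].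
  have : nbhs (X w) [set z | y < f z] by exact: (cvgr_gt _ (cf (X w))).
  move=> /nbhs_ballP [e /= e0 He].
  have c0 : 0 < 2 * d.+1%:R :> R by rewrite mulr_gt0 // ltr0n.
  have [q /andP[q0 qe]] : exists q : rat, 0 < (ratr q : R) < e / (2 * d.+1%:R).
    by have [q] := @rat_in_itvoo R 0 _ (divr_gt0 e0 c0); rewrite in_itv; exists q.
  have [c Hc] : exists c : 'I_d -> rat, forall i, `|X w i 0 - ratr (c i)| < ratr q.
    have Hi i : exists c : rat, `|X w i 0 - ratr c| < ratr q; last by have [c] := choice Hi; exists c.
    have [|c] := @rat_in_itvoo R (X w i 0) (X w i 0 + ratr q); first by rewrite ltrDl.
    by rewrite in_itv /= => /andP[h1 h2]; exists c; rewrite distrC gtr0_norm ?subr_gt0 // ltrBlDl.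
  exists ([ffun i => c i], q) => //; split => //; split => [i|z cz] /=; first by rewrite ffunE.
  apply: He; rewrite -ball_normE /=; apply: le_lt_trans (mx_norm_enorm _) _.
  apply: le_lt_trans (enorm_cV_le_sum _) _.
  apply: (@le_lt_trans _ _ (\sum_(i < d) 2 * ratr q)).
    apply: ler_sum => i _; rewrite !mxE; have := cz i; rewrite /= ffunE => h1; have h2 := Hc i.
    have -> : X w i 0 - z i 0 = (X w i 0 - ratr (c i)) - (z i 0 - ratr (c i)) by ring.
    apply: le_trans (ler_normB _ _) _; lra.
  rewrite sumr_const card_ord -[X in X < _]mulr_natr; move: qe; rewrite ltr_pdivlMr // => qe.
  apply: le_lt_trans qe; have : d%:R <= d.+1%:R :> R by rewrite ler_nat.
  nra.
apply: countable_bigcupT_measurable; first exact: countableP.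
move=> [c q]; have [sub|nsub] := pselect (cube c q `<=` [set z | y < f z]); last first.
  by rewrite (_ : _ `&` _ = set0) //; apply/seteqP; split => // w [_ [_ /= /nsub]].
have -> : D `&` [set w | cube (c, q).1 (c, q).2 (X w) /\ cube (c, q).1 (c, q).2 `<=` [set z | y < f z]] =
    D `&` \bigcap_(i in [set: 'I_d])
      (D `&` (fun w => X w i 0) @^-1` `](ratr (c i) - ratr q : R), (ratr (c i) + ratr q)[%classic).
  apply/seteqP; split=> w /=.
    move=> [Dw [cw _]]; split => // i _; split => //; rewrite /= in_itv /=.
    by have := cw i; rewrite /= ltr_norml => /andP[h1 h2]; apply/andP; split; lra.
  move=> [Dw H]; split => //; split => // i; have [_] := H i I.
  by rewrite /= in_itv /= ltr_norml => /andP[h1 h2]; apply/andP; split; lra.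
apply: measurableI => //; apply: fin_bigcap_measurable; first exact: finite_finset.
by move=> i _; apply: mX => //.
Qed.

End measurable_composition.

Section time_integral.
Context {R : realType} (T : R).
Local Notation mu := (@lebesgue_measure R).

Lemma lebesgue_slab (a b : R) : 0 <= a -> a <= b -> b <= T ->
  mu.-integrable `[0, T]%classic (EFin \o (fun r => (a < r <= b)%R%:R)) /\
  \int[mu]_(r in `[0, T]) (a < r <= b)%R%:R = b - a.
Proof.
move=> a0 ab bT.
have E := itv_oc_indic a b.
have iE : (\int[mu]_(r in `[0%R, T]) ((a < r <= b)%R%:R : R)%:E = (b - a)%:E)%E.
  transitivity (\int[mu]_(r in `[0%R, T]) (\1_(`]a, b]%classic) r)%:E)%E.
    by apply: eq_integral => r _; rewrite -E.
  rewrite integral_indic // (_ : _ `&` _ = `]a, b]%classic); last first.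
    apply/seteqP; split => r /=; first by case.
    by rewrite !in_itv /= => /andP[h1 h2]; rewrite h1 h2 (ltW (le_lt_trans a0 h1)) (le_trans h2 bT).
  apply: etrans (lebesgue_measure_itv _) _; rewrite /= lte_fin.
  by case: ltP => // ba; congr EFin; lra.
split; last by rewrite /Rintegral iE.
by apply: ge0_integrable; rewrite ?iE ?ltry // E; exact: measurable_indic.
Qed.

Lemma Rintegral_cut (g : R -> R) (t : R) : 0 <= t <= T -> mu.-integrable `[0, T]%classic (EFin \o g) ->
  \int[mu]_(r in `[0, t]) g r = \int[mu]_(r in `[0, T]) (g r * (0 < r <= t)%R%:R).
Proof.
move=> /andP[t0 tT] ig.
have it : mu.-integrable `]0, t]%classic (EFin \o g).
  apply: integrableS ig => // r /=; rewrite !in_itv /= => /andP[r0 rt].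
  by rewrite (ltW r0) (le_trans rt).
rewrite -(Rintegral_itv_obnd_cbnd it) Rintegral_mkcond [RHS]Rintegral_mkcond.
congr Rintegral; apply/funext => r; rewrite !patchE.
case: ifPn => [/set_mem|/negP rt]; rewrite /= ?in_itv /=.
  move=> /andP[r0 rt]; rewrite ifT ?r0 ?rt ?mulr1 //; apply/mem_set.
  by rewrite /= in_itv /= (ltW r0) (le_trans rt).
rewrite (_ : (0 < r <= t) = false) ?mulr0 ?if_same //.
by apply/negP => h; apply: rt; apply/mem_set; rewrite /= in_itv.
Qed.

Lemma integrable_cut (g : R -> R) (a b : R) : mu.-integrable `[0, T]%classic (EFin \o g) ->
  mu.-integrable `[0, T]%classic (EFin \o (fun r => g r * (a < r <= b)%R%:R)).
Proof.
move=> ig; apply: (le_integrable _ _ _ ig) => //.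
  apply/measurable_EFinP; apply: measurable_funM.
    by have /integrableP[/measurable_EFinP] := ig.
  by rewrite itv_oc_indic; exact: measurable_indic.
move=> r _; rewrite /= lee_fin normrM; case: (_ && _); first by rewrite normr1 mulr1.
by rewrite normr0 mulr0.
Qed.

(* Integrate [2 c g - c^2 <= g^2] over ]a, b] with [c] the mean of [g]. *)
Lemma sqr_Rintegral_le (g : R -> R) (a b : R) : 0 <= a -> a <= b -> b <= T ->
  mu.-integrable `[0, T]%classic (EFin \o g) -> (forall r, g r != 0 -> a < r <= b) ->
  (((\int[mu]_(r in `[0, T]) g r) ^+ 2)%:E <=
   (b - a)%:E * \int[mu]_(r in `[0%R, T]) (g r ^+ 2)%:E)%E.
Proof.
move=> a0 ab bT ig sg; set I := Rintegral _ _ _.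
have [i1 e1] := lebesgue_slab a0 ab bT.
have mg : measurable_fun `[0, T]%classic g by have /integrableP[/measurable_EFinP] := ig.
have V0 : (0 <= \int[mu]_(r in `[0%R, T]) (g r ^+ 2)%:E)%E.
  by apply: integral_ge0 => r _; rewrite lee_fin sqr_ge0.
move: ab; rewrite le_eqVlt => /orP[/eqP ab'|ab'].
  have g0 r : g r = 0.
    by case: (eqVneq (g r) 0) => // /sg; rewrite -ab' => /andP[/lt_le_trans h /h]; rewrite ltxx.
  have -> : I = 0.
    transitivity (\int[mu]_(r in `[0, T]) (0 : R)); first by apply: eq_Rintegral => r _; exact: g0.
    by rewrite Rintegral_cst // mul0r.
  by rewrite expr2 mul0r mule_ge0 // lee_fin subr_ge0 ab'.
have key c : ((2 * c * I - c ^+ 2 * (b - a))%:E <= \int[mu]_(r in `[0%R, T]) (g r ^+ 2)%:E)%E.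
  case E : (\int[mu]_(r in `[0%R, T]) (g r ^+ 2)%:E)%E V0 => [v| |] // _; last by rewrite leey.
  have iV : mu.-integrable `[0, T]%classic (EFin \o (fun r => g r ^+ 2)).
    by apply: ge0_integrable; [exact: measurable_funX|move=> r; exact: sqr_ge0|rewrite E ltry].
  have iZ : mu.-integrable `[0, T]%classic (EFin \o (fun r => 2 * c * g r)).
    by apply: (integrableZl _ (2 * c) ig).
  have iS : mu.-integrable `[0, T]%classic (EFin \o (fun r => c ^+ 2 * (a < r <= b)%R%:R)).
    by apply: (integrableZl _ (c ^+ 2) i1).
  have iB : mu.-integrable `[0, T]%classic
    (EFin \o (fun r => 2 * c * g r - c ^+ 2 * (a < r <= b)%R%:R)) by apply: (integrableB _ iZ iS).
  have -> : (2 * c * I - c ^+ 2 * (b - a)) =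
     \int[mu]_(r in `[0, T]) (2 * c * g r - c ^+ 2 * (a < r <= b)%R%:R).
    by rewrite RintegralB // !RintegralZl // e1.
  have -> : v = \int[mu]_(r in `[0, T]) (g r ^+ 2) by rewrite /Rintegral E.
  rewrite lee_fin; apply: le_Rintegral => // r _.
  case: (boolP (a < r <= b)) => rab; rewrite ?mulr1 ?mulr0.
    by have := sqr_ge0 (g r - c); rewrite sqrrB; nra.
  have -> : g r = 0 by case: (eqVneq (g r) 0) => // /sg; rewrite (negPf rab).
  by rewrite mulr0 subr0 expr0n.
have ba : 0 < b - a by rewrite subr_gt0.
have := key (I / (b - a)).
have -> : 2 * (I / (b - a)) * I - (I / (b - a)) ^+ 2 * (b - a) = (b - a)^-1 * I ^+ 2.
  by field; exact: lt0r_neq0.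
move=> h; have -> : (I ^+ 2)%:E = ((b - a)%:E * ((b - a)^-1 * I ^+ 2)%:E)%E.
  by rewrite -EFinM mulrA mulfV ?mul1r // gt_eqF.
by apply: lee_wpmul2l => //; rewrite lee_fin ltW.
Qed.

End time_integral.

Lemma cvg_pow {R : realType} (u : nat -> R) (l : R) k : u n @[n --> \oo] --> l ->
  u n ^+ k @[n --> \oo] --> l ^+ k.
Proof.
move=> ul; elim: k => [|k IH]; first by rewrite expr0; exact: cvg_cst.
rewrite exprS (_ : (fun n => _) = fun n => u n * u n ^+ k); first exact: cvgM.
by apply/funext => n; rewrite exprS.
Qed.

Lemma Rintegral_ord_sum {R : realType} {d0} {Om : measurableType d0}
    (mu : {measure set Om -> \bar R}) (D : set Om) (F : nat -> Om -> R) m : measurable D ->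
    (forall i, (i < m)%N -> mu.-integrable D (EFin \o F i)) ->
  mu.-integrable D (EFin \o (fun w => \sum_(i < m) F i w)) /\
  \int[mu]_(w in D) (\sum_(i < m) F i w) = \sum_(i < m) \int[mu]_(w in D) F i w.
Proof.
move=> mD; elim: m => [_|m IH iF].
  have E0 : (fun w => \sum_(i < 0) F i w) = fun=> 0 by apply/funext => w; rewrite big_ord0.
  rewrite E0 big_ord0 Rintegral_cst // mul0r; split => //; exact: integrable0.
have [i1 e1] := IH (fun i im => iF i (ltn_trans im (ltnSn m))).
have E1 : (fun w => \sum_(i < m.+1) F i w) = fun w => \sum_(i < m) F i w + F m w.
  by apply/funext => w; rewrite big_ord_recr.
rewrite E1; split; first exact: (integrableD mD i1 (iF m (ltnSn m))).
by rewrite RintegralD // ?e1 ?big_ord_recr //; exact: iF.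
Qed.

(** * Finite grids and slabs in time *)

Section grid.
Context {R : realType}.
Implicit Types (L : seq R) (a b r : R).

Definition gridpt L i : R := nth 0 (0 :: L) i.

Lemma gridpt_ltE L i k : path <%R 0 L -> (i <= size L)%N -> (k <= size L)%N ->
  (gridpt L i < gridpt L k) = (i < k)%N.
Proof. by move=> pL iL kL; rewrite /gridpt lt_sorted_ltn_nth ?inE //= ltnS. Qed.

Lemma gridpt_leE L i k : path <%R 0 L -> (i <= size L)%N -> (k <= size L)%N ->
  (gridpt L i <= gridpt L k) = (i <= k)%N.
Proof. by move=> pL iL kL; rewrite leNgt gridpt_ltE // -leqNgt. Qed.

Lemma gridptP L a : a \in 0 :: L -> exists2 i, (i <= size L)%N & a = gridpt L i.
Proof.
move=> aL; exists (index a (0 :: L)); first by rewrite -ltnS -[(size L).+1]/(size (0 :: L)) index_mem.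
by rewrite /gridpt nth_index.
Qed.

Lemma gridpt_last L : gridpt L (size L) = last 0 L.
Proof. by rewrite /gridpt -[size L]/(size (0 :: L)).-1 nth_last. Qed.

Lemma grid_telescope L a b (f : R -> R) : path <%R 0 L -> a \in 0 :: L -> b \in 0 :: L -> a <= b ->
  \sum_(i < size L) (a < gridpt L i.+1 <= b)%R%:R * (f (gridpt L i.+1) - f (gridpt L i)) = f b - f a.
Proof.
move=> pL /gridptP[p pL' ->] /gridptP[q qL ->]; rewrite gridpt_leE // => pq.
rewrite -(big_mkord xpredT (fun i => (gridpt L p < gridpt L i.+1 <= gridpt L q)%R%:R *
  (f (gridpt L i.+1) - f (gridpt L i)))).
rewrite -(telescope_sumr (fun i => f (gridpt L i)) pq) (big_cat_nat (leq0n p) pL') /=.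
rewrite (big_cat_nat pq qL) /= [X in X + _]big_nat_cond [X in X + _]big1 ?add0r; last first.
  move=> i; rewrite andbT => /andP[_ ip]; rewrite gridpt_ltE //; last exact: leq_trans ip pL'.
  by rewrite ltnS leqNgt ip mul0r.
rewrite [X in _ + X]big_nat_cond [X in _ + X]big1 ?addr0; last first.
  move=> i; rewrite andbT => /andP[qi iL]; rewrite gridpt_leE //.
  by rewrite [(i < q)%N]ltnNge qi andbF mul0r.
apply: eq_big_nat => i /andP[pi iq]; have iL : (i < size L)%N by exact: leq_trans iq qL.
by rewrite gridpt_ltE // gridpt_leE // ltnS pi iq mul1r.
Qed.

Lemma grid_indicator L a b r i : path <%R 0 L -> a \in 0 :: L -> b \in 0 :: L ->
  (i < size L)%N -> gridpt L i < r <= gridpt L i.+1 ->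
  (a < r <= b) = (a < gridpt L i.+1 <= b).
Proof.
move=> pL /gridptP[p pL' ->] /gridptP[q qL ->] iL /andP[ir ri].
congr (_ && _); apply/idP/idP => h.
- exact: lt_le_trans ri.
- apply: le_lt_trans ir; rewrite gridpt_leE ?(ltnW iL) //; move: h; rewrite gridpt_ltE //.
- by have := lt_le_trans ir h; rewrite gridpt_ltE ?(ltnW iL) // => iq; rewrite gridpt_leE.
- exact: le_trans ri h.
Qed.

Lemma grid_cover L r : path <%R 0 L -> 0 < r <= last 0 L ->
  exists2 i, (i < size L)%N & gridpt L i < r <= gridpt L i.+1.
Proof.
move=> pL /andP[r0 rL].
have ex : exists i, r <= gridpt L i.
  by exists (size L); rewrite gridpt_last.
have [i ri imin] := ex_minnP ex.
case: i ri imin => [|i] ri imin; first by move: r0; rewrite ltNge ri.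
have iL : (i < size L)%N.
  by apply: (imin (size L)); rewrite gridpt_last.
exists i => //; rewrite ri andbT ltNge; apply/negP => /imin; by rewrite ltnn.
Qed.

End grid.

Section slabs.
Context {R : realType} (h r : R) (h0 : 0 < h).
Local Notation ind m := ((m%:R * h < r <= m.+1%:R * h)%R%:R : R).

Lemma slab_sum_out (G : nat -> R) k : ~~ (0 < r <= k%:R * h) -> \sum_(m < k) G m * ind m = 0.
Proof.
move=> H; apply: big1 => m _; case: (boolP (_ < r <= _)) => [/andP[mr rm]|_]; last by rewrite mulr0.
have m0 : 0 <= m%:R * h by rewrite mulr_ge0 // ltW.
have mk : m.+1%:R * h <= k%:R * h by rewrite ler_pM2r // ler_nat ltn_ord.
by case/negP: H; rewrite (le_lt_trans m0 mr) (le_trans rm mk).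
Qed.

(** At each [r] at most one slab is active, so the square can be estimated slab by slab and no
    constant is lost. *)
Lemma slab_sqr (c : R) (G H : nat -> R) k : (forall m, (m < k)%N -> (c - G m) ^+ 2 <= H m) ->
  (c * (0 < r <= k%:R * h)%R%:R - \sum_(m < k) G m * ind m) ^+ 2 <= \sum_(m < k) H m * ind m.
Proof.
elim: k => [|k IH] GH.
  rewrite !big_ord0 mul0r; case: (boolP (0 < r <= 0)) => [/andP[h1 h2]|_].
    by move: (lt_le_trans h1 h2); rewrite ltxx.
  by rewrite mulr0 subr0 expr2 mul0r.
have kS : k%:R * h <= k.+1%:R * h by rewrite ler_pM2r // ler_nat.
rewrite !big_ord_recr /=; case: (leP r (k%:R * h)) => rk.
  rewrite !mulr0 !addr0 (le_trans rk kS); rewrite rk in IH.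
  exact: IH (fun m mk => GH m (ltnW mk)).
have H0 : ~~ (0 < r <= k%:R * h) by rewrite negb_and -!leNgt -ltNge rk orbT.
rewrite !slab_sum_out // !add0r.
have -> : 0 < r by apply: le_lt_trans rk; rewrite mulr_ge0 // ltW.
case: (r <= _) => /=; first by rewrite !mulr1 GH.
by rewrite !mulr0 subr0 expr2 mul0r.
Qed.

End slabs.

Lemma gronwall_geometric {R : realType} (A B : R) k :
  A + B * \sum_(m < k) A * (1 + B) ^+ m = A * (1 + B) ^+ k.
Proof.
elim: k => [|k IH]; first by rewrite big_ord0 mulr0 addr0 expr0 mulr1.
by rewrite big_ord_recr /= mulrDr addrA IH exprS; ring.
Qed.

(** * Lipschitz regularization by infimal convolution *)

Section inf_convolution.
Context {R : realType} {d : nat}.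
Local Notation V := 'cV[R]_d.
Context (phi : V -> R) (M : R) (phiM : forall z, `|phi z| <= M).

(** For bounded [phi] and [0 <= K] this is the largest [K]-Lipschitz minorant of [phi]. It keeps the
    bound [M] and replaces a merely continuous [phi] by a Lipschitz function, as membership in [Lip]
    requires. *)
Definition inf_conv (K : R) (z : V) : R := inf [set phi q + K * enorm (q - z) | q in [set: V]].

Context (K : R) (K0 : 0 <= K).

Let phi_ge q : - M <= phi q. Proof. by have := phiM q; rewrite ler_norml => /andP[]. Qed.

Let values_ge z : lbound [set phi q + K * enorm (q - z) | q in [set: V]] (- M).
Proof. by move=> _ [q _ <-]; rewrite -[- M]addr0 lerD ?mulr_ge0 ?enorm_ge0. Qed.

Lemma inf_conv_le z q : inf_conv K z <= phi q + K * enorm (q - z).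
Proof. by apply: ge_inf; [exists (- M); exact: values_ge|exists q]. Qed.

Lemma le_inf_conv z c : (forall q, c <= phi q + K * enorm (q - z)) -> c <= inf_conv K z.
Proof.
move=> H; apply: lb_le_inf; first by exists (phi 0 + K * enorm (0 - z)), 0.
by move=> _ [q _ <-].
Qed.

Lemma inf_conv_le_self z : inf_conv K z <= phi z.
Proof. by have := inf_conv_le z z; rewrite subrr enorm0 mulr0 addr0. Qed.

Lemma inf_conv_bound z : `|inf_conv K z| <= M.
Proof.
rewrite ler_norml; apply/andP; split.
  by apply: le_inf_conv => q; apply: values_ge; exists q.
apply: le_trans (inf_conv_le_self z) _; exact: le_trans (ler_norm _) (phiM z).
Qed.

Lemma inf_conv_lip y z : `|inf_conv K y - inf_conv K z| <= K * enorm (y - z).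
Proof.
have H u v : inf_conv K u - inf_conv K v <= K * enorm (u - v).
  rewrite lerBlDr -lerBlDl; apply: le_inf_conv => q; rewrite lerBlDl.
  apply: le_trans (inf_conv_le u q) _; rewrite addrCA lerD2l -mulrDr ler_wpM2l //.
  have -> : q - u = (q - v) - (u - v) by rewrite opprB addrA subrK.
  by rewrite (le_trans (enormD _ _)) // enormN addrC.
rewrite ler_norml -lerNl; apply/andP; split; last exact: H.
by rewrite opprB enorm_distC H.
Qed.

End inf_convolution.

Lemma inf_conv_close {R : realType} {d : nat} (phi : 'cV[R]_d -> R) (M : R) (r e : R) :
  (forall z, `|phi z| <= M) -> continuous phi -> 0 < e ->
  exists2 K0 : R, 0 <= K0 & forall K, K0 <= K -> forall z, enorm z <= r ->
    `|phi z - inf_conv phi K z| <= e.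
Proof.
move=> phiM cphi e0; have [h h0 H] := compact_uniform (@compact_box R d r) cphi e0.
have M0 : 0 <= M by exact: le_trans (normr_ge0 _) (phiM 0).
exists (2 * M / h); first by rewrite divr_ge0 ?mulr_ge0 // ltW.
move=> K; rewrite ler_pdivrMr // => hK z zr.
have K0 : 0 <= K by rewrite -(pmulr_lge0 _ h0); apply: le_trans hK; rewrite mulr_ge0.
rewrite ger0_norm ?subr_ge0 ?(inf_conv_le_self phiM) // lerBlDr -lerBlDl.
apply: le_inf_conv => q; have [qz|zq] := leP (enorm (q - z)) h.
  have : `|phi q - phi z| <= e.
    apply: H; first by move=> i; apply: le_trans (enorm_coord z i 0) zr.
    exact: le_trans (mx_norm_enorm _) qz.
  rewrite ler_norml => /andP[h1 _]; have : 0 <= K * enorm (q - z) by rewrite mulr_ge0 ?enorm_ge0.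
  lra.
have : K * h <= K * enorm (q - z) by rewrite ler_wpM2l // ltW.
have := phiM z; have := phiM q; rewrite !ler_norml => /andP[h1 h2] /andP[h3 h4]; lra.
Qed.

(** * The quadratic coefficients of the log-Harnack recursion *)

Section coefficients.
Context {R : realType} (h kappa L Lb U2 C : R) (n : nat) (h0 : 0 < h) (kappa0 : 0 < kappa)
  (C0 : 0 < C) (U20 : 0 <= U2) (L0 : 0 <= L) (LE : L = 2 * Lb + U2).
Local Notation T := (n%:R * h).
Let CE : R := C * expR (T * (L + 1)).
Let L2 : R := Lb ^+ 2 + U2 * (CE / kappa).
Hypothesis hL2 : h * L2 <= 1.
Let Rf : R := 1 + h * (L + h * L2).

(* [c |-> 1 / c] turns the recursion of the quadratic coefficients into an
   affine one. *)
Fixpoint inv_coef (j : nat) : R :=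
  if j is j'.+1 then (inv_coef j' + h / kappa) / Rf else C^-1.

Let L20 : 0 <= L2.
Proof.
rewrite addr_ge0 ?sqr_ge0 // mulr_ge0 // divr_ge0 ?(ltW kappa0) //.
by rewrite mulr_ge0 ?expR_ge0 // ltW.
Qed.

Let Rf1 : 1 <= Rf.
Proof. by rewrite lerDl mulr_ge0 ?(ltW h0) // addr_ge0 // mulr_ge0 // ltW. Qed.

Let Rf0 : 0 < Rf. Proof. exact: lt_le_trans ltr01 Rf1. Qed.

Let RfE j : Rf ^+ j <= expR (j%:R * (h * (L + h * L2))).
Proof.
rewrite expRM_natl; apply: lerXn2r; rewrite ?nnegrE ?expR_ge0 ?(ltW Rf0) //.
apply: expR_ge1Dx.
Qed.

Lemma inv_coef_gt0 j : 0 < inv_coef j.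
Proof.
elim: j => [|j IH] /=; first by rewrite invr_gt0.
by rewrite divr_gt0 // addr_gt0 // divr_gt0.
Qed.

Let inv_coef_ge j : (C * Rf ^+ j)^-1 <= inv_coef j.
Proof.
elim: j => [|j IH] /=; first by rewrite expr0 mulr1.
rewrite exprSr mulrA invfM ler_wpM2r ?invr_ge0 ?(ltW Rf0) //.
by apply: le_trans IH _; rewrite lerDl divr_ge0 ?ltW.
Qed.

(** The a priori bound [CE] enters the growth factor [Rf] through [L2]. The circle closes because
    [h * L2 <= 1] keeps the rate below [L + 1], whatever the size of [CE]. *)
Let coef_le j : (j <= n)%N -> (inv_coef j)^-1 <= CE.
Proof.
move=> jn; have := inv_coef_ge j; have p0 := inv_coef_gt0 j.
have q0 : 0 < C * Rf ^+ j by rewrite mulr_gt0 // exprn_gt0.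
move=> H; apply: (@le_trans _ _ (C * Rf ^+ j)).
  by rewrite -[leRHS]invrK lef_pV2 ?posrE ?invr_gt0.
rewrite /CE ler_pM2l //; apply: le_trans (RfE j) _; rewrite ler_expR mulrA.
apply: ler_pM; rewrite ?mulr_ge0 ?(ltW h0) //; last by rewrite lerD2l.
  by rewrite addr_ge0 // mulr_ge0 // ltW.
by rewrite ler_pM2r // ler_nat.
Qed.

(** The left side is the coefficient that one step of the scheme produces from [(inv_coef j)^-1].
    Over the denominator [inv_coef j + h / kappa], its numerator still contains [(inv_coef j)^-1];
    replacing this by the bound [CE] turns the numerator into the constant [Rf]. *)
Lemma inv_coef_step j : (j < n)%N ->
  (1 + h * Lb) ^+ 2 * ((inv_coef j)^-1 * kappa / (kappa + (inv_coef j)^-1 * h)) +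
    (inv_coef j)^-1 * U2 * h <= (inv_coef j.+1)^-1.
Proof.
move=> jn /=; have := coef_le (ltnW jn); have p0 := inv_coef_gt0 j.
move: (inv_coef j) p0 => p p0 pC.
have q0 : 0 < p + h / kappa by rewrite addr_gt0 // divr_gt0.
have kp : 0 < kappa * p + h by rewrite addr_gt0 // mulr_gt0.
have -> : (1 + h * Lb) ^+ 2 * (p^-1 * kappa / (kappa + p^-1 * h)) + p^-1 * U2 * h =
  ((1 + h * Lb) ^+ 2 + U2 * h * (1 + h / kappa * p^-1)) / (p + h / kappa).
  by field; rewrite !lt0r_neq0 // mulrC.
rewrite invf_div ler_wpM2r ?invr_ge0 ?(ltW q0) //.
have h1 : h / kappa * p^-1 <= h / kappa * CE by rewrite ler_wpM2l // divr_ge0 ?ltW.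
have h2 : U2 * h * (1 + h / kappa * p^-1) <= U2 * h * (1 + h / kappa * CE).
  by rewrite ler_wpM2l ?mulr_ge0 ?(ltW h0) // lerD2l.
have -> : Rf = (1 + h * Lb) ^+ 2 + U2 * h * (1 + h / kappa * CE).
  by rewrite /Rf /L2 LE; ring.
by rewrite lerD2l.
Qed.

Lemma exp_quotient_step s : exp_quotient L (s + h) <= expR (- (h * L)) * exp_quotient L s + h.
Proof.
rewrite /exp_quotient; have [->|Ln] := eqVneq L 0.
  by rewrite mulr0 oppr0 expR0 mul1r.
have Lp : 0 < L by rewrite lt0r Ln.
rewrite ler_pdivrMr // mulrDl mulrA divfK //.
have -> : expR (- (L * (s + h))) = expR (- (h * L)) * expR (- (L * s)) by rewrite -expRD; congr expR; ring.
have := expR_ge1Dx (- (h * L)); lra.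
Qed.

Lemma exp_quotient0 : exp_quotient L 0 = 0.
Proof. by rewrite /exp_quotient mulr0 oppr0 expR0 subrr mul0r; case: ifP. Qed.

(** [kappa * inv_coef] behaves like an Euler scheme for [xi' = 1 - L * xi], whose solution from 0 is
    [exp_quotient L]. In the exponent, [j%:R * (h * (h * L2))] collects the second-order parts of
    the factors [Rf], and the extra [h * L] accounts for the division of the newest increment by
    [Rf]. *)
Let inv_coef_quotient j :
  expR (- (j%:R * (h * (h * L2))) - h * L) * exp_quotient L (j%:R * h) <= kappa * inv_coef j.
Proof.
elim: j => [|j IH]; first by rewrite !mul0r exp_quotient0 mulr0 mulr_ge0 ?invr_ge0 ?ltW.
have RfE1 : Rf <= expR (h * (L + h * L2)) by apply: expR_ge1Dx.
rewrite /= [leRHS]mulrA ler_pdivlMr // [leRHS]mulrDr.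
have -> : kappa * (h / kappa) = h by rewrite mulrCA mulfV ?mulr1 // gt_eqF.
have hD : 0 <= j%:R * (h * (h * L2)) by rewrite !mulr_ge0 ?(ltW h0).
set a := expR (- (j.+1%:R * (h * (h * L2))) - h * L).
have q1 : exp_quotient L (j.+1%:R * h) <= expR (- (h * L)) * exp_quotient L (j%:R * h) + h.
  by rewrite -natr1 mulrDl mul1r; exact: exp_quotient_step.
have aR : a * Rf <= expR (- (j%:R * (h * (h * L2)))).
  apply: (@le_trans _ _ (a * expR (h * (L + h * L2)))); first by rewrite ler_wpM2l ?expR_ge0.
  by rewrite -expRD ler_expR -natr1; lra.
have pos : 0 <= expR (- (h * L)) * exp_quotient L (j%:R * h) + h.
  apply: le_trans q1; rewrite /exp_quotient; case: ifP => L_0.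
    by rewrite mulr_ge0 ?(ltW h0).
  rewrite divr_ge0 // subr_ge0 -[leRHS]expR0 ler_expR oppr_le0 !mulr_ge0 ?(ltW h0) //.
rewrite mulrAC; apply: le_trans (ler_wpM2l (mulr_ge0 (expR_ge0 _) (ltW Rf0)) q1) _.
apply: le_trans (ler_wpM2r pos aR) _; rewrite mulrDr; apply: lerD.
  by apply: le_trans IH; rewrite [leLHS]mulrA -expRD.
by rewrite ler_piMl ?(ltW h0) // -[leRHS]expR0 ler_expR oppr_le0.
Qed.

(** The mesh condition bounds the exponent by [4^-1], and [1 + x <= expR x] gives [3 / 4]; its
    inverse is one of the two constants balanced in [one_sided]. *)
Lemma inv_coef_final : h * L2 * T + h * L <= 4^-1 ->
  3 / 4 * exp_quotient L T <= kappa * inv_coef n.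
Proof.
move=> hs; apply: le_trans (inv_coef_quotient n); apply: ler_wpM2r.
  rewrite /exp_quotient; case: ifP => L_0; first by rewrite mulr_ge0 ?(ltW h0).
  by rewrite divr_ge0 // subr_ge0 -[leRHS]expR0 ler_expR oppr_le0 !mulr_ge0 ?(ltW h0).
apply: le_trans (expR_ge1Dx _).
have -> : n%:R * (h * (h * L2)) = h * L2 * T by ring.
lra.
Qed.

End coefficients.

(** [expR s] is the square of [expR (s / 2)], which is at most [(1 - s / 2)^-1]; what remains is a
    polynomial inequality. The coefficient [3 / 2] on the range up to [2 / 3] balances the loss in
    [inv_coef_final]. *)
Lemma expR_le_quadratic {R : realType} (s : R) : s <= 2 / 3 -> expR s <= 1 + s + 3 / 2 * s ^+ 2.
Proof.
move=> s23; have a0 : 0 < 1 - s / 2 by lra.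
have h1 : expR (s / 2) <= (1 - s / 2)^-1.
  rewrite -[leLHS]invrK lef_pV2 ?posrE ?invr_gt0 ?expR_gt0 // -expRN.
  by have := expR_ge1Dx (- (s / 2)).
have -> : s = s / 2 + s / 2 by lra.
rewrite {1}expRD -(_ : s = s / 2 + s / 2); last by lra.
apply: (@le_trans _ _ ((1 - s / 2)^-1 * (1 - s / 2)^-1)); first by apply: ler_pM; rewrite ?expR_ge0.
rewrite -invfM -[leLHS]mul1r ler_pdivrMr ?mulr_gt0 //.
have : 0 <= s ^+ 2 * (3 / 4 - 5 / 4 * s + 3 / 8 * s ^+ 2).
  by rewrite mulr_ge0 ?sqr_ge0 //; nra.
nra.
Qed.

Lemma exp_quotient_gt0 {R : realType} (L T : R) : 0 <= L -> 0 < T -> 0 < exp_quotient L T.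
Proof.
move=> L0 T0; rewrite /exp_quotient; case: eqVneq => // Ln.
have Lp : 0 < L by rewrite lt0r Ln.
by rewrite divr_gt0 // subr_gt0 -[ltRHS]expR0 ltr_expR oppr_lt0 mulr_gt0.
Qed.

Lemma le_sub_close {R : realFieldType} (a a' c c' m e : R) : `|a - c| <= e -> `|a' - c'| <= e ->
  c - c' <= m + e -> a - a' <= m + 3 * e.
Proof. by rewrite !ler_norml => /andP[? ?] /andP[? ?] ?; lra. Qed.

Lemma le_norm_shift {R : realFieldType} (a c m : R) : `|a| <= m -> `|c| <= m -> a <= c + 2 * m.
Proof. by rewrite !ler_norml => /andP[? ?] /andP[? ?]; lra. Qed.

Lemma mesh_small {R : realFieldType} (t rate l n : R) : 0 < t -> 0 < n -> 0 <= rate -> 0 <= l ->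
  4 * t * (rate * (t + 1) + l) < n -> t / n * rate <= 1 /\ t / n * rate * t + t / n * l <= 4^-1.
Proof.
move=> t0 n0 r0 l0 H.
have h0 : 0 <= t / n by rewrite divr_ge0 ?ltW.
have hT : 0 <= t / n * rate * t by rewrite mulr_ge0 ?(ltW t0) // mulr_ge0.
have hl : 0 <= t / n * l by rewrite mulr_ge0.
have hr : 0 <= t / n * rate by rewrite mulr_ge0.
have : t / n * rate * t + t / n * rate + t / n * l <= 4^-1.
  have -> : t / n * rate * t + t / n * rate + t / n * l = t * (rate * (t + 1) + l) / n by ring.
  by rewrite ler_pdivrMr //; lra.
by split; lra.
Qed.

Section represented.
Context {R : realType} {d : nat} {T : R} (Gamma : set 'M[R]_d) (lG UG : R) (T_gt0 : 0 < T)
  (ellG : elliptic Gamma lG UG) (d_gt0 : (0 < d)%N).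
Local Notation G := (Gfun Gamma).
Local Notation Om := (wpath d T).
Local Notation V := 'cV[R]_d.
Local Notation E := (R * 'cV[R]_d)%type.
Context (PP : set (probability Om R)) (rep : represents G PP).
Local Notation mu := (@lebesgue_measure R).

(** * Increments under a representing measure *)

Section paths.

Lemma nbhs_path (w : Om) e : 0 < e ->
  nbhs w [set v : Om | forall t, 0 <= t <= T -> `|w t - v t| < e].
Proof.
move=> e0.
have : nbhs (wpath_unif w) [set h : {uniform` `[0, T]%classic -> 'cV[R]_d} |
    forall t, `[0, T]%classic t -> ball (w t) e (h t)].
  apply/uniform_nbhs; exists [set xy | ball xy.1 e xy.2]; split => //.
  exact: (entourage_ball _ (PosNum e0)).
move=> /(@initial_continuous _ _ (@wpath_unif R d T) w) h.
have {}h : nbhs w (@wpath_unif R d T @^-1` [set h : {uniform` `[0, T]%classic -> 'cV[R]_d} |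
    forall t, `[0, T]%classic t -> ball (w t) e (h t)]) by exact: h.
apply: filterS h => v /= H t tT; have := H t; rewrite in_itv /= tT => /(_ isT).
by rewrite -ball_normE.
Qed.

Lemma measurable_continuous_path (f : Om -> R) : continuous f -> measT f.
Proof.
move=> /continuousP cf; apply: (measurability _ (RGenOpens.measurableE R)) => _ [_ [a [b ->] <-]].
by rewrite setTI; apply: sub_sigma_algebra; apply: cf; exact: interval_open.
Qed.

Lemma continuous_path (f : Om -> R) :
  (forall (w : Om) e, 0 < e -> exists2 h : R, 0 < h &
    forall v : Om, (forall t, 0 <= t <= T -> `|w t - v t| < h) -> `|f w - f v| <= e) ->
  continuous f.
Proof.
move=> H w; apply: (@cvgrPdist_le _ _ _ _ (nbhs_filter w) _ _).2 => e e0.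
have [h h0 hf] := H w e e0; apply: filterS (nbhs_path w h0) => v; exact: hf.
Qed.

Lemma continuous_cylf D Phi : {in D, forall t, 0 <= t <= T} -> cylf D Phi ->
  continuous (fun w : Om => Phi w).
Proof.
move=> Ds [_ [K K0 PK]]; apply: continuous_path => w e e0.
pose c := (K + 1) * (size D * d).+1%:R; have c0 : 0 < c by rewrite mulr_gt0 // ltr_wpDl.
exists (e / c); first by rewrite divr_gt0.
move=> v vh; apply: le_trans (PK w v) _.
apply: (@le_trans _ _ (K * ((size D * d)%:R * (e / c)))); last first.
  apply: (@le_trans _ _ (c * (e / c))); last by rewrite mulrCA divff ?mulr1 // gt_eqF.
  rewrite [leLHS]mulrA; apply: ler_wpM2r (ltW (divr_gt0 e0 c0)) _ _ _.
  by apply: ler_pM => //; [rewrite lerDl|rewrite ler_nat].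
rewrite ler_wpM2l // /wdist natrM -mulrA.
apply: (@le_trans _ _ (\sum_(t <- D) d%:R * (e / c))); last first.
  by rewrite big_const_seq count_predT iter_addr_0 -[leLHS]mulr_natl.
rewrite big_seq [leRHS]big_seq; apply: ler_sum => t /Ds tT.
by apply: le_trans (enorm_le_norm _) _; rewrite ler_wpM2l // ltW // vh.
Qed.

Lemma measurable_coord t j : measT (fun w : Om => w t j 0).
Proof.
have -> : (fun w : Om => w t j 0) = (fun w : Om => w (Num.max 0 (Num.min t T)) j 0).
  by apply/funext => w; rewrite -wpath_stop.
apply: measurable_continuous_path; apply: continuous_path => w e e0; exists e => // v H.
have := H (Num.max 0 (Num.min t T)); rewrite le_max lexx /= ge_max (ltW T_gt0) ge_min lexx orbT.
move=> /(_ isT)/ltW; apply: le_trans; move: (Num.max _ _) => s.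
by have := mx_norm_coord (w s - v s) j 0; rewrite !mxE.
Qed.

End paths.

Section cylf_algebra.
Implicit Types (D : seq R) (Phi Psi : (R -> 'cV[R]_d) -> R).

Definition trunc (n x : R) : R := Num.max (- n) (Num.min x n).

Lemma trunc_bound n x : 0 <= n -> `|trunc n x| <= n.
Proof.
move=> n0; rewrite /trunc ler_norml.
by case: (leP x n) => ?; [case: (leP (- n) x) => ?|case: (leP (- n) n) => ?]; apply/andP; split; lra.
Qed.

Lemma trunc_id n x : `|x| <= n -> trunc n x = x.
Proof. by rewrite ler_norml /trunc => /andP[nx xn]; rewrite (min_l xn) max_r. Qed.

Lemma trunc_le n x : 0 <= n -> `|trunc n x| <= `|x|.
Proof.
move=> n0; have [xn|nx] := leP `|x| n; first by rewrite trunc_id.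
by apply: le_trans (trunc_bound x n0) (ltW nx).
Qed.

Lemma trunc_lip n x y : 0 <= n -> `|trunc n x - trunc n y| <= `|x - y|.
Proof.
move=> n0; have := ler_norm (x - y); have := ler_norm (- (x - y)); rewrite normrN ler_norml.
move: `|_| => z h1 h2; rewrite /trunc.
case: (leP x n) => ?; case: (leP y n) => ?; [case: (leP (- n) x) => ?; case: (leP (- n) y) => ?|
  case: (leP (- n) x) => ?; case: (leP (- n) n) => ?|case: (leP (- n) n) => ?; case: (leP (- n) y) => ?|
  case: (leP (- n) n) => ?]; apply/andP; split; lra.
Qed.

Lemma trunc_err n x : 0 < n -> `|x - trunc n x| <= x ^+ 2 / n.
Proof.
move=> n0; have [xn|nx] := leP `|x| n.
  by rewrite trunc_id // subrr normr0 divr_ge0 ?sqr_ge0 // ltW.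
rewrite ler_pdivlMr // -real_normK ?num_real // expr2; apply: ler_pM; rewrite ?normr_ge0 ?(ltW n0) ?(ltW nx) //.
have [x0|x0] := leP 0 x.
  move: nx; rewrite ger0_norm // => nx; rewrite /trunc (min_r (ltW nx)) max_r; last by lra.
  by rewrite ger0_norm ?subr_ge0 ?(ltW nx) //; lra.
move: nx; rewrite ltr0_norm // => nx; rewrite /trunc min_l; last by lra.
by rewrite max_l; [rewrite ler0_norm; lra|lra].
Qed.

Lemma cylf_cst (c : R) : cylf [::] (fun _ : R -> 'cV[R]_d => c).
Proof. by split; [exists `|c| => //|exists 0 => // w w'; rewrite subrr normr0 mul0r]. Qed.

Lemma cylfD D Phi Psi : cylf D Phi -> cylf D Psi -> cylf D (fun w => Phi w + Psi w).
Proof.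
move=> [[M PM] [K K0 PK]] [[M' PM'] [K' K0' PK']]; split.
  by exists (M + M') => w; apply: le_trans (ler_normD _ _) _; exact: lerD.
exists (K + K'); first exact: addr_ge0.
move=> w w'; rewrite opprD addrACA mulrDl; apply: le_trans (ler_normD _ _) _; exact: lerD.
Qed.

Lemma cylfM D Phi Psi : cylf D Phi -> cylf D Psi -> cylf D (fun w => Phi w * Psi w).
Proof.
move=> [[M PM] [K K0 PK]] [[M' PM'] [K' K0' PK']]; split.
  by exists (M * M') => w; rewrite normrM; apply: ler_pM.
have M0 : 0 <= M by exact: le_trans (normr_ge0 _) (PM (fun=> 0)).
have M0' : 0 <= M' by exact: le_trans (normr_ge0 _) (PM' (fun=> 0)).
exists (M * K' + M' * K); first by rewrite addr_ge0 // mulr_ge0.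
move=> w w'.
have -> : Phi w * Psi w - Phi w' * Psi w' = Phi w * (Psi w - Psi w') + Psi w' * (Phi w - Phi w').
  by ring.
rewrite mulrDl -!mulrA; apply: le_trans (ler_normD _ _) _; rewrite !normrM.
by apply: lerD; apply: ler_pM.
Qed.

Lemma cylf_sum (I : Type) (r : seq I) D (F : I -> (R -> 'cV[R]_d) -> R) :
  (forall i, cylf D (F i)) -> cylf D (fun w => \sum_(i <- r) F i w).
Proof.
move=> cF; elim: r => [|i r IH].
  rewrite (_ : (fun _ => _) = fun=> 0); last by apply/funext => w; rewrite big_nil.
  by apply: cylf_sub (cylf_cst 0).
rewrite (_ : (fun _ => _) = fun w => F i w + \sum_(i <- r) F i w); first exact: cylfD.
by apply/funext => w; rewrite big_cons.
Qed.

Lemma cylf_trunc_inc n s t (j : 'I_d) : 0 <= n ->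
  cylf [:: t; s] (fun w : R -> 'cV[R]_d => trunc n (w t j 0 - w s j 0)).
Proof.
move=> n0; split; first by exists n => w; exact: trunc_bound.
exists 1 => // w w'; rewrite mul1r /wdist big_cons big_seq1.
apply: le_trans (trunc_lip _ _ n0) _.
have -> : w t j 0 - w s j 0 - (w' t j 0 - w' s j 0) = (w t - w' t) j 0 - (w s - w' s) j 0.
  by rewrite !mxE; ring.
by apply: le_trans (ler_normB _ _) _; apply: lerD; exact: enorm_coord.
Qed.

End cylf_algebra.

(** With variance [UG ^+ 2 * h] over the remaining time [h], the brackets are the means of
    [(z + N) ^+ 2] and [(z + N) ^+ 4] for a centred Gaussian [N]. They are convex in [z], so for
    nonnegative [be] and [ga] the largest admissible variance is the worst one; [al] is free because
    [z] is linear. *)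
Definition barrier (j : 'I_d) (c t al be ga c0 : R) (p : E) : R :=
  let z := p.2 j 0 - c in let h := t - p.1 in
  al * z + be * (z ^+ 2 + UG ^+ 2 * h)
    + ga * (z ^+ 4 + 6 * UG ^+ 2 * h * z ^+ 2 + 3 * UG ^+ 4 * h ^+ 2) + c0.

Lemma barrier_supersolution j c t al be ga c0 : 0 <= be -> 0 <= ga ->
  exists qt qx qxx, hasC12 (barrier j c t al be ga c0) qt qx qxx /\
    forall p : E, p.1 <= t -> qt p + Gfun Gamma (hess qxx p) <= 0.
Proof.
move=> be0 ga0.
pose z (p : E) := p.2 j 0 - c; pose h (p : E) := t - p.1.
have hz : hasC12 z (fun=> 0) (fun i _ => (i == j)%:R) (fun _ _ _ => 0).
  have H := hasC12D (@hasC12_coord R d j) (hasC12_cst (- c)).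
  by apply: (hasC12_ext H) => [p|p|i p|i k p] //=; rewrite addr0.
have hh : hasC12 h (fun=> - 1) (fun _ _ => 0) (fun _ _ _ => 0).
  have H := hasC12D (@hasC12_cst R d t) (hasC12Z (- 1) (@hasC12_fst R d)).
  by apply: (hasC12_ext H) => [p|p|i p|i k p] /=; rewrite /h; ring.
have hz2 := hasC12M hz hz; have hz4 := hasC12M hz2 hz2; have hhz := hasC12M hh hz2.
have hh2 := hasC12M hh hh.
have H := hasC12D (hasC12D (hasC12D (hasC12Z al hz) (hasC12Z be
  (hasC12D hz2 (hasC12Z (UG ^+ 2) hh)))) (hasC12Z ga (hasC12D (hasC12D hz4
  (hasC12Z (6 * UG ^+ 2) hhz)) (hasC12Z (3 * UG ^+ 4) hh2)))) (hasC12_cst c0).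
pose qt p := - (be * UG ^+ 2) - ga * (6 * UG ^+ 2 * z p ^+ 2 + 6 * UG ^+ 4 * h p).
pose cx p := 2 * be + ga * (12 * z p ^+ 2 + 12 * UG ^+ 2 * h p).
exists qt, (fun i p => (al + 2 * be * z p + ga * (4 * z p ^+ 3 + 12 * UG ^+ 2 * h p * z p))
  * (i == j)%:R), (fun i k p => cx p * ((i == j)%:R * (k == j)%:R)); split.
  apply: (hasC12_ext H) => [p|p|i p|i k p]; rewrite /barrier /qt /cx -/(z p) -/(h p); ring.
move=> p pt; rewrite addrC -lerBrDr sub0r; apply: (Gfun_le ellG) => g Gg.
have -> : \tr (hess (fun i k p => cx p * ((i == j)%:R * (k == j)%:R)) p *m g) = cx p * g j j.
  rewrite /mxtrace (bigD1 j) //= mxE (bigD1 j) //= mxE !eqxx mul1r mulr1.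
  rewrite big1 => [|k /negPf kj]; last by rewrite mxE kj eqxx !mulr0 mul0r.
  rewrite addr0 big1 ?addr0 // => i /negPf ij; rewrite mxE big1 // => k _.
  by rewrite mxE ij mul0r mulr0 mul0r.
have cx0 : 0 <= cx p.
  apply: addr_ge0 (mulr_ge0 (ler0n _ _) be0) (mulr_ge0 ga0 (addr_ge0 _ _)).
    exact: mulr_ge0 (ler0n _ _) (sqr_ge0 _).
  by apply: mulr_ge0 (mulr_ge0 (ler0n _ _) (sqr_ge0 _)) _; rewrite subr_ge0.
apply: (@le_trans _ _ (2^-1 * (cx p * UG ^+ 2))).
  by rewrite !ler_wpM2l ?invr_ge0 //; exact: (elliptic_diag ellG).
by apply: le_of_eq; rewrite /cx /qt; field.
Qed.

(** Comparison requires a lower bound on the added supersolution. The linear term is absorbed by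
    completing the square, which is why [al] must vanish with [be]; the quotient is then 0 by the
    convention for division by zero. *)
Lemma barrier_lower j c t al be ga c0 (p : E) : 0 <= be -> 0 <= ga -> (be = 0 -> al = 0) ->
  p.1 <= t -> c0 - al ^+ 2 / (4 * be) <= barrier j c t al be ga c0 p.
Proof.
move=> be0 ga0 ba pt; rewrite /barrier; set z := _ - c; set h := t - p.1.
have h0 : 0 <= h by rewrite subr_ge0.
have g0 : 0 <= ga * (z ^+ 4 + 6 * UG ^+ 2 * h * z ^+ 2 + 3 * UG ^+ 4 * h ^+ 2).
  have e4 (x : R) : 0 <= x ^+ 4 by rewrite exprn_even_ge0.
  apply: mulr_ge0 ga0 (addr_ge0 (addr_ge0 (e4 z) (mulr_ge0 (mulr_ge0 _ h0) (sqr_ge0 z))) _).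
    exact: mulr_ge0 (ler0n _ _) (sqr_ge0 _).
  exact: mulr_ge0 (mulr_ge0 (ler0n _ _) (e4 UG)) (sqr_ge0 _).
have u0 : 0 <= be * (UG ^+ 2 * h) by exact: mulr_ge0 be0 (mulr_ge0 (sqr_ge0 _) h0).
suff : - (al ^+ 2 / (4 * be)) <= al * z + be * z ^+ 2.
  rewrite (mulrDr be); move: g0 u0; move: (ga * _) (be * (UG ^+ 2 * h)) (al * z) (be * z ^+ 2).
  by move: (al ^+ 2 / _) => *; lra.
have [b0|b0] := eqVneq be 0; first by rewrite b0 (ba b0) !mul0r addr0 mulr0 invr0 mulr0 oppr0.
have bp : 0 < be by rewrite lt_neqAle eq_sym b0.
have : 0 <= be * (z + al / (2 * be)) ^+ 2 by exact: mulr_ge0 be0 (sqr_ge0 _).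
have -> : be * (z + al / (2 * be)) ^+ 2 = al * z + be * z ^+ 2 + al ^+ 2 / (4 * be) by field.
by rewrite -lerBlDr sub0r.
Qed.

Section integrals.
Variable P : probability Om R.

Lemma integrable_bounded (f : Om -> R) M : measT f -> (forall w, `|f w| <= M) ->
  intT P f.
Proof.
move=> mf fM; apply: measurable_bounded_integrable => //.
  exact: le_lt_trans (probability_le1 P measurableT) (ltry 1).
exists M; split; first exact: num_real.
by move=> x Mx w _; apply: le_trans (fM w) (ltW Mx).
Qed.

Lemma integrable_le (f g : Om -> R) : measT f -> (forall w, `|f w| <= g w) ->
  intT P g -> intT P f.
Proof.
move=> mf fg; apply: le_integrable => //; first exact/measurable_EFinP.
by move=> w _; rewrite /= lee_fin; apply: le_trans (fg w) (ler_norm _).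
Qed.

Lemma Rintegral_EFin (f : Om -> R) : intT P f ->
  (\int[P]_w (f w)%:E)%E = (\int[P]_w f w)%:E.
Proof. by move=> h; rewrite /Rintegral fineK // integrable_fin_num. Qed.

Lemma cylf_measurable D Phi : {in D, forall t, 0 <= t <= T} -> cylf D Phi ->
  measT (fun w : Om => Phi w).
Proof. by move=> Ds cP; apply: measurable_continuous_path; exact: continuous_cylf cP. Qed.

Lemma cylf_integrable D Phi : {in D, forall t, 0 <= t <= T} -> cylf D Phi ->
  intT P (fun w : Om => Phi w).
Proof.
move=> Ds cP; have [[M PM] _] := cP; apply: (@integrable_bounded _ M) => //.
exact: cylf_measurable cP.
Qed.

Lemma fatou_le (f_ : nat -> Om -> R) (f : Om -> R) (C : \bar R) :
  (forall n, measT (f_ n)) -> (forall n w, 0 <= f_ n w) ->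
  (forall w, f_ n w @[n --> \oo] --> f w) ->
  (forall n, (\int[P]_w (f_ n w)%:E <= C)%E) -> (\int[P]_w (f w)%:E <= C)%E.
Proof.
move=> mf f0 ff fC.
have mfE n : measT (EFin \o f_ n) by apply/measurable_EFinP.
have := @fatou _ _ _ P setT measurableT (fun n => EFin \o f_ n) mfE (fun n w _ => f0 n w).
have -> : (\int[P]_w limn_einf (fun n => (EFin \o f_ n) w) = \int[P]_w (f w)%:E)%E.
  apply: eq_integral => w _.
  have h : (EFin \o f_ n) w @[n --> \oo] --> (f w)%:E.
    by apply: cvg_EFin; [exact: nearW|exact: ff].
  by rewrite (is_cvg_limn_einfE _); [exact: cvg_lim h|apply/cvg_ex; exists (f w)%:E].
move=> h; apply: le_trans h _; rewrite limn_einf_lim; apply: lime_le; first exact: is_cvg_einfs.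
apply: nearW => n; apply: le_trans (fC n); apply: ereal_inf_lbound.
by exists n => /=.
Qed.

Lemma Rintegral_limit0 (f_ : nat -> Om -> R) (f g : Om -> R) (c : nat -> R) :
  (forall n, measT (f_ n)) -> measT f ->
  (forall w, f_ n w @[n --> \oo] --> f w) ->
  (forall n w, `|f_ n w| <= g w) -> intT P g ->
  (forall n, `|\int[P]_w f_ n w| <= c n) -> c n @[n --> \oo] --> (0 : R) ->
  \int[P]_w f w = 0.
Proof.
move=> mf_ mf ff fg ig fc c0.
have i_ n : intT P (f_ n) by exact: integrable_le (mf_ n) (fg n) ig.
have h1 : \forall w \ae P, [set: Om] w -> (EFin \o f_ n) w @[n --> \oo] --> (EFin \o f) w.
  by apply: aeW => w _; apply: cvg_EFin; [exact: nearW|exact: ff].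
have h2 : \forall w \ae P, forall n, [set: Om] w -> (`|(EFin \o f_ n) w| <= (EFin \o g) w)%E.
  by apply: aeW => w n _; rewrite /= lee_fin.
have [fi _ cv] := dominated_convergence measurableT (fun n => (measurable_EFinP _ _).2 (mf_ n))
  ((measurable_EFinP _ _).2 mf) h1 ig h2.
have {}cv : \int[P]_w f_ n w @[n --> \oo] --> \int[P]_w f w.
  apply/fine_cvg; rewrite /Rintegral fineK ?integrable_fin_num //.
have cv0 : \int[P]_w f_ n w @[n --> \oo] --> (0 : R).
  apply/cvgrPdist_le => e e0; have /cvgrPdist_le/(_ e e0) := c0.
  apply: filterS => n; rewrite !sub0r !normrN => /(le_trans (ler_norm _)); exact: le_trans.
exact: (cvg_unique _ cv cv0).
Qed.

End integrals.

Section one_step_expectation.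
Context (P : probability Om R) (PPP : PP P).

Lemma Lip_integrable t (xi : Om -> R) : t <= T -> Lip t xi -> intT P xi.
Proof.
move=> tT /LipP[D [Phi [Dt cP ->]]]; apply: (cylf_integrable P _ cP) => r /Dt /andP[-> /le_trans].
exact.
Qed.

Lemma Lip_expectation_le (xi : Om -> R) : Lip T xi -> \int[P]_w xi w <= lip_expectation G xi.
Proof.
move=> lx; rewrite -lee_fin -Rintegral_EFin; last exact: Lip_integrable lx.
by rewrite rep.2 //; apply: ereal_sup_ubound; exists P.
Qed.

(** All moments of increments under [P] are obtained through this: it is enough to bound the
    functional, as a function of its last value, by a barrier whose coefficients may depend on
    [w]. *)
Lemma expectation_one_step (s t : R) D Phi j : 0 <= s -> s < t -> t <= T ->
  {in D, forall r, 0 <= r <= s} -> cylf (t :: D) Phi ->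
  (forall w, exists al be ga c0, [/\ 0 <= be, 0 <= ga, be = 0 -> al = 0,
     forall y, Phi (upd w t y) <= al * (y j 0 - w s j 0) + be * (y j 0 - w s j 0) ^+ 2
       + ga * (y j 0 - w s j 0) ^+ 4 + c0 &
     be * (UG ^+ 2 * (t - s)) + ga * (3 * UG ^+ 4 * (t - s) ^+ 2) + c0 <= 0]) ->
  \int[P]_w Phi (w : Om) <= 0.
Proof.
move=> s0 st tT Ds cP H.
have lx : Lip T (fun w : Om => Phi w).
  apply/LipP; exists (t :: D), Phi; split => // r; rewrite inE => /orP[/eqP ->|/Ds /andP[-> rs]].
    by rewrite tT andbT; apply: le_trans s0 (ltW st).
  by apply: le_trans rs (le_trans (ltW st) tT).
apply: le_trans (Lip_expectation_le lx) _.
apply: (lip_expectation_one_step ellG d_gt0 s0 st tT Ds cP) => w w0.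
have [al [be [ga [c0 [be0 ga0 ba Pq le0]]]]] := H w.
have [qt [qx [qxx [hq sq]]]] := barrier_supersolution j (w s j 0) t al c0 be0 ga0.
have bP : bounded_lipschitz (fun y => Phi (upd w t y)).
  exact: (BV_bounded_lipschitz (s := [::]) (t := 0) ellG d_gt0 t w cP).
rewrite -[leRHS](addr0 0).
apply: le_trans (_ : Sop Gamma s t (fun=> 0) (w s) +
   barrier j (w s j 0) t al be ga c0 (s, w s) <= _); last first.
  rewrite (Sop_cst ellG) ?(ltW st) // lerD2l /barrier /= subrr !expr0n /= !mulr0 !add0r.
  by apply: le_trans le0; rewrite lexx.
apply: (Sop_le_quad (C := c0 - al ^+ 2 / (4 * be)) ellG d_gt0 (w s) (ltW st) bP _ hq).
- exact: bounded_lipschitz_cst.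
- by move=> p /andP[_ /ltW]; exact: sq.
- by move=> p /andP[_ pt]; apply: barrier_lower.
- move=> y; apply: le_trans (Pq y) _; rewrite /barrier /= subrr !mulr0 !mul0r !expr0n /= !mulr0.
  by rewrite !addr0 add0r.
Qed.

End one_step_expectation.

(** * Moments of increments and the Ito isometry inequality *)

Lemma trunc_cvg (x : R) : trunc n%:R x @[n --> \oo] --> x.
Proof.
apply/cvgrPdist_le => e e0; exists (Num.truncn `|x|).+1 => // n /= h.
rewrite trunc_id ?subrr ?normr0 ?ltW //; apply: lt_le_trans (truncnS_gt _) _.
by rewrite ler_nat.
Qed.

Section moments.
Context (P : probability Om R) (PPP : PP P) (j : 'I_d).

Local Notation inc s t w := ((w : R -> 'cV[R]_d) t j 0 - (w : R -> 'cV[R]_d) s j 0).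

Lemma measurable_inc s t : measT (fun w : Om => inc s t w).
Proof. by apply: measurable_funB; exact: measurable_coord. Qed.

Lemma Rintegral_prob_cst (c : R) : \int[P]_(w in [set: Om]) c = c.
Proof.
rewrite Rintegral_cst // [X in c * X](_ : _ = 1) ?mulr1 //; exact: (congr1 fine (probability_setT P)).
Qed.

Lemma upd_inc s t (w : R -> 'cV[R]_d) y : s < t -> inc s t (upd w t y) = y j 0 - w s j 0.
Proof. by move=> st; rewrite /upd eqxx lt_eqF. Qed.

Section increment.
Context (s t : R) (s0 : 0 <= s) (st : s < t) (tT : t <= T).

Let tT' : 0 <= t <= T. Proof. by rewrite tT (le_trans s0 (ltW st)). Qed.
Let sT' : 0 <= s <= T. Proof. by rewrite s0 (le_trans (ltW st) tT). Qed.

Let ts_sub D : {in D, forall r, 0 <= r <= s} -> {in [:: t, s & D], forall r, 0 <= r <= T}.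
Proof.
move=> Ds r; rewrite !inE => /or3P[/eqP ->|/eqP ->|/Ds /andP[-> rs]] //.
by apply: le_trans rs _; case/andP: sT'.
Qed.

Let cylf_ts D (Phi : (R -> 'cV[R]_d) -> R) : cylf D Phi -> cylf [:: t, s & D] Phi.
Proof. by apply: cylf_sub => r rD; rewrite !inE rD !orbT. Qed.

Let cylf_inc D n : 0 <= n -> cylf [:: t, s & D] (fun w => trunc n (inc s t w)).
Proof.
move=> n0; apply: (@cylf_sub _ _ [:: t; s]); last exact: cylf_trunc_inc.
by move=> r; rewrite !inE => /orP[->|->]; rewrite ?orbT.
Qed.

Let cyl_cst D (c : R) : cylf D (fun _ : R -> 'cV[R]_d => c).
Proof. by apply: cylf_sub (cylf_cst c). Qed.

Let in_sD D : {in D, forall r, 0 <= r <= s} -> {in s :: D, forall r, 0 <= r <= s}.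
Proof. by move=> Ds r; rewrite inE => /orP[/eqP ->|/Ds //]; rewrite s0 lexx. Qed.

(** The fourth power is unbounded, so the estimate is made for clamped increments, whose powers are
    in [Lip], and passes to the limit by Fatou's lemma. *)
Lemma moment4 : (\int[P]_w (inc s t (w : Om) ^+ 4)%:E <= (3 * UG ^+ 4 * (t - s) ^+ 2)%:E)%E.
Proof.
set C := 3 * _ * _.
have e4 (x : R) : 0 <= x ^+ 4 by rewrite exprn_even_ge0.
apply: (@fatou_le P (fun n w => trunc n%:R (inc s t w) ^+ 4)) => //.
- move=> n; apply: measurable_funX; apply: (cylf_measurable _ (@cylf_inc [::] n%:R (ler0n _ _))).
  exact: ts_sub.
- by move=> w; apply: cvg_pow; exact: trunc_cvg.
move=> n; have ci := @cylf_inc [::] n%:R (ler0n _ _).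
have c4 : cylf [:: t; s] (fun w => trunc n%:R (inc s t w) ^+ 4).
  by have := cylfM (cylfM ci ci) (cylfM ci ci); congr cylf; apply/funext => w; ring.
have nil_sub : {in [::], forall r : R, 0 <= r <= s} by [].
have i4 := cylf_integrable P (ts_sub nil_sub) c4; rewrite Rintegral_EFin ?i4 // lee_fin.
have iC : intT P (fun _ : Om => C).
  exact: (cylf_integrable P (D := [::]) _ (cylf_cst C)).
rewrite -subr_le0 -(Rintegral_prob_cst C) -(RintegralB measurableT i4 iC).
have := @expectation_one_step P PPP s t [:: s]
  (fun w => trunc n%:R (inc s t w) ^+ 4 - C) j s0 st tT.
apply.
- exact: (@in_sD [::]).
- by have := cylfD c4 (@cyl_cst _ (- C)).
move=> w; exists 0, 0, 1, (- C); split => //; last by rewrite mul0r mul1r add0r /C subrr.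
move=> y; rewrite upd_inc // !mul0r !add0r mul1r lerD2r.
set z := _ - _; have := trunc_le z (ler0n R n).
rewrite -[trunc _ _ ^+ 4]ger0_norm ?e4 // -[z ^+ 4]ger0_norm ?e4 // !normrX => h.
by rewrite ler_pXn2r ?nnegrE.
Qed.

Lemma integrable_inc4 : intT P (fun w : Om => inc s t w ^+ 4).
Proof.
apply: ge0_integrable; first by apply: measurable_funX; exact: measurable_inc.
  by move=> w; rewrite exprn_even_ge0.
exact: le_lt_trans moment4 (ltry _).
Qed.

Lemma integrable_inc2 : intT P (fun w : Om => inc s t w ^+ 2).
Proof.
have ic := @integrable_bounded P (fun=> 1) 1 (measurable_cst _) (fun=> _).
have {}ic := ic ltac:(by move=> w; rewrite normr1).
apply: (integrable_le (g := fun w : Om => 1 + inc s t w ^+ 4)).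
- by apply: measurable_funX; exact: measurable_inc.
- move=> w; rewrite ger0_norm ?sqr_ge0 // -[4%N]/(2 * 2)%N exprM.
  by have := sqr_ge0 (inc s t w ^+ 2 - 1); have := sqr_ge0 (inc s t w); move: (_ ^+ 2) => x; nra.
- exact: (integrableD measurableT ic integrable_inc4).
Qed.

Section weight.
Context (D : seq R) (Phi : (R -> 'cV[R]_d) -> R) (M : R) (Ds : {in D, forall r, 0 <= r <= s})
  (cP : cylf D Phi) (PM : forall w, `|Phi w| <= M).

Let Phi_upd w y : Phi (upd w t y) = Phi w.
Proof.
apply: (cylf_agree cP) => r /Ds /andP[_ rs]; rewrite /upd; case: eqP => // rt.
by move: rs; rewrite rt leNgt st.
Qed.

Let D_T : {in D, forall r, 0 <= r <= T}.
Proof. by move=> r rD; apply: (@ts_sub D Ds); rewrite !inE rD !orbT. Qed.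

Let measurable_Phi : measT (fun w : Om => Phi w).
Proof. exact: (cylf_measurable D_T cP). Qed.

Let tsD (r : R) : (r \in [:: t, s & D]) = (r \in t :: s :: D). Proof. by []. Qed.

Lemma moment2 : (\int[P]_w ((Phi (w : Om)) ^+ 2 * inc s t w ^+ 2)%:E <=
  (UG ^+ 2 * (t - s) * \int[P]_w (Phi (w : Om) ^+ 2))%:E)%E.
Proof.
set C := UG ^+ 2 * (t - s).
have cP2 : cylf [:: t, s & D] (fun w => Phi w ^+ 2).
  by have := cylfM (cylf_ts cP) (cylf_ts cP); congr cylf; apply/funext => w; ring.
have iP2 := cylf_integrable P (@ts_sub D Ds) cP2.
apply: (@fatou_le P (fun n w => Phi w ^+ 2 * trunc n%:R (inc s t w) ^+ 2)) => //.
- move=> n; apply: measurable_funM; first by apply: measurable_funX.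
  apply: measurable_funX; apply: (cylf_measurable _ (@cylf_inc D n%:R (ler0n _ _))).
  exact: ts_sub.
- by move=> n w; rewrite mulr_ge0 ?sqr_ge0.
- by move=> w; apply: cvgM; [exact: cvg_cst|apply: cvg_pow; exact: trunc_cvg].
move=> n; have ci := @cylf_inc D n%:R (ler0n _ _).
have c2 : cylf [:: t, s & D] (fun w => Phi w ^+ 2 * trunc n%:R (inc s t w) ^+ 2).
  by have := cylfM cP2 (cylfM ci ci); congr cylf; apply/funext => w; ring.
have i2 := cylf_integrable P (@ts_sub D Ds) c2; rewrite Rintegral_EFin ?i2 // lee_fin.
rewrite -subr_le0 -RintegralZl // -RintegralB //; last exact: (integrableZl measurableT _ iP2).
have := @expectation_one_step P PPP s t (s :: D)
  (fun w => Phi w ^+ 2 * trunc n%:R (inc s t w) ^+ 2 - C * Phi w ^+ 2) j s0 st tT.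
apply.
- exact: in_sD.
- have := cylfD c2 (cylfM (@cyl_cst _ (- C)) cP2).
  by congr cylf; apply/funext => w; ring.
move=> w; exists 0, (Phi w ^+ 2), 0, (- (C * Phi w ^+ 2)); split => //; first exact: sqr_ge0.
  move=> y; rewrite upd_inc // Phi_upd !mul0r !add0r addr0 lerD2r ler_wpM2l ?sqr_ge0 //.
  rewrite -[leLHS]real_normK ?num_real // -[leRHS]real_normK ?num_real //.
  by rewrite ler_pXn2r ?nnegrE ?trunc_le.
by rewrite mul0r addr0 /C mulrC subrr.
Qed.

(** Clamping destroys linearity, but [trunc_err] bounds the defect by the square of the increment
    over the clamping level. A barrier with slope [sg * Phi w] and a curvature of order [M / n]
    therefore bounds both signs, up to an error that tends to 0. *)
Lemma moment1 : \int[P]_w (Phi (w : Om) * inc s t w) = 0.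
Proof.
have M0 : 0 <= M by exact: le_trans (normr_ge0 _) (PM (fun=> 0)).
have ic := @integrable_bounded P (fun=> M) `|M| (measurable_cst _) (fun=> lexx _).
have mt n : measT (fun w : Om => trunc n%:R (inc s t w)).
  by apply: (cylf_measurable _ (@cylf_inc D n%:R (ler0n _ _))); exact: ts_sub.
apply: (@Rintegral_limit0 P (fun n w => Phi w * trunc n.+1%:R (inc s t w)) _
  (fun w : Om => M + M * inc s t w ^+ 2) (fun n => M * UG ^+ 2 * (t - s) / n.+1%:R)).
- by move=> n; apply: measurable_funM => //; exact: mt.
- by apply: measurable_funM => //; exact: measurable_inc.
- move=> w; apply: cvgM; first exact: cvg_cst.
  by have := @trunc_cvg (inc s t w); rewrite -(cvg_shiftS); exact.
- move=> n w; rewrite normrM (_ : M + M * _ = M * (1 + inc s t w ^+ 2)); last by ring.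
  apply: ler_pM => //.
  apply: le_trans (trunc_le _ (ler0n R _)) _.
  rewrite -(real_normK (num_real (inc s t w))); move: `|inc s t w| (normr_ge0 (inc s t w)) => x x0.
  by have := sqr_ge0 (x - 1); rewrite sqrrB; nra.
- exact: (integrableD measurableT ic (integrableZl measurableT _ integrable_inc2)).
- move=> n; set c := _ / _.
  have n0 : 0 < n.+1%:R :> R by [].
  have half (sg : R) : `|sg| = 1 ->
      \int[P]_w (sg * (Phi (w : Om) * trunc n.+1%:R (inc s t w))) <= c.
    move=> sg1; have ci := @cylf_inc D n.+1%:R (ler0n _ _).
    have c1 : cylf [:: t, s & D] (fun w => sg * (Phi w * trunc n.+1%:R (inc s t w))).
      exact: cylfM (@cyl_cst _ sg) (cylfM (cylf_ts cP) ci).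
    rewrite -subr_le0 -(Rintegral_prob_cst c) -RintegralB //; first last.
    + exact: (cylf_integrable P (D := [::]) _ (cylf_cst c)).
    + exact: (cylf_integrable P (@ts_sub D Ds) c1).
    have := @expectation_one_step P PPP s t (s :: D)
      (fun w => sg * (Phi w * trunc n.+1%:R (inc s t w)) - c) j s0 st tT.
    apply; first exact: in_sD.
    + exact: cylfD c1 (@cyl_cst _ (- c)).
    move=> w; have [M00|M00] := eqVneq M 0.
      have P0 : Phi w = 0 by have := PM w; rewrite M00 normr_le0 => /eqP.
      exists 0, 0, 0, 0; split => //; last by rewrite !mul0r !addr0.
      by move=> y; rewrite Phi_upd P0 /c M00 !mul0r mulr0 subr0 !addr0.
    exists (sg * Phi w), (M / n.+1%:R), 0, (- c); split => //.
    + by rewrite divr_ge0.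
    + by move=> /eqP; rewrite mulf_eq0 invr_eq0 (gt_eqF n0) orbF (negPf M00).
    + move=> y; rewrite upd_inc // Phi_upd mul0r addr0 lerD2r mulrA; set z := _ - _.
      have h1 : sg * Phi w * (trunc n.+1%:R z - z) <= M * (z ^+ 2 / n.+1%:R).
        apply: le_trans (ler_norm _) _; rewrite !normrM sg1 mul1r; apply: ler_pM => //.
        by rewrite distrC; exact: trunc_err.
      by move: h1; rewrite mulrBr (mulrA M) (mulrAC M); move: (_ * _) (_ * _) (_ * _) => *; lra.
    + rewrite mul0r addr0 /c; apply: le_of_eq; field.
      by rewrite gt_eqF.
  have i1 : intT P (fun w : Om => Phi w * trunc n.+1%:R (inc s t w)).
    have ci := @cylf_inc D n.+1%:R (ler0n _ _).
    exact: (cylf_integrable P (@ts_sub D Ds) (cylfM (cylf_ts cP) ci)).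
  rewrite ler_norml lerNl; apply/andP; split.
    by have := half (- 1) (normrN1 _); rewrite RintegralZl // mulN1r.
  by have := half 1 (normr1 _); rewrite RintegralZl // mul1r.
- rewrite -(mulr0 (M * UG ^+ 2 * (t - s))); apply: cvgM; first exact: cvg_cst.
  exact: cvg_harmonic.
Qed.

End weight.
End increment.

(** For the later increment, the product of [Phi] with the clamped earlier increment is an
    admissible weight in [moment1]; dominated convergence removes the clamp. *)
Lemma cross_moment s0 s1 s t D Phi M : 0 <= s0 -> s0 < s1 -> s1 <= s -> s < t -> t <= T ->
  {in D, forall r, 0 <= r <= s} -> cylf D Phi -> (forall w, `|Phi w| <= M) ->
  intT P (fun w : Om => Phi w * inc s0 s1 w * inc s t w) /\
  \int[P]_w (Phi (w : Om) * inc s0 s1 w * inc s t w) = 0.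
Proof.
move=> s00 s01 s1s st tT Ds cP PM.
have s0' : 0 <= s by apply: le_trans s00 (le_trans (ltW s01) s1s).
have M0 : 0 <= M by exact: le_trans (normr_ge0 _) (PM (fun=> 0)).
have DT : {in D, forall r, 0 <= r <= T}.
  by move=> r /Ds /andP[-> rs]; apply: le_trans rs (le_trans (ltW st) tT).
have mP : measT (fun w : Om => Phi w) by exact: (cylf_measurable DT cP).
pose g (w : Om) := M * inc s0 s1 w ^+ 2 + M * inc s t w ^+ 2.
have ig : intT P g.
  have s1T : s1 <= T by apply: le_trans s1s (le_trans (ltW st) tT).
  exact: (integrableD measurableT (integrableZl measurableT _ (integrable_inc2 s00 s01 s1T))
    (integrableZl measurableT _ (integrable_inc2 s0' st tT))).
have bg (a x y : R) (w : Om) : `|a| <= M -> `|x| <= `|inc s0 s1 w| -> `|y| <= `|inc s t w| ->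
    `|a * x * y| <= g w.
  move=> aM xa yb; rewrite !normrM -mulrA /g -mulrDr; apply: ler_pM => //.
  rewrite -(real_normK (num_real (inc s0 s1 w))) -(real_normK (num_real (inc s t w))).
  move: xa yb (normr_ge0 x) (normr_ge0 y) (sqr_ge0 (`|inc s0 s1 w| - `|inc s t w|)).
  by move: `|x| `|y| `|inc s0 s1 w| `|inc s t w| => *; nra.
have mf : measT (fun w : Om => Phi w * inc s0 s1 w * inc s t w).
  by apply: measurable_funM; [apply: measurable_funM => //|]; exact: measurable_inc.
split; first by apply: integrable_le mf _ ig => w; exact: bg.
have cn n : cylf [:: s1, s0 & D] (fun w => Phi w * trunc n%:R (inc s0 s1 w)).
  apply: cylfM; first by apply: cylf_sub cP => r rD; rewrite !inE rD !orbT.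
  apply: (@cylf_sub _ _ [:: s1; s0]); last exact: cylf_trunc_inc.
  by move=> r; rewrite !inE => /orP[->|->]; rewrite ?orbT.
have Dn : {in [:: s1, s0 & D], forall r, 0 <= r <= s}.
  move=> r; rewrite !inE => /or3P[/eqP ->|/eqP ->|/Ds //].
    by rewrite s1s andbT; exact: le_trans s00 (ltW s01).
  by rewrite s00 (le_trans (ltW s01) s1s).
apply: (@Rintegral_limit0 P (fun n w => Phi w * trunc n%:R (inc s0 s1 w) * inc s t w) _ g
  (fun=> 0)) => //.
- move=> n; apply: measurable_funM; last exact: measurable_inc.
  by apply: (cylf_measurable _ (cn n)) => r /Dn /andP[-> rs]; apply: le_trans rs (le_trans (ltW st) tT).
- move=> w; apply: cvgM; last exact: cvg_cst.
  by apply: cvgM; [exact: cvg_cst|exact: trunc_cvg].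
- by move=> n w; apply: bg => //; exact: trunc_le.
- move=> n; rewrite (moment1 s0' st tT Dn (cn n) (M := M * n%:R)) ?normr0 // => w.
  by rewrite normrM; apply: ler_pM => //; exact: trunc_bound.
- exact: cvg_cst.
Qed.

Section on_grid.
Context (L : seq R) (D : nat -> seq R) (c : nat -> (R -> 'cV[R]_d) -> R) (M : R) (pL : path <%R 0 L)
  (lL : last 0 L = T) (Dc : forall i, (i < size L)%N -> {in D i, forall r, 0 <= r <= gridpt L i})
  (cc : forall i, (i < size L)%N -> cylf (D i) (c i)) (cM : forall i w, `|c i w| <= M).

Let g0 i : (i <= size L)%N -> 0 <= gridpt L i.
Proof. by move=> iL; rewrite -[0]/(gridpt L 0) gridpt_leE. Qed.

Let gT i : (i <= size L)%N -> gridpt L i <= T.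
Proof.
by move=> iL; rewrite -lL -gridpt_last gridpt_leE.
Qed.

Let glt i : (i < size L)%N -> gridpt L i < gridpt L i.+1.
Proof. by move=> iL; rewrite gridpt_ltE // ltnW. Qed.

Let J m (w : R -> 'cV[R]_d) := \sum_(i < m) c i w * inc (gridpt L i) (gridpt L i.+1) w.

(** Cross terms vanish by [cross_moment]. An inequality is all one can expect, since under [P] the
    variance per unit of time is only known to be at most [UG ^+ 2]. *)
Lemma isometry_grid m : (m <= size L)%N ->
  intT P (fun w : Om => J m w ^+ 2) /\
  \int[P]_w (J m (w : Om) ^+ 2) <= UG ^+ 2 *
    \sum_(i < m) (gridpt L i.+1 - gridpt L i) * \int[P]_w (c i (w : Om) ^+ 2).
Proof.
elim: m => [_|m IH mL].
  have J0 : (fun w : Om => J 0 w ^+ 2) = fun=> 0.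
    by apply/funext => w; rewrite /J big_ord0 expr0n.
  rewrite J0 big_ord0 mulr0 Rintegral_cst // mul0r; split => //.
  by apply: (@integrable_bounded P _ 0) => // w; rewrite normr0.
have [iJ leJ] := IH (ltnW mL).
have mDT i : (i < size L)%N -> {in D i, forall r, 0 <= r <= T}.
  by move=> iL r /(Dc iL)/andP[-> rs]; apply: le_trans rs (gT (ltnW iL)).
have mc i : (i < size L)%N -> measT (fun w : Om => c i w).
  by move=> iL; exact: (cylf_measurable (mDT i iL) (cc iL)).
have M0 : 0 <= M by exact: le_trans (normr_ge0 _) (cM 0 (fun=> 0)).
have [[gm0 gm] gmT] := (g0 (ltnW mL), glt mL, gT mL).
have cross i : (i < m)%N ->
    intT P (fun w : Om => c m w * c i w * inc (gridpt L i) (gridpt L i.+1) w *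
      inc (gridpt L m) (gridpt L m.+1) w) /\
    \int[P]_w (c m (w : Om) * c i w * inc (gridpt L i) (gridpt L i.+1) w *
      inc (gridpt L m) (gridpt L m.+1) w) = 0.
  move=> im; have iL := ltn_trans im mL.
  have im' : gridpt L i.+1 <= gridpt L m by rewrite gridpt_leE // ltnW.
  apply: (@cross_moment (gridpt L i) (gridpt L i.+1)
    (gridpt L m) (gridpt L m.+1) (D m ++ D i) (fun w => c m w * c i w) (M * M)) => //.
  - exact: g0 (ltnW iL).
  - exact: glt.
  - move=> r; rewrite mem_cat => /orP[/(Dc mL)//|/(Dc iL)/andP[-> ri]].
    by apply: le_trans ri _; rewrite gridpt_leE // ltnW.
  - apply: cylfM; [apply: cylf_sub (cc mL)|apply: cylf_sub (cc iL)] => r rD.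
      by rewrite mem_cat rD.
    by rewrite mem_cat rD orbT.
  - by move=> w; rewrite normrM; apply: ler_pM.
pose K (w : Om) := \sum_(i < m) (c m w * c i w * inc (gridpt L i) (gridpt L i.+1) w *
      inc (gridpt L m) (gridpt L m.+1) w).
have [iK K0] : intT P K /\ \int[P]_w K w = 0.
  have [i1 ->] := Rintegral_ord_sum (F := fun i (w : Om) => c m w * c i w *
    inc (gridpt L i) (gridpt L i.+1) w * inc (gridpt L m) (gridpt L m.+1) w)
    measurableT (fun i im => (cross i im).1).
  by split => //; apply: big1 => i _; exact: (cross i (ltn_ord i)).2.
pose Q (w : Om) := (c m w) ^+ 2 * inc (gridpt L m) (gridpt L m.+1) w ^+ 2.
have leQ := @moment2 _ _ gm0 gm gmT (D m) (c m)
  (Dc mL) (cc mL).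
have mQ : measT Q.
  apply: measurable_funM; apply: measurable_funX; first exact: mc.
  exact: measurable_inc.
have iQ : intT P Q.
  apply: ge0_integrable => //; last exact: le_lt_trans leQ (ltry _).
  by move=> w; rewrite mulr_ge0 ?sqr_ge0.
have JE : (fun w : Om => J m.+1 w ^+ 2) = fun w => (J m w ^+ 2 + 2 * K w) + Q w.
  apply/funext => w; rewrite /J big_ord_recr /= -/(J m w) sqrrD /Q exprMn; congr (_ + _ + _).
  rewrite /K /J -mulr_natl; congr (2 * _); rewrite mulr_suml; apply: eq_bigr => i _; ring.
have i2K : intT P (fun w => 2 * K w) := integrableZl measurableT 2 iK.
have iJK : intT P (fun w : Om => J m w ^+ 2 + 2 * K w) :=
  integrableD measurableT iJ i2K.
rewrite JE; split; first exact: (integrableD measurableT iJK iQ).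
rewrite RintegralD // RintegralD // RintegralZl // K0 mulr0 addr0 big_ord_recr /= mulrDr.
apply: lerD => //; rewrite Rintegral_EFin // lee_fin in leQ.
by rewrite mulrA.
Qed.

End on_grid.

Section elementary.
Context (I : finType) (a b : I -> R) (F : I -> (R -> 'cV[R]_d) -> R) (D : I -> seq R)
  (a0 : forall k, 0 <= a k) (ab : forall k, a k <= b k) (bT : forall k, b k <= T)
  (cF : forall k, cylf (D k) (F k)) (DF : forall k, a k < b k -> {in D k, forall r, 0 <= r <= a k}).

Definition elem_int (w : R -> 'cV[R]_d) : R := \sum_k F k w * inc (a k) (b k) w.

Definition elem_eval (r : R) (w : R -> 'cV[R]_d) : R := \sum_k F k w * (a k < r <= b k)%R%:R.

(** The intervals may overlap, which keeps such sums closed under differences. Sorting all end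
    points refines them to a grid on whose cells the integrand is constant in time. *)
Theorem isometry : (\int[P]_w (elem_int (w : Om) ^+ 2)%:E <= (UG ^+ 2)%:E *
  \int[P]_w \int[lebesgue_measure]_(r in `[0%R, T]) (elem_eval r (w : Om) ^+ 2)%:E)%E.
Proof.
pose L := sort <=%R (undup [seq r <- T :: map a (enum I) ++ map b (enum I) | 0 < r]).
have mL r : (r \in L) = (0 < r) && (r \in T :: map a (enum I) ++ map b (enum I)).
  by rewrite mem_sort mem_undup mem_filter.
have sL : sorted <%R L by rewrite sort_lt_sorted undup_uniq.
have pL : path <%R 0 L.
  by rewrite path_sortedE; [rewrite sL andbT; apply/allP => r; rewrite mL => /andP[]|exact: lt_trans].
have TL : T \in L by rewrite mL T_gt0 mem_head.
have leT r : r \in L -> r <= T.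
  rewrite mL inE mem_cat => /andP[_ /or3P[/eqP -> //|/mapP[k _ ->]|/mapP[k _ ->]]] //.
  exact: le_trans (ab k) (bT k).
have lL : last 0 L = T.
  apply/le_anti; rewrite (path_lt_last pL TL) andbT; apply: leT.
  by case: (L) TL => // x s _; rewrite /= mem_last.
have aL k : a k \in 0 :: L.
  rewrite inE mL; have := a0 k; rewrite le_eqVlt => /orP[/eqP <-|->]; first by rewrite eqxx.
  by rewrite inE mem_cat map_f ?mem_enum ?orbT.
have bL k : b k \in 0 :: L.
  rewrite inE mL; have := le_trans (a0 k) (ab k).
  rewrite le_eqVlt => /orP[/eqP <-|->]; first by rewrite eqxx.
  by rewrite inE mem_cat (map_f b) ?mem_enum ?orbT.
pose act i k := (a k < gridpt L i.+1 <= b k).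
pose c i w := \sum_k F k w * (act i k)%:R.
pose Dg i := flatten [seq D k | k <- enum I & act i k].
have [M FM] := fin_all_exists (fun k => (cF k).1).
have cM i w : `|c i w| <= \sum_k M k.
  apply: le_trans (ler_norm_sum _ _ _) _; apply: ler_sum => k _; rewrite normrM.
  have h : `|(act i k)%:R| <= 1 :> R by case: (act i k); rewrite ?normr1 ?normr0 ?ler01.
  apply: le_trans (FM k w); rewrite ler_piMr //.
have cc i : (i < size L)%N -> cylf (Dg i) (c i).
  move=> iL; apply: cylf_sum => k; have [ik|ik] := boolP (act i k); last first.
    rewrite (_ : (fun _ => _) = fun=> 0); first exact: cylf_sub (cylf_cst 0).
    by apply/funext => w; rewrite mulr0.
  rewrite (_ : (fun _ => _) = F k); last by apply/funext => w; rewrite mulr1.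
  apply: cylf_sub (cF k) => r rD; apply/flattenP; exists (D k) => //; apply: map_f.
  by rewrite mem_filter ik mem_enum.
have Dc i : (i < size L)%N -> {in Dg i, forall r, 0 <= r <= gridpt L i}.
  move=> iL r /flattenP[_ /mapP[k + ->] rD]; rewrite mem_filter => /andP[/andP[ag gb] _].
  have /andP[-> ra] := DF (lt_le_trans ag gb) rD; apply: le_trans ra _.
  have /gridptP[p pL' ap] := aL k; move: ag; rewrite ap gridpt_ltE // ltnS => pi.
  by rewrite gridpt_leE // ltnW.
have [iJ leJ] := isometry_grid pL lL Dc cc cM (leqnn (size L)).
have JE : (fun w : Om => \sum_(i < size L) c i w * inc (gridpt L i) (gridpt L i.+1) w) =
    (fun w : Om => elem_int w).
  apply/funext => w; rewrite /elem_int /c; under eq_bigr do rewrite mulr_suml.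
  rewrite exchange_big; apply: eq_bigr => k _ /=.
  rewrite -(grid_telescope (fun r => w r j 0) pL (aL k) (bL k) (ab k)) mulr_sumr.
  by apply: eq_bigr => i _; rewrite mulrA.
have iJ' : intT P (fun w : Om => elem_int w ^+ 2).
  by move: iJ; congr (integrable _ _ _); apply/funext => w; rewrite /= -[elem_int w]/((fun w : Om => elem_int w) w) -JE.
have evE (w : R -> 'cV[R]_d) r : 0 <= r <= T -> elem_eval r w ^+ 2 =
    \sum_(i < size L) (c i w) ^+ 2 * \1_(`]gridpt L i, gridpt L i.+1]%classic) r.
  have I1 i : \1_(`]gridpt L i, gridpt L i.+1]%classic) r = (gridpt L i < r <= gridpt L i.+1)%R%:R :> R.
    by rewrite -itv_oc_indic.
  move=> /andP[]; rewrite le_eqVlt => /orP[/eqP r0 _|r0 rT].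
    rewrite /elem_eval big1 => [|k _]; last by rewrite -r0 ltNge a0 mulr0.
    rewrite expr0n big1 // => i _; rewrite I1 -r0 ltNge -[0]/(gridpt L 0) gridpt_leE ?mulr0 //.
    exact: ltnW.
  have rL : 0 < r <= last 0 L by rewrite r0 lL.
  have [i iL ri] := grid_cover pL rL.
  rewrite (bigD1 (Ordinal iL)) //= I1 ri mulr1 big1 ?addr0 => [|k ki].
    congr (_ ^+ 2); apply: eq_bigr => k _; congr (_ * _%:R).
    have := grid_indicator pL (aL k) (bL k) iL ri; rewrite /act => ->.
    by [].
  rewrite I1; case: (boolP (_ < r <= _)) => [/andP[kr rk]|_]; last by rewrite mulr0.
  have /andP[ir ri'] := ri; move: ki; rewrite -val_eqE /= eqn_leq.
  have := lt_le_trans kr ri'; rewrite gridpt_ltE // ?ltnS; last exact: ltnW (ltn_ord k).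
  move=> ->; have := lt_le_trans ir rk; rewrite gridpt_ltE // ?ltnS; last exact: ltnW.
  by move=> ->.
pose S (w : Om) := \sum_(i < size L) (gridpt L i.+1 - gridpt L i) * c i w ^+ 2.
have glt i : (i < size L)%N -> gridpt L i < gridpt L i.+1 by move=> iL; rewrite gridpt_ltE // ltnW.
have inner (w : Om) : (\int[lebesgue_measure]_(r in `[0%R, T]) (elem_eval r w ^+ 2)%:E = (S w)%:E)%E.
  transitivity (\int[lebesgue_measure]_(r in `[0%R, T]) (\sum_(i < size L) ((c i w) ^+ 2)%:E *
      (\1_(`]gridpt L i, gridpt L i.+1]%classic) r)%:E))%E.
    apply: eq_integral => r; rewrite inE /= in_itv /= => rT; rewrite evE // -sumEFin.
    by apply: eq_bigr => i _; rewrite EFinM.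
  rewrite ge0_integral_sum //; first last.
  - by move=> i r _; rewrite mule_ge0 // lee_fin ?sqr_ge0 // indicE.
  - move=> i; apply: emeasurable_funM; first exact: measurable_cst.
    by apply/measurable_EFinP; exact: measurable_indic.
  rewrite /S -sumEFin; apply: eq_bigr => i _.
  rewrite ge0_integralZl //; first last.
  - by rewrite lee_fin sqr_ge0.
  - by apply/measurable_EFinP; exact: measurable_indic.
  rewrite integral_indic // setIidl; last first.
    move=> r /=; rewrite !in_itv /= => /andP[ir ri]; apply/andP; split.
      apply: le_trans (ltW ir); rewrite -[0]/(gridpt L 0) gridpt_leE //; exact: ltnW.
    by apply: le_trans ri _; rewrite -lL -gridpt_last gridpt_leE.
  transitivity ((c i w ^+ 2)%:E * (gridpt L i.+1 - gridpt L i)%:E)%E; last by rewrite -EFinM mulrC.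
  congr (_ * _)%E; apply: etrans (lebesgue_measure_itv _) _.
  by rewrite /= lte_fin glt // -EFinB.
have -> : (\int[P]_w \int[lebesgue_measure]_(r in `[0%R, T]) (elem_eval r (w : Om) ^+ 2)%:E =
    \int[P]_w (S w)%:E)%E by apply: eq_integral => w _; exact: inner.
have ic i : (i < size L)%N -> intT P (fun w : Om => c i w ^+ 2).
  move=> iL; have DT : {in Dg i, forall r, 0 <= r <= T}.
    move=> r /(Dc i iL)/andP[-> ra]; apply: le_trans ra _.
    by rewrite -lL -gridpt_last gridpt_leE // ltnW.
  have := cylf_integrable P DT (cylfM (cc i iL) (cc i iL)).
  by congr (integrable _ _ _); apply/funext => w; rewrite /= expr2.
have [iS eS] := Rintegral_ord_sum (mu := P)
  (F := fun i (w : Om) => (gridpt L i.+1 - gridpt L i) * c i w ^+ 2)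
  measurableT (fun i iL => integrableZl measurableT (gridpt L i.+1 - gridpt L i) (ic i iL)).
rewrite (Rintegral_EFin iS) -/S eS (Rintegral_EFin iJ') -EFinM lee_fin.
have -> : \int[P]_w (elem_int (w : Om) ^+ 2) = \int[P]_w
    ((\sum_(i < size L) c i (w : Om) * inc (gridpt L i) (gridpt L i.+1) w) ^+ 2).
  by apply: eq_Rintegral => w _; congr (_ ^+ 2); rewrite -[LHS]/((fun w : Om => elem_int w) w) -JE.
apply: le_trans leJ _; rewrite ler_wpM2l ?sqr_ge0 //; apply: le_of_eq.
by apply: eq_bigr => i _; rewrite RintegralZl //; exact: ic.
Qed.

End elementary.
End moments.

(** * Stochastic integrals under one measure *)

Section ito.
Context (P : probability Om R) (PPP : PP P) (j : 'I_d).

Definition elementary (I : finType) (a b : I -> R) (F : I -> (R -> 'cV[R]_d) -> R)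
    (D : I -> seq R) : Prop :=
  [/\ forall k, 0 <= a k, forall k, a k <= b k, forall k, b k <= T,
      forall k, cylf (D k) (F k) &
      forall k, a k < b k -> {in D k, forall r, 0 <= r <= a k}].

(* Only increments over nonempty intervals matter, hence the conditional
   adaptedness above; measurability needs the remaining coefficients to
   depend on times in [0, T] too. *)
Definition bounded_times (I : finType) (D : I -> seq R) :=
  forall k, {in D k, forall r, 0 <= r <= T}.

Lemma elem_int_measurable I a b F D : @elementary I a b F D -> bounded_times D ->
  measT (fun w : Om => elem_int j a b F w).
Proof.
move=> [_ _ _ cF _] DT; apply: measurable_sum => k; apply: measurable_funM.
  exact: cylf_measurable (@DT k) (cF k).
exact: measurable_inc.
Qed.

Lemma elem_eval_measurable I a b F D : @elementary I a b F D -> bounded_times D ->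
  jointly_measurable T (fun r (w : Om) => elem_eval a b F r w).
Proof.
move=> [_ _ _ cF _] DT; apply: jointly_measurable_sum => k; apply: measurable_funM.
  exact: jointly_measurable_const (cylf_measurable (@DT k) (cF k)).
exact: jointly_measurable_indic.
Qed.

(** What is kept of the integral under one measure [P]: simultaneous approximation of integral and
    integrand by elementary sums. In this form integrands may be cut off at a time [t], and
    differences of two integrals are covered as well. *)
Definition ito_approx (zeta : R -> Om -> R) (I0 : Om -> R) : Prop :=
  [/\ measT I0, jointly_measurable T zeta &
    forall eps : R, 0 < eps -> exists (I : finType) a b F D,
      [/\ @elementary I a b F D, bounded_times D,
        (\int[P]_w ((I0 w - elem_int j a b F w) ^+ 2)%:E <= eps%:E)%E &
        (dintegral P T (fun r w => (zeta r w - elem_eval a b F r w) ^+ 2)%R <= eps%:E)%E]].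

(** Two uses of [(x + y)^2 <= 2 x^2 + 2 y^2] cost the factor 4, and the summand 1 keeps the constant
    positive, so that an infinite right side is trivial. The constant affects only the convergence
    of the Euler scheme. *)
Lemma ito_approx_isometry zeta I0 : ito_approx zeta I0 ->
  (\int[P]_w (I0 w ^+ 2)%:E <=
   (1 + 4 * UG ^+ 2)%:E * dintegral P T (fun r w => zeta r w ^+ 2)%R)%E.
Proof.
move=> [mI mz H].
have Dz0 : (0 <= dintegral P T (fun r w => zeta r w ^+ 2)%R)%E.
  by apply: integral_ge0 => w _; apply: integral_ge0 => r _; rewrite lee_fin sqr_ge0.
have c0 : 0 < 1 + 4 * UG ^+ 2 by rewrite ltr_pwDl // mulr_ge0 // sqr_ge0.
case E : (dintegral _ _ _) Dz0 => [z| |] // z0; last by rewrite gt0_muley ?leey // lte_fin.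
rewrite lee_fin in z0; apply/lee_addgt0Pr => e e0.
pose e1 := e / (2 + 4 * UG ^+ 2).
have c1 : 0 < 2 + 4 * UG ^+ 2 by lra.
have e10 : 0 < e1 by rewrite divr_gt0.
have [I [a [b [F [D [el DT hI hz]]]]]] := H e1 e10.
have mJ := elem_int_measurable el DT; have mev := elem_eval_measurable el DT.
have mIJ : measT (fun w => I0 w - elem_int j a b F w) := measurable_funB mI mJ.
have mvz : jointly_measurable T (fun r (w : Om) => elem_eval a b F r w - zeta r w) :=
  measurable_funB mev mz.
have h1 := prob_integral_sqrD P mIJ mJ.
have h2 := dintegral_sqrD P mvz mz.
have iso : (\int[P]_w (elem_int j a b F (w : Om) ^+ 2)%:E <= (UG ^+ 2)%:E *
    dintegral P T (fun r w => elem_eval a b F r w ^+ 2)%R)%E.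
  by case: el => *; exact: isometry.
have E1 : (fun w => ((I0 w - elem_int j a b F w + elem_int j a b F w) ^+ 2)%:E) = (fun w => (I0 w ^+ 2)%:E).
  by apply/funext => w; rewrite subrK.
have E2 : (fun r (w : Om) => (elem_eval a b F r w - zeta r w + zeta r w) ^+ 2) =
    fun r (w : Om) => elem_eval a b F r w ^+ 2.
  by apply/funext => r; apply/funext => w; rewrite subrK.
have E3 : (fun r (w : Om) => (elem_eval a b F r w - zeta r w) ^+ 2) =
    fun r (w : Om) => (zeta r w - elem_eval a b F r w) ^+ 2.
  by apply/funext => r; apply/funext => w; rewrite -sqrrN opprB.
rewrite E2 E3 E in h2; rewrite E1 in h1.
have h3 : (dintegral P T (fun r w => elem_eval a b F r w ^+ 2)%R <= (2 * e1 + 2 * z)%:E)%E.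
  apply: le_trans h2 _.
  have -> : (2 * e1 + 2 * z)%:E = (2%:E * e1%:E + 2%:E * z%:E)%E by rewrite -!EFinM -EFinD.
  by apply: leeD; [exact: lee_wpmul2l|exact: lexx].
apply: le_trans h1 _.
have h4 : (\int[P]_w (elem_int j a b F (w : Om) ^+ 2)%:E <= (UG ^+ 2 * (2 * e1 + 2 * z))%:E)%E.
  have -> : (UG ^+ 2 * (2 * e1 + 2 * z))%:E = ((UG ^+ 2)%:E * (2 * e1 + 2 * z)%:E)%E by rewrite -EFinM.
  by apply: le_trans iso _; apply: lee_wpmul2l => //; rewrite lee_fin sqr_ge0.
have -> : ((1 + 4 * UG ^+ 2)%:E * z%:E + e%:E = (2 * e1)%:E + (2 * (UG ^+ 2 * (2 * e1 + 2 * z)) + z)%:E)%E.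
  rewrite -EFinM -!EFinD; congr EFin.
  have -> : e = e1 * (2 + 4 * UG ^+ 2) by rewrite /e1 divfK // gt_eqF.
  ring.
apply: leeD.
  by rewrite EFinM; apply: lee_wpmul2l.
apply: le_trans (_ : (2 * (UG ^+ 2 * (2 * e1 + 2 * z)))%:E <= _)%E; last by rewrite lee_fin lerDl.
by rewrite EFinM; apply: lee_wpmul2l.
Qed.

Lemma ito_approx_elem I a b F D : @elementary I a b F D -> bounded_times D ->
  ito_approx (fun r w => elem_eval a b F r w) (fun w => elem_int j a b F w).
Proof.
move=> el DT; split; [exact: elem_int_measurable el DT|exact: elem_eval_measurable el DT|].
move=> e e0; exists I, a, b, F, D; split => //.
- rewrite (_ : (fun w => _) = fun=> 0%E); first by rewrite integral0 lee_fin ltW.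
  by apply/funext => w; rewrite subrr expr0n.
- by rewrite dintegral0 ?lee_fin ?ltW // => r w; rewrite subrr expr0n.
Qed.

Lemma ito_approxB z1 I1 z2 I2 : ito_approx z1 I1 -> ito_approx z2 I2 ->
  ito_approx (fun r w => z1 r w - z2 r w) (fun w => I1 w - I2 w).
Proof.
move=> [mI1 mz1 H1] [mI2 mz2 H2]; split; [exact: measurable_funB|exact: measurable_funB|].
move=> e e0; have e4 : 0 < e / 4 by lra.
have [K1 [a1 [b1 [F1 [D1 [el1 DT1 hI1 hz1]]]]]] := H1 _ e4.
have [K2 [a2 [b2 [F2 [D2 [el2 DT2 hI2 hz2]]]]]] := H2 _ e4.
have mJ1 := elem_int_measurable el1 DT1; have mev1 := elem_eval_measurable el1 DT1.
have mJ2 := elem_int_measurable el2 DT2; have mev2 := elem_eval_measurable el2 DT2.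
pose a k := match k : K1 + K2 with inl k => a1 k | inr k => a2 k end.
pose b k := match k : K1 + K2 with inl k => b1 k | inr k => b2 k end.
pose D k := match k : K1 + K2 with inl k => D1 k | inr k => D2 k end.
pose F k := match k : K1 + K2 with inl k => F1 k | inr k => fun w => -1 * F2 k w end.
exists (K1 + K2)%type, a, b, F, D.
have EI w : elem_int j a b F w = elem_int j a1 b1 F1 w - elem_int j a2 b2 F2 w.
  rewrite /elem_int big_sumType /= -sumrN; congr (_ + _); apply: eq_bigr => k _; ring.
have EV r w : elem_eval a b F r w = elem_eval a1 b1 F1 r w - elem_eval a2 b2 F2 r w.
  rewrite /elem_eval big_sumType /= -sumrN; congr (_ + _); apply: eq_bigr => k _; ring.
case: el1 => a10 ab1 bT1 cF1 DF1; case: el2 => a20 ab2 bT2 cF2 DF2.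
split; first split.
- by case.
- by case.
- by case.
- case => k //=; apply: cylfM (cF2 k); exact: cylf_sub (cylf_cst _).
- by case.
- by case.
- rewrite (_ : (fun w => _) = fun w : Om => (((I1 w - elem_int j a1 b1 F1 w) +
    (elem_int j a2 b2 F2 w - I2 w)) ^+ 2)%:E); last first.
    by apply/funext => w; rewrite EI; congr (_ ^+ 2)%:E; ring.
  apply: le_trans (prob_integral_sqrD P _ _) _.
  + exact: (measurable_funB mI1 mJ1).
  + exact: (measurable_funB mJ2 mI2).
  have -> : e%:E = (2%:E * (e / 4)%:E + 2%:E * (e / 4)%:E)%E.
    by rewrite -!EFinM -EFinD; congr EFin; lra.
  apply: leeD; apply: double_le; first by [].
  apply: le_trans hI2; apply: le_of_eq; apply: eq_integral => w _.
  by rewrite -sqrrN opprB.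
- rewrite (_ : (fun r w => _) = fun r (w : Om) => ((z1 r w - elem_eval a1 b1 F1 r w) +
    (elem_eval a2 b2 F2 r w - z2 r w)) ^+ 2); last first.
    by apply/funext => r; apply/funext => w; rewrite EV; congr (_ ^+ 2); ring.
  apply: le_trans (dintegral_sqrD P _ _) _.
  + exact: (measurable_funB mz1 mev1).
  + exact: (measurable_funB mev2 mz2).
  have -> : e%:E = (2%:E * (e / 4)%:E + 2%:E * (e / 4)%:E)%E.
    by rewrite -!EFinM -EFinD; congr EFin; lra.
  apply: leeD; apply: double_le; first by [].
  rewrite (_ : (fun r w => _) = fun r (w : Om) => (z2 r w - elem_eval a2 b2 F2 r w) ^+ 2) //.
  by apply/funext => r; apply/funext => w; rewrite -sqrrN opprB.
Qed.

Lemma cvge0_le (u : nat -> \bar R) : u n @[n --> \oo] --> 0%E ->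
  forall e : R, 0 < e -> \forall n \near \oo, (u n <= e%:E)%E.
Proof.
move=> u0 e e0.
have : nbhs 0%E [set y : \bar R | (y < e%:E)%E].
  by apply: open_nbhs_nbhs; split; [exact: open_ereal_lt_ereal|rewrite /= lte_fin].
by move=> /u0 [N _ H]; exists N => // n /H /= /ltW.
Qed.

Lemma le_upper_expectation (f : Om -> \bar R) : (\int[P]_w f w <= upper_expectation PP f)%E.
Proof. by apply: ereal_sup_ubound; exists P. Qed.

Section steps.
Variable h : step_process d T.

Lemma step_time_le i k : (i <= k)%N -> (k <= step_size h)%N -> step_time h i <= step_time h k.
Proof.
elim: k => [|k IH]; first by rewrite leqn0 => /eqP ->.
rewrite leq_eqVlt => /orP[/eqP -> //|ik] kh.
by apply: le_trans (IH ik (ltnW kh)) _; rewrite ltW // step_lt.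
Qed.

Lemma step_time_itv k : (k <= step_size h)%N -> 0 <= step_time h k <= T.
Proof. by move=> kh; rewrite -[X in X <= _](step_first h) step_time_le //= -[X in _ <= X](step_last h) step_time_le. Qed.

Lemma step_evalE r w : step_eval h r w =
  \sum_(k < step_size h) step_coef h k w * (step_time h k < r <= step_time h k.+1)%R%:R.
Proof.
by apply: eq_bigr => k _; rewrite -itv_oc_indic.
Qed.

Lemma step_coef_repr : exists (D : 'I_(step_size h) -> seq R) (F : 'I_(step_size h) -> (R -> 'cV[R]_d) -> R),
  forall k, [/\ {in D k, forall r, 0 <= r <= step_time h k}, cylf (D k) (F k) &
    step_coef h k = fun w : Om => F k w].
Proof.
have H (k : 'I_(step_size h)) : exists DF : seq R * ((R -> 'cV[R]_d) -> R),
    [/\ {in DF.1, forall r, 0 <= r <= step_time h k}, cylf DF.1 DF.2 &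
    step_coef h k = fun w : Om => DF.2 w].
  by have /LipP[D [F H]] := step_lip (ltn_ord k); exists (D, F).
have [f Hf] := choice H; exists (fun k => (f k).1), (fun k => (f k).2) => k; exact: Hf.
Qed.

Lemma step_eval_measurable : jointly_measurable T (step_eval h).
Proof.
have -> : step_eval h = fun r w =>
    \sum_(k < step_size h) step_coef h k w * (step_time h k < r <= step_time h k.+1)%R%:R.
  by apply/funext => r; apply/funext => w; exact: step_evalE.
have [D [F DF]] := step_coef_repr.
apply: jointly_measurable_sum => k; apply: measurable_funM; last exact: jointly_measurable_indic.
apply: jointly_measurable_const; have [Dk cF ->] := DF k; apply: cylf_measurable cF.
move=> r /Dk /andP[-> h1]; have /andP[_ h2] := step_time_itv (ltnW (ltn_ord k)).
exact: le_trans h2.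
Qed.

Lemma step_elementary t : 0 <= t <= T -> exists (I : finType) a b F D,
  [/\ @elementary I a b F D, bounded_times D, forall w, step_ito h j t w = elem_int j a b F w &
    forall r w, step_eval h r w * (0 < r <= t)%R%:R = elem_eval a b F r w].
Proof.
move=> /andP[t0 tT]; have [D [F DF]] := step_coef_repr.
exists 'I_(step_size h), (fun k : 'I_(step_size h) => Num.min (step_time h k) t),
  (fun k : 'I_(step_size h) => Num.min (step_time h k.+1) t), F, D.
have tk0 k : (k <= step_size h)%N -> 0 <= step_time h k by move=> /step_time_itv/andP[].
split; first split.
- by move=> k; rewrite le_min t0 andbT tk0 // ltnW.
- by move=> k; rewrite le_min !ge_min lexx orbT andbT ltW // step_lt.
- by move=> k; rewrite ge_min tT orbT.
- by move=> k; case: (DF k).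
- move=> k; have [Dk _ _] := DF k => ab r /Dk; case: (leP (step_time h k) t) ab => //.
  by rewrite lt_min ltxx andbF.
- move=> k; have [Dk _ _] := DF k => r /Dk /andP[-> rk] /=.
  by have /andP[_ h2] := step_time_itv (ltnW (ltn_ord k)); exact: le_trans h2.
- by move=> w; apply: eq_bigr => k _; have [_ _ ->] := DF k.
- move=> r w; rewrite step_evalE /elem_eval mulr_suml; apply: eq_bigr => k _.
  have [_ _ ->] := DF k; rewrite -mulrA -natrM mulnb; congr (_ * (nat_of_bool _)%:R).
  have k0 := tk0 _ (ltnW (ltn_ord k)).
  rewrite gt_min le_min; case: (leP r t) => rt; last by rewrite !andbF.
  by rewrite orbF !andbT; case: ltP => //= /(le_lt_trans k0) ->; rewrite andbT.
Qed.

End steps.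

Lemma is_ito_approx eta t I0 : 0 <= t <= T -> is_ito PP j eta t I0 ->
  ito_approx (fun r w => eta r w * (0 < r <= t)%R%:R) I0.
Proof.
move=> tT [hn [[meta ch] [mI cI]]].
have mz : jointly_measurable T (fun r (w : Om) => eta r w * (0 < r <= t)%R%:R).
  by apply: measurable_funM => //; exact: jointly_measurable_indic.
split => // e e0.
have [N _ HN] := cvge0_le ch e0; have [N' _ HN'] := cvge0_le cI e0.
pose n := maxn N N'.
have {HN} h1 := HN n (leq_maxl _ _); have {HN'} h2 := HN' n (leq_maxr _ _).
have [I [a [b [F [D [el DT EI EV]]]]]] := step_elementary (hn n) tT.
exists I, a, b, F, D; split => //.
- apply: le_trans h2; apply: le_trans (le_upper_expectation _).
  apply: le_of_eq; apply: eq_integral => w _.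
  by rewrite EI -normrX ger0_norm // sqr_ge0.
- apply: le_trans h1; apply: le_trans (le_upper_expectation _).
  have -> : (\int[P]_w \int[lebesgue_measure]_(s in `[0%R, T])
      (`|eta s w - step_eval (hn n) s w| ^+ 2)%:E)%E =
      dintegral P T (fun r w => (eta r w - step_eval (hn n) r w) ^+ 2)%R.
    by apply: eq_integral => w _; apply: eq_integral => r _; rewrite -normrX ger0_norm // sqr_ge0.
  apply: dintegral_le.
  + by apply: measurable_funX; apply: measurable_funB mz _; exact: elem_eval_measurable el DT.
  + by apply: measurable_funX; apply: measurable_funB meta _; exact: step_eval_measurable.
  + move=> r w _; rewrite sqr_ge0 /= -EV -mulrBl exprMn.
    by case: (0 < r <= t); [rewrite expr1n mulr1|rewrite mulr0n expr0n mulr0 sqr_ge0].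
Qed.

End ito.

(** * Euler approximation *)

Section drift_diffusion.
Context (P : probability Om R) (PPP : PP P).

Lemma sqr_sum_le (I : finType) (z : I -> R) :
  (\sum_k z k) ^+ 2 <= #|I|%:R * \sum_k z k ^+ 2.
Proof.
have H0 : 0 <= \sum_k \sum_l (z k - z l) ^+ 2.
  by apply: sumr_ge0 => k _; apply: sumr_ge0 => l _; exact: sqr_ge0.
have : \sum_k \sum_l (z k - z l) ^+ 2 = 2 * (#|I|%:R * \sum_k z k ^+ 2) - 2 * (\sum_k z k) ^+ 2.
  transitivity (\sum_k (#|I|%:R * z k ^+ 2 + \sum_l z l ^+ 2 - 2 * (z k * \sum_l z l))).
    apply: eq_bigr => k _.
    rewrite (eq_bigr (fun l => z k ^+ 2 + z l ^+ 2 - 2 * (z k * z l))); last by move=> l _; ring.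
    by rewrite sumrB big_split /= sumr_const mulr_natl -!mulr_sumr.
  rewrite sumrB big_split /= -!mulr_sumr sumr_const -mulr_suml mulr_natl; ring.
by move=> E; move: H0; rewrite E; lra.
Qed.

Lemma ae_prob_integral_le (f g : Om -> \bar R) (N : set Om) :
  measurable N -> P N = 0%E -> measT f -> measT g ->
  (forall w, (0 <= f w)%E) -> (forall w, (0 <= g w)%E) -> (forall w, ~ N w -> (f w <= g w)%E) ->
  (\int[P]_w f w <= \int[P]_w g w)%E.
Proof.
move=> mN PN mf mg f0 g0 fg; apply: ae_ge0_le_integral => //.
by exists N; split => // w /= H; apply: contrapT => nN; apply: H => _; exact: fg.
Qed.

(** Serves twice: for increments of the solution with [Er = 0], and for the distance to the Euler
    scheme, where [Er] is the effect of clamping. *)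
Lemma ito_process_L2 (A Er : Om -> R) (z : 'I_d -> R -> Om -> R) (I0 : 'I_d -> Om -> R)
    (z0 : R -> Om -> R) (N : set Om) (a b : R) :
  0 <= a -> a <= b -> b <= T ->
  (forall j, ito_approx P j (z j) (I0 j)) -> jointly_measurable T z0 ->
  (forall r w, z0 r w != 0 -> a < r <= b) ->
  measT A -> measT Er -> measurable N -> P N = 0%E ->
  (forall w, ~ N w -> mu.-integrable `[0, T]%classic (EFin \o z0^~ w) /\
    A w = \sum_j I0 j w + \int[mu]_(r in `[0, T]) z0 r w + Er w) ->
  (\int[P]_w (A w ^+ 2)%:E <=
    \sum_j (3 * d%:R * (1 + 4 * UG ^+ 2))%:E * dintegral P T (fun r w => z j r w ^+ 2)%R +
    (3 * (b - a))%:E * dintegral P T (fun r w => z0 r w ^+ 2)%R +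
    3%:E * \int[P]_w (Er w ^+ 2)%:E)%E.
Proof.
move=> a0 ab bT Iz mz0 sz0 mA mEr mN PN H.
have mI j : measT (I0 j) by case: (Iz j).
have mz02 : jointly_measurable T (fun r (w : Om) => z0 r w ^+ 2) by exact: measurable_funX.
pose B (w : Om) := ((3 * d%:R * \sum_j I0 j w ^+ 2)%:E +
  (3 * (b - a))%:E * \int[mu]_(r in `[0%R, T]) (z0 r w ^+ 2)%:E + (3 * Er w ^+ 2)%:E)%E.
have ti0 w : (0 <= \int[mu]_(r in `[0%R, T]) (z0 r w ^+ 2)%:E)%E.
  by apply: integral_ge0 => r _; rewrite lee_fin sqr_ge0.
have mti : measT (fun w : Om => \int[mu]_(r in `[0%R, T]) (z0 r w ^+ 2)%:E)%E.
  by apply: measurable_time_integral => // r w _; exact: sqr_ge0.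
have ba0 : 0 <= 3 * (b - a) by rewrite mulr_ge0 // subr_ge0.
have mS : measT (fun w => 3 * d%:R * \sum_j I0 j w ^+ 2).
  by apply: measurable_funM => //; apply: measurable_sum => j; exact: measurable_funX.
have S0 w : 0 <= 3 * d%:R * \sum_j I0 j w ^+ 2.
  by rewrite mulr_ge0 ?mulr_ge0 // sumr_ge0 // => j _; exact: sqr_ge0.
have mE2 : measT (fun w => 3 * Er w ^+ 2).
  by apply: measurable_funM => //; exact: measurable_funX.
have mdr : measT (fun w : Om => (3 * (b - a))%:E * \int[mu]_(r in `[0%R, T]) (z0 r w ^+ 2)%:E)%E.
  by apply: emeasurable_funM => //.
have mSE : measT (fun w => (3 * d%:R * \sum_j I0 j w ^+ 2)%:E) by exact/measurable_EFinP.
have mEE : measT (fun w => (3 * Er w ^+ 2)%:E) by exact/measurable_EFinP.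
have dr0 w : (0 <= (3 * (b - a))%:E * \int[mu]_(r in `[0%R, T]) (z0 r w ^+ 2)%:E)%E.
  by apply: mule_ge0 => //; rewrite lee_fin.
have E0 w : (0 <= (3 * Er w ^+ 2)%:E)%E by rewrite lee_fin mulr_ge0 // sqr_ge0.
apply: (@le_trans _ _ (\int[P]_w B w)%E).
  apply: (ae_prob_integral_le mN PN).
  - by apply/measurable_EFinP; exact: measurable_funX.
  - by apply: emeasurable_funD => //; exact: emeasurable_funD.
  - by move=> w; rewrite lee_fin sqr_ge0.
  - by move=> w; rewrite !adde_ge0 // lee_fin.
  - move=> w /H[iz ->]; rewrite /B.
    set I1 := \sum_j I0 j w; set I2 := Rintegral _ _ _.
    have h1 : I1 ^+ 2 <= d%:R * \sum_j I0 j w ^+ 2.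
      by have := sqr_sum_le (fun j => I0 j w); rewrite card_ord.
    have h2 := sqr_Rintegral_le a0 ab bT iz (fun r => sz0 r w).
    apply: (@le_trans _ _ ((3 * I1 ^+ 2)%:E + (3 * I2 ^+ 2)%:E + (3 * Er w ^+ 2)%:E)%E).
      rewrite -!EFinD lee_fin.
      have := sqr_ge0 (I1 - I2); have := sqr_ge0 (I1 - Er w); have := sqr_ge0 (I2 - Er w).
      move: (I1) (I2) (Er w) => x y u; nra.
    apply: leeD => //; apply: leeD; first by rewrite lee_fin -mulrA ler_pM2l.
    by rewrite !EFinM -muleA; apply: lee_wpmul2l.
rewrite /B ge0_integralD //; [|by move=> w _; rewrite adde_ge0 // lee_fin|exact: emeasurable_funD].
apply: leeD; last by rewrite -prob_integralZ //; [exact: measurable_funX|move=> w; exact: sqr_ge0].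
rewrite ge0_integralD //; last by move=> w _; rewrite lee_fin.
apply: leeD; last by rewrite ge0_integralZl // lee_fin.
have mI2 : measT (fun w => \sum_j I0 j w ^+ 2).
  by apply: measurable_sum => j; exact: measurable_funX.
rewrite prob_integralZ ?mulr_ge0 //; last by move=> w; apply: sumr_ge0 => j _; exact: sqr_ge0.
rewrite sum_prob_integral; [|by move=> j; exact: measurable_funX|by move=> j w; exact: sqr_ge0].
rewrite ge0_sume_distrr; last first.
  by move=> j _; apply: integral_ge0 => w _; rewrite lee_fin sqr_ge0.
apply: lee_sum => j _.
rewrite (EFinM (3 * d%:R) (1 + 4 * UG ^+ 2)) -muleA; apply: lee_wpmul2l.
  by rewrite lee_fin mulr_ge0.
exact: (ito_approx_isometry PPP (Iz j)).
Qed.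

Lemma dintegral_slab (f : R -> Om -> R) (a b c : R) : 0 <= a -> a <= b -> b <= T ->
  jointly_measurable T f -> (forall r w, 0 <= r <= T -> 0 <= f r w) -> 0 <= c ->
  (forall r, a < r <= b -> (\int[P]_w (f r w)%:E <= c%:E)%E) ->
  (dintegral P T (fun r w => f r w * (a < r <= b)%R%:R)%R <= (c * (b - a))%:E)%E.
Proof.
move=> a0 ab bT mf f0 c0 fc.
have mfi : jointly_measurable T (fun r (w : Om) => f r w * (a < r <= b)%R%:R).
  by apply: measurable_funM => //; exact: jointly_measurable_indic.
have fi0 r w : 0 <= r <= T -> 0 <= f r w * (a < r <= b)%R%:R by move=> rT; rewrite mulr_ge0 ?f0.
rewrite dintegral_swap //.
have [i1 e1] := lebesgue_slab a0 ab bT.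
have e1' : (\int[mu]_(r in `[0%R, T]) (((a < r <= b)%R%:R : R)%:E) = (b - a)%:E)%E.
  by rewrite -e1 /Rintegral fineK //; apply: integrable_fin_num.
have m1 : measurable_fun `[0, T]%classic (fun r => (a < r <= b)%R%:R : R).
  by have /integrableP[/measurable_EFinP] := i1.
rewrite EFinM -e1' -ge0_integralZl //; last by apply/measurable_EFinP.
apply: ge0_le_integral => //.
- move=> r /=; rewrite in_itv /= => rT; apply: integral_ge0 => w _.
  by rewrite lee_fin fi0.
- exact: measurable_expectation.
- by apply: measurable_funeM; apply/measurable_EFinP.
- move=> r _; rewrite -EFinM; case: (boolP (a < r <= b)) => rab.
    by under eq_integral do rewrite mulr1; rewrite mulr1; exact: fc.
  by under eq_integral do rewrite mulr0; rewrite integral0 mulr0.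
Qed.

End drift_diffusion.

(** * The clamped Euler scheme *)

Section scheme.
Variables (sigma : V -> 'M[R]_d) (b : V -> V).

Definition truncv (rho : R) (z : V) : V := \col_j trunc rho (z j 0).

Definition euler_step (h rho : R) (x z : V) : V := x + h *: b x + sigma x *m truncv rho z.

(** Driven by an arbitrary function of time, so that [BV] applies. Clamping bounds each step in
    terms of the current state, hence the whole scheme by constants free of [w]; this makes its
    coordinates bounded Lipschitz functions of finitely many values. *)
Fixpoint euler (h rho : R) (x : V) (k : nat) (w : R -> V) : V :=
  if k is k'.+1 then
    euler_step h rho (euler h rho x k' w) (w (k'.+1%:R * h) - w (k'%:R * h))
  else x.

Lemma lipschitz_coord K m n p q (f : 'M[R]_(m, n) -> 'M[R]_(p, q)) i j :
  lipschitz_with K f -> forall x y, `|f x i j - f y i j| <= K * enorm (x - y).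
Proof.
move=> fL x y; apply: le_trans (fL x y).
by have := enorm_coord (f x - f y) i j; rewrite !mxE.
Qed.

Lemma lipschitz_continuous (g : V -> R) K : (forall x y, `|g x - g y| <= K * enorm (x - y)) ->
  continuous g.
Proof.
move=> gK x; apply/continuous_dist => e e0.
have c0 : 0 < (`|K| + 1) * (d%:R + 1) by rewrite mulr_gt0 // ltr_wpDl.
exists (e / ((`|K| + 1) * (d%:R + 1))); first by rewrite divr_gt0.
move=> y; rewrite ltr_pdivlMr // => h.
apply: le_trans (ltW h); apply: le_trans (gK y x) _.
have := enorm_le_norm (y - x); have := ler_norm K; have := enorm_ge0 (y - x); have := normr_ge0 (y - x).
have := normr_ge0 K; have : 0 <= d%:R :> R by [].
move: (`|K|) (enorm _) (`|y - x|) (d%:R : R) => k u v dd d0 k0 v0 u0 Kk uv; nra.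
Qed.

Lemma cylf_comp D (Y : (R -> V) -> V) (g : V -> R) K :
  (forall i, cylf D (fun w => Y w i 0)) -> (forall x y, `|g x - g y| <= K * enorm (x - y)) ->
  cylf D (fun w => g (Y w)).
Proof.
move=> cY gK.
have gK' x y : `|g x - g y| <= `|K| * \sum_i `|x i 0 - y i 0|.
  apply: le_trans (gK x y) _; apply: (@le_trans _ _ (`|K| * enorm (x - y))).
    by rewrite ler_wpM2r ?enorm_ge0 // ler_norm.
  rewrite ler_wpM2l //; apply: le_trans (enorm_cV_le_sum _) _.
  by apply: ler_sum => i _; rewrite !mxE.
have [M HM] := choice (fun i => (cY i).1).
have [L HL] : exists L : 'I_d -> R, forall i, 0 <= L i /\
    forall w w', `|Y w i 0 - Y w' i 0| <= L i * wdist D w w'.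
  have Hi i : exists L : R, 0 <= L /\ forall w w', `|Y w i 0 - Y w' i 0| <= L * wdist D w w'.
    by have [_ [L L0 HL]] := cY i; exists L.
  by have [L HL] := choice Hi; exists L.
split.
  exists (`|g 0| + `|K| * \sum_i M i) => w.
  rewrite -[g (Y w)](subrK (g 0)) addrC; apply: le_trans (ler_normD _ _) _; rewrite lerD2l.
  apply: le_trans (gK' _ _) _; rewrite ler_wpM2l //; apply: ler_sum => i _.
  by rewrite mxE subr0; exact: HM.
exists (`|K| * \sum_i L i).
  by rewrite mulr_ge0 // sumr_ge0 // => i _; case: (HL i).
move=> w w'; apply: le_trans (gK' _ _) _; rewrite -mulrA ler_wpM2l // mulr_suml.
by apply: ler_sum => i _; case: (HL i).
Qed.

Context (Ls Lb : R) (sigma_lip : lipschitz_with Ls sigma) (b_lip : lipschitz_with Lb b).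

Definition euler_grid (h : R) (k : nat) : seq R := [seq m%:R * h | m <- iota 0 k.+1].

Lemma euler_gridS h k : {subset euler_grid h k <= euler_grid h k.+1}.
Proof.
move=> r /mapP[m]; rewrite mem_iota add0n => /andP[_ mk] ->; apply/mapP; exists m => //.
by rewrite mem_iota add0n /= (ltn_trans mk).
Qed.

Lemma mem_euler_grid h k m : (m <= k)%N -> m%:R * h \in euler_grid h k.
Proof. by move=> mk; apply/mapP; exists m => //; rewrite mem_iota add0n. Qed.

Lemma euler_coordS h rho x k w i : euler h rho x k.+1 w i 0 = euler h rho x k w i 0 +
  (h * b (euler h rho x k w) i 0 + \sum_j sigma (euler h rho x k w) i j *
    trunc rho (w (k.+1%:R * h) j 0 - w (k%:R * h) j 0)).
Proof.
rewrite /= /euler_step; move: (euler _ _ _ _ _) => y; rewrite !mxE addrA; congr (_ + _).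
by apply: eq_bigr => j _; rewrite !mxE.
Qed.

Lemma euler_cylf h rho x k i : 0 <= rho -> cylf (euler_grid h k) (fun w => euler h rho x k w i 0).
Proof.
move=> r0; elim: k i => [|k IH] i; first by apply: cylf_sub (cylf_cst _).
have c0 i' : cylf (euler_grid h k.+1) (fun w => euler h rho x k w i' 0).
  exact: cylf_sub (@euler_gridS h k) (IH i').
rewrite (_ : (fun w => _) = fun w => euler h rho x k w i 0 +
  (h * b (euler h rho x k w) i 0 + \sum_j sigma (euler h rho x k w) i j *
    trunc rho (w (k.+1%:R * h) j 0 - w (k%:R * h) j 0))); last first.
  by apply/funext => w; rewrite euler_coordS.
apply: cylfD => //; apply: cylfD.
  apply: cylfM; first by apply: cylf_sub (cylf_cst _).
  exact: (cylf_comp c0 (@lipschitz_coord _ _ _ _ _ b i 0 b_lip)).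
apply: cylf_sum => j; apply: cylfM.
  exact: (cylf_comp c0 (@lipschitz_coord _ _ _ _ _ sigma i j sigma_lip)).
apply: cylf_sub (cylf_trunc_inc _ _ j r0) => r; rewrite mem_seq2 => /orP[/eqP ->|/eqP ->].
  exact: mem_euler_grid.
exact: mem_euler_grid.
Qed.

Lemma euler_sum h rho x k w i : euler h rho x k w i 0 = x i 0 +
  \sum_(m < k) b (euler h rho x m w) i 0 * h + \sum_(m < k) \sum_j sigma (euler h rho x m w) i j *
    trunc rho (w (m.+1%:R * h) j 0 - w (m%:R * h) j 0).
Proof.
elim: k => [|k IH]; first by rewrite !big_ord0 !addr0.
by rewrite euler_coordS !big_ord_recr /= IH; ring.
Qed.

End scheme.

(** * The G-expectation of a function of the solution *)

(** Closeness uniform over [PP], which the representation as a supremum turns into closeness of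
    G-expectations. *)
Definition L1_close (e : R) (Xi xi : Om -> R) :=
  forall P, PP P -> (\int[P]_w (`|Xi w - xi w|)%:E <= e%:E)%E.

Let mLip (xi : Om -> R) : Lip T xi -> measT xi.
Proof.
move=> /LipP[D [F [DT cF ->]]]; apply: cylf_measurable cF => r rD; exact: DT.
Qed.

Lemma Lip_expectation_close xi xi' e : Lip T xi -> Lip T xi' -> L1_close e xi xi' ->
  lip_expectation G xi <= lip_expectation G xi' + e.
Proof.
move=> lx lx' H; rewrite -lee_fin rep.2 //; apply: ub_ereal_sup => _ [P PPP <-].
have i1 := Lip_integrable P (lexx T) lx; have i2 := Lip_integrable P (lexx T) lx'.
rewrite EFinD; apply: le_trans (leeD (_ : \int[P]_w (xi' w)%:E <= _)%E (H P PPP)); last first.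
  by rewrite rep.2 //; exact: le_upper_expectation.
have iB : intT P (fun w => `|xi w - xi' w|).
  exact: (integrable_norm (integrableB measurableT i1 i2)).
rewrite -integralD //; apply: le_integral => //; first exact: integrableD.
by move=> w _; rewrite -EFinD lee_fin -lerBlDl ler_norm.
Qed.

Lemma L1_closeC e xi xi' : L1_close e xi xi' -> L1_close e xi' xi.
Proof.
move=> H P PPP; apply: le_trans (H P PPP); apply: le_of_eq.
by apply: eq_integral => w _; rewrite distrC.
Qed.

Lemma L1_close_trans e e' f g k : measT f -> measT g ->
  measT k -> L1_close e f g -> L1_close e' g k -> L1_close (e + e') f k.
Proof.
move=> mf mg mk fg gk P PPP; rewrite EFinD.
have m1 : measT (fun w => `|f w - g w|).
  by apply: measurableT_comp => //; exact: measurable_funB.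
have m2 : measT (fun w => `|g w - k w|).
  by apply: measurableT_comp => //; exact: measurable_funB.
apply: le_trans (leeD (fg P PPP) (gk P PPP)); rewrite -prob_integralD //.
apply: prob_integral_le.
- by apply: measurableT_comp => //; exact: measurable_funB.
- exact: measurable_funD.
- by move=> w; rewrite normr_ge0 /= ler_distD.
Qed.

(** Holds for every admissible limit [v], hence for whichever one [xget] returns. *)
Lemma Gexpectation_limit_close Xi xi e v : measT Xi -> Lip T xi -> L1_close e Xi xi ->
  is_Gexpectation G PP Xi v -> `|v - lip_expectation G xi| <= e.
Proof.
move=> mX lx cl [xin [lxin [_ cx] cv]].
apply/ler_addgt0Pr => eta eta0; have e2 : 0 < eta / 2 by lra.
have [N _ HN] := cvge0_le cx e2.
have [N' _ HN'] := (cvgrPdist_le _ _).1 cv (eta / 2) e2.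
pose n := maxn N N'; have {}HN := HN n (leq_maxl _ _); have {}HN' := HN' n (leq_maxr _ _).
have cn : L1_close (eta / 2) Xi (xin n).
  move=> P PPP; apply: le_trans HN; apply: le_trans (le_upper_expectation PPP _).
  by apply: le_of_eq; apply: eq_integral => w _; rewrite expr1.
have c1 := L1_close_trans (mLip (lxin n)) mX (mLip lx) (L1_closeC cn) cl.
have h1 := Lip_expectation_close (lxin n) lx c1.
have h2 := Lip_expectation_close lx (lxin n) (L1_closeC c1).
move: HN'; rewrite /= !ler_norml => /andP[h3 h4]; apply/andP; split; lra.
Qed.

Lemma representing_nonempty : exists P, PP P.
Proof.
apply: contrapT => nP.
have l0 : Lip T (fun _ : Om => 0 : R).
  by apply/LipP; exists [::], (fun=> 0); split => //; exact: cylf_cst.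
have := rep.2 _ l0; rewrite /upper_expectation (_ : [set _ | P in PP] = set0) ?ereal_sup0 //.
by rewrite -subset0 => y [P PPP _]; apply: nP; exists P.
Qed.

Lemma Gexpectation_exists Xi : measT Xi ->
  (forall e, 0 < e -> exists2 xi, Lip T xi & L1_close e Xi xi) ->
  exists v, is_Gexpectation G PP Xi v.
Proof.
move=> mX H.
have Hn n : exists xi, Lip T xi /\ L1_close n.+1%:R^-1 Xi xi.
  have [|xi lx cl] := H n.+1%:R^-1; first by rewrite invr_gt0.
  by exists xi.
have [xin Hxin] := choice Hn.
have lxin n : Lip T (xin n) by case: (Hxin n).
have cl n : L1_close n.+1%:R^-1 Xi (xin n) by case: (Hxin n).
have mxin n := mLip (lxin n).
have lipn m n : `|lip_expectation G (xin m) - lip_expectation G (xin n)| <= m.+1%:R^-1 + n.+1%:R^-1.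
  have c1 := L1_close_trans (mxin m) mX (mxin n) (L1_closeC (cl m)) (cl n).
  have h1 := Lip_expectation_close (lxin m) (lxin n) c1.
  have h2 := Lip_expectation_close (lxin n) (lxin m) (L1_closeC c1).
  move: (lip_expectation G (xin m)) (lip_expectation G (xin n)) (m.+1%:R^-1 + n.+1%:R^-1) h1 h2 => u v p h1 h2.
  by rewrite ler_norml; apply/andP; split; lra.
have cau : cauchy (lip_expectation G (xin n) @[n --> \oo]).
  apply: cauchy_exP => e e0; pose N := Num.truncn (2 / e).
  have Ne : N.+1%:R^-1 < e / 2.
    by rewrite -[e / 2]invrK ltf_pV2 ?posrE ?invr_gt0 ?divr_gt0 // invf_div; exact: truncnS_gt.
  exists (lip_expectation G (xin N)); exists N => // n /= Nn; rewrite -ball_normE /=.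
  apply: le_lt_trans (lipn N n) _.
  have h : n.+1%:R^-1 <= N.+1%:R^-1 :> R by rewrite lef_pV2 ?posrE // ler_nat.
  by move: Ne h; move: (N.+1%:R^-1) (n.+1%:R^-1) => u v h1 h2; lra.
exists (lim (lip_expectation G (xin n) @[n --> \oo])), xin; split => //.
  split => //; apply: (@squeeze_cvge _ _ _ _ (fun=> 0%E) _ (fun n => (n.+1%:R^-1)%:E)).
  - apply: nearW => n; have [P0 PP0] := representing_nonempty.
    apply/andP; split.
      apply: le_trans (le_upper_expectation PP0 _).
      by apply: integral_ge0 => w _; rewrite lee_fin exprn_ge0.
    apply: ub_ereal_sup => _ [P PPP <-]; apply: le_trans (cl n P PPP).
    by apply: le_of_eq; apply: eq_integral => w _; rewrite expr1.
  - exact: cvg_cst.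
  - by apply: cvg_EFin; [exact: nearW|exact: cvg_harmonic].
exact: cauchy_cvg.
Qed.

Lemma Gexpectation_close Xi xi e : measT Xi ->
  (forall e, 0 < e -> exists2 xi, Lip T xi & L1_close e Xi xi) ->
  Lip T xi -> L1_close e Xi xi -> `|Gexpectation G PP Xi - lip_expectation G xi| <= e.
Proof.
move=> mX H lx cl; apply: (Gexpectation_limit_close mX lx cl).
have [v Hv] := Gexpectation_exists mX H.
exact: (@xgetPex _ 0 [set e | is_Gexpectation G PP Xi e] (ex_intro _ v Hv)).
Qed.

(** * Convergence of the Euler scheme to the solution *)

Section sde.
Context (sigma : V -> 'M[R]_d) (b : V -> V) (Ls Lb S : R) (sigma_lip : lipschitz_with Ls sigma)
  (b_lip : lipschitz_with Lb b) (sigma_le : forall x i j, `|sigma x i j| <= S) (x : V)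
  (X : R -> Om -> V) (HX : SDE_solution PP sigma b x X).

Lemma quasi_surely_null P (Q : Om -> Prop) : PP P -> quasi_surely PP Q ->
  exists N, [/\ measurable N, P N = 0%E & forall w, ~ N w -> Q w].
Proof.
move=> PPP [N [mN cN H]]; exists N; split => //; apply/eqP; rewrite eq_le measure_ge0 andbT -cN.
by apply: ereal_sup_ubound; exists P.
Qed.

Lemma solution_measurable (g : V -> R) K : (forall y z, `|g y - g z| <= K * enorm (y - z)) ->
  jointly_measurable T (fun r w => g (X r w)).
Proof.
move=> gK; have [mX _ _] := HX.
have := @measurable_comp_cV R _ _ d (`[0%R, T]%classic `*` [set: Om]) (fun q => X q.1 q.2) g (lipschitz_continuous gK).
apply => i.
by have [hn [mi _]] := mX i.
Qed.

Lemma solution_coord_measurable i : jointly_measurable T (fun r w => X r w i 0).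
Proof. by have [mX _ _] := HX; have [hn [mi _]] := mX i. Qed.

(** One approximating step process, being bounded, controls the solution under all measures of [PP]
    at once. *)
Lemma solution_L2 : exists2 C : R, 0 <= C & forall P, PP P -> forall i,
  (dintegral P T (fun r w => X r w i 0 ^+ 2)%R <= C%:E)%E.
Proof.
have [mX _ _] := HX.
have H i : exists C : R, 0 <= C /\ forall P, PP P ->
    (dintegral P T (fun r w => X r w i 0 ^+ 2)%R <= C%:E)%E.
  have [hn [mi ci]] := mX i.
  have [N _ HN] := cvge0_le ci ltr01; have {HN} h1 := HN N (leqnn _).
  have [M [M0 HM]] : exists M : R, 0 <= M /\ forall r w, `|step_eval (hn N) r w| <= M.
    have [D [F DF]] := step_coef_repr (hn N).
    have Hk k : exists M : R, 0 <= M /\ forall w, `|F k w| <= M.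
      have [_ [[M HM] _] _] := DF k; exists M; split => //.
      exact: le_trans (normr_ge0 _) (HM (fun=> 0)).
    have [M HM] := choice Hk; exists (\sum_k M k); split.
      by apply: sumr_ge0 => k _; case: (HM k).
    move=> r w; rewrite step_evalE; apply: le_trans (ler_norm_sum _ _ _) _; apply: ler_sum => k _.
    have [Mk0 HMk] := HM k; have [_ _ ->] := DF k; rewrite normrM.
    case: (_ && _); first by rewrite normr1 mulr1.
    by rewrite normr0 mulr0.
  exists (2 * 1 + 2 * (M ^+ 2 * T)); split.
    by rewrite addr_ge0 ?mulr_ge0 ?sqr_ge0 // ltW.
  move=> P PPP.
  have mse := step_eval_measurable (hn N).
  have mxs : jointly_measurable T (fun r w => X r w i 0 - step_eval (hn N) r w) := measurable_funB mi mse.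
  have -> : (fun r (w : Om) => X r w i 0 ^+ 2) =
      fun r (w : Om) => (X r w i 0 - step_eval (hn N) r w + step_eval (hn N) r w) ^+ 2.
    by apply/funext => r; apply/funext => w; rewrite subrK.
  apply: le_trans (dintegral_sqrD P mxs mse) _.
  have -> : (2 * 1 + 2 * (M ^+ 2 * T))%:E = (2%:E * 1%:E + 2%:E * (M ^+ 2 * T)%:E)%E.
    by rewrite -!EFinM -EFinD.
  apply: leeD; apply: double_le.
    apply: le_trans h1; apply: le_trans (le_upper_expectation PPP _).
    apply: le_of_eq.
    by apply: eq_integral => w _; apply: eq_integral => r _; rewrite -normrX ger0_norm // sqr_ge0.
  have -> : (M ^+ 2 * T)%:E = (M ^+ 2 * (T - 0))%:E by rewrite subr0.
  have m2 : jointly_measurable T (fun r w => step_eval (hn N) r w ^+ 2) := measurable_funX 2 mse.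
  have mi2 : jointly_measurable T (fun r w => step_eval (hn N) r w ^+ 2 * (0 < r <= T)%R%:R).
    by apply: measurable_funM => //; exact: jointly_measurable_indic.
  have le2 (w : Om) r : step_eval (hn N) r w ^+ 2 <= M ^+ 2.
    exact: sqr_le_norm.
  apply: (@le_trans _ _ (dintegral P T (fun r w => step_eval (hn N) r w ^+ 2 * (0 < r <= T)%R%:R)%R)).
    apply: dintegral_le => // r w /andP[r0 rT]; rewrite sqr_ge0 rT andbT /=.
    case: (ltP 0 r) => r0'; first by rewrite mulr1.
    rewrite step_evalE big1 ?expr2 ?mul0r // => k _.
    have /andP[tk0 _] := step_time_itv (ltnW (ltn_ord k)).
    by rewrite (ltNge _ r) (le_trans r0' tk0) mulr0.
  apply: dintegral_slab => //; first exact: ltW.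
    by move=> r w _; exact: sqr_ge0.
    by rewrite sqr_ge0.
  move=> r /andP[r0 rT]; apply: (@le_trans _ _ (\int[P]_(w in [set: Om]) (M ^+ 2)%:E)%E); last first.
    by rewrite prob_integral_cst.
  apply: prob_integral_le => //; first by apply: jointly_measurable_time m2 _; rewrite ltW.
  by move=> w; rewrite sqr_ge0 le2.
have [C HC] := choice H; exists (\sum_i C i); first by apply: sumr_ge0 => i _; case: (HC i).
move=> P PPP i; apply: le_trans ((HC i).2 P PPP) _; rewrite lee_fin (bigD1 i) //= lerDl.
by apply: sumr_ge0 => k _; case: (HC k).
Qed.

(** Path continuity makes the drift integrable outside one null set. All integrals are written over
    [[0, T]] with indicators, so that values at different times can be subtracted under a single
    integral. *)
Lemma solution_regular P : PP P -> exists M : 'I_d -> 'I_d -> R -> Om -> R, exists N : set Om,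
  [/\ forall i j t, 0 <= t <= T ->
        ito_approx P j (fun r w => sigma (X r w) i j * (0 < r <= t)%R%:R) (M i j t),
      measurable N, P N = 0%E,
      forall w, ~ N w -> forall i, mu.-integrable `[0, T]%classic (EFin \o (fun r => b (X r w) i 0)) &
      forall w, ~ N w -> forall t i, 0 <= t <= T -> X t w i 0 = x i 0 + \sum_j M i j t w +
        \int[mu]_(r in `[0, T]) (b (X r w) i 0 * (0 < r <= t)%R%:R)].
Proof.
move=> PPP; have [_ qc [M [HM qe]]] := HX.
have [N1 [mN1 PN1 H1]] := quasi_surely_null PPP qc.
have [N2 [mN2 PN2 H2]] := quasi_surely_null PPP qe.
have ib w : ~ (N1 `|` N2) w -> forall i,
    mu.-integrable `[0, T]%classic (EFin \o (fun r => b (X r w) i 0)).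
  move=> nN i; apply: continuous_compact_integrable; first exact: segment_compact.
  have cX : {within `[0, T], continuous X^~ w} by apply: H1 => h; apply: nN; left.
  move=> r; apply: (@continuous_comp (subspace `[0, T]%classic) V R (X^~ w) (fun y : V => b y i 0)); first exact: cX.
  have cb : continuous (fun y : V => b y i 0) := lipschitz_continuous (lipschitz_coord i 0 b_lip).
  exact: cb.
exists M, (N1 `|` N2); split => //.
- by move=> i j t tT; exact: (is_ito_approx PPP tT (HM i j t tT)).
- exact: measurableU.
- by apply/eqP; rewrite eq_le measure_ge0 andbT; apply: (le_trans (measureU2 P mN1 mN2)); apply: le_of_eq;
     rewrite -[RHS]adde0; congr (_ + _)%E; [exact: PN1|exact: PN2].
- move=> w nN t i tT; rewrite -(Rintegral_cut tT (ib w nN i)).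
  by apply: H2 => // h; apply: nN; right.
Qed.

Lemma indic_diff (f a r s : R) : 0 <= a -> a <= r ->
  f * (0 < s <= r)%R%:R - f * (0 < s <= a)%R%:R = f * (a < s <= r)%R%:R.
Proof.
move=> a0 ar; case: (leP s a) => sa; last first.
  by rewrite andbF mulr0 subr0 (le_lt_trans a0 sa).
by rewrite (le_trans sa ar) !andbT subrr mulr0.
Qed.

Definition sqdist (y z : V) : R := enorm (y - z) ^+ 2.

Lemma sqdistE y z : sqdist y z = \sum_i (y i 0 - z i 0) ^+ 2.
Proof. by rewrite /sqdist enorm_cV; apply: eq_bigr => i _; rewrite !mxE. Qed.

Lemma measurable_enorm_sqr (y : Om -> V) : (forall i, measT (fun w => y w i 0)) ->
  measT (fun w => enorm (y w) ^+ 2).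
Proof.
by move=> my; under eq_fun do rewrite enorm_cV; apply: measurable_sum => i; exact: measurable_funX.
Qed.

Lemma measurable_sqdist (y z : Om -> V) : (forall i, measT (fun w => y w i 0)) ->
  (forall i, measT (fun w => z w i 0)) ->
  measT (fun w => sqdist (y w) (z w)).
Proof.
move=> my mz; apply: measurable_enorm_sqr => i.
by under eq_fun do rewrite !mxE; exact: measurable_funB.
Qed.

Lemma sqdist_triangle y z u : sqdist y u <= 2 * sqdist y z + 2 * sqdist z u.
Proof.
rewrite !sqdistE !mulr_sumr -big_split /=; apply: ler_sum => i _.
have := sqr_ge0 ((y i 0 - z i 0) - (z i 0 - u i 0)); nra.
Qed.

(** The diffusion part is of order [r - a] because the entries of [sigma] are bounded. For the drift
    only a bound in mean square over [[0, T]] is at hand; there the factor [r - a] comes from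
    [sqr_Rintegral_le]. *)
Lemma solution_increment : exists2 C : R, 0 <= C & forall P, PP P -> forall a r,
  0 <= a -> a <= r -> r <= T -> (\int[P]_w (sqdist (X r w) (X a w))%:E <= (C * (r - a))%:E)%E.
Proof.
have [C2 C20 HC2] := solution_L2.
pose C3 i := 2 * b 0 i 0 ^+ 2 * T + 2 * Lb ^+ 2 * (d%:R * C2).
pose c1 := 3 * d%:R * (1 + 4 * UG ^+ 2).
have C30 i : 0 <= C3 i.
  rewrite /C3; apply: addr_ge0; apply: mulr_ge0 => //; try exact: mulr_ge0 (ler0n _ _) (sqr_ge0 _).
    exact: ltW.
  exact: mulr_ge0.
have c10 : 0 <= c1 by rewrite mulr_ge0 ?mulr_ge0 // addr_ge0 // mulr_ge0 // sqr_ge0.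
exists (\sum_(i < d) (d%:R * (c1 * S ^+ 2) + 3 * C3 i)).
  by apply: sumr_ge0 => i _; rewrite addr_ge0 // mulr_ge0 // mulr_ge0 // sqr_ge0.
move=> P PPP a r a0 ar rT; have [M [N [iM mN PN ib eqX]]] := solution_regular PPP.
have aT : 0 <= a <= T by rewrite a0 (le_trans ar).
have rT' : 0 <= r <= T by rewrite rT (le_trans a0).
have mX i s : 0 <= s <= T -> measT (fun w => X s w i 0).
  exact: jointly_measurable_time (solution_coord_measurable i).
have -> : (\int[P]_w (sqdist (X r w) (X a w))%:E = \sum_i \int[P]_w ((X r w i 0 - X a w i 0) ^+ 2)%:E)%E.
  rewrite -sum_prob_integral; last by move=> i w; exact: sqr_ge0.
    by apply: eq_integral => w _; rewrite sqdistE.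
  by move=> i; apply: measurable_funX; apply: measurable_funB; exact: mX.
rewrite mulr_suml -sumEFin; apply: lee_sum => i _.
have mb := solution_measurable (lipschitz_coord i 0 b_lip).
have ms j := solution_measurable (lipschitz_coord i j sigma_lip).
have mcut (f : R -> Om -> R) u v : jointly_measurable T f ->
    jointly_measurable T (fun s w => f s w * (u < s <= v)%R%:R).
  by move=> mf; apply: measurable_funM => //; exact: jointly_measurable_indic.
pose z j s (w : Om) := sigma (X s w) i j * (0 < s <= r)%R%:R - sigma (X s w) i j * (0 < s <= a)%R%:R.
have zE j s w : z j s w = sigma (X s w) i j * (a < s <= r)%R%:R by exact: indic_diff.
pose z0 s (w : Om) := b (X s w) i 0 * (a < s <= r)%R%:R.
have := @ito_process_L2 _ PPP
  (fun w => X r w i 0 - X a w i 0) (fun=> 0) z (fun j w => M i j r w - M i j a w) z0 N a r a0 ar rT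
  (fun j => ito_approxB (iM i j r rT') (iM i j a aT)) (mcut _ a r mb).
move=> /(_ _ _ _ mN PN) H; apply: le_trans (H _ _ _ _) _ => //.
- by move=> s w; rewrite /z0; case: (a < s <= r) => //; rewrite mulr0 eqxx.
- by apply: measurable_funB; exact: mX.
- move=> w nN; split; first exact: integrable_cut (ib w nN i).
  rewrite !eqX // sumrB addr0.
  have -> : \int[mu]_(s in `[0, T]) z0 s w =
      \int[mu]_(s in `[0, T]) (b (X s w) i 0 * (0 < s <= r)%R%:R) -
      \int[mu]_(s in `[0, T]) (b (X s w) i 0 * (0 < s <= a)%R%:R).
    rewrite -RintegralB //; [|exact: integrable_cut (ib w nN i)|exact: integrable_cut (ib w nN i)].
    by apply: eq_Rintegral => s _; rewrite indic_diff.
  ring.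
- have -> : ((d%:R * (c1 * S ^+ 2) + 3 * C3 i) * (r - a))%:E =
    (\sum_(j < d) c1%:E * (S ^+ 2 * (r - a))%:E + (3 * (r - a))%:E * (C3 i)%:E + 3%:E * 0)%E.
    by rewrite mule0 adde0 -!EFinM sumEFin sumr_const card_ord -EFinD -mulr_natl; congr EFin; ring.
  apply: leeD; last first.
    rewrite (_ : (fun w => _) = fun=> 0%E) ?integral0 //.
    by apply/funext => w; rewrite expr2 mul0r.
  apply: leeD.
    apply: lee_sum => j _; apply: lee_wpmul2l; first by rewrite lee_fin.
    have -> : (fun s (w : Om) => z j s w ^+ 2) =
        fun s w => sigma (X s w) i j ^+ 2 * (a < s <= r)%R%:R.
      apply/funext => s; apply/funext => w; rewrite zE exprMn.
      by case: (_ && _); [rewrite expr1n|rewrite mulr0n expr0n].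
    have ms2 : jointly_measurable T (fun s w => sigma (X s w) i j ^+ 2) := measurable_funX 2 (ms j).
    apply: dintegral_slab => //; rewrite ?sqr_ge0 //; first by move=> s w _; exact: sqr_ge0.
    move=> s /andP[as_ sr]; apply: (@le_trans _ _ (\int[P]_(w in [set: Om]) (S ^+ 2)%:E)%E); last first.
      by rewrite prob_integral_cst.
    apply: prob_integral_le => //.
      by apply: jointly_measurable_time ms2 _; rewrite (le_trans a0 (ltW as_)) (le_trans sr).
    by move=> w; rewrite sqr_ge0 sqr_le_norm.
  apply: lee_wpmul2l; first by rewrite lee_fin mulr_ge0 // subr_ge0.
  have mXi2 k : jointly_measurable T (fun s w => X s w k 0 ^+ 2).
    exact: measurable_funX (solution_coord_measurable k).
  pose f1 s (w : Om) : R := 2 * b 0 i 0 ^+ 2 * (0 < s <= T)%R%:R.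
  pose f2 s (w : Om) : R := 2 * Lb ^+ 2 * \sum_k X s w k 0 ^+ 2.
  have mf1 : jointly_measurable T f1.
    by apply: measurable_funM => //; exact: jointly_measurable_indic.
  have mf2' : jointly_measurable T (fun s w => \sum_k X s w k 0 ^+ 2).
    exact: (@jointly_measurable_sum _ _ _ _ _ _ (fun k s w => X s w k 0 ^+ 2)).
  have mf2 : jointly_measurable T f2 by apply: measurable_funM => //; exact: mf2'.
  have f10 s w : 0 <= s <= T -> 0 <= f1 s w.
    by move=> _; exact: mulr_ge0 (mulr_ge0 (ler0n _ _) (sqr_ge0 _)) (ler0n _ _).
  have f20' s (w : Om) : 0 <= \sum_k X s w k 0 ^+ 2 by apply: sumr_ge0 => k _; exact: sqr_ge0.
  have L20 : 0 <= 2 * Lb ^+ 2 by exact: mulr_ge0 (ler0n _ _) (sqr_ge0 _).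
  have f20 s w : 0 <= s <= T -> 0 <= f2 s w by rewrite /f2 mulr_ge0.
  apply: (@le_trans _ _ (dintegral P T (fun s w => f1 s w + f2 s w)%R)).
    apply: dintegral_le.
    - exact: measurable_funX (mcut _ a r mb).
    - exact: measurable_funD mf1 mf2.
    - move=> s w sT; rewrite sqr_ge0 /= /z0; case: (boolP (a < s <= r)) => [/andP[as_ sr]|_].
        rewrite mulr1 /f1 (le_lt_trans a0 as_) (le_trans sr rT) mulr1 /f2 -enorm_cV.
        have h : (b (X s w) i 0 - b 0 i 0) ^+ 2 <= Lb ^+ 2 * enorm (X s w) ^+ 2.
          have h := lipschitz_coord i 0 b_lip (X s w) 0; rewrite subr0 in h.
          by rewrite -exprMn sqr_le_norm.
        rewrite -(mulrA 2 (Lb ^+ 2)); have := sqr_ge0 (b (X s w) i 0 - b 0 i 0 - b 0 i 0).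
        move: (Lb ^+ 2 * _) (b (X s w) i 0) (b 0 i 0) h => u p v; nra.
      by rewrite mulr0 expr2 mul0r addr_ge0 ?f10 ?f20.
  rewrite dintegralD // /C3 EFinD; apply: leeD.
    have -> : 2 * b 0 i 0 ^+ 2 * T = 2 * b 0 i 0 ^+ 2 * (T - 0) by rewrite subr0.
    apply: (@dintegral_slab P (fun _ _ => 2 * b 0 i 0 ^+ 2)) => //; first exact: ltW.
    - exact: measurable_cst.
    - by move=> *; exact: mulr_ge0 (ler0n _ _) (sqr_ge0 _).
    - exact: mulr_ge0 (ler0n _ _) (sqr_ge0 _).
    - by move=> *; rewrite prob_integral_cst.
  have -> : (2 * Lb ^+ 2 * (d%:R * C2))%:E = ((2 * Lb ^+ 2)%:E * (d%:R * C2)%:E)%E by rewrite -EFinM.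
  rewrite dintegralZ //; apply: lee_wpmul2l; first by rewrite lee_fin.
  have -> : d%:R * C2 = \sum_(k < d) C2 by rewrite sum_ord_const.
  apply: (@dintegral_sum_le _ _ _ P T _ _ (fun (k : 'I_d) s (w : Om) => X s w k 0 ^+ 2) (fun=> C2)) => //.
  - by move=> k s w _; exact: sqr_ge0.
  - exact: HC2.
Qed.

(** [euler_c0] collects the Lipschitz constants that feed the error back; [euler_c1] comes from
    clamping, through [|z - trunc rho z| <= z ^+ 2 / rho] and the fourth moment of the
    increments. *)
Definition euler_c0 : R := d%:R * (3 * d%:R ^+ 2 * (1 + 4 * UG ^+ 2) * Ls ^+ 2 + 3 * T * Lb ^+ 2).
Definition euler_c1 : R := d%:R * (9 * d%:R ^+ 2 * S ^+ 2 * UG ^+ 4 * T ^+ 2).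

Lemma euler_c0_ge0 : 0 <= euler_c0.
Proof.
rewrite /euler_c0 mulr_ge0 // addr_ge0 // mulr_ge0 ?sqr_ge0 //; last by rewrite mulr_ge0 // ltW.
by rewrite mulr_ge0 ?mulr_ge0 ?sqr_ge0 // addr_ge0 // mulr_ge0 // sqr_ge0.
Qed.

Lemma euler_c1_ge0 : 0 <= euler_c1.
Proof. by rewrite /euler_c1 mulr_ge0 // mulr_ge0 ?sqr_ge0 // mulr_ge0 ?exprn_even_ge0 // mulr_ge0 ?sqr_ge0 // mulr_ge0 ?sqr_ge0. Qed.

Let mesh_itv n k : (0 < n)%N -> (k <= n)%N -> 0 <= k%:R * (T / n%:R) <= T.
Proof.
move=> n0 kn; rewrite mulr_ge0 ?divr_ge0 ?(ltW T_gt0) //= mulrA ler_pdivrMr ?ltr0n // mulrC ler_pM2l //.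
by rewrite ler_nat.
Qed.

Let grid_sub h k r : 0 <= h -> r \in euler_grid h k -> 0 <= r <= k%:R * h.
Proof.
move=> h0 /mapP[m]; rewrite mem_iota add0n => /andP[_ mk] ->; rewrite mulr_ge0 //=.
by rewrite ler_wpM2r // ler_nat -ltnS.
Qed.

Lemma euler_grid_itv n k : (0 < n)%N -> (k <= n)%N ->
  {in euler_grid (T / n%:R) k, forall r, 0 <= r <= T}.
Proof.
move=> n0 kn r /grid_sub/andP[|-> rk]; first by rewrite divr_ge0 // ltW.
by apply: le_trans rk _; have /andP[] := mesh_itv n0 kn.
Qed.

Section euler_error.
Context (C : R) (n : nat) (rho : R) (P : probability Om R) (PPP : PP P) (C0 : 0 <= C)
  (incC : forall a r, 0 <= a -> a <= r -> r <= T -> (\int[P]_w (sqdist (X r w) (X a w))%:E <= (C * (r - a))%:E)%E)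
  (n0 : (0 < n)%N) (rho0 : 0 < rho).
Let h := T / n%:R.
Local Notation Y k w := (euler sigma b h rho x k w).

Let h0 : 0 < h. Proof. by rewrite divr_gt0 // ltr0n. Qed.

Let grid_itv k : (k <= n)%N -> 0 <= k%:R * h <= T. Proof. exact: mesh_itv. Qed.

Let mY k i : (k <= n)%N -> measT (fun w : Om => Y k w i 0).
Proof.
move=> kn; exact: (cylf_measurable (euler_grid_itv n0 kn) (euler_cylf sigma_lip b_lip h x k i (ltW rho0))).
Qed.

Let mXt k i : (k <= n)%N -> measT (fun w : Om => X (k%:R * h) w i 0).
Proof. by move=> /grid_itv; exact: jointly_measurable_time (solution_coord_measurable i). Qed.

Let cylf_coef (g : V -> R) K m : (forall y z, `|g y - g z| <= K * enorm (y - z)) ->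
  cylf (euler_grid h m) (fun w => g (Y m w)).
Proof. by apply: cylf_comp => i; exact: (euler_cylf sigma_lip b_lip h x m i (ltW rho0)). Qed.

Section step.
Context (k : nat) (e : nat -> R) (kn : (k <= n)%N) (e0 : forall m, 0 <= e m)
  (He : forall m, (m < k)%N -> (\int[P]_w (sqdist (X (m%:R * h) w) (Y m (w : Om)))%:E <= (e m)%:E)%E).

Let W r (w : Om) := \sum_(m < k) sqdist (X r w) (Y m w) * (m%:R * h < r <= m.+1%:R * h)%R%:R.

Let mn (m : 'I_k) : (m.+1 <= n)%N. Proof. exact: leq_trans (ltn_ord m) kn. Qed.

Let mXY (m : 'I_k) : jointly_measurable T (fun r (w : Om) => sqdist (X r w) (Y m w)).
Proof.
have -> : (fun r (w : Om) => sqdist (X r w) (Y m w)) = fun r w => \sum_i (X r w i 0 - Y m w i 0) ^+ 2.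
  by apply/funext => r; apply/funext => w; rewrite sqdistE.
apply: (@jointly_measurable_sum _ _ _ _ _ _ (fun i r (w : Om) => (X r w i 0 - Y m w i 0) ^+ 2)) => i.
apply: measurable_funX; apply: measurable_funB; first exact: solution_coord_measurable.
exact: jointly_measurable_const (mY i (ltnW (mn m))).
Qed.

Let mW : jointly_measurable T W.
Proof.
apply: (@jointly_measurable_sum _ _ _ _ _ _
  (fun (m : 'I_k) r (w : Om) => sqdist (X r w) (Y m w) * (m%:R * h < r <= m.+1%:R * h)%R%:R)) => m.
by apply: measurable_funM => //; [exact: mXY|exact: jointly_measurable_indic].
Qed.

Let sq0 y z : 0 <= sqdist y z. Proof. exact: sqr_ge0. Qed.

Let W0 r w : 0 <= W r w.
Proof. by apply: sumr_ge0 => m _; rewrite mulr_ge0. Qed.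

Let q := \sum_(m < k) (2 * (C * h) + 2 * e m) * h.

Let DW : (dintegral P T W <= q%:E)%E.
Proof.
apply: (@dintegral_sum_le _ _ _ P T _ _
  (fun (m : 'I_k) r (w : Om) => sqdist (X r w) (Y m w) * (m%:R * h < r <= m.+1%:R * h)%R%:R)
  (fun m : 'I_k => (2 * (C * h) + 2 * e m) * h)).
- by move=> m; apply: measurable_funM => //; [exact: mXY|exact: jointly_measurable_indic].
- by move=> m r w _; rewrite mulr_ge0.
move=> m; have /andP[m0 _] := grid_itv (ltnW (mn m)); have /andP[_ mT] := grid_itv (mn m).
have mS : m.+1%:R * h - m%:R * h = h by rewrite -natr1; ring.
have mS' : m%:R * h <= m.+1%:R * h by rewrite ler_pM2r // ler_nat.
rewrite -[X in (_ * X)%:E]mS; apply: dintegral_slab => //.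
  by apply: addr_ge0; rewrite !mulr_ge0 // ltW.
move=> r /andP[mr rm].
have rT : 0 <= r <= T by rewrite (le_trans m0 (ltW mr)) (le_trans rm).
have mXr i : measT (fun w => X r w i 0).
  exact: jointly_measurable_time (solution_coord_measurable i) rT.
have mX1 := measurable_sqdist mXr (fun i => mXt i (ltnW (mn m))).
have mX2 := measurable_sqdist (fun i => mXt i (ltnW (mn m))) (fun i => mY i (ltnW (mn m))).
apply: (@le_trans _ _ (\int[P]_w (2 * sqdist (X r w) (X (m%:R * h) w) +
    2 * sqdist (X (m%:R * h) w) (Y m (w : Om)))%:E)%E).
  apply: prob_integral_le.
  - exact: measurable_sqdist mXr (fun i => mY i (ltnW (mn m))).
  - by apply: measurable_funD; apply: measurable_funM.
  - by move=> w; rewrite sq0 sqdist_triangle.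
rewrite prob_integralD; [|by apply: measurable_funM|by apply: measurable_funM|
  by move=> w; rewrite mulr_ge0|by move=> w; rewrite mulr_ge0].
have -> : (2 * (C * h) + 2 * e m)%:E = (2%:E * (C * h)%:E + 2%:E * (e m)%:E)%E.
  by rewrite -!EFinM -EFinD.
rewrite !prob_integralZ //; apply: leeD; apply: double_le; last exact: He.
apply: le_trans (incC m0 (ltW mr) (andP rT).2) _; rewrite lee_fin ler_wpM2l //.
by rewrite -[leRHS]mS lerD2r.
Qed.

Let slab_dintegral (g : V -> R) K : (forall y z, `|g y - g z| <= K * enorm (y - z)) ->
  jointly_measurable T (fun r (w : Om) => g (X r w) * (0 < r <= k%:R * h)%R%:R -
    \sum_(m < k) g (Y m w) * (m%:R * h < r <= m.+1%:R * h)%R%:R) /\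
  (dintegral P T (fun r (w : Om) => (g (X r w) * (0 < r <= k%:R * h)%R%:R -
    \sum_(m < k) g (Y m w) * (m%:R * h < r <= m.+1%:R * h)%R%:R) ^+ 2)%R <= (K ^+ 2 * q)%:E)%E.
Proof.
move=> gK.
have mz : jointly_measurable T (fun r (w : Om) => g (X r w) * (0 < r <= k%:R * h)%R%:R -
    \sum_(m < k) g (Y m w) * (m%:R * h < r <= m.+1%:R * h)%R%:R).
  apply: measurable_funB.
    by apply: measurable_funM => //; [exact: solution_measurable gK|exact: jointly_measurable_indic].
  apply: (@jointly_measurable_sum _ _ _ _ _ _
    (fun (m : 'I_k) r (w : Om) => g (Y m w) * (m%:R * h < r <= m.+1%:R * h)%R%:R)) => m.
  apply: measurable_funM => //; last exact: jointly_measurable_indic.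
  exact: jointly_measurable_const (cylf_measurable (euler_grid_itv n0 (ltnW (mn m))) (cylf_coef m gK)).
split=> //; apply: (@le_trans _ _ (dintegral P T (fun r w => K ^+ 2 * W r w)%R)).
  apply: dintegral_le.
  - exact: measurable_funX.
  - by apply: measurable_funM => //; exact: mW.
  - move=> r w _; rewrite sqr_ge0 /=.
    apply: le_trans (@slab_sqr R h r h0 (g (X r w)) (fun m => g (Y m w))
      (fun m => K ^+ 2 * sqdist (X r w) (Y m w)) k _) _.
      by move=> m _; rewrite /sqdist -exprMn sqr_le_norm.
    by rewrite mulr_sumr; apply: ler_sum => m _; rewrite mulrA.
have -> : (K ^+ 2 * q)%:E = ((K ^+ 2)%:E * q%:E)%E by rewrite -EFinM.
rewrite dintegralZ ?sqr_ge0 //; apply: lee_wpmul2l => //.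
by rewrite lee_fin sqr_ge0.
Qed.

Let err i (w : Om) := \sum_(p : 'I_d * 'I_k) sigma (Y p.2 w) i p.1 *
  ((w (p.2.+1%:R * h) p.1 0 - w (p.2%:R * h) p.1 0) -
   trunc rho (w (p.2.+1%:R * h) p.1 0 - w (p.2%:R * h) p.1 0)).

Let inc (p : 'I_d * 'I_k) (w : Om) := w (p.2.+1%:R * h) p.1 0 - w (p.2%:R * h) p.1 0.

Let minc p : measT (inc p).
Proof. exact: measurable_inc. Qed.

Let merr i : measT (err i).
Proof.
apply: measurable_sum => p; apply: measurable_funM.
  exact: (cylf_measurable (euler_grid_itv n0 (ltnW (mn p.2))) (cylf_coef p.2 (lipschitz_coord i p.1 sigma_lip))).
apply: measurable_funB; first exact: minc.
have r0 := ltW rho0; apply: (cylf_measurable _ (cylf_trunc_inc (p.2%:R * h) (p.2.+1%:R * h) p.1 r0)).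
by move=> r; rewrite mem_seq2 => /orP[/eqP ->|/eqP ->]; apply: grid_itv => //; exact: ltnW.
Qed.

Let err_le i : (\int[P]_w (err i w ^+ 2)%:E <=
  (3 * d%:R ^+ 2 * S ^+ 2 * UG ^+ 4 * T ^+ 2 / rho ^+ 2)%:E)%E.
Proof.
pose c := (d * k)%:R * (S ^+ 2 / rho ^+ 2).
have c0 : 0 <= c by rewrite mulr_ge0 // divr_ge0 ?sqr_ge0.
have x40 (y : R) : 0 <= y ^+ 4 by rewrite exprn_even_ge0.
apply: (@le_trans _ _ (\int[P]_w (c * \sum_p inc p w ^+ 4)%:E)%E).
  apply: prob_integral_le.
  - exact: measurable_funX.
  - by apply: measurable_funM => //; apply: measurable_sum => p; apply: measurable_funX; exact: minc.
  - move=> w; rewrite sqr_ge0 /=; apply: le_trans (sqr_sum_le _) _.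
    rewrite card_prod !card_ord /c -mulrA ler_wpM2l // mulr_sumr; apply: ler_sum => p _.
    rewrite exprMn (_ : S ^+ 2 / rho ^+ 2 * inc p w ^+ 4 = S ^+ 2 * (inc p w ^+ 4 / rho ^+ 2)); last by ring.
    apply: ler_pM; rewrite ?sqr_ge0 //.
      exact: sqr_le_norm.
    rewrite -real_normK ?num_real // -[4%N]/(2 * 2)%N exprM -expr_div_n.
    by rewrite ler_pXn2r ?nnegrE ?normr_ge0 ?divr_ge0 ?sqr_ge0 ?(ltW rho0) // trunc_err.
have mS : measT (fun w => \sum_p inc p w ^+ 4).
  by apply: measurable_sum => p; apply: measurable_funX; exact: minc.
rewrite prob_integralZ //; last by move=> w; apply: sumr_ge0.
rewrite sum_prob_integral; [|by move=> p; apply: measurable_funX; exact: minc|by []].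
apply: (@le_trans _ _ (c%:E * \sum_(p : 'I_d * 'I_k) (3 * UG ^+ 4 * h ^+ 2)%:E)%E).
  apply: lee_wpmul2l; first by rewrite lee_fin.
  apply: lee_sum => p _; have /andP[m0 _] := grid_itv (ltnW (mn p.2)).
  have /andP[_ mT] := grid_itv (mn p.2).
  have mS' : p.2%:R * h < p.2.+1%:R * h by rewrite ltr_pM2r // ltr_nat.
  have -> : h = p.2.+1%:R * h - p.2%:R * h by rewrite -natr1; ring.
  exact: (moment4 PPP p.1 m0 mS' mT).
rewrite sumEFin -EFinM lee_fin sumr_const card_prod !card_ord /c -[X in _ * X]mulr_natl natrM.
have /andP[k0 kT] := grid_itv kn.
have kT2 : (k%:R * h) ^+ 2 <= T ^+ 2 by rewrite ler_pXn2r ?nnegrE // ltW.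
have -> : d%:R * k%:R * (S ^+ 2 / rho ^+ 2) * (d%:R * k%:R * (3 * UG ^+ 4 * h ^+ 2)) =
  3 * d%:R ^+ 2 * S ^+ 2 * UG ^+ 4 * (k%:R * h) ^+ 2 / rho ^+ 2.
  by field; rewrite lt0r_neq0.
rewrite ler_wpM2r ?invr_ge0 ?sqr_ge0 // ler_wpM2l // mulr_ge0 // mulr_ge0 ?sqr_ge0 //.
Qed.

(** The coefficients of the two processes are taken at [X r] and at the last grid value of the
    scheme. The squared distance of these points splits into that of the increment of [X] since the
    grid time, of order [C * h], and the earlier error [e m]; this is the form required by
    Gronwall's argument. *)
Lemma euler_local_error : (\int[P]_w (sqdist (X (k%:R * h) w) (Y k (w : Om)))%:E <=
  (euler_c0 * (\sum_(m < k) (2 * (C * h) + 2 * e m) * h) + euler_c1 / rho ^+ 2)%:E)%E.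
Proof.
rewrite -/q; have [M [N [iM mN PN ib eqX]]] := solution_regular PPP.
have tT := grid_itv kn; have /andP[t0 tT'] := tT.
have -> : (\int[P]_w (sqdist (X (k%:R * h) w) (Y k (w : Om)))%:E =
    \sum_i \int[P]_w ((X (k%:R * h) w i 0 - Y k (w : Om) i 0) ^+ 2)%:E)%E.
  rewrite -sum_prob_integral; last by move=> i w; exact: sqr_ge0.
    by apply: eq_integral => w _; rewrite sqdistE.
  by move=> i; apply: measurable_funX; apply: measurable_funB; [exact: mXt|exact: mY].
pose c1 := 3 * d%:R * (1 + 4 * UG ^+ 2).
have c10 : 0 <= c1 by rewrite mulr_ge0 ?mulr_ge0 // addr_ge0 // mulr_ge0 // sqr_ge0.
pose ci := d%:R * (c1 * (Ls ^+ 2 * q)) + 3 * T * (Lb ^+ 2 * q) +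
  3 * (3 * d%:R ^+ 2 * S ^+ 2 * UG ^+ 4 * T ^+ 2 / rho ^+ 2).
have -> : euler_c0 * q + euler_c1 / rho ^+ 2 = \sum_(i < d) ci.
  rewrite sum_ord_const /ci /c1 /euler_c0 /euler_c1; ring.
rewrite -sumEFin; apply: lee_sum => i _.
pose a (m : 'I_k) := m%:R * h; pose b' (m : 'I_k) := m.+1%:R * h.
pose F j (m : 'I_k) (w : R -> V) := sigma (Y m w) i j.
have el j : elementary a b' (F j) (fun m : 'I_k => euler_grid h m) /\
    bounded_times (fun m : 'I_k => euler_grid h m).
  split; last by move=> m; exact: (euler_grid_itv n0 (ltnW (mn m))).
  split=> m.
  - by have /andP[] := grid_itv (ltnW (mn m)).
  - by rewrite /a /b' ler_pM2r // ler_nat.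
  - by have /andP[] := grid_itv (mn m).
  - exact: cylf_coef (lipschitz_coord i j sigma_lip).
  - by move=> _ r; exact: grid_sub (ltW h0).
have Iz j := ito_approxB (iM i j _ tT) (ito_approx_elem P j (el j).1 (el j).2).
have [mz0 Dz0] := slab_dintegral (lipschitz_coord i 0 b_lip).
pose z0 r (w : Om) := b (X r w) i 0 * (0 < r <= k%:R * h)%R%:R -
  \sum_(m < k) b (Y m w) i 0 * (m%:R * h < r <= m.+1%:R * h)%R%:R.
have sz0 r w : z0 r w != 0 -> 0 < r <= k%:R * h.
  move=> H; case: (boolP (0 < r <= k%:R * h)) => // nr.
  by move: H; rewrite /z0 (negPf nr) mulr0 (slab_sum_out h0 (fun m => b (Y m w) i 0) nr) subrr eqxx.
have mA : measT (fun w : Om => X (k%:R * h) w i 0 - Y k w i 0).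
  by apply: measurable_funB; [exact: mXt|exact: mY].
apply: le_trans (ito_process_L2 PPP (lexx 0) t0 tT' Iz mz0 sz0 mA (merr i) mN PN _) _.
  move=> w nN.
  pose H m r := b (Y m w) i 0 * (m%:R * h < r <= m.+1%:R * h)%R%:R.
  have iH m : (m < k)%N -> mu.-integrable `[0, T]%classic (EFin \o H m) /\
      \int[mu]_(r in `[0, T]) H m r = b (Y m w) i 0 * h.
    move=> mk; have /andP[m0 _] := grid_itv (ltnW (mn (Ordinal mk))).
    have /andP[_ mT] := grid_itv (mn (Ordinal mk)).
    have mS' : m%:R * h <= m.+1%:R * h by rewrite ler_pM2r // ler_nat.
    have [i1 e1] := lebesgue_slab m0 mS' mT; split.
      by apply: (integrableZl _ (b (Y m w) i 0) i1).
    rewrite /H RintegralZl // e1 -natr1; ring.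
  have [iS eS] : mu.-integrable `[0, T]%classic (EFin \o (fun r => \sum_(m < k) H m r)) /\
      \int[mu]_(r in `[0, T]) (\sum_(m < k) H m r) = \sum_(m < k) \int[mu]_(r in `[0, T]) H m r.
    by apply: Rintegral_ord_sum => // m /iH[].
  have ic := integrable_cut 0 (k%:R * h) (ib w nN i).
  split; first by apply: (integrableB _ ic iS).
  have -> : \int[mu]_(r in `[0, T]) z0 r w =
      \int[mu]_(r in `[0, T]) (b (X r w) i 0 * (0 < r <= k%:R * h)%R%:R) -
      \sum_(m < k) b (Y m w) i 0 * h.
    rewrite /z0 RintegralB // eS; congr (_ - _); apply: eq_bigr => m _.
    exact: (iH m (ltn_ord m)).2.
  rewrite eqX // euler_sum sumrB.
  have -> : err i w = \sum_j elem_int j a b' (F j) w -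
      \sum_(m < k) \sum_j sigma (Y m w) i j * trunc rho (w (m.+1%:R * h) j 0 - w (m%:R * h) j 0).
    rewrite [X in _ - X]exchange_big /= -sumrB /err -(pair_bigA _ (fun j (m : 'I_k) => sigma (Y m w) i j *
      ((w (m.+1%:R * h) j 0 - w (m%:R * h) j 0) -
       trunc rho (w (m.+1%:R * h) j 0 - w (m%:R * h) j 0)))) /=.
    apply: eq_bigr => j _; rewrite -sumrB; apply: eq_bigr => m _; rewrite mulrBr; congr (_ - _).
  ring.
have -> : ci%:E = (\sum_(j < d) c1%:E * (Ls ^+ 2 * q)%:E + (3 * T)%:E * (Lb ^+ 2 * q)%:E +
    3%:E * (3 * d%:R ^+ 2 * S ^+ 2 * UG ^+ 4 * T ^+ 2 / rho ^+ 2)%:E)%E.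
  by rewrite -!EFinM sumEFin sum_ord_const -!EFinD.
apply: leeD; last by apply: lee_wpmul2l => //; exact: err_le.
apply: leeD.
  apply: lee_sum => j _; apply: lee_wpmul2l; first by rewrite lee_fin.
  exact: (slab_dintegral (lipschitz_coord i j sigma_lip)).2.
apply: (@le_trans _ _ ((3 * (k%:R * h - 0))%:E * (Lb ^+ 2 * q)%:E)%E).
  by apply: lee_wpmul2l => //; rewrite lee_fin subr0 mulr_ge0.
rewrite -!EFinM lee_fin subr0; apply: ler_wpM2r; last by rewrite ler_pM2l.
rewrite mulr_ge0 ?sqr_ge0 // sumr_ge0 // => m _; rewrite mulr_ge0 ?(ltW h0) //.
by rewrite addr_ge0 // !mulr_ge0 // ltW.
Qed.

End step.

Lemma euler_gronwall k : (k <= n)%N ->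
  (\int[P]_w (sqdist (X (k%:R * h) w) (Y k (w : Om)))%:E <=
   ((euler_c0 * (2 * C * T) * h + euler_c1 / rho ^+ 2) * (1 + 2 * euler_c0 * h) ^+ k)%:E)%E.
Proof.
have c00 := euler_c0_ge0; have c10 := euler_c1_ge0.
pose A := euler_c0 * (2 * C * T) * h + euler_c1 / rho ^+ 2; pose B := 2 * euler_c0 * h.
have hge := ltW h0; have Tge := ltW T_gt0.
have B0 : 0 <= B by exact: mulr_ge0 (mulr_ge0 (ler0n _ 2) c00) hge.
have A0 : 0 <= A.
  exact: addr_ge0 (mulr_ge0 (mulr_ge0 c00 (mulr_ge0 (mulr_ge0 (ler0n _ 2) C0) Tge)) hge)
    (divr_ge0 c10 (sqr_ge0 _)).
rewrite -/A -/B; elim/ltn_ind: k => k IH kn.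
apply: le_trans (euler_local_error kn (e := fun m => A * (1 + B) ^+ m) _ _) _.
- by move=> m; rewrite mulr_ge0 // exprn_ge0 // addr_ge0.
- by move=> m mk; apply: IH => //; exact: leq_trans (ltnW mk) kn.
rewrite lee_fin -(gronwall_geometric A B k).
have -> : \sum_(m < k) (2 * (C * h) + 2 * (A * (1 + B) ^+ m)) * h =
    2 * (C * h) * (k%:R * h) + 2 * h * \sum_(m < k) A * (1 + B) ^+ m.
  rewrite mulr_sumr; under eq_bigr do rewrite mulrDl.
  rewrite big_split /= sum_ord_const; congr (_ + _); first by ring.
  by apply: eq_bigr => m _; ring.
have /andP[k0 kT] := grid_itv kn.
have : 2 * (C * h) * (k%:R * h) <= 2 * (C * h) * T.
  by rewrite ler_wpM2l // !mulr_ge0 // ltW.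
move: (\sum_(m < k) _) => Z; rewrite /A /B => le1.
have := ler_wpM2l c00 le1; lra.
Qed.

End euler_error.

Theorem euler_error : exists K1 K2 : R, [/\ 0 <= K1, 0 <= K2 & forall n rho P,
  (0 < n)%N -> 0 < rho -> PP P ->
  (\int[P]_w (sqdist (X T w) (euler sigma b (T / n%:R) rho x n w))%:E <=
   (K1 / n%:R + K2 / rho ^+ 2)%:E)%E].
Proof.
have [C C0 incC] := solution_increment.
pose E := expR (2 * euler_c0 * T).
exists (euler_c0 * (2 * C * T) * T * E), (euler_c1 * E).
have c00 := euler_c0_ge0; have c10 := euler_c1_ge0.
have T0 := ltW T_gt0.
have K0 : 0 <= euler_c0 * (2 * C * T) * T.
  exact: mulr_ge0 (mulr_ge0 c00 (mulr_ge0 (mulr_ge0 (ler0n _ 2) C0) T0)) T0.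
split; [by rewrite mulr_ge0 // expR_ge0|by rewrite mulr_ge0 // expR_ge0|].
move=> n rho P n0 rho0 PPP.
have nh : n%:R * (T / n%:R) = T by rewrite mulrC divfK // pnatr_eq0 -lt0n.
have := euler_gronwall PPP C0 (incC P PPP) n0 rho0 (leqnn n); rewrite nh => H; apply: le_trans H _.
have h0 : 0 <= T / n%:R by rewrite divr_ge0.
have le1 : (1 + 2 * euler_c0 * (T / n%:R)) ^+ n <= E.
  have -> : E = expR (2 * euler_c0 * (T / n%:R)) ^+ n.
    by rewrite -expRM_natl /E; congr expR; rewrite [RHS]mulrCA nh.
  have e0 := mulr_ge0 (mulr_ge0 (ler0n _ 2) c00) h0.
  by apply: lerXn2r; rewrite ?nnegrE ?expR_ge0 ?expR_ge1Dx // addr_ge0.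
rewrite lee_fin.
have -> : euler_c0 * (2 * C * T) * T * E / n%:R + euler_c1 * E / rho ^+ 2 =
  (euler_c0 * (2 * C * T) * (T / n%:R) + euler_c1 / rho ^+ 2) * E by ring.
apply: ler_wpM2l => //.
exact: addr_ge0 (mulr_ge0 (mulr_ge0 c00 (mulr_ge0 (mulr_ge0 (ler0n _ 2) C0) T0)) h0)
  (divr_ge0 c10 (sqr_ge0 _)).
Qed.

Section functional.
Context (phi : V -> R) (M : R) (phiM : forall z, `|phi z| <= M) (cphi : continuous phi).

Let mXT i : measT (fun w => X T w i 0).
Proof. by apply: (jointly_measurable_time (solution_coord_measurable i)); rewrite lexx ltW. Qed.

Lemma measurable_functional : measT (fun w => phi (X T w)).
Proof. exact: measurable_comp_cV. Qed.

Let measurable_error n rho : (0 < n)%N -> 0 <= rho ->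
  measT (fun w : Om => sqdist (X T w) (euler sigma b (T / n%:R) rho x n w)).
Proof.
move=> n0 r0; apply: measurable_sqdist => // i.
exact: cylf_measurable (euler_grid_itv n0 (leqnn n)) (euler_cylf sigma_lip b_lip _ x n i r0).
Qed.

Lemma euler_functional_Lip n rho g K : (0 < n)%N -> 0 <= rho ->
  (forall z, `|g z| <= M) -> (forall y z, `|g y - g z| <= K * enorm (y - z)) ->
  Lip T (fun w : Om => g (euler sigma b (T / n%:R) rho x n w)).
Proof.
move=> n0 r0 gM gK; apply/LipP.
exists (euler_grid (T / n%:R) n), (fun w => g (euler sigma b (T / n%:R) rho x n w)).
split; [exact: euler_grid_itv|apply: cylf_comp gK => i; exact: euler_cylf|by []].
Qed.

Lemma solution_moment : exists2 C : R, 0 <= C & forall P, PP P ->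
  (\int[P]_w (enorm (X T w) ^+ 2)%:E <= C%:E)%E.
Proof.
have [K1 [K2 [K10 K20 H]]] := euler_error.
pose Y w := euler sigma b (T / 1%:R) 1 x 1 w.
have cY i := euler_cylf sigma_lip b_lip (T / 1%:R) x 1 i ler01.
have [B HB] := choice (fun i => (cY i).1).
have YB w : enorm (Y w) ^+ 2 <= \sum_i B i ^+ 2.
  by rewrite enorm_cV; apply: ler_sum => i _; rewrite sqr_le_norm.
have B0 : 0 <= \sum_i B i ^+ 2 by apply: sumr_ge0 => i _; exact: sqr_ge0.
exists (2 * (K1 + K2) + 2 * \sum_i B i ^+ 2); first by rewrite addr_ge0 // mulr_ge0 // addr_ge0.
move=> P PPP; have {}H := H 1%N 1 P (ltn0Sn 0) ltr01 PPP.
have mX2 := measurable_enorm_sqr mXT.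
have mXY := measurable_error (ltn0Sn 0) ler01.
apply: (@le_trans _ _ (\int[P]_w (2 * sqdist (X T w) (Y w) + 2 * \sum_i B i ^+ 2)%:E)%E).
  apply: prob_integral_le => //.
    by apply: measurable_funD => //; apply: measurable_funM.
  move=> w; rewrite sqr_ge0 /=; have := sqdist_triangle (X T w) (Y w) 0.
  by have := YB w; rewrite /sqdist !subr0; lra.
rewrite prob_integralD //; first last.
- by move=> w; rewrite mulr_ge0.
- by move=> w; rewrite mulr_ge0 // sqr_ge0.
- by apply: measurable_funM.
rewrite prob_integral_cst prob_integralZ //; last by move=> w; exact: sqr_ge0.
have -> : (2 * (K1 + K2) + 2 * \sum_i B i ^+ 2)%:E = (2%:E * (K1 + K2)%:E + (2 * \sum_i B i ^+ 2)%:E)%E.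
  by rewrite -EFinM -EFinD.
apply: leeD => //; apply: double_le.
have -> : K1 + K2 = K1 / 1%:R + K2 / 1 ^+ 2 by rewrite expr1n !divr1.
exact: H.
Qed.

(** The radius [r] comes from the second moment of [X T], then [K0] from [inf_conv_close] on that
    ball, then [eta] from [K u <= K eta / 2 + K u^2 / (2 eta)], and [N] last. All larger [K] are
    allowed because one [K] has to serve both starting points. *)
Lemma euler_functional e : 0 < e -> exists2 K0 : R, 0 <= K0 & forall K, K0 <= K ->
  exists N : nat, forall n rho, (N <= n)%N -> N%:R <= rho -> (0 < n)%N /\ 0 < rho /\
    L1_close e (fun w => phi (X T w))
      (fun w => inf_conv phi K (euler sigma b (T / n%:R) rho x n w)).
Proof.
move=> e0; have [C C0 HC] := solution_moment.
have M0 : 0 <= M by exact: le_trans (normr_ge0 _) (phiM 0).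
have [r [r0 Hr]] : exists r : R, 0 < r /\ 2 * M / r ^+ 2 * C <= e / 4.
  pose r2 := 8 * M * C / e + 1.
  have r20 : 0 < r2 by rewrite ltr_wpDl // divr_ge0 ?mulr_ge0 // ltW.
  exists (Num.sqrt r2); split; first by rewrite sqrtr_gt0.
  rewrite sqr_sqrtr ?(ltW r20) // mulrAC ler_pdivrMr //.
  have -> : e / 4 * r2 = 2 * M * C + e / 4 by rewrite /r2; field; exact: lt0r_neq0.
  lra.
have [K0 K00 HK] := inf_conv_close r phiM cphi (divr_gt0 e0 (ltr0n _ 4)).
exists K0 => // K K0K; have K_0 : 0 <= K by exact: le_trans K0K.
have [K1 [K2 [K10 K20 H]]] := euler_error.
pose eta := e / (2 * (K + 1)).
have eta0 : 0 < eta by rewrite divr_gt0 // mulr_gt0 // ltr_wpDl.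
pose c := K / (2 * eta).
have c0 : 0 <= c by rewrite divr_ge0 // mulr_ge0 // ltW.
pose N := (Num.truncn (4 * c * (K1 + K2) / e)).+1.
exists N => n rho Nn Nrho.
have n0 : (0 < n)%N by apply: leq_trans Nn.
have N1 : 1 <= N%:R :> R by rewrite ler1n.
have rho0 : 0 < rho by apply: lt_le_trans Nrho; rewrite ltr0n.
split=> //; split=> // P PPP.
have bnd : c * (K1 / n%:R + K2 / rho ^+ 2) <= e / 4.
  have h1 : K1 / n%:R <= K1 / N%:R by rewrite ler_wpM2l // lef_pV2 ?posrE ?ltr0n // ler_nat.
  have h2 : K2 / rho ^+ 2 <= K2 / N%:R.
    rewrite ler_wpM2l // lef_pV2 ?posrE ?exprn_gt0 ?ltr0n //.
    apply: (le_trans Nrho); rewrite expr2 ler_peMr ?(ltW rho0) //; exact: le_trans N1 Nrho.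
  have h3 : 4 * c * (K1 + K2) / e < N%:R by exact: truncnS_gt.
  have N0 : 0 < N%:R :> R by rewrite ltr0n.
  apply: (@le_trans _ _ (c * ((K1 + K2) / N%:R))).
    by rewrite ler_wpM2l // mulrDl lerD.
  rewrite mulrA ler_pdivrMr //; move: h3; rewrite ltr_pdivrMr //; lra.
pose Y w := euler sigma b (T / n%:R) rho x n w.
have mX2 := measurable_enorm_sqr mXT.
have mXY := measurable_error n0 (ltW rho0).
have KL := @inf_conv_lip R d phi M phiM K K_0.
have mfY : measT (fun w : Om => inf_conv phi K (Y w)).
  have := euler_functional_Lip n0 (ltW rho0) (inf_conv_bound phiM K_0) KL.
  by move=> /LipP[D [F [DT cF E]]]; rewrite [X in measurable_fun _ X]E; exact: cylf_measurable cF.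
have r2 : 0 < r ^+ 2 by rewrite exprn_gt0.
apply: (@le_trans _ _ (\int[P]_w ((e / 4 + K * eta / 2) +
    (2 * M / r ^+ 2 * enorm (X T w) ^+ 2 + c * sqdist (X T w) (Y w)))%:E)%E).
  apply: prob_integral_le.
  - by apply: measurableT_comp => //; apply: measurable_funB => //; exact: measurable_functional.
  - by apply: measurable_funD => //; apply: measurable_funD; apply: measurable_funM.
  - move=> w; rewrite normr_ge0 /= -/(Y w); set y := X T w; set z := Y w.
    apply: le_trans (ler_distD (inf_conv phi K y) _ _) _.
    have a1 : `|phi y - inf_conv phi K y| <= e / 4 + 2 * M / r ^+ 2 * enorm y ^+ 2.
      have q0 : 0 <= 2 * M / r ^+ 2 * enorm y ^+ 2.
        by rewrite mulr_ge0 ?sqr_ge0 // divr_ge0 ?mulr_ge0 // ltW.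
      have [yr|ry] := leP (enorm y) r; first by have := HK K K0K y yr; lra.
      have : 2 * M <= 2 * M / r ^+ 2 * enorm y ^+ 2.
        rewrite mulrAC ler_pdivlMr // ler_wpM2l ?mulr_ge0 //.
        by rewrite ler_pXn2r ?nnegrE ?enorm_ge0 // ltW.
      have := phiM y; have := inf_conv_bound phiM K_0 y; rewrite !ler_norml.
      move: q0; move: (2 * M / _ * _) (phi y) (inf_conv phi K y) => q p v q0 /andP[? ?] /andP[? ?] h.
      by apply/andP; split; lra.
    have a2 : `|inf_conv phi K y - inf_conv phi K z| <= K * eta / 2 + c * sqdist y z.
      apply: le_trans (KL y z) _; rewrite /sqdist /c; move: (enorm (y - z)) => u.
      have -> : K * eta / 2 + K / (2 * eta) * u ^+ 2 = K * u + K / (2 * eta) * (u - eta) ^+ 2.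
        by field; exact: lt0r_neq0.
      by rewrite lerDl mulr_ge0 ?sqr_ge0.
    lra.
rewrite prob_integralD //; first last.
- by move=> w; rewrite addr_ge0 // mulr_ge0 ?sqr_ge0 // divr_ge0 ?mulr_ge0 // ltW.
- by move=> w; exact: addr_ge0 (divr_ge0 (ltW e0) (ler0n _ 4)) (divr_ge0 (mulr_ge0 K_0 (ltW eta0)) (ler0n _ 2)).
- by apply: measurable_funD; apply: measurable_funM.
rewrite prob_integral_cst prob_integralD; [|by apply: measurable_funM|by apply: measurable_funM| |];
  [|by move=> w; rewrite mulr_ge0 ?sqr_ge0 // divr_ge0 ?mulr_ge0 // ltW|by move=> w; rewrite mulr_ge0 ?sqr_ge0].
rewrite !prob_integralZ //; [|by move=> w; exact: sqr_ge0|by rewrite divr_ge0 ?mulr_ge0 // ltW|by move=> w; exact: sqr_ge0].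
apply: (@le_trans _ _ ((e / 4 + K * eta / 2)%:E + ((2 * M / r ^+ 2)%:E * C%:E +
    c%:E * (K1 / n%:R + K2 / rho ^+ 2)%:E))%E).
  apply: leeD => //; apply: leeD; apply: lee_wpmul2l; rewrite ?lee_fin //.
  - by rewrite divr_ge0 ?mulr_ge0 // ltW.
  - exact: HC.
  - exact: H.
rewrite -!EFinM -!EFinD lee_fin.
have : K * eta / 2 <= e / 4.
  rewrite /eta; have -> : K * (e / (2 * (K + 1))) / 2 = e / 4 * (K / (K + 1)).
    by field; rewrite lt0r_neq0 // ltr_wpDl.
  rewrite ler_piMr ?divr_ge0 ?(ltW e0) // ler_pdivrMr ?mul1r ?lerDl // ltr_wpDl //.
lra.
Qed.

End functional.
End sde.

Lemma lip_expectation_upper (xi xi' : Om -> R) (lam c : R) : 0 < lam -> Lip T xi -> Lip T xi' ->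
  (forall w, xi w <= lam * xi' w + c) ->
  lip_expectation G xi <= lam * lip_expectation G xi' + c.
Proof.
move=> lam0 lx lx' H; rewrite -lee_fin rep.2 //; apply: ub_ereal_sup => _ [P PPP <-].
have i1 := Lip_integrable P (lexx T) lx; have i2 := Lip_integrable P (lexx T) lx'.
have ic : intT P (fun=> c).
  by apply: (@integrable_bounded P (fun=> c) `|c|).
have iZ : intT P (fun w => lam * xi' w) by apply: (integrableZl _ lam i2).
have iD : intT P (fun w => lam * xi' w + c) by apply: (integrableD _ iZ ic).
rewrite Rintegral_EFin // lee_fin.
apply: (@le_trans _ _ (\int[P]_w (lam * xi' w + c))); first exact: le_Rintegral.
rewrite RintegralD // RintegralZl // Rintegral_prob_cst lerD2r ler_pM2l //.
by rewrite -lee_fin -Rintegral_EFin // rep.2 //; apply: ereal_sup_ubound; exists P.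
Qed.

(** * The Harnack inequality of the Euler scheme *)

Section harnack.
Local Notation Sop := (Sop Gamma).

Lemma Gfun_gram_le (c : R) (N : 'M[R]_d) : 0 <= c ->
  Gfun Gamma (2 * c *: (N^T *m N)) <= c * (UG ^+ 2 * enorm N ^+ 2).
Proof.
move=> c0; apply: (Gfun_le ellG) => g Gg.
rewrite -scalemxAl mxtraceZ (_ : 2^-1 * (2 * c * _) = c * \tr (N^T *m N *m g)); last by field.
rewrite ler_wpM2l //; have [_ _ /(_ g Gg)[_ _ gU]] := ellG.
rewrite -mulmxA mxtrace_mulC /mxtrace enorm_sqr mulr_sumr; apply: ler_sum => k _.
have := gU (row k N)^T; rewrite enorm_cV quadE exchange_big => H.
rewrite !mxE; apply: (le_trans _ (le_trans H _)); apply: le_of_eq.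
  by apply: eq_bigr => j _; rewrite !mxE mulr_suml; apply: eq_bigr => i _; rewrite !mxE.
by congr (_ * _); apply: eq_bigr => j _; rewrite !mxE.
Qed.

Lemma hasC12_affine (a : R) (u : V) :
  hasC12 (fun p : E => a + \sum_j u j 0 * p.2 j 0) (fun=> 0) (fun i _ => u i 0) (fun _ _ _ => 0).
Proof.
have h := hasC12D (hasC12_cst a) (hasC12_sum (index_enum 'I_d) (fun j => hasC12Z (u j 0) (hasC12_coord j))).
apply: (hasC12_ext h) => //.
- by move=> p; rewrite big1 ?addr0 // => j _; rewrite mulr0.
- move=> i p; rewrite add0r (bigD1 i) //= eqxx mulr1 big1 ?addr0 // => j ji.
  by rewrite eq_sym (negPf ji) mulr0.
- by move=> i j p; rewrite big1 ?addr0 // => k _; rewrite mulr0.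
Qed.

(* Test function [c |A + N z|^2 + c UG^2 |N|^2 (t - s) + e]. *)
Lemma Sop_le_affine (r t c e : R) (A : V) (N : 'M[R]_d) (f g : V -> R) : r <= t ->
  bounded_lipschitz f -> bounded_lipschitz g -> 0 <= c -> 0 <= e ->
  (forall z, f z <= g z + (c * enorm (A + N *m z) ^+ 2 + e)) ->
  Sop r t f 0 <= Sop r t g 0 +
    (c * enorm A ^+ 2 + c * (UG ^+ 2 * enorm N ^+ 2) * (t - r) + e).
Proof.
move=> rt bf bg c0 e0 fg; pose k := c * (UG ^+ 2 * enorm N ^+ 2).
have k0 : 0 <= k by rewrite mulr_ge0 // mulr_ge0 // sqr_ge0.
pose l i (p : E) := A i 0 + \sum_j (row i N)^T j 0 * p.2 j 0.
have lE i p : l i p = (A + N *m p.2) i 0.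
  by rewrite /l !mxE; congr (_ + _); apply: eq_bigr => j _; rewrite !mxE.
have hl i := hasC12_affine (A i 0) (row i N)^T.
have hq : hasC12 (fun p : E => (k * t + e + - k * p.1) + c * \sum_i l i p * l i p) (fun=> - k)
    (fun i p => c * \sum_m 2 * (l m p * N m i)) (fun i j _ => 2 * c * \sum_m N m i * N m j).
  have h := hasC12D (hasC12D (hasC12_cst (k * t + e)) (hasC12Z (- k) hasC12_fst))
    (hasC12Z c (hasC12_sum (index_enum 'I_d) (fun i => hasC12M (hl i) (hl i)))).
  apply: (hasC12_ext h) => //.
  - by move=> p; rewrite big1 => [|i _]; [ring|rewrite mulr0 addr0].
  - move=> i p; rewrite mulr0 !add0r; congr (_ * _); apply: eq_bigr => m _.
    by rewrite /= !mxE -/(l m p); ring.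
  - move=> i j p /=; transitivity (c * \sum_m (2 * (N m i * N m j))); last by rewrite -mulr_sumr; ring.
    by rewrite mulr0 !add0r; congr (_ * _); apply: eq_bigr => m _; rewrite !mxE; ring.
have qE (p : E) : (k * t + e + - k * p.1) + c * \sum_i l i p * l i p =
    c * enorm (A + N *m p.2) ^+ 2 + e + k * (t - p.1).
  rewrite enorm_cV (eq_bigr (fun i => l i p ^+ 2)); last by move=> i _; rewrite expr2.
  under [in RHS]eq_bigr do rewrite -lE.
  ring.
have := Sop_le_quad ellG d_gt0 0 rt bf bg hq (C := 0).
rewrite (qE (r, 0)) mulmx0 addr0 => H.
have -> : c * enorm A ^+ 2 + k * (t - r) + e = c * enorm A ^+ 2 + e + k * (t - r) by ring.
apply: H.
- move=> p _; rewrite addrC subr_le0.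
  rewrite (_ : hess _ p = 2 * c *: (N^T *m N)); first exact: Gfun_gram_le.
  apply/matrixP => i j; rewrite !mxE; congr (_ * _); apply: eq_bigr => m _.
  by rewrite !mxE.
- move=> p /andP[_ pt]; rewrite qE; apply: addr_ge0; last by rewrite mulr_ge0 // subr_ge0.
  by rewrite addr_ge0 // mulr_ge0 // sqr_ge0.
- by move=> z; rewrite (qE (t, z)) /= subrr mulr0 addr0; exact: fg.
Qed.

Context (sigma : V -> 'M[R]_d) (b : V -> V) (Ls Lb lsig : R) (sigma_lip : lipschitz_with Ls sigma)
  (b_lip : lipschitz_with Lb b) (lsig_gt0 : 0 < lsig)
  (sigma_ge : forall x (v : V), lsig * enorm v <= enorm (sigma x *m v)).

Lemma lG_gt0 : 0 < lG. Proof. by case: ellG. Qed.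

(** The lower bound on [sigma x] makes it injective, hence invertible, and at the same time bounds
    the inverse. *)
Lemma sigma_solve x v : exists2 a : V, sigma x *m a = v & enorm a <= enorm v / lsig.
Proof.
have u : sigma x \in unitmx.
  rewrite -unitmx_tr -row_free_unit -kermx_eq0; set K := kermx _.
  have K0 i : row i K = 0.
    have : sigma x *m (row i K)^T = 0.
      by rewrite -[sigma x]trmxK -trmx_mul -row_mul mulmx_ker row0 trmx0.
    move=> h; have := sigma_ge x (row i K)^T; rewrite h enorm0 pmulr_rle0 // => le0.
    by apply: trmx_inj; rewrite trmx0; apply: enorm_eq0; apply/le_anti; rewrite le0 enorm_ge0.
  by apply/eqP/row_matrixP => i; rewrite K0 row0.
exists (invmx (sigma x) *m v); first by rewrite mulKVmx.
by rewrite ler_pdivlMr // mulrC; apply: le_trans (sigma_ge x _) _; rewrite mulKVmx.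
Qed.

Lemma bounded_lipschitz_comp (g : V -> R) (F : V -> V) K : bounded_lipschitz g ->
  (forall y z, enorm (F y - F z) <= K * enorm (y - z)) -> bounded_lipschitz (fun z => g (F z)).
Proof.
move=> [[M gM] [L gL]] FK; split; first by exists M.
exists (`|L| * K) => y z; apply: le_trans (gL _ _) _; rewrite -mulrA.
apply: le_trans (ler_wpM2r (enorm_ge0 _) (ler_norm L)) _.
by rewrite ler_wpM2l.
Qed.

Lemma truncv_lip rho (y z : V) : 0 <= rho -> enorm (truncv rho y - truncv rho z) <= enorm (y - z).
Proof.
move=> r0; rewrite -(ler_pXn2r (ltn0Sn 1)) ?nnegrE ?enorm_ge0 // !enorm_cV.
apply: ler_sum => i _; rewrite !mxE -(real_normK (num_real (y i 0 - z i 0))).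
rewrite -(real_normK (num_real (_ - trunc _ _))) ler_pXn2r ?nnegrE ?normr_ge0 //.
exact: trunc_lip.
Qed.

Lemma euler_step_lip h rho x y z : 0 <= rho ->
  enorm (euler_step sigma b h rho x y - euler_step sigma b h rho x z) <=
  enorm (sigma x) * enorm (y - z).
Proof.
move=> r0; rewrite /euler_step opprD addrACA subrr add0r -mulmxBr.
apply: le_trans (enorm_mulmx _ _) _; rewrite ler_wpM2l ?enorm_ge0 //; exact: truncv_lip.
Qed.

Lemma enorm_truncv (rho : R) (z : V) : 0 <= rho -> enorm (truncv rho z) <= d%:R * rho.
Proof.
move=> r0; apply: le_trans (enorm_cV_le_sum _) _.
apply: (@le_trans _ _ (\sum_(i < d) rho)); last by rewrite sum_ord_const.
by apply: ler_sum => i _; rewrite mxE trunc_bound.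
Qed.

Lemma euler_step_lip_start h rho x y z : 0 <= h -> 0 <= rho ->
  enorm (euler_step sigma b h rho x z - euler_step sigma b h rho y z) <=
  (1 + h * Lb + Ls * (d%:R * rho)) * enorm (x - y).
Proof.
move=> h0 r0.
have -> : euler_step sigma b h rho x z - euler_step sigma b h rho y z =
    (x - y) + h *: (b x - b y) + (sigma x - sigma y) *m truncv rho z.
  by rewrite /euler_step scalerBr mulmxBl !opprD [LHS]addrACA; congr (_ + _); rewrite addrACA.
apply: le_trans (enormD _ _) _; rewrite [leRHS]mulrDl; apply: lerD.
  apply: le_trans (enormD _ _) _; rewrite [leRHS]mulrDl mul1r lerD2l.
  by rewrite enormZ ger0_norm // -mulrA ler_wpM2l.
apply: le_trans (enorm_mulmx _ _) _; rewrite mulrAC; apply: ler_pM; rewrite ?enorm_ge0 //.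
exact: enorm_truncv.
Qed.

Section one_step.
Context (r t rho m : R) (W U : V -> R) (c e : R) (rt : r < t) (rho0 : 0 < rho) (c0 : 0 < c)
  (e0 : 0 <= e) (bW : bounded_lipschitz W) (bU : bounded_lipschitz U) (Wm : forall x, `|W x| <= m)
  (U_ge : forall x, expR (- m) <= U x) (U_le : forall x, U x <= expR m)
  (WU : forall x y, W x <= ln (U y) + c * enorm (x - y) ^+ 2 + e).
Let h := t - r.
(** Steering with drift [a] costs [enorm a ^+ 2 / (2 * lG ^+ 2)] per unit of time, and solving for
    the drift that produces a given displacement costs a factor [lsig^-1] in norm; [kappa] combines
    the two. *)
Let kappa : R := (2 * lsig ^+ 2 * lG ^+ 2)^-1.

Let h0 : 0 < h. Proof. by rewrite subr_gt0. Qed.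
Let kappa0 : 0 < kappa.
Proof. by rewrite invr_gt0 mulr_gt0 ?exprn_gt0 ?lG_gt0 // mulr_gt0 // exprn_gt0. Qed.

Let lin (x z : V) : V := x + h *: b x + sigma x *m z.

Let bl_lin g x : bounded_lipschitz g -> bounded_lipschitz (fun z => g (lin x z)).
Proof.
move=> bg; apply: (bounded_lipschitz_comp (F := lin x) (K := enorm (sigma x)) bg) => y z.
rewrite /lin opprD addrACA subrr add0r -mulmxBr; exact: enorm_mulmx.
Qed.

Let bl_step g x : bounded_lipschitz g -> bounded_lipschitz (fun z => g (euler_step sigma b h rho x z)).
Proof.
move=> bg; apply: (bounded_lipschitz_comp (F := euler_step sigma b h rho x) (K := enorm (sigma x)) bg).
by move=> y z; exact: euler_step_lip (ltW rho0).
Qed.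

(** Clamping acts only where some coordinate exceeds [rho], and there the difference is at most
    [2 * M]. The argument [0 + 1%:M *m z] has the form expected by [Sop_le_affine]. *)
Let clamp_le (g : V -> R) x M z : (forall y, `|g y| <= M) ->
  `|g (euler_step sigma b h rho x z) - g (lin x z)| <= 2 * M / rho ^+ 2 * enorm (0 + 1%:M *m z) ^+ 2.
Proof.
move=> gM; rewrite add0r mul1mx.
have M0 : 0 <= M by exact: le_trans (normr_ge0 _) (gM 0).
have r2 : 0 < rho ^+ 2 by rewrite exprn_gt0.
have [zr|zr] := pselect (forall i, `|z i 0| <= rho).
  have -> : euler_step sigma b h rho x z = lin x z.
    rewrite /euler_step /lin; congr (_ + _ *m _); apply/matrixP => i j.
    by rewrite mxE ord1 trunc_id.
  by rewrite subrr normr0 mulr_ge0 ?sqr_ge0 // divr_ge0 ?mulr_ge0 // ltW.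
have [i zi] : exists i, rho < `|z i 0|.
  by apply: contrapT => H; apply: zr => i; rewrite leNgt; apply/negP => zi; apply: H; exists i.
apply: (@le_trans _ _ (2 * M)).
  apply: le_trans (ler_normB _ _) _; rewrite mulrDl mul1r; exact: lerD.
rewrite mulrAC ler_pdivlMr // ler_wpM2l ?mulr_ge0 //.
rewrite ler_pXn2r ?nnegrE ?enorm_ge0 ?(ltW rho0) //.
exact: le_trans (ltW zi) (enorm_coord z i 0).
Qed.

Let clampE : R := d%:R * UG ^+ 2.

Let Sop_clamp (g : V -> R) x (M : R) : bounded_lipschitz g -> (forall y, `|g y| <= M) ->
  Sop r t (fun z => g (euler_step sigma b h rho x z)) 0 <=
    Sop r t (fun z => g (lin x z)) 0 + 2 * M / rho ^+ 2 * clampE * h /\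
  Sop r t (fun z => g (lin x z)) 0 <=
    Sop r t (fun z => g (euler_step sigma b h rho x z)) 0 + 2 * M / rho ^+ 2 * clampE * h.
Proof.
move=> bg gM; have M0 : 0 <= M by exact: le_trans (normr_ge0 _) (gM 0).
have q0 : 0 <= 2 * M / rho ^+ 2 by exact: divr_ge0 (mulr_ge0 (ler0n _ 2) M0) (sqr_ge0 rho).
have n1 : enorm (1%:M : 'M[R]_d) ^+ 2 = d%:R.
  rewrite enorm_sqr (eq_bigr (fun=> 1)) ?sumr_const ?card_ord // => i _.
  rewrite (bigD1 i) //= mxE eqxx expr1n big1 ?addr0 // => j ji.
  by rewrite mxE eq_sym (negPf ji) expr0n.
have H f1 f2 : bounded_lipschitz f1 -> bounded_lipschitz f2 ->
    (forall z, f1 z <= f2 z + 2 * M / rho ^+ 2 * enorm (0 + 1%:M *m z) ^+ 2) ->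
    Sop r t f1 0 <= Sop r t f2 0 + 2 * M / rho ^+ 2 * clampE * h.
  move=> b1 b2 f12; have := Sop_le_affine (ltW rt) b1 b2 q0 (lexx 0).
  move=> /(_ 0 1%:M); rewrite enorm0 n1 expr0n mulr0 add0r addr0 /clampE (mulrC d%:R); apply => z.
  by rewrite addr0.
by split; (apply: H; [exact: bl_step || exact: bl_lin|exact: bl_step || exact: bl_lin|move=> z]);
  have := clamp_le x z gM; rewrite ler_norml => /andP[h1 h2]; lra.
Qed.

(** [2 * m] is the clamping error for [W]. For [U], of size [expR m], the logarithm divides the
    error by a value at least [expR (- m)], which gives [expR (2 * m)]. *)
Definition harnack_error : R := (2 * m + 2 * expR (2 * m)) * clampE.

(** [c * kappa / (kappa + c * h)] is the minimum over [al] of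
    [kappa * al ^+ 2 / h + c * (1 - al) ^+ 2]: a fraction [al] of the gap is closed at the price
    [kappa], the rest is kept at the price [c]. The last summand stems from the difference of the
    diffusion matrices. *)
Definition harnack_coef : R :=
  (1 + h * Lb) ^+ 2 * (c * kappa / (kappa + c * h)) + c * (UG ^+ 2 * Ls ^+ 2) * h.

(** The step is unclamped first, because the drift acts as a translation of the increment [z], which
    clamping would not respect. With [sigma y *m a0 = al *: D] the two positions then differ by
    [(1 - al) *: D] plus the noise [N *m z], to which [Sop_le_affine] applies. *)
Lemma one_step_harnack x y :
  Sop r t (fun z => W (euler_step sigma b h rho x z)) 0 <=
  ln (Sop r t (fun z => U (euler_step sigma b h rho y z)) 0) +
    harnack_coef * enorm (x - y) ^+ 2 + (e + h * harnack_error / rho ^+ 2).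
Proof.
pose D := x - y + h *: (b x - b y).
pose al := c * h / (kappa + c * h).
have [a0 sa an] := sigma_solve y (al *: D).
pose a := h^-1 *: a0.
have ha : h *: a = a0 by rewrite scalerA mulfV ?scale1r // gt_eqF.
pose A := (1 - al) *: D; pose N := sigma x - sigma y.
pose F z := U (lin y z); pose f z := ln (F z).
have F_ge z : expR (- m) <= F z by exact: U_ge.
have bF : bounded_lipschitz F by exact: bl_lin.
have bf : bounded_lipschitz f.
  have em0 := expR_gt0 (- m); have [_ [K FK]] := bF; split; last first.
    exists (K / expR (- m)) => u v; apply: le_trans (ln_dist em0 (F_ge u) (F_ge v)) _.
    by rewrite mulrAC ler_wpM2r ?invr_ge0 ?expR_ge0.
  exists m => u; rewrite /f ler_norml; apply/andP; split.
    by rewrite -[- m]expRK ler_ln ?posrE ?F_ge // (lt_le_trans em0).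
  by rewrite -[m]expRK ler_ln ?posrE ?expR_gt0 ?U_le // (lt_le_trans em0).
have s1 := (Sop_clamp x bW Wm).1.
have s2 : Sop r t (fun z => W (lin x z)) 0 <= Sop r t (fun z => f (z + h *: a)) 0 +
    (c * enorm A ^+ 2 + c * (UG ^+ 2 * enorm N ^+ 2) * h + e).
  apply: (Sop_le_affine (ltW rt) (bl_lin x bW) (bounded_lipschitz_shift (h *: a) bf) (ltW c0) e0) => z.
  rewrite addrA; apply: le_trans (WU (lin x z) (lin y (z + h *: a))) _.
  have -> : lin x z - lin y (z + h *: a) = A + N *m z; last by [].
  rewrite ha /lin mulmxDr sa /A /N /D mulmxBl.
  apply/matrixP => i j; rewrite !mxE; move: (\sum_k _) (\sum_k _) => u v.
  ring.
have s3 : Sop r t (fun z => f (z + h *: a)) 0 <=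
    ln (Sop r t F 0) + h * (enorm a ^+ 2 / (2 * lG ^+ 2)).
  rewrite (Sop_shift ellG d_gt0 0 (h *: a) (ltW rt) bf).
  by apply: (Sop_log ellG d_gt0 0 a (ltW rt) bf bF (expR_gt0 (- m)) F_ge).
have em1 : expR (- m) * expR m = 1 by rewrite -expRD addNr expR0.
have s4 : ln (Sop r t F 0) <= ln (Sop r t (fun z => U (euler_step sigma b h rho y z)) 0) +
    2 * expR (2 * m) / rho ^+ 2 * clampE * h.
  have Um z : `|U z| <= expR m by rewrite ger0_norm // (le_trans (expR_ge0 (- m)) (U_ge z)).
  have := (Sop_clamp y bU Um).2; set u := Sop r t _ 0; set v := Sop r t _ 0 => uv.
  have vge : expR (- m) <= v.
    rewrite /v -(Sop_cst ellG d_gt0 (expR (- m)) 0 (ltW rt)) -[leRHS]addr0.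
    apply: (Sop_le ellG d_gt0 0 (ltW rt)) => //; first exact: bounded_lipschitz_cst.
      exact: bl_step.
    by move=> z; rewrite addr0.
  have uge : expR (- m) <= u.
    rewrite /u -(Sop_cst ellG d_gt0 (expR (- m)) 0 (ltW rt)) -[leRHS]addr0.
    apply: (Sop_le ellG d_gt0 0 (ltW rt)) => //; first exact: bounded_lipschitz_cst.
    by move=> z; rewrite addr0; exact: F_ge.
  have v0 : 0 < v by exact: lt_le_trans (expR_gt0 _) vge.
  have u0 : 0 < u by exact: lt_le_trans (expR_gt0 _) uge.
  set q := _ * clampE * h in uv.
  have q0 : 0 <= q.
    have cE0 : 0 <= clampE by exact: mulr_ge0 (ler0n _ d) (sqr_ge0 UG).
    exact: mulr_ge0 (mulr_ge0 (divr_ge0 (mulr_ge0 (ler0n _ 2) (expR_ge0 m)) (sqr_ge0 rho)) cE0) (ltW h0).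
  apply: (@le_trans _ _ (ln (v + q))).
    by rewrite ler_ln ?posrE // ltr_wpDr.
  have -> : v + q = v * (1 + q / v) by field; exact: lt0r_neq0.
  have qv0 : 0 <= q / v by rewrite divr_ge0 // ltW.
  rewrite lnM ?posrE // ?ltr_pwDl // lerD2l.
  apply: le_trans (le_ln1Dx _) _; first by apply: lt_le_trans qv0; rewrite ltrN10.
  rewrite ler_pdivrMr //.
  have -> : 2 * expR (2 * m) / rho ^+ 2 * clampE * h = q * expR m.
    rewrite /q (_ : 2 * m = m + m); last by ring.
    by rewrite expRD; ring.
  rewrite -mulrA ler_peMr // mulrC -em1 ler_wpM2r ?expR_ge0 //.
have Dle : enorm D <= (1 + h * Lb) * enorm (x - y).
  apply: le_trans (enormD _ _) _; rewrite mulrDl mul1r lerD2l enormZ gtr0_norm // -mulrA.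
  by rewrite ler_wpM2l // ltW.
have D2 : enorm D ^+ 2 <= (1 + h * Lb) ^+ 2 * enorm (x - y) ^+ 2.
  rewrite -exprMn ler_pXn2r ?nnegrE ?enorm_ge0 //; exact: le_trans (enorm_ge0 _) Dle.
have Nle : enorm N <= Ls * enorm (x - y) := sigma_lip x y.
have N2 : enorm N ^+ 2 <= Ls ^+ 2 * enorm (x - y) ^+ 2.
  rewrite -exprMn ler_pXn2r ?nnegrE ?enorm_ge0 //; exact: le_trans (enorm_ge0 _) Nle.
have kc : 0 < kappa + c * h by rewrite ltr_wpDr // mulr_ge0 // ltW.
have al0 : 0 <= al by rewrite divr_ge0 ?mulr_ge0 // ltW.
have a2 : h * (enorm a ^+ 2 / (2 * lG ^+ 2)) <= kappa * al ^+ 2 / h * enorm D ^+ 2.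
  have l0 := lG_gt0.
  have an2 : enorm a0 ^+ 2 <= (al * enorm D / lsig) ^+ 2.
    have an' : enorm a0 <= al * enorm D / lsig by move: an; rewrite enormZ ger0_norm.
    rewrite ler_pXn2r ?nnegrE ?enorm_ge0 //; exact: le_trans (enorm_ge0 _) an'.
  rewrite /a enormZ gtr0_norm ?invr_gt0 //.
  have -> : h * ((h^-1 * enorm a0) ^+ 2 / (2 * lG ^+ 2)) = enorm a0 ^+ 2 * (2 * lG ^+ 2 * h)^-1.
    by field; rewrite !lt0r_neq0.
  have -> : kappa * al ^+ 2 / h * enorm D ^+ 2 = (al * enorm D / lsig) ^+ 2 * (2 * lG ^+ 2 * h)^-1.
    by rewrite /kappa; field; rewrite !lt0r_neq0.
  by rewrite ler_wpM2r // invr_ge0 !mulr_ge0 ?sqr_ge0 // ltW.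
have Aal : enorm A ^+ 2 = (1 - al) ^+ 2 * enorm D ^+ 2.
  by rewrite /A enormZ exprMn real_normK ?num_real.
have opt : kappa * al ^+ 2 / h + c * (1 - al) ^+ 2 = c * kappa / (kappa + c * h).
  by rewrite /al; field; rewrite !lt0r_neq0.
have main : c * enorm A ^+ 2 + c * (UG ^+ 2 * enorm N ^+ 2) * h + h * (enorm a ^+ 2 / (2 * lG ^+ 2)) <=
    harnack_coef * enorm (x - y) ^+ 2.
  rewrite /harnack_coef [leRHS]mulrDl Aal.
  apply: (@le_trans _ _ (c * kappa / (kappa + c * h) * enorm D ^+ 2 +
     c * (UG ^+ 2 * enorm N ^+ 2) * h)).
    apply: (@le_trans _ _ (c * ((1 - al) ^+ 2 * enorm D ^+ 2) + c * (UG ^+ 2 * enorm N ^+ 2) * h +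
      kappa * al ^+ 2 / h * enorm D ^+ 2)); first by rewrite lerD2l.
    by rewrite -opt; apply: le_of_eq; ring.
  apply: lerD.
    rewrite [leRHS](_ : _ = c * kappa / (kappa + c * h) * ((1 + h * Lb) ^+ 2 * enorm (x - y) ^+ 2));
      last by ring.
    apply: ler_wpM2l => //.
    exact: divr_ge0 (mulr_ge0 (ltW c0) (ltW kappa0)) (ltW kc).
  rewrite [leLHS](_ : _ = c * UG ^+ 2 * h * enorm N ^+ 2); last by ring.
  rewrite [leRHS](_ : _ = c * UG ^+ 2 * h * (Ls ^+ 2 * enorm (x - y) ^+ 2)); last by ring.
  apply: ler_wpM2l => //; exact: mulr_ge0 (mulr_ge0 (ltW c0) (sqr_ge0 UG)) (ltW h0).
have -> : h * harnack_error / rho ^+ 2 = 2 * m / rho ^+ 2 * clampE * h +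
    2 * expR (2 * m) / rho ^+ 2 * clampE * h by rewrite /harnack_error; ring.
move: s1 s2 s3 s4 main; rewrite -/F -/f.
move: (Sop r t _ 0) (Sop r t _ 0) (Sop r t _ 0) (ln _) (ln _).
move: (2 * m / _ * _ * _) (2 * expR _ / _ * _ * _) (c * enorm A ^+ 2) (c * (UG ^+ 2 * _) * h).
move: (h * (enorm a ^+ 2 / _)) (harnack_coef * _) => p1 p2 p3 p4 p5 p6 q1 q2 q3 q4 q5 *.
lra.
Qed.

End one_step.

(** * Backward values of the scheme *)

Section backward.
Context (h rho : R) (h0 : 0 < h) (rho0 : 0 < rho).

(** The past enters only through the current position [x]; the G-heat equation is solved in the
    increment, from 0, which translation invariance permits. *)
Fixpoint euler_value (F : V -> R) (j k : nat) (x : V) : R :=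
  if j is j'.+1 then
    Sop (k%:R * h) (k.+1%:R * h) (fun z => euler_value F j' k.+1 (euler_step sigma b h rho x z)) 0
  else F x.

Let tk k : k%:R * h <= k.+1%:R * h.
Proof. by rewrite ler_pM2r // ler_nat. Qed.

Lemma bounded_lipschitz_step g x : bounded_lipschitz g ->
  bounded_lipschitz (fun z => g (euler_step sigma b h rho x z)).
Proof.
move=> bg; apply: (bounded_lipschitz_comp (F := euler_step sigma b h rho x) (K := enorm (sigma x)) bg).
by move=> y z; exact: euler_step_lip (ltW rho0).
Qed.

Lemma euler_value_bl F j k : bounded_lipschitz F -> bounded_lipschitz (euler_value F j k).
Proof.
move=> bF; elim: j k => [//|j IH] k /=.
have bg := IH k.+1; have [[M gM] [L0 gL0]] := bg.
have [L Lge0 gL] := lipschitz_ge0 gL0.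
split.
  exists M => x; apply: (Sop_bound ellG d_gt0 0 (tk k)); first exact: bounded_lipschitz_step.
  by move=> z; exact: gM.
exists (L * (1 + h * Lb + Ls * (d%:R * rho))) => x y.
have H u v : Sop (k%:R * h) (k.+1%:R * h) (fun z => euler_value F j k.+1 (euler_step sigma b h rho u z)) 0 <=
    Sop (k%:R * h) (k.+1%:R * h) (fun z => euler_value F j k.+1 (euler_step sigma b h rho v z)) 0 +
    L * (1 + h * Lb + Ls * (d%:R * rho)) * enorm (u - v).
  apply: (Sop_le ellG d_gt0 0 (tk k)); [exact: bounded_lipschitz_step|exact: bounded_lipschitz_step|].
  move=> z; rewrite -lerBlDl; apply: le_trans (ler_norm _) _; apply: le_trans (gL _ _) _.
  rewrite -mulrA ler_wpM2l //; exact: euler_step_lip_start (ltW h0) (ltW rho0).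
rewrite ler_norml; apply/andP; split; last by rewrite lerBlDl; exact: H.
by have := H y x; rewrite enorm_distC; lra.
Qed.

Lemma euler_value_ge F j k c x : bounded_lipschitz F -> (forall y, c <= F y) -> c <= euler_value F j k x.
Proof.
move=> bF cF; elim: j k x => [//|j IH] k x /=.
rewrite -(Sop_cst ellG d_gt0 c 0 (tk k)) -[leRHS]addr0.
apply: (Sop_le ellG d_gt0 0 (tk k)); first exact: bounded_lipschitz_cst.
  by apply: bounded_lipschitz_step; exact: euler_value_bl.
by move=> z; rewrite addr0; exact: IH.
Qed.

Lemma euler_value_le F j k c x : bounded_lipschitz F -> (forall y, F y <= c) -> euler_value F j k x <= c.
Proof.
move=> bF cF; elim: j k x => [//|j IH] k x /=.
rewrite -[leRHS](Sop_cst ellG d_gt0 c 0 (tk k)) -[leRHS]addr0.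
apply: (Sop_le ellG d_gt0 0 (tk k)); last by move=> z; rewrite addr0; exact: IH.
  by apply: bounded_lipschitz_step; exact: euler_value_bl.
exact: bounded_lipschitz_cst.
Qed.

Lemma euler_agree x k w w' : (forall r, 0 <= r <= k%:R * h -> w r = w' r) ->
  euler sigma b h rho x k w = euler sigma b h rho x k w'.
Proof.
elim: k => [//|k IH] ww /=; rewrite IH; last first.
  by move=> r /andP[r0 rk]; apply: ww; rewrite r0 (le_trans rk).
by rewrite !ww // ?lexx ?mulr_ge0 ?tk // ltW.
Qed.

(** [upd w 0 0] supplies the value at time 0, which the partition omits. [Sop_shift] passes from the
    position [y] of the driving path to its next increment. *)
Lemma BV_euler_value F x n k j w y : bounded_lipschitz F -> (k + j)%N = n ->
  upd w 0 0 (k%:R * h) = y ->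
  BV Gamma (fun w => F (euler sigma b h rho x n (upd w 0 0))) (k%:R * h)
    [seq m%:R * h | m <- iota k.+1 j] w y =
  euler_value F j k (euler sigma b h rho x k (upd w 0 0)).
Proof.
move=> bF; elim: j k w y => [|j IH] k w y kj wy /=; first by rewrite -kj addn0.
set e := euler _ _ _ _ _ k _.
pose g z := euler_value F j k.+1 (euler_step sigma b h rho e z).
have bg : bounded_lipschitz g by apply: bounded_lipschitz_step; exact: euler_value_bl.
rewrite -[X in _ = X]/(Sop (k%:R * h) (k.+1%:R * h) g 0).
rewrite -[X in _ = Sop _ _ _ X](subrr y) -(Sop_shift ellG d_gt0 y (- y) (tk k) bg).
congr (Sop _ _ _ _); apply/funext => y'.
have kS : k.+1%:R * h != 0 :> R by rewrite mulf_neq0 ?pnatr_eq0 // gt_eqF.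
rewrite (IH k.+1 (upd w (k.+1%:R * h) y') y'); [|by rewrite addSnnS|by rewrite /upd (negPf kS) eqxx].
have kk : (k%:R * h == k.+1%:R * h) = false.
  by apply: lt_eqF; rewrite ltr_pM2r // ltr_nat.
rewrite /g; congr (euler_value _ _ _ _); rewrite -[LHS]/(euler_step sigma b h rho _ _).
congr (euler_step _ _ _ _ _ _).
  apply: euler_agree => r /andP[_ rk]; rewrite /upd; case: eqP => // _; case: eqP => // rE.
  by move: rk; rewrite rE leNgt ltr_pM2r // ltr_nat ltnSn.
rewrite {1}/upd (negPf kS) /upd eqxx; congr (_ - _).
by rewrite -wy /upd; case: eqP => // _; rewrite kk.
Qed.

Lemma lip_expectation_euler F x n : n%:R * h = T -> bounded_lipschitz F ->
  lip_expectation G (fun w : Om => F (euler sigma b h rho x n w)) =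
  euler_value F n 0 x.
Proof.
move=> nT bF; have [[M FM] [K FK]] := bF.
have n0 : (0 < n)%N by rewrite lt0n; apply/negP => /eqP n0; move: (T_gt0); rewrite -nT n0 mul0r ltxx.
have cY : cylf (euler_grid h n) (fun w => F (euler sigma b h rho x n w)).
  by apply: cylf_comp FK => i; exact: (euler_cylf sigma_lip b_lip h x n i (ltW rho0)).
have cY0 := cylf_upd0 cY.
have -> : (fun w : wpath d T => F (euler sigma b h rho x n w)) =
    fun w : wpath d T => F (euler sigma b h rho x n (upd w 0 0)).
  apply/funext => w; congr F; congr (euler _ _ _ _ _ _ _); apply/funext => r.
  by rewrite /upd; case: eqP => // ->; rewrite wpath_start.
pose s := [seq m%:R * h | m <- iota 1 n].
have ps m k : path <%R (m%:R * h) [seq i%:R * h | i <- iota m.+1 k].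
  elim: k m => [//|k IH] m /=; rewrite IH andbT ltr_pM2r // ltr_nat //.
have ls m k : last (m%:R * h) [seq i%:R * h | i <- iota m.+1 k] = (m + k)%:R * h.
  by elim: k m => [|k IH] m /=; [rewrite addn0|rewrite IH addSnnS].
rewrite (lip_expectation_BV ellG d_gt0 T_gt0 cY0 (s := s)).
- have := @BV_euler_value F x n 0 n (fun=> 0) 0 bF erefl; rewrite mul0r /upd; apply.
  by rewrite eqxx.
- move=> r; rewrite mem_filter => /andP[r0 /mapP[m]]; rewrite mem_iota add0n => /andP[_ mn] rE.
  apply/mapP; exists m => //; rewrite mem_iota add1n mn andbT lt0n.
  by apply: contraNneq r0 => m0; rewrite rE m0 mul0r.
- by have := ps 0%N n; rewrite mul0r.
- by have := ls 0%N n; rewrite mul0r add0n nT.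
Qed.

End backward.

(** * The log-Harnack inequality over all steps *)

Section scheme_harnack.
Hypothesis Lb0 : 0 <= Lb.
Let kappa : R := (2 * lsig ^+ 2 * lG ^+ 2)^-1.
Let L : R := 2 * Lb + UG ^+ 2 * Ls ^+ 2.

Let kappa0 : 0 < kappa.
Proof.
by rewrite invr_gt0 mulr_gt0 ?exprn_gt0 ?lG_gt0 // mulr_gt0 // exprn_gt0.
Qed.

Definition mesh_rate (C : R) : R :=
  Lb ^+ 2 + UG ^+ 2 * Ls ^+ 2 * (C * expR (T * (L + 1)) / kappa).

Context (g : V -> R) (K M lam C rho : R) (n : nat) (gM : forall z, `|g z| <= M)
  (gK : forall y z, `|g y - g z| <= K * enorm (y - z)) (K0 : 0 <= K) (lam0 : 0 < lam)
  (lamM : lam * M <= 2 / 3) (C0 : 0 < C) (n0 : (0 < n)%N) (rho0 : 0 < rho).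
Let h : R := T / n%:R.
Context (mesh1 : h * mesh_rate C <= 1) (mesh2 : h * mesh_rate C * T + h * L <= 4^-1).
Let m := lam * M.

Let h0 : 0 < h. Proof. by rewrite divr_gt0 // ltr0n. Qed.
Let nh : n%:R * h = T. Proof. by rewrite mulrC divfK // pnatr_eq0 -lt0n. Qed.
Let L0 : 0 <= L.
Proof. by apply: addr_ge0; [rewrite mulr_ge0|exact: mulr_ge0 (sqr_ge0 _) (sqr_ge0 _)]. Qed.
Let rateE : mesh_rate C = Lb ^+ 2 + UG ^+ 2 * Ls ^+ 2 * (C * expR (n%:R * h * (L + 1)) / kappa).
Proof. by rewrite nh. Qed.
Let U20 : 0 <= UG ^+ 2 * Ls ^+ 2. Proof. exact: mulr_ge0 (sqr_ge0 _) (sqr_ge0 _). Qed.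

Local Notation p := (inv_coef h kappa L Lb (UG ^+ 2 * Ls ^+ 2) C n).
Let F1 z := lam * g z.
Let F2 z := expR (lam * g z).

Let F1m z : `|F1 z| <= m.
Proof. by rewrite /F1 normrM gtr0_norm // ler_wpM2l // ltW. Qed.

Let m0 : 0 <= m. Proof. exact: le_trans (normr_ge0 _) (F1m 0). Qed.

Let bF1 : bounded_lipschitz F1.
Proof.
split; first by exists m; exact: F1m.
exists (lam * K) => y z; rewrite /F1 -mulrBr normrM gtr0_norm // -mulrA.
by apply: ler_wpM2l; [exact: ltW|exact: gK].
Qed.

Let F2_ge z : expR (- m) <= F2 z.
Proof. by rewrite ler_expR; have := F1m z; rewrite ler_norml => /andP[]. Qed.

Let F2_le z : F2 z <= expR m.
Proof. by rewrite ler_expR; have := F1m z; rewrite ler_norml => /andP[]. Qed.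

Let expR_lip (s t : R) : s <= m -> t <= m -> `|expR s - expR t| <= expR m * `|s - t|.
Proof.
wlog st : s t / t <= s.
  by move=> H sm tm; have [|/ltW] := leP t s => ?; [|rewrite distrC (distrC s)]; exact: H.
move=> sm tm; rewrite !ger0_norm ?subr_ge0 ?ler_expR //.
apply: (@le_trans _ _ (expR s * (s - t))); last by rewrite ler_wpM2r ?subr_ge0 ?ler_expR.
have := ler_wpM2l (expR_ge0 s) (expR_ge1Dx (t - s)).
rewrite -expRD (_ : s + (t - s) = t); last by ring.
lra.
Qed.

Let bF2 : bounded_lipschitz F2.
Proof.
have Fm z : F1 z <= m by exact: le_trans (ler_norm _) (F1m z).
split; first by exists (expR m) => z; rewrite ger0_norm ?expR_ge0 ?F2_le.
have [_ [K1 HK1]] := bF1; exists (expR m * K1) => y z; rewrite -mulrA.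
by apply: le_trans (expR_lip (Fm y) (Fm z)) _; rewrite ler_wpM2l ?expR_ge0.
Qed.

Local Notation EV := (euler_value h rho).
Let err : R := h * harnack_error m / rho ^+ 2.
(** The ideal terminal coefficient would be infinite, since the final bound must not depend on the
    Lipschitz constant [K]. A finite [C] admits [K]-Lipschitz data at the cost [e0] in
    [lam * K * u <= C * u ^+ 2 + e0], and [e0] vanishes as [C] grows. *)
Let e0 : R := (lam * K) ^+ 2 / (4 * C).

Let err0 : 0 <= err.
Proof.
apply: divr_ge0; last exact: sqr_ge0.
apply: mulr_ge0; first exact: ltW.
apply: mulr_ge0; last exact: mulr_ge0 (ler0n _ _) (sqr_ge0 _).
by apply: addr_ge0; [exact: mulr_ge0|exact: mulr_ge0 (ler0n _ 2) (expR_ge0 _)].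
Qed.

Let e00 : 0 <= e0.
Proof. by apply: divr_ge0; [exact: sqr_ge0|rewrite mulr_ge0 // ltW]. Qed.

Let values j k x y : (j <= n)%N ->
  EV F1 j k x <= ln (EV F2 j k y) + (p j)^-1 * enorm (x - y) ^+ 2 + (e0 + j%:R * err).
Proof.
elim: j k x y => [|j IH] k x y jn.
  rewrite /= mul0r addr0 invrK /F2 expRK /F1 -addrA -lerBlDl -mulrBr.
  apply: (@le_trans _ _ (lam * (K * enorm (x - y)))).
    by rewrite ler_pM2l // (le_trans (ler_norm _)).
  rewrite /e0; move: (enorm _) => u.
  have -> : C * u ^+ 2 + (lam * K) ^+ 2 / (4 * C) = lam * (K * u) + C * (u - lam * K / (2 * C)) ^+ 2.
    by field; rewrite lt0r_neq0.
  by rewrite lerDl mulr_ge0 ?sqr_ge0 // ltW.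
have p0 := inv_coef_gt0 Lb n h0 kappa0 C0 U20 L0.
have tk : k%:R * h < k.+1%:R * h by rewrite ltr_pM2r // ltr_nat.
have hE : k.+1%:R * h - k%:R * h = h by rewrite -natr1; ring.
have c0 : 0 < (p j)^-1 by rewrite invr_gt0.
have ee0 : 0 <= e0 + j%:R * err by rewrite addr_ge0 // mulr_ge0.
have := one_step_harnack tk rho0 c0 ee0
  (euler_value_bl h0 rho0 j k.+1 bF1)
  (euler_value_bl h0 rho0 j k.+1 bF2) (m := m).
move=> /(_ _ _ _ (fun x y => IH k.+1 x y (ltnW jn)) x y); rewrite /harnack_coef !hE => H.
apply: (le_trans (H _ _ _)).
- move=> z; rewrite ler_norml; apply/andP; split.
    apply: (euler_value_ge h0 rho0 j k.+1 z bF1) => y'.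
    by have := F1m y'; rewrite ler_norml => /andP[].
  apply: (euler_value_le h0 rho0 j k.+1 z bF1) => y'.
  exact: le_trans (ler_norm _) (F1m y').
- by move=> z; exact: (euler_value_ge h0 rho0 j k.+1 z bF2 F2_ge).
- by move=> z; exact: (euler_value_le h0 rho0 j k.+1 z bF2 F2_le).
rewrite -!addrA lerD2l; apply: lerD; last by rewrite -/err lerD2l -natr1 mulrDl mul1r.
apply: ler_wpM2r; first exact: sqr_ge0.
by apply: inv_coef_step => //; rewrite -rateE.
Qed.

Local Notation xi0 := (exp_quotient L T).

Theorem scheme_harnack x y : 0 < xi0 ->
  lam * (lip_expectation G (fun w : Om => g (euler sigma b h rho x n w)) -
         lip_expectation G (fun w : Om => g (euler sigma b h rho y n w))) <=
  3 / 2 * m ^+ 2 + 4 / 3 * (kappa / xi0) * enorm (x - y) ^+ 2 +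
    (e0 + T * harnack_error m / rho ^+ 2).
Proof.
move=> xi00.
have E1 := lip_expectation_euler h0 rho0 x nh bF1.
have E2 := lip_expectation_euler h0 rho0 y nh bF2.
have lipE (F : V -> R) z : bounded_lipschitz F -> Lip T (fun w : Om => F (euler sigma b h rho z n w)).
  move=> [[N FN] [K' FK]].
  exact: (euler_functional_Lip sigma_lip b_lip z n0 (ltW rho0) FN FK).
have bg : bounded_lipschitz g by split; [exists M|exists K].
have h1 : lip_expectation G (fun w : Om => g (euler sigma b h rho x n w)) <= lam^-1 * EV F1 n 0 x.
  rewrite -E1 -[leRHS]addr0; apply: lip_expectation_upper; rewrite ?invr_gt0 //; [exact: lipE|exact: (lipE F1)|].
  by move=> w; rewrite addr0 /F1 mulKf // gt_eqF.
(* The exponential is linearized under the expectation: a pointwise bound by a positive multiple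
   plus a constant passes through [lip_expectation_upper]. *)
have h2 : EV F2 n 0 y <= lam * lip_expectation G (fun w : Om => g (euler sigma b h rho y n w)) +
    (1 + 3 / 2 * m ^+ 2).
  rewrite -E2; apply: lip_expectation_upper => //; [exact: (lipE F2)|exact: lipE|].
  move=> w; rewrite /F2; move: (euler _ _ _ _ _ _ _) => z.
  have Fz := F1m z; have le23 : F1 z <= 2 / 3 by exact: le_trans (ler_norm _) (le_trans Fz lamM).
  apply: le_trans (expR_le_quadratic le23) _; rewrite -/(F1 z).
  have : F1 z ^+ 2 <= m ^+ 2 by exact: sqr_le_norm.
  lra.
have h3 := values 0 x y (leqnn n).
have U0 : 0 < EV F2 n 0 y.
  apply: lt_le_trans (expR_gt0 (- m)) _.
  exact: (euler_value_ge h0 rho0 n 0 y bF2 F2_ge).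
have h4 : ln (EV F2 n 0 y) <= EV F2 n 0 y - 1.
  have := @le_ln1Dx R (EV F2 n 0 y - 1).
  rewrite (_ : 1 + (EV F2 n 0 y - 1) = EV F2 n 0 y); last by ring.
  by apply; move: U0; lra.
have h5 : (p n)^-1 <= 4 / 3 * (kappa / xi0).
  have p0 := inv_coef_gt0 Lb n h0 kappa0 C0 U20 L0 n.
  have := @inv_coef_final R h kappa L Lb _ C n h0 kappa0 C0 U20 L0.
  rewrite -rateE nh => /(_ mesh2) H.
  rewrite -[leLHS]div1r ler_pdivrMr //.
  have -> : 4 / 3 * (kappa / xi0) * p n = 4 / 3 * (kappa * p n) / xi0 by ring.
  rewrite ler_pdivlMr // mul1r; lra.
have h6 : (p n)^-1 * enorm (x - y) ^+ 2 <= 4 / 3 * (kappa / xi0) * enorm (x - y) ^+ 2.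
  by rewrite ler_wpM2r // sqr_ge0.
have h7 : n%:R * err = T * harnack_error m / rho ^+ 2 by rewrite /err -nh; ring.
rewrite h7 in h3.
have h8 : lam * lip_expectation G (fun w : Om => g (euler sigma b h rho x n w)) <= EV F1 n 0 x.
  by rewrite mulrC -ler_pdivlMr // [leRHS]mulrC.
rewrite mulrBr.
move: h2 h3 h4 h6 h8; move: (lip_expectation _ _) (lip_expectation _ _) => u v.
move: (EV F1 n 0 x) (EV F2 n 0 y) (ln _) (_ * enorm _ ^+ 2) (_ * enorm _ ^+ 2) (_ / rho ^+ 2) e0 (3 / 2 * _).
move=> q1 q2 q3 q4 q5 q6 q7 q8 *; lra.
Qed.

End scheme_harnack.

(** * Choice of the parameters and the gradient estimate *)

Section gradient_estimate.
Context (S : R) (sigma_le : forall x i j, `|sigma x i j| <= S) (X : V -> R -> Om -> V)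
  (HX : forall x, SDE_solution PP sigma b x (X x)) (phi : V -> R) (M : R) (cphi : continuous phi)
  (phiM : forall z, `|phi z| <= M) (M0 : 0 < M).

Let L : R := 2 * Lb + UG ^+ 2 * Ls ^+ 2.
Let xi0 : R := exp_quotient L T.
Let u x := Gexpectation G PP (fun w => phi (X x T w)).

Let Lb0 : 0 <= Lb.
Proof.
have := b_lip (basis_cv (Ordinal d_gt0)) 0; rewrite subr0 enorm_basis mulr1.
by apply: le_trans; exact: enorm_ge0.
Qed.

Let L0 : 0 <= L.
Proof. by apply: addr_ge0; [rewrite mulr_ge0|exact: mulr_ge0 (sqr_ge0 _) (sqr_ge0 _)]. Qed.

Let xi00 : 0 < xi0. Proof. exact: exp_quotient_gt0. Qed.

Let lG0 : 0 < lG. Proof. exact: lG_gt0. Qed.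

Definition gradient_rate : R := (lsig * lG * Num.sqrt xi0)^-1.

Let rate0 : 0 < gradient_rate.
Proof. by rewrite invr_gt0 mulr_gt0 ?sqrtr_gt0 // mulr_gt0. Qed.

Let rate2 : (2 * lsig ^+ 2 * lG ^+ 2)^-1 / xi0 = gradient_rate ^+ 2 / 2.
Proof.
rewrite /gradient_rate exprVn !exprMn sqr_sqrtr ?(ltW xi00) //.
by field; rewrite !lt0r_neq0.
Qed.

Let phi_approx x e : 0 < e -> exists2 xi, Lip T xi & L1_close e (fun w => phi (X x T w)) xi.
Proof.
move=> e0.
have [K0 K00 H] := euler_functional sigma_lip b_lip sigma_le (HX x) phiM cphi e0.
have [N /(_ (maxn N 1) (maxn N 1)%:R (leq_maxl _ _))[]] := H K0 (lexx _).
  by rewrite ler_nat leq_maxl.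
move=> n0 [r0 cl]; eexists; last exact: cl.
exact: (euler_functional_Lip sigma_lip b_lip x n0 (ltW r0) (inf_conv_bound phiM K00)
  (inf_conv_lip phiM K00)).
Qed.

Let one_sided x y : u x - u y <= 2 * M * (enorm (x - y) * gradient_rate).
Proof.
have [->|xy] := eqVneq x y; first by rewrite !subrr enorm0 mul0r mulr0.
set q := enorm (x - y) * gradient_rate.
have xy0 : 0 < enorm (x - y).
  rewrite lt0r enorm_ge0 andbT; apply: contra_neq xy => /enorm_eq0 h.
  by apply/eqP; rewrite -subr_eq0 h.
have q0 : 0 < q by rewrite mulr_gt0.
apply/ler_addgt0Pr => eta eta0; pose e := eta / 3; have e0 : 0 < e by rewrite divr_gt0.
have [Kx Kx0 HKx] := euler_functional sigma_lip b_lip sigma_le (HX x) phiM cphi e0.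
have [Ky Ky0 HKy] := euler_functional sigma_lip b_lip sigma_le (HX y) phiM cphi e0.
pose K := Num.max Kx Ky.
have Kx' : Kx <= K by rewrite le_max lexx.
have Ky' : Ky <= K by rewrite le_max lexx orbT.
have K0 : 0 <= K by exact: le_trans Kx'.
have [Nx HNx] := HKx K Kx'; have [Ny HNy] := HKy K Ky'.
pose lam := 2 / 3 * q / M; have lam0 : 0 < lam by rewrite divr_gt0 // mulr_gt0.
have lamM : lam * M = 2 / 3 * q by rewrite /lam divfK // gt_eqF.
(* This [C] makes the terminal cost at most [lam * (e / 2)]. The parameters are fixed in the order
   [K], [lam], [C], [n], [rho]: the mesh condition on [n] involves [C], and [rho] has to beat a
   clamping error that depends on [lam]. *)
pose C := lam * K ^+ 2 / (2 * e) + 1.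
have C0 : 0 < C.
  rewrite ltr_wpDl //; apply: divr_ge0; first exact: mulr_ge0 (ltW lam0) (sqr_ge0 _).
  exact: mulr_ge0 (ler0n _ 2) (ltW e0).
pose rate := mesh_rate C.
have rate00 : 0 <= rate.
  apply: addr_ge0; first exact: sqr_ge0.
  apply: mulr_ge0; first exact: mulr_ge0 (sqr_ge0 _) (sqr_ge0 _).
  apply: divr_ge0; first by rewrite mulr_ge0 ?expR_ge0 // ltW.
  by rewrite invr_ge0; exact: mulr_ge0 (mulr_ge0 (ler0n _ 2) (sqr_ge0 _)) (sqr_ge0 _).
pose Z := rate * (T + 1) + L.
pose herr := harnack_error (lam * M).
have herr0 : 0 <= herr.
  apply: mulr_ge0; last exact: mulr_ge0 (ler0n _ _) (sqr_ge0 _).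
  apply: addr_ge0; last exact: mulr_ge0 (ler0n _ 2) (expR_ge0 _).
  exact: mulr_ge0 (ler0n _ 2) (mulr_ge0 (ltW lam0) (ltW M0)).
pose n := maxn (maxn Nx Ny) (Num.truncn (4 * T * Z)).+1.
have nx : (Nx <= n)%N by rewrite /n !leq_max leqnn.
have ny : (Ny <= n)%N by rewrite /n !leq_max leqnn orbT.
have nZ : 4 * T * Z < n%:R.
  by apply: lt_le_trans (truncnS_gt _) _; rewrite ler_nat leq_maxr.
pose rho := n%:R + 2 * T * herr / (lam * e).
have t0 : 0 <= 2 * T * herr / (lam * e).
  apply: divr_ge0; last by rewrite ltW // mulr_gt0.
  exact: mulr_ge0 (mulr_ge0 (ler0n _ 2) (ltW T_gt0)) herr0.
have nrho : n%:R <= rho by rewrite lerDl.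
have xrho : Nx%:R <= rho by apply: le_trans nrho; rewrite ler_nat.
have yrho : Ny%:R <= rho by apply: le_trans nrho; rewrite ler_nat.
have [n0 [rho0 clx]] := HNx n rho nx xrho; have [_ [_ cly]] := HNy n rho ny yrho.
pose g := inf_conv phi K.
have gM : forall z, `|g z| <= M := inf_conv_bound phiM K0.
have gK : forall y z, `|g y - g z| <= K * enorm (y - z) := inf_conv_lip phiM K0.
pose Ev z := lip_expectation G (fun w : Om => g (euler sigma b (T / n%:R) rho z n w)).
have lx z : Lip T (fun w : Om => g (euler sigma b (T / n%:R) rho z n w)).
  exact: (euler_functional_Lip sigma_lip b_lip z n0 (ltW rho0) gM gK).
have ux : `|u x - Ev x| <= e.
  exact: (Gexpectation_close (measurable_functional (HX x) cphi) (phi_approx x) (lx x) clx).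
have uy : `|u y - Ev y| <= e.
  exact: (Gexpectation_close (measurable_functional (HX y) cphi) (phi_approx y) (lx y) cly).
suff main : Ev x - Ev y <= 2 * M * q + e.
  have := le_sub_close ux uy main.
  by rewrite (_ : 3 * e = eta) // /e mulrCA mulfV ?mulr1 // pnatr_eq0.
have [q1|q1] := leP 1 q.
  have : Ev x <= 1 * Ev y + 2 * M.
    apply: (lip_expectation_upper ltr01 (lx x) (lx y)) => w; rewrite mul1r.
    by apply: le_norm_shift; exact: gM.
  rewrite mul1r -lerBlDl => /le_trans; apply; rewrite ler_wpDr ?(ltW e0) //.
  by rewrite ler_peMr // mulr_ge0 // ltW.
have nR : 0 < n%:R :> R by rewrite ltr0n.
have [mesh1 mesh2] := mesh_small T_gt0 nR rate00 L0 nZ.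
have lamM' : lam * M <= 2 / 3 by rewrite lamM ler_piMr ?(ltW q1).
have := scheme_harnack Lb0 gM gK lam0 lamM'
  C0 n0 rho0 mesh1 mesh2 x y xi00.
rewrite -/(Ev x) -/(Ev y) -/herr rate2 lamM.
have -> : 3 / 2 * (2 / 3 * q) ^+ 2 + 4 / 3 * (gradient_rate ^+ 2 / 2) * enorm (x - y) ^+ 2 =
    lam * (2 * M * q).
  by rewrite /lam /q; field; exact: lt0r_neq0.
have c1 : (lam * K) ^+ 2 / (4 * C) <= lam * (e / 2).
  rewrite ler_pdivrMr ?mulr_gt0 //.
  have -> : lam * (e / 2) * (4 * C) = (lam * K) ^+ 2 + lam * (2 * e).
    by rewrite /C; field; exact: lt0r_neq0.
  by rewrite lerDl; exact: mulr_ge0 (ltW lam0) (mulr_ge0 (ler0n _ 2) (ltW e0)).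
have c2 : T * herr / rho ^+ 2 <= lam * (e / 2).
  have le0 : 0 < lam * e by rewrite mulr_gt0.
  have r1 : 1 <= rho by apply: le_trans nrho; rewrite ler1n.
  rewrite ler_pdivrMr ?exprn_gt0 //; apply: (@le_trans _ _ (lam * (e / 2) * rho)).
    have -> : lam * (e / 2) * rho = lam * e / 2 * n%:R + T * herr.
      by rewrite /rho; field; rewrite !lt0r_neq0.
    by rewrite lerDr mulr_ge0 // divr_ge0 // ltW.
  apply: ler_wpM2l; first exact: mulr_ge0 (ltW lam0) (divr_ge0 (ltW e0) (ler0n _ 2)).
  by rewrite expr2 ler_peMr // ltW.
move=> H; rewrite -(ler_pM2l lam0); apply: le_trans H _.
rewrite [leRHS]mulrDr lerD2l; have -> : lam * e = lam * (e / 2) + lam * (e / 2) by field.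
exact: lerD.
Qed.

Theorem gradient_estimate x y : `|u x - u y| <= 2 * M * (enorm (x - y) * gradient_rate).
Proof.
rewrite ler_norml; apply/andP; split; last exact: one_sided.
by have := one_sided y x; rewrite enorm_distC; move: (u x) (u y) (2 * M * _) => p q r; lra.
Qed.

End gradient_estimate.

End harnack.
End represented.

Theorem theorem4p1 (R : realType) (d : nat) (T : R) (T_gt0 : 0 < T)
  (Gamma : set 'M[R]_d)
  (Gamma_nonempty : Gamma !=set0)
  (Gamma_psd : forall g, Gamma g -> symmetric_mx g /\ loewner_le 0 g)
  (Gamma_bounded : bounded_set Gamma)
  (Gamma_closed : closed Gamma)
  (Gamma_convex : convex_set (Gamma : set (convex_lmodType 'M[R]_d)))
  (PP : set (probability (wpath d T) R))
  (PP_represents : represents (Gfun Gamma) PP)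
  (sigma : 'cV[R]_d -> 'M[R]_d) (b : 'cV[R]_d -> 'cV[R]_d)
  (sigma_sym : forall x, symmetric_mx (sigma x))
  (Lsigma Lb lsigma Usigma lGamma UGamma : R)
  (sigma_lip : lipschitz_with Lsigma sigma)
  (b_lip : lipschitz_with Lb b)
  (lsigma_gt0 : 0 < lsigma) (le_lUsigma : lsigma <= Usigma)
  (sigma_bounds : forall x,
     loewner_le lsigma%:M (sigma x) /\ loewner_le (sigma x) Usigma%:M)
  (lGamma_gt0 : 0 < lGamma) (le_lUGamma : lGamma <= UGamma)
  (Gamma_bounds : forall g, Gamma g ->
     loewner_le (lGamma ^+ 2)%:M g /\ loewner_le g (UGamma ^+ 2)%:M)
  (X : 'cV[R]_d -> R -> wpath d T -> 'cV[R]_d)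
  (X_solution : forall x, SDE_solution PP sigma b x (X x))
  (phi : 'cV[R]_d -> R)
  (phi_continuous : continuous phi) (phi_bounded : bounded_real phi) :
  let u := fun x : 'cV[R]_d =>
    Gexpectation (Gfun Gamma) PP (fun w => phi (X x T w)) in
  let C := 2 * Usigma ^+ 2 / (lsigma ^+ 3 * lGamma) in
  let L := 2 * Lb + UGamma ^+ 2 * Lsigma ^+ 2 in
  forall x y : 'cV[R]_d,
    `|u x - u y|
      <= C * (sup_norm phi / Num.sqrt (exp_quotient L T)) * enorm (x - y).
Proof.
move=> u C L x y.
(* In dimension 0 all points coincide; the walks and the scheme are set up for [0 < d]. *)
have [d0|d0] := posnP d.
  have -> : x = y by apply/matrixP => i j; have := ltn_ord i; rewrite [in X in (_ < X)%N]d0.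
  by rewrite !subrr normr0 enorm0 mulr0.
have ellG : elliptic Gamma lGamma UGamma.
  split=> // g Gg; have [sg _] := Gamma_psd g Gg; have [gl gu] := Gamma_bounds g Gg.
  by split=> // v; [have := gl v|have := gu v]; rewrite -!/(quad _ _) quad_scalar.
have sigma_ge z (v : 'cV[R]_d) : lsigma * enorm v <= enorm (sigma z *m v).
  have [->|v0] := eqVneq (enorm v) 0; first by rewrite mulr0 enorm_ge0.
  have vp : 0 < enorm v by rewrite lt0r v0 enorm_ge0.
  have [sl _] := sigma_bounds z; have := sl v; rewrite -!/(quad _ _) quad_scalar.
  rewrite /quad -mulmxA => H; have := le_trans H (cauchy_schwarz_cV v (sigma z *m v)).
  by rewrite mulrC expr2 -mulrA ler_pM2l // mulrC.
have Us0 : 0 < Usigma by exact: lt_le_trans le_lUsigma.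
have sigma_le z i j : `|sigma z i j| <= Usigma.
  (* Square roots, because [elliptic] squares its two bounds. *)
  have el : elliptic [set sigma z] (Num.sqrt lsigma) (Num.sqrt Usigma).
    split; [by exists (sigma z)|by rewrite sqrtr_gt0|move=> _ ->].
    rewrite !sqr_sqrtr ?(ltW lsigma_gt0) ?(ltW Us0) //; have [sl su] := sigma_bounds z.
    by split=> [|v|v]; [exact: sigma_sym|have := sl v|have := su v];
      rewrite -?/(quad _ _) ?quad_scalar.
  by have := elliptic_entry el i j (erefl (sigma z)); rewrite sqr_sqrtr // ltW.
have phi_le z : `|phi z| <= sup_norm phi.
  by apply: sup_ubound; [case: phi_bounded => N HN; exists N => _ [w _ <-]|exists z].
have s0 : 0 <= sup_norm phi by exact: le_trans (normr_ge0 _) (phi_le 0).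
have Lb0 : 0 <= Lb.
  have := b_lip (basis_cv (Ordinal d0)) 0; rewrite subr0 enorm_basis mulr1.
  by apply: le_trans; exact: enorm_ge0.
have L0 : 0 <= L by apply: addr_ge0; [rewrite mulr_ge0|exact: mulr_ge0 (sqr_ge0 _) (sqr_ge0 _)].
have xi0 := exp_quotient_gt0 L0 T_gt0.
pose k := 2 * (enorm (x - y) * (lsigma * lGamma * Num.sqrt (exp_quotient L T))^-1).
have k0 : 0 <= k.
  apply: mulr_ge0 => //; apply: mulr_ge0; first exact: enorm_ge0.
  by rewrite invr_ge0 !mulr_ge0 ?sqrtr_ge0 // ltW.
(* [gradient_estimate] asks for a positive bound, as [lam] is a quotient by it; the supremum norm
   may vanish and is enlarged by [e]. *)
have key e : 0 < e -> `|u x - u y| <= k * (sup_norm phi + e).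
  move=> e0; have M0 : 0 < sup_norm phi + e by rewrite ltr_wpDl.
  have phiM z : `|phi z| <= sup_norm phi + e by apply: le_trans (phi_le z) _; rewrite lerDl ltW.
  have := gradient_estimate T_gt0 ellG d0 PP_represents sigma_lip b_lip lsigma_gt0 sigma_ge
    sigma_le X_solution phi_continuous phiM M0 x y.
  by rewrite /gradient_rate -/L /k mulrAC.
have key0 : `|u x - u y| <= k * sup_norm phi.
  apply/ler_addgt0Pr => e e0; have k1 : 0 < k + 1 by rewrite ltr_wpDl.
  apply: le_trans (key (e / (k + 1)) (divr_gt0 e0 k1)) _.
  rewrite mulrDr lerD2l mulrA ler_pdivrMr // mulrC ler_wpM2l ?(ltW e0) // lerDl //.
apply: le_trans key0 _.
have sq0 : 0 < Num.sqrt (exp_quotient L T) by rewrite sqrtr_gt0.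
(* [C] exceeds the constant obtained so far by a factor that is the square of a ratio at least 1. *)
have -> : C * (sup_norm phi / Num.sqrt (exp_quotient L T)) * enorm (x - y) =
    (Usigma / lsigma) ^+ 2 * (k * sup_norm phi).
  by rewrite /C /k; field; rewrite !lt0r_neq0.
by apply: ler_peMl; [exact: mulr_ge0|apply: exprn_ege1; rewrite ler_pdivlMr // mul1r].
Qed.
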